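(* Let $(X,D,F)$ be a sub-Finsler manifold with $X$ three-dimensional and $D$ an oriented rank-two contact distribution, let $\mathcal{B}_4$ be the associated manifold of oriented 4-adapted coframes with canonical coframing $(\eta^1,\eta^2,\eta^3,\phi)$ and invariants $I,J_1,A_2,K$, let $\bar{\mathcal I}=\{\eta^2,\eta^3\}$, and let $\bar{\mathcal L}(\bar\gamma)=\int_{\bar\gamma}\eta^1$. Then the critical curves of $\bar{\mathcal L}$ among integral curves of $\bar{\mathcal I}$ on $\mathcal{B}_4$ are precisely the projections to $\mathcal{B}_4$ of the integral curves, with transversality condition $\eta^1\neq 0$, of the differential system $$\mathcal J=\{\eta^2,\ \eta^3,\ \phi-\lambda\eta^1,\ d\lambda-C\eta^1\}$$ on $Y\cong \mathcal{B}_4\times\mathbb R$, where $\lambda$ is the coordinate on the factor $\mathbb R$ and $$C=\lambda^2 I+\lambda J_1+A_2+\tfrac12 IK .$$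
   Context: Setting. $X$ is a smooth 3-manifold and $D\subset TX$ is a rank-two contact distribution: for any local vector fields $v_1,v_2$ spanning $D$, the vectors $v_1,v_2,[v_1,v_2]$ span $TX$ at each point. A sub-Finsler metric on $D$ is a function $F:D\to[0,\infty)$, smooth away from the zero section, with $F(cv)=cF(v)$ for $c>0$, and such that the Hessian of $\tfrac12F^2$ restricted to each $D_x$ is positive definite on $D_x\setminus\{0\}$. Its indicatrix bundle is the 4-manifold $\Sigma=\{u\in D: F(u)=1\}$, with basepoint projection $\pi:\Sigma\to X$. Adapted coframings. A vector $v\in T_u\Sigma$ is monic if $\pi'(u)(v)=u$. A 1-form on $\Sigma$ is monic if it takes the value $1$ on all monic vectors; a nonvanishing 1-form is null if it vanishes on all monic vectors. A local coframing $(\eta^1,\eta^2,\eta^3,\phi)$ of $\Sigma$ is 0-adapted if $\eta^1$ is monic, $\eta^2,\eta^3$ are null, and $D=\{\eta^3\}^\perp$ (i.e. $\ker \eta^3_u=\pi'(u)^{-1}(D)$). It is 4-adapted if it is 0-adapted and there are functions $I,J_1,J_2,K,A_1,A_2,S_0,S_1,S_2$ with $$\begin{aligned} d\eta^1&=\eta^2\wedge\phi+A_1\eta^2\wedge\eta^3+(A_2+\tfrac12IK)\eta^3\wedge\eta^1+J_1\eta^3\wedge\phi,\\ d\eta^2&=-\eta^1\wedge\phi+(A_2-\tfrac12IK)\eta^2\wedge\eta^3-A_1\eta^3\wedge\eta^1+J_2\eta^3\wedge\phi+I\eta^2\wedge\phi,\\ d\eta^3&=\eta^1\wedge\eta^2+I\eta^3\wedge\phi,\\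 d\phi&=S_0\eta^3\wedge\phi+S_1\eta^2\wedge\eta^3+S_2\eta^3\wedge\eta^1-J_1\eta^1\wedge\phi-2J_2\eta^2\wedge\phi+K\eta^1\wedge\eta^2. \end{aligned}$$ 4-adapted coframings exist near every point of $\Sigma$ and are unique up to $(\eta^1,\eta^2,\eta^3,\phi)\mapsto(\eta^1,\epsilon\eta^2,\epsilon\eta^3,\epsilon\phi)$, $\epsilon=\pm1$. The 4-adapted coframes form a double cover of $\Sigma$ carrying canonical 1-forms $\eta^1,\eta^2,\eta^3,\phi$ satisfying these equations. Here an orientation of $D$ is fixed and $\mathcal{B}_4$ denotes the set of 4-adapted coframes preserving this orientation (so $\eta^1\wedge\eta^2$ is positive on $D$). Conventions. Every horizontal curve $\gamma$ in $X$ (tangent to $D$) lifts canonically to an integral curve $\bar\gamma$ of $\bar{\mathcal I}$ on $\mathcal{B}_4$ with $\eta^1(\bar\gamma')\neq0$, by choosing the 4-adapted coframe along $\gamma$ for which the vector dual to $\eta^1$ points along the velocity; the sub-Finsler length of $\gamma$ equals $\bar{\mathcal L}(\bar\gamma)$. An integral curve of a system of 1-forms is a curve on which all the forms pull back to zero. ''Critical among integral curves of $\bar{\mathcal I}$'' means that the first variation of $\bar{\mathcal L}$ vanishes for all variations through integral curves of $\bar{\mathcal I}$ with $\eta^1\ne0$ whose projections to $X$ have fixed endpoints. Pullbacks of forms and functions from $\mathcal{B}_4$ to $Y$ are suppressed. *)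

(* Defs.v *)
From HB Require Import structures.
From mathcomp Require Import all_boot all_order all_algebra.
From mathcomp Require Import all_classical all_reals all_analysis.
Set Implicit Arguments.
Unset Strict Implicit.
Unset Printing Implicit Defensive.
Import Order.TTheory GRing.Theory Num.Theory.
Import numFieldNormedType.Exports.
Local Open Scope classical_set_scope.
Local Open Scope ring_scope.

Fixpoint Ck {R : realType} (k : nat) {V W : normedModType R}
    (O : set V) (f : V -> W) : Prop :=
  match k with
  | 0%N => forall x, O x -> {for x, continuous f}
  | k'.+1 => (forall x, O x -> differentiable f x)
             /\ (forall v, Ck k' O ('D_v f))
  end.

Definition smooth {R : realType} {V W : normedModType R}
    (O : set V) (f : V -> W) : Prop := forall k, Ck k O f.

(** A manifold is a subset [body] of a type together with an atlas; only the
    values of [coord c] on [dom c] and of [param c] on the image of [dom c]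
    matter.  The record carries no axioms: these are in [is_manifold]. *)

Record chart (R : realType) (T : Type) (n : nat) := Chart {
  dom : set T;
  coord : T -> 'rV[R]_n;
  param : 'rV[R]_n -> T }.

Record premanifold (R : realType) (n : nat) := Premanifold {
  mpoint : Type;
  body : set mpoint;
  atlas : set (chart R mpoint n) }.
Arguments mpoint {R n} p.
Arguments body {R n} p.
Arguments atlas {R n} p.

Section Manifolds.
Context {R : realType} {n : nat}.
Implicit Types M : premanifold R n.

Definition cimg {T : Type} (c : chart R T n) (A : set T) : set 'rV[R]_n :=
  coord c @` (A `&` dom c).

Definition transition {T : Type} (c d : chart R T n) : 'rV[R]_n -> 'rV[R]_n :=
  coord d \o param c.

Definition chart_at M (x : mpoint M) (c : chart R (mpoint M) n) : Prop :=
  atlas M c /\ dom c x.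

Definition mopen M (A : set (mpoint M)) : Prop :=
  A `<=` body M /\ forall c, atlas M c -> open (cimg c A).

Definition is_manifold M : Prop :=
  [/\ (forall x, body M x -> exists c, chart_at x c),
      (forall c, atlas M c ->
         [/\ dom c `<=` body M, {in dom c, cancel (coord c) (param c)}
           & open (cimg c setT)]),
      (forall c d, atlas M c -> atlas M d ->
         open (cimg c (dom d)) /\ smooth (cimg c (dom d)) (transition c d)),
      (forall x y, body M x -> body M y -> x <> y ->
         exists A B, [/\ mopen A, mopen B, A x, B y & A `&` B = set0])
    & (exists B : nat -> set (mpoint M),
         (forall i, mopen (B i)) /\
         (forall A x, mopen A -> A x -> exists i, B i x /\ B i `<=` A))].

(** Some chart at [x]; a chart with empty domain if there is none. *)
Definition some_chart M (x : mpoint M) : chart R (mpoint M) n :=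
  match pselect (exists c, chart_at x c) with
  | left h => projT1 (cid h)
  | right _ => Chart set0 (fun=> 0) (fun=> x)
  end.

(** A tangent vector at [x] is the family of its components in all charts at
    [x], related by the differentials of the transition maps; the components
    in the other charts are set to 0. *)
Definition tfam M := chart R (mpoint M) n -> 'rV[R]_n.

Definition tangent M (x : mpoint M) (v : tfam M) : Prop :=
  [/\ body M x,
      (forall c d, chart_at x c -> chart_at x d ->
         v d = 'd (transition c d) (coord c x) (v c))
    & (forall c, ~ chart_at x c -> v c = 0)].

(** The tangent vector at [x] with components [a] in the chart [c]. *)
Definition vec_of M (c : chart R (mpoint M) n) (x : mpoint M) (a : 'rV[R]_n) :
    tfam M :=
  fun d => if `[< chart_at x d >] then 'd (transition c d) (coord c x) a else 0.

Definition smooth_into {V : normedModType R} M (O : set V) (f : V -> mpoint M) :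
    Prop :=
  forall p, O p -> exists d, chart_at (f p) d /\
    exists O' : set V, [/\ open O', O' p, O' `<=` O,
      (forall q, O' q -> dom d (f q)) & smooth O' (coord d \o f)].

Definition pushvec {V : normedModType R} M (f : V -> mpoint M) (p w : V) :
    tfam M :=
  fun d => if `[< chart_at (f p) d >] then 'd (coord d \o f) p w else 0.

Definition velocity M (g : R -> mpoint M) (t : R) : tfam M := pushvec g t 1.

Definition vfield M := mpoint M -> tfam M.

Definition smooth_vfield M (A : set (mpoint M)) (v : vfield M) : Prop :=
  (forall x, A x -> tangent x (v x)) /\
  (forall c, atlas M c -> smooth (cimg c A) (fun y => v (param c y) c)).

Definition bracket M (v w : vfield M) : vfield M :=
  fun x c => if `[< chart_at x c >] then
    let vc y := v (param c y) c in
    let wc y := w (param c y) c in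
    'D_(vc (coord c x)) wc (coord c x) - 'D_(wc (coord c x)) vc (coord c x)
  else 0.

(** A covector vanishes off the tangent space, so that it is determined by its
    restriction to the tangent space. *)
Definition covector M (x : mpoint M) (xi : tfam M -> R) : Prop :=
  (forall (k : R) v w, tangent x v -> tangent x w ->
     xi (k *: v + w) = k * xi v + xi w) /\
  (forall v, ~ tangent x v -> xi v = 0).

Definition form M := mpoint M -> tfam M -> R.

Definition smooth_form M (A : set (mpoint M)) (w : form M) : Prop :=
  (forall x, A x -> covector x (w x)) /\
  (forall c, atlas M c -> forall a,
     smooth (cimg c A) (fun y => w (param c y) (vec_of c (param c y) a))).

Definition wedge M (al be : form M) (x : mpoint M) (v w : tfam M) : R :=
  al x v * be x w - al x w * be x v.

(** Exterior derivative of a 1-form, as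
    [sum_(i,j) (d_i w_j - d_j w_i) v_i w_j] in the coordinates of a chart. *)
Definition dext M (al : form M) (x : mpoint M) (v w : tfam M) : R :=
  let c := some_chart x in
  let comp b y := al (param c y) (vec_of c (param c y) b) in
  'D_(v c) (comp (w c)) (coord c x) - 'D_(w c) (comp (v c)) (coord c x).

Definition dfun M (f : mpoint M -> R) : form M :=
  fun x v => let c := some_chart x in 'd (f \o param c) (coord c x) (v c).

(** A curve on [[a, b]] is a map on [R] considered near [[a, b]] only; it is
    smooth if it is so on a neighbourhood of [[a, b]]. *)
Definition smooth_curve M (a b : R) (g : R -> mpoint M) : Prop :=
  exists O : set R, [/\ open O, `[a, b] `<=` O & smooth_into O g].

Definition integral_curve M (S : set (form M)) (a b : R) (g : R -> mpoint M) :
    Prop :=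
  smooth_curve a b g /\
  forall w t, S w -> t \in `[a, b] -> w (g t) (velocity g t) = 0.

Definition transverse M (w : form M) (a b : R) (g : R -> mpoint M) : Prop :=
  forall t, t \in `[a, b] -> w (g t) (velocity g t) != 0.

Definition curve_integral M (w : form M) (a b : R) (g : R -> mpoint M) : R :=
  Rintegral lebesgue_measure `[a, b] (fun t => w (g t) (velocity g t)).

End Manifolds.

Definition dmap {R : realType} {n m : nat} {M : premanifold R n}
    {N : premanifold R m} (f : mpoint M -> mpoint N) (x : mpoint M) (v : tfam M) :
    tfam N :=
  let c := some_chart x in pushvec (M := N) (f \o param c) (coord c x) (v c).

Definition pullback {R : realType} {n m : nat} {M : premanifold R n}
    {N : premanifold R m} (f : mpoint M -> mpoint N) (w : form N) : form M :=
  fun x v => w (f x) (dmap (N := N) f x v).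

Definition tangent_chart {R : realType} {n : nat} (M : premanifold R n)
    (c : chart R (mpoint M) n) : chart R (mpoint M * tfam M) (n + n) :=
  Chart [set u | dom c u.1 /\ tangent u.1 u.2]
        (fun u => row_mx (coord c u.1) (u.2 c))
        (fun y => let x := param c (lsubmx y) in (x, vec_of c x (rsubmx y))).

Definition tangent_bundle {R : realType} {n : nat} (M : premanifold R n) :
    premanifold R (n + n) :=
  Premanifold [set u : mpoint M * tfam M | tangent u.1 u.2]
              (@tangent_chart R n M @` atlas M).

(** Embedded submanifold [S] of dimension [m]: its charts are the inverses of
    all the smooth immersive homeomorphisms from an open set of [R^m] onto a
    relatively open subset of [S]. *)
Definition submanifold_chart {R : realType} {n : nat} (N : premanifold R n)
    (S : set (mpoint N)) (m : nat) (c : chart R (mpoint N) m) : Prop :=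
  [/\ dom c `<=` S, {in dom c, cancel (coord c) (param c)},
      open (cimg c setT) /\ smooth_into (M := N) (cimg c setT) (param c),
      (forall y a, cimg c setT y -> pushvec (M := N) (param c) y a = 0 -> a = 0)
    & (forall U, open U -> U `<=` cimg c setT ->
         exists W, mopen (M := N) W /\ param c @` U = S `&` W)].

Definition submanifold {R : realType} {n : nat} (N : premanifold R n)
    (S : set (mpoint N)) (m : nat) : premanifold R m :=
  Premanifold S [set c | submanifold_chart S c].

Definition line_chart {R : realType} {n : nat} {T : Type} (c : chart R T n) :
    chart R (T * R) (n + 1) :=
  Chart [set p | dom c p.1]
        (fun p => row_mx (coord c p.1) (const_mx p.2))
        (fun y => (param c (lsubmx y), rsubmx y 0 0)).

Definition times_line {R : realType} {n : nat} (M : premanifold R n) :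
    premanifold R (n + 1) :=
  Premanifold [set p : mpoint M * R | body M p.1] (line_chart @` atlas M).

Section SubFinsler.
Context {R : realType} {X : premanifold R 3}.

Definition distribution := mpoint X -> set (tfam X).

Definition local_frame (D : distribution) (A : set (mpoint X))
    (v1 v2 : vfield X) : Prop :=
  [/\ mopen A, smooth_vfield A v1, smooth_vfield A v2,
      (forall x, A x -> forall v,
         D x v <-> exists a b : R, v = a *: v1 x + b *: v2 x)
    & (forall x, A x -> forall a b : R,
         a *: v1 x + b *: v2 x = 0 -> a = 0 /\ b = 0)].

Definition rank_two (D : distribution) : Prop :=
  forall x, body X x -> exists A v1 v2, A x /\ local_frame D A v1 v2.

Definition contact (D : distribution) : Prop :=
  rank_two D /\
  forall A v1 v2, local_frame D A v1 v2 -> forall x, A x ->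
  forall w, tangent x w -> exists a b c : R,
    w = a *: v1 x + b *: v2 x + c *: bracket v1 v2 x.

(** [o x v w] means that [(v, w)] is a positive basis of [D x]. *)
Definition orientation (D : distribution)
    (o : mpoint X -> tfam X -> tfam X -> Prop) : Prop :=
  forall x, body X x -> exists A v1 v2,
    [/\ A x, local_frame D A v1 v2
      & forall y, A y -> forall v w, o y v w <->
          exists a b c d : R, [/\ v = a *: v1 y + b *: v2 y,
            w = c *: v1 y + d *: v2 y & 0 < a * d - b * c]].

(** Smoothness on [D] minus its zero section is expressed in the
    trivialisations [A x R^2] of [D] given by local frames; the Hessian on the
    vector space [D x] is evaluated as a second derivative along lines. *)
Definition sub_Finsler (D : distribution) (F : mpoint X -> tfam X -> R) : Prop :=
  [/\ (forall x v, body X x -> D x v -> 0 <= F x v),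
      (forall A v1 v2 c, local_frame D A v1 v2 -> atlas X c ->
         smooth [set p : 'rV[R]_3 * 'rV[R]_2 | cimg c A p.1 /\ p.2 != 0]
           (fun p : 'rV[R]_3 * 'rV[R]_2 => let x := param c p.1 in
              F x (p.2 0 0 *: v1 x + p.2 0 1 *: v2 x))),
      (forall x v (k : R), body X x -> D x v -> 0 < k ->
         F x (k *: v) = k * F x v)
    & (forall x u w, body X x -> D x u -> D x w -> u <> 0 -> w <> 0 ->
         0 < derive1n 2 (fun s : R => 2^-1 * F x (u + s *: w) ^+ 2) 0)].

Definition indicatrix (D : distribution) (F : mpoint X -> tfam X -> R) :
    premanifold R 4 :=
  submanifold (N := tangent_bundle X)
    [set u | [/\ body X u.1, D u.1 u.2 & F u.1 u.2 = 1]] 4.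

End SubFinsler.

Record coframe (R : realType) (T : Type) := Coframe {
  eta1 : T -> R; eta2 : T -> R; eta3 : T -> R; phi : T -> R }.

Section Coframings.
Context {R : realType} {M : premanifold R 4}.

Definition coframing := mpoint M -> coframe R (tfam M).

Definition form_eta1 (e : coframing) : form M := fun x => eta1 (e x).
Definition form_eta2 (e : coframing) : form M := fun x => eta2 (e x).
Definition form_eta3 (e : coframing) : form M := fun x => eta3 (e x).
Definition form_phi (e : coframing) : form M := fun x => phi (e x).

Definition is_coframing (A : set (mpoint M)) (e : coframing) : Prop :=
  [/\ mopen A,
      smooth_form A (form_eta1 e) /\ smooth_form A (form_eta2 e),
      smooth_form A (form_eta3 e) /\ smooth_form A (form_phi e)
    & forall x, A x -> forall a1 a2 a3 a4 : R, exists! v,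
        tangent x v /\ [/\ eta1 (e x) v = a1, eta2 (e x) v = a2,
                           eta3 (e x) v = a3 & phi (e x) v = a4]].

Definition structure_equations (A : set (mpoint M)) (e : coframing)
    (I J1 J2 K A1 A2 S0 S1 S2 : mpoint M -> R) : Prop :=
  forall x, A x -> forall v w, tangent x v -> tangent x w ->
  let e1 := form_eta1 e in let e2 := form_eta2 e in
  let e3 := form_eta3 e in let p := form_phi e in
  let wd al be := wedge al be x v w in
  [/\ dext e1 x v w =
        wd e2 p + A1 x * wd e2 e3 + (A2 x + 2^-1 * I x * K x) * wd e3 e1
        + J1 x * wd e3 p,
      dext e2 x v w =
        - wd e1 p + (A2 x - 2^-1 * I x * K x) * wd e2 e3 - A1 x * wd e3 e1
        + J2 x * wd e3 p + I x * wd e2 p,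
      dext e3 x v w = wd e1 e2 + I x * wd e3 p
    & dext p x v w =
        S0 x * wd e3 p + S1 x * wd e2 e3 + S2 x * wd e3 e1
        - J1 x * wd e1 p - 2 * J2 x * wd e2 p + K x * wd e1 e2].

End Coframings.
Arguments coframing {R} M.

Section AdaptedCoframings.
Context {R : realType} {X : premanifold R 3}.
Variables (D : @distribution R X) (F : mpoint X -> tfam X -> R).
Variable o : mpoint X -> tfam X -> tfam X -> Prop.

Let Sigma := indicatrix D F.

Definition basepoint (u : mpoint Sigma) : mpoint X := u.1.

Definition monic_vector (u : mpoint Sigma) (v : tfam Sigma) : Prop :=
  tangent u v /\ dmap (N := X) basepoint u v = u.2.

Definition monic (A : set (mpoint Sigma)) (w : form Sigma) : Prop :=
  forall u v, A u -> monic_vector u v -> w u v = 1.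

Definition null (A : set (mpoint Sigma)) (w : form Sigma) : Prop :=
  (forall u, A u -> exists2 v, tangent u v & w u v != 0) /\
  (forall u v, A u -> monic_vector u v -> w u v = 0).

Definition adapted0 (A : set (mpoint Sigma)) (e : coframing Sigma) : Prop :=
  [/\ is_coframing A e, monic A (form_eta1 e),
      null A (form_eta2 e), null A (form_eta3 e)
    & forall u v, A u -> tangent u v ->
        eta3 (e u) v = 0 <->
        D (basepoint u) (dmap (N := X) basepoint u v)].

Definition adapted4 (A : set (mpoint Sigma)) (e : coframing Sigma) : Prop :=
  adapted0 A e /\
  exists I J1 J2 K A1 A2 S0 S1 S2,
    structure_equations A e I J1 J2 K A1 A2 S0 S1 S2.

Definition positive (A : set (mpoint Sigma)) (e : coframing Sigma) : Prop :=
  forall u v w, A u -> tangent u v -> tangent u w ->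
    o (basepoint u) (dmap (N := X) basepoint u v)
                    (dmap (N := X) basepoint u w) ->
    0 < wedge (form_eta1 e) (form_eta2 e) u v w.

(** The manifold of positive 4-adapted coframes: pairs of a point [u] of the
    indicatrix bundle and the value at [u] of a positive 4-adapted local
    coframing.  The smooth structure is the one for which these local
    coframings are local diffeomorphisms onto their images. *)
Definition B4_chart (A : set (mpoint Sigma)) (e : coframing Sigma)
    (c : chart R (mpoint Sigma) 4) :
    chart R (mpoint Sigma * coframe R (tfam Sigma)) 4 :=
  Chart [set b | [/\ A b.1, dom c b.1 & b.2 = e b.1]]
        (fun b => coord c b.1)
        (fun y => (param c y, e (param c y))).

Definition B4 : premanifold R 4 :=
  Premanifold
    [set b : mpoint Sigma * coframe R (tfam Sigma) |
       exists A e, [/\ adapted4 A e, positive A e, A b.1 & b.2 = e b.1]]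
    [set k | exists A e c,
       [/\ adapted4 A e, positive A e, atlas Sigma c & k = B4_chart A e c]].

Definition B4_to_Sigma (b : mpoint B4) : mpoint Sigma := b.1.

Definition B4_to_X (b : mpoint B4) : mpoint X := basepoint (B4_to_Sigma b).

Definition canonical_coframing : coframing B4 := fun b =>
  let push := dmap (M := B4) (N := Sigma) B4_to_Sigma b in
  Coframe (fun v => eta1 b.2 (push v)) (fun v => eta2 b.2 (push v))
          (fun v => eta3 b.2 (push v)) (fun v => phi b.2 (push v)).

Definition Ibar : set (form B4) :=
  [set form_eta2 canonical_coframing; form_eta3 canonical_coframing].

Definition Ibar_curve (a b : R) (g : R -> mpoint B4) : Prop :=
  integral_curve Ibar a b g /\ transverse (form_eta1 canonical_coframing) a b g.

Definition Lbar (a b : R) (g : R -> mpoint B4) : R :=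
  curve_integral (form_eta1 canonical_coframing) a b g.

(** A variation of [g] with parameter [s] in [(-eps, eps)], through integral
    curves of [Ibar] whose projections to [X] have fixed endpoints. *)
Definition Ibar_variation (a b : R) (g : R -> mpoint B4) (eps : R)
    (V : R -> R -> mpoint B4) : Prop :=
  [/\ (exists O : set (R * R),
         [/\ open O, (forall s t, `|s| < eps -> t \in `[a, b] -> O (s, t))
           & smooth_into (M := B4) O (fun p => V p.1 p.2)]),
      (forall t, t \in `[a, b] -> V 0 t = g t),
      (forall s, `|s| < eps -> Ibar_curve a b (V s)),
      (forall s, `|s| < eps -> B4_to_X (V s a) = B4_to_X (g a))
    & (forall s, `|s| < eps -> B4_to_X (V s b) = B4_to_X (g b))].

Definition critical (a b : R) (g : R -> mpoint B4) : Prop :=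
  forall eps V, 0 < eps -> Ibar_variation a b g eps V ->
    is_derive (0 : R) (1 : R) (fun s => Lbar a b (V s)) 0.

Definition Y : premanifold R 5 := times_line B4.

Definition Y_to_B4 (y : mpoint Y) : mpoint B4 := y.1.
Definition lambda (y : mpoint Y) : R := y.2.

Definition on_Y (w : form B4) : form Y :=
  pullback (M := Y) (N := B4) Y_to_B4 w.

Definition Cfun (I J1 A2 K : mpoint B4 -> R) (y : mpoint Y) : R :=
  let b := Y_to_B4 y in
  lambda y ^+ 2 * I b + lambda y * J1 b + A2 b + 2^-1 * I b * K b.

Definition Jsys (I J1 A2 K : mpoint B4 -> R) : set (form Y) :=
  let e1 := on_Y (form_eta1 canonical_coframing) in
  [set on_Y (form_eta2 canonical_coframing); on_Y (form_eta3 canonical_coframing);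
       (fun y v => on_Y (form_phi canonical_coframing) y v - lambda y * e1 y v);
       (fun y v => dfun (M := Y) lambda y v - Cfun I J1 A2 K y * e1 y v)].

End AdaptedCoframings.
Arguments canonical_coframing {R X} D F o b.
Arguments Y_to_B4 {R X} D F o y.

(* Main.v *)
From HB Require Import structures.
From mathcomp Require Import all_boot all_order all_algebra.
From mathcomp Require Import all_classical all_reals all_analysis.
From mathcomp Require Import ring lra.
Require Import Defs.
Set Implicit Arguments.
Unset Strict Implicit.
Unset Printing Implicit Defensive.
Import Order.TTheory GRing.Theory Num.Theory.
Import numFieldNormedType.Exports.
Local Open Scope classical_set_scope.
Local Open Scope ring_scope.

(** Write [C] for [lambda ^+ 2 * I + lambda * J1 + A2 + 2^-1 * I * K].  Let [g] be
    an integral curve of [eta2], [eta3] with [eta1] nonzero on its velocity,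
    and put [l = phi / eta1] along [g].  A curve in [B4 x R] over [g] is an
    integral curve of the system [J] exactly when its last coordinate is [l]
    and [l' = C eta1], so the theorem says that [g] is critical if and only if
    its function [l] satisfies this equation.

    Contract the structure equations of [eta1] and [eta3] with the velocity of
    a curve on which [eta2 = eta3 = 0] and [phi = l eta1]: every term in
    [eta2] cancels from [d eta1 + l d eta3], and what remains is
    [C eta1(g') eta3] ([structure_pairing]).  On a two-parameter map an exterior
    derivative is a commutator of partial derivatives ([dext_pushvec]), so for a
    variation [V s t] through integral curves of the system this identity reads

      [d/ds eta1(V_t) = d/dt (eta1(V_s) + l eta3(V_s)) + (C eta1(g') - l') eta3(V_s)]

    at [s = 0] ([first_variation]).  The boundary term vanishes at both ends,
    because the endpoints in [X] are fixed and [eta1], [eta3] kill vertical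
    vectors.  Hence [l' = C eta1] implies that the derivative of the length is
    zero ([multiplier_stationary], [extremal_critical]).

    Conversely suppose that [k = C eta1 - l'] is nonzero at an interior time
    [t0].  A variation with [eta3(V_s)] of one sign, nonzero at [t0] and zero
    where [k] could change sign makes the derivative of the length nonzero.
    Horizontal curves cannot be varied by partitions of unity, and such a
    variation is obtained by moving the projection of [g] to [X] with the flow
    of the contact vector field whose Hamiltonian is a bump function: the flow
    preserves [D], so horizontal curves go to horizontal curves
    ([flow_contact]), and the contact form of the field is the bump itself.
    The moved curves lift to the indicatrix bundle by normalising their
    velocities with [F], and to [B4] by a local coframing ([bump_variation]).
    So [k] vanishes in the interior ([defect_zero]), and at the ends by
    continuity.  The functions [I], [J1], [A2], [K] are only known as
    coefficients of the structure equations; the continuity of [k] along the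
    curve is read off from exterior derivatives ([Clambda_continuous]).

    Three things have to be built for this.  [B4] must be a manifold: the charts
    of the indicatrix bundle are inverses of immersions, and their transition
    maps are smooth by a weak form of the implicit function theorem
    ([smooth_implicit], [smooth_lift]); positive 4-adapted coframes are unique at
    each point ([coframe_unique]), so the transition maps of [B4] are those of the
    indicatrix bundle ([regular_B4]).  The form [eta1] must determine
    horizontal velocities: this rests on the fibres of the indicatrix bundle
    being curves ([vertical_dependent], [coframe_kernel]).  Finally flows of smooth
    vector fields must exist and be smooth in time and initial value
    ([flow_exists], [flow_smooth]). *)

(** * Differentials, directional derivatives and the classes C^k *)

Section Differentials.
Context {R : realType}.

Lemma diff_of_bound (V W : normedModType R) (f : V -> W)
    (L : {linear V -> W}) x : continuous L ->
  (forall e, 0 < e -> \forall y \near x,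
     `|f y - f x - L (y - x)| <= e * `|y - x|) ->
  differentiable f x /\ 'd f x = L :> (V -> W).
Proof.
move=> Lc H.
have E : f \o shift x = cst (f x) + L +o_ 0 id.
  apply/eqaddoP => e e0; have := H e e0.
  rewrite (near_shift 0 x) subr0; apply: filterS => h /=.
  rewrite /shift/= addrK.
  by rewrite !fctE /= opprD addrA.
split; last exact: diff_unique.
by apply/diff_locallyP; rewrite (diff_unique Lc E); split.
Qed.

Lemma diff_bound (V W : normedModType R) (f : V -> W) x :
  differentiable f x -> forall e, 0 < e -> \forall y \near x,
     `|f y - f x - 'd f x (y - x)| <= e * `|y - x|.
Proof.
move=> /diff_locallyP[_ /eqaddoP E] e e0; have := E e e0.
rewrite (near_shift 0 x) subr0; apply: filterS => h /=.
by rewrite /shift/= addrK !fctE /= opprD addrA.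
Qed.

Lemma diff_continuous_lin (V W : normedModType R) (f : V -> W) x :
  differentiable f x -> continuous ('d f x).
Proof. by case/diff_locallyP. Qed.

Lemma near_eq_diff (V W : normedModType R) (f g : V -> W) x :
  (\forall y \near x, f y = g y) -> differentiable f x ->
  differentiable g x /\ 'd g x = 'd f x :> (V -> W).
Proof.
move=> fg df; apply: diff_of_bound; first exact: diff_continuous_lin.
move=> e e0; have E := nbhs_singleton fg.
near=> y.
rewrite -E; have <- : f y = g y by near: y.
by near: y; exact: diff_bound.
Unshelve. all: by end_near. Qed.

Lemma near_eq_D (V W : normedModType R) (f g : V -> W) x v :
  (\forall y \near x, f y = g y) -> 'D_v f x = 'D_v g x.
Proof.
move=> fg; have [->|v0] := eqVneq v 0; first by rewrite !derive0.
exact: near_eq_derive.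
Qed.

Lemma D_comp (U V W : normedModType R) (f : U -> V) (g : V -> W) x v :
  differentiable f x -> differentiable g (f x) ->
  'D_v (g \o f) x = 'd g (f x) ('D_v f x).
Proof.
move=> df dg; rewrite !deriveE//; last exact: differentiable_comp.
by rewrite diff_comp.
Qed.

Lemma D_lin (V W : normedModType R) (f : {linear V -> W}) x v :
  continuous f -> 'D_v f x = f v.
Proof.
move=> fc; rewrite deriveE; last exact: linear_differentiable.
by rewrite diff_lin.
Qed.

Lemma continuous_sum (V : topologicalType) (W : normedModType R) (I : Type)
    (r : seq I) (P : pred I) (F : I -> V -> W) x :
  (forall i, P i -> {for x, continuous (F i)}) ->
  {for x, continuous (fun y => \sum_(i <- r | P i) F i y)}.
Proof.
move=> Fc; elim: r => [|i r IH].
  rewrite (_ : (fun y => _) = fun=> 0); last by apply/funext => y; rewrite big_nil.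
  exact: cvg_cst.
rewrite (_ : (fun y => _) = fun y => (if P i then F i y else 0) +
    \sum_(j <- r | P j) F j y); last first.
  by apply/funext => y; rewrite big_cons; case: ifP => // _; rewrite add0r.
apply: cvgD IH; case: ifP => [Pi|_]; [exact: Fc|exact: cvg_cst].
Qed.

Lemma linear_rV_continuous n (W : normedModType R)
  (f : {linear 'rV[R]_n -> W}) : continuous f.
Proof.
have -> : f = (fun x : 'rV[R]_n => \sum_(i < n) x 0 i *: f (delta_mx 0 i)) :> (_ -> _).
  apply/funext => x; rewrite [in LHS](row_sum_delta x) linear_sum.
  by under eq_bigr do rewrite linearZ.
move=> x; apply: continuous_sum => i _.
by apply: continuousZr_tmp; exact: coord_continuous.
Qed.

Definition mk_linear (V W : lmodType R) (f : V -> W) (lf : linear f) :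
    {linear V -> W} :=
  HB.pack_for {linear V -> W} f (GRing.isLinear.Build _ _ _ _ _ lf).

(** Continuous linear coordinates: all that the chain rule for [Ck] asks of the
    intermediate space. *)
Definition has_coords (V : normedModType R) : Prop :=
  exists (I : finType) (e : I -> V) (l : I -> {linear V -> R}),
    (forall i, continuous (l i)) /\ forall x, x = \sum_i l i x *: e i.

Lemma has_coords_rV n : has_coords 'rV[R]_n.
Proof.
have lin i : linear (fun x : 'rV[R]_n => x 0 i).
  by move=> k u v; rewrite !mxE.
exists 'I_n, (fun i => delta_mx 0 i), (fun i => mk_linear (lin i)).
split; last exact: row_sum_delta.
by move=> i; exact: linear_rV_continuous.
Qed.

Lemma has_coords_R : has_coords R.
Proof.
have lin : linear (@id R) by [].
exists unit, (fun=> 1), (fun=> mk_linear lin); split; first by move=> _ x; exact: cvg_id.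
move=> x; rewrite (bigD1 tt)//= big1 ?addr0; last by case.
by rewrite /GRing.scale/= mulr1.
Qed.

Lemma has_coords_prod (V W : normedModType R) :
  has_coords V -> has_coords W -> has_coords (V * W)%type.
Proof.
move=> [I [e [l [lc lE]]]] [J [f [m [mc mE]]]].
have lin1 i : linear (fun x : V * W => l i x.1).
  by move=> k u v /=; rewrite linearP.
have lin2 i : linear (fun x : V * W => m i x.2).
  by move=> k u v /=; rewrite linearP.
exists (I + J)%type, (fun i => match i with inl i => (e i, 0) | inr i => (0, f i) end),
  (fun i => match i with inl i => mk_linear (lin1 i) | inr i => mk_linear (lin2 i) end).
split.
  case=> i /= x.
  - apply: (@continuous_comp _ _ _ fst (l i)); [exact: cvg_fst|exact: lc].
  - apply: (@continuous_comp _ _ _ snd (m i)); [exact: cvg_snd|exact: mc].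
move=> [x y]; rewrite big_sumType/= [in LHS](lE x) [in LHS](mE y).
have E1 (r : seq I) : \sum_(i <- r) l i x *: (e i, 0 : W) = (\sum_(i <- r) l i x *: e i, 0).
  elim: r => [|i r IH]; first by rewrite !big_nil.
  by rewrite !big_cons IH; congr pair; rewrite /= ?scaler0 addr0.
have E2 (r : seq J) : \sum_(i <- r) m i y *: (0 : V, f i) = (0, \sum_(i <- r) m i y *: f i).
  elim: r => [|i r IH]; first by rewrite !big_nil.
  by rewrite !big_cons IH; congr pair; rewrite /= ?scaler0 addr0.
by rewrite E1 E2; congr pair; rewrite ?addr0 ?add0r.
Qed.

Section Classes.
Variables (V : normedModType R).
Implicit Types (O : set V).

Lemma open_near O x : open O -> O x -> \forall y \near x, O y.
Proof. by move=> oO Ox; exact: open_nbhs_nbhs. Qed.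

Lemma Ck_sub (W : normedModType R) k O O' (f : V -> W) : O `<=` O' -> Ck k O' f -> Ck k O f.
Proof.
elim: k f => [|k IH] f OO /=; first by move=> H x /OO; exact: H.
by case=> df H; split=> [x /OO|v]; [exact: df|exact: IH].
Qed.

Lemma CkS (W : normedModType R) k O (f : V -> W) : Ck k.+1 O f -> Ck k O f.
Proof.
elim: k f => [|k IH] f; first by case=> df _ x Ox; exact/differentiable_continuous/df.
by case=> df H; split=> // v; exact: IH.
Qed.

Lemma Ck_ext (W : normedModType R) k O (f g : V -> W) : open O ->
  (forall x, O x -> f x = g x) -> Ck k O f -> Ck k O g.
Proof.
move=> oO; elim: k f g => [|k IH] f g fg /=.
  move=> H x Ox; have fgx : \forall y \near x, f y = g y.
    by apply: filterS (open_near oO Ox).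
  rewrite /prop_for/continuous_at -fg//; apply: cvg_trans (H x Ox).
  by apply: near_eq_cvg; apply: filterS fgx => y ->.
case=> df H; split=> [x Ox|v].
  by have [] := near_eq_diff (filterS fg (open_near oO Ox)) (df x Ox).
apply: IH (H v) => x Ox; apply: near_eq_D; exact: filterS fg (open_near oO Ox).
Qed.

Lemma Ck_local (W : normedModType R) k O (f : V -> W) :
  (forall x, O x -> exists U : set V, [/\ open U, U x & Ck k U f]) -> Ck k O f.
Proof.
elim: k f => [|k IH] f H /=.
  by move=> x Ox; have [U [_ Ux H']] := H x Ox; exact: H'.
split=> [x Ox|v]; first by have [U [_ Ux [df _]]] := H x Ox; exact: df.
apply: IH => x Ox; have [U [oU Ux [_ H']]] := H x Ox; by exists U; split=> //; exact: H'.
Qed.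

Lemma Ck_cst (W : normedModType R) k O (c : W) : Ck k O (fun=> c).
Proof.
elim: k c => [|k IH] c /=; first by move=> x _; exact: cvg_cst.
split=> [x _|v]; first exact: differentiable_cst.
rewrite (_ : 'D_v _ = fun=> 0)//.
by apply/funext => x; exact: derive_cst.
Qed.

Lemma Ck_lin (W : normedModType R) k O (f : {linear V -> W}) : continuous f -> Ck k O f.
Proof.
move=> fc; case: k => [|k] /=; first by move=> x _; exact: fc.
split=> [x _|v]; first exact: linear_differentiable.
rewrite (_ : 'D_v _ = fun=> f v); first exact: Ck_cst.
by apply/funext => x; rewrite D_lin.
Qed.

Lemma Ck_id k O : Ck k O (@id V).
Proof.
have lin : linear (@id V) by [].
by apply: (@Ck_lin _ k O (mk_linear lin)) => x; exact: cvg_id.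
Qed.

Lemma CkD (W : normedModType R) k O (f g : V -> W) : open O ->
  Ck k O f -> Ck k O g -> Ck k O (fun x => f x + g x).
Proof.
move=> oO; elim: k f g => [|k IH] f g /=.
  by move=> cf cg x Ox; apply: cvgD; [exact: cf|exact: cg].
move=> [df Hf] [dg Hg]; split=> [x Ox|v].
  by apply: differentiableD; [exact: df|exact: dg].
apply: Ck_ext (IH _ _ (Hf v) (Hg v)) => // x Ox.
by rewrite deriveD//; apply: diff_derivable; [exact: df|exact: dg].
Qed.

Lemma Ck_sum (W : normedModType R) k O (I : Type) (r : seq I) (F : I -> V -> W) : open O ->
  (forall i, Ck k O (F i)) -> Ck k O (fun x => \sum_(i <- r) F i x).
Proof.
move=> oO HF; elim: r => [|i r IH].
  by apply: Ck_ext (Ck_cst k O 0) => // x _; rewrite big_nil.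
by apply: Ck_ext (CkD oO (HF i) IH) => // x _; rewrite big_cons.
Qed.

Lemma CkM k O (f g : V -> R) : open O ->
  Ck k O f -> Ck k O g -> Ck k O (fun x => f x * g x).
Proof.
move=> oO; elim: k f g => [|k IH] f g.
  by move=> cf cg x Ox; apply: cvgM; [exact: cf|exact: cg].
move=> Cf Cg; have [df Hf] := Cf; have [dg Hg] := Cg; split=> [x Ox|v].
  by apply: differentiableM; [exact: df|exact: dg].
have := CkD oO (IH _ _ (CkS Cf) (Hg v)) (IH _ _ (CkS Cg) (Hf v)).
apply: Ck_ext => // x Ox; rewrite deriveM//; apply: diff_derivable.
  exact: df.
exact: dg.
Qed.

Lemma Ck_prod k O (I : Type) (r : seq I) (F : I -> V -> R) : open O ->
  (forall i, Ck k O (F i)) -> Ck k O (fun x => \prod_(i <- r) F i x).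
Proof.
move=> oO HF; elim: r => [|i r IH].
  by apply: Ck_ext (Ck_cst k O (1 : R)) => // x _; rewrite big_nil.
by apply: Ck_ext (CkM oO (HF i) IH) => // x _; rewrite big_cons.
Qed.

Lemma CkN k O (f : V -> R) : open O -> Ck k O f -> Ck k O (fun x => - f x).
Proof.
move=> oO Cf; apply: Ck_ext (CkM oO (Ck_cst k O (-1 : R)) Cf) => // x _.
by rewrite mulN1r.
Qed.

Lemma CkB k O (f g : V -> R) : open O ->
  Ck k O f -> Ck k O g -> Ck k O (fun x => f x - g x).
Proof. by move=> oO Cf Cg; apply: CkD => //; exact: CkN. Qed.

Lemma CkV k O (f : V -> R) : open O -> (forall x, O x -> f x != 0) ->
  Ck k O f -> Ck k O (fun x => (f x)^-1).
Proof.
move=> oO f0; elim: k => [|k IH].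
  by move=> cf x Ox; apply: cvgV; [exact: f0|exact: cf].
move=> Cf; have [df Hf] := Cf; split=> [x Ox|v].
  by apply: differentiableV; [exact: df|exact: f0].
have CV := IH (CkS Cf).
have := CkN oO (CkM oO (CkM oO CV CV) (Hf v)).
apply: Ck_ext => // x Ox.
rewrite deriveV; last 2 first.
- exact: f0.
- exact/diff_derivable/df.
by rewrite -invfM -expr2 -mulNr.
Qed.

(** Induction on the order: the derivative of the composite is the sum over
    the coordinates of [U] of a coordinate of the derivative of [f] times a
    partial derivative of [g] composed with [f]. *)
Lemma Ck_comp (U : normedModType R) k O (O' : set U) (f : V -> U) (g : U -> R) :
  has_coords U -> open O -> (forall x, O x -> O' (f x)) ->
  Ck k O f -> Ck k O' g -> Ck k O (g \o f).
Proof.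
move=> [I [e [l [lc lE]]]] oO ff; elim: k f g ff => [|k IH] f g ff.
  move=> cf cg x Ox; apply: (@continuous_comp _ _ _ f g); first exact: cf.
  exact/cg/ff.
move=> Cf Cg; have [df Hf] := Cf; have [dg Hg] := Cg; split=> [x Ox|v].
  by apply: differentiable_comp; [exact: df|exact/dg/ff].
have L i : Ck k O (l i \o 'D_v f).
  elim: (k) ('D_v f) (Hf v) => [|j IHj] h.
    move=> hc x Ox; apply: (@continuous_comp _ _ _ h (l i)); [exact: hc|exact: lc].
  move=> [dh Hh]; split=> [x Ox|w].
    by apply: differentiable_comp; [exact: dh|exact: linear_differentiable].
  apply: Ck_ext (IHj _ (Hh w)) => // x Ox.
  rewrite D_comp ?diff_lin//; first exact: dh.
  exact: linear_differentiable.
have := Ck_sum (index_enum I) oO (fun i => CkM oO (L i) (IH _ _ ff (CkS Cf) (Hg (e i)))).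
apply: Ck_ext => // x Ox; rewrite D_comp; [|exact: df|exact: dg (ff _ Ox)].
rewrite [in RHS](lE ('D_v f x)) linear_sum; apply: eq_bigr => i _ /=.
have dgx := dg _ (ff _ Ox); by rewrite linearZ/= -[in RHS]deriveE.
Qed.

End Classes.

Section RowClasses.
Variables (V : normedModType R).
Implicit Types (O : set V).

Lemma Ck_row k n O (f : V -> 'rV[R]_n) : open O ->
  (forall i, Ck k O (fun x => f x 0 i)) -> Ck k O f.
Proof.
move=> oO H; have lin i : linear (fun c : R => c *: delta_mx (0 : 'I_1) (i : 'I_n)).
  by move=> c u v; rewrite scalerDl scalerA.
have L' i j (h : V -> R) : Ck j O h -> Ck j O (fun x => h x *: delta_mx (0 : 'I_1) (i : 'I_n)).
  elim: j h => [|j IHj] h.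
    move=> hc x Ox; by apply: continuousZr_tmp; exact: hc.
  move=> [dh Hh]; split=> [x Ox|w].
    by apply: differentiableZl; exact: dh.
  apply: Ck_ext (IHj _ (Hh w)) => // x Ox.
  rewrite [RHS]deriveE; last by apply: differentiableZl; exact: dh.
  by rewrite diffZl; [rewrite deriveE//; exact: dh|exact: dh].
apply: Ck_ext (Ck_sum (index_enum 'I_n) oO (fun i => L' i _ _ (H i))) => // x _.
by rewrite -row_sum_delta.
Qed.

Lemma Ck_coord k n O (f : V -> 'rV[R]_n) i : open O ->
  Ck k O f -> Ck k O (fun x => f x 0 i).
Proof.
move=> oO Cf; have lin : linear (fun x : 'rV[R]_n => x 0 i).
  by move=> c u v; rewrite !mxE.
apply: (@Ck_comp V 'rV[R]_n k O setT f (mk_linear lin)) => //; first exact: has_coords_rV.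
apply: Ck_lin; exact: linear_rV_continuous.
Qed.

Lemma Ck_pair (U W : normedModType R) k O (f : V -> U) (g : V -> W) : open O ->
  Ck k O f -> Ck k O g -> Ck k O (fun x => (f x, g x)).
Proof.
move=> oO; elim: k f g => [|k IH] f g.
  by move=> cf cg x Ox; apply: cvg_pair; [exact: cf|exact: cg].
move=> [df Hf] [dg Hg]; split=> [x Ox|v].
  by apply: differentiable_pair; [exact: df|exact: dg].
apply: Ck_ext (IH _ _ (Hf v) (Hg v)) => // x Ox.
rewrite [RHS]deriveE; last by apply: differentiable_pair; [exact: df|exact: dg].
have dfx := df _ Ox; have dgx := dg _ Ox; by rewrite diff_pair//= !deriveE.
Qed.

End RowClasses.

Lemma Ck_comp_row (V U : normedModType R) k n (O : set V) (O' : set U) (f : V -> U) (g : U -> 'rV[R]_n) :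
  has_coords U -> open O -> (forall x, O x -> O' (f x)) -> open O' ->
  Ck k O f -> Ck k O' g -> Ck k O (g \o f).
Proof.
move=> hU oO ff oO' Cf Cg; apply: Ck_row => // i.
apply: (@Ck_comp _ _ k O O' f (fun y => g y 0 i)) => //; exact: Ck_coord.
Qed.

Lemma near_ballP (V : normedModType R) (x : V) (P : V -> Prop) :
  (\forall y \near x, P y) <-> exists2 d : R, 0 < d & forall y, `|y - x| < d -> P y.
Proof.
split=> [/nbhs_ballP[d /= d0 H]|[d d0 H]].
  by exists d => // y yx; apply: H; rewrite -ball_normE /ball_/= distrC.
by apply/nbhs_ballP; exists d => //= y; rewrite -ball_normE /ball_/= distrC => /H.
Qed.

Lemma is_derive_line (V : normedModType R) (p u : V) (a : R) :
  is_derive a (1 : R) (fun a : R => p + a *: u) u.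
Proof.
have lin : linear (fun a : R => a *: u).
  by move=> k x y; rewrite scalerDl scalerA.
have [] := @diff_of_bound R V (fun a : R => p + a *: u) (mk_linear lin) a.
- by move=> x; apply: continuousZr_tmp; exact: cvg_id.
- move=> e e0; near=> y => /=.
  rewrite opprD addrACA subrr add0r scalerBl subrr normr0.
  by rewrite mulr_ge0// ltW.
move=> df E; split; first exact/derivable1_diffP.
by rewrite deriveE// E /= scale1r.
Unshelve. all: by end_near. Qed.

(** The mean value theorem in the direction [u] turns the second difference
    into a difference of values of the directional derivative along [u],
    which is differentiable at [x]. The constant [C] bounds the
    displacements, measured in units of [h]. *)
Lemma second_difference (V : normedModType R) (O : set V) (f : V -> R) x u v :
  open O -> O x -> Ck 2 O f ->
  exists2 C : R, 0 < C & forall e, 0 < e -> exists2 d : R, 0 < d &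
    forall h, 0 < h < d ->
    `|f (x + h *: u + h *: v) - f (x + h *: u) - (f (x + h *: v) - f x)
      - h ^+ 2 * 'D_v ('D_u f) x| <= e * C * h ^+ 2.
Proof.
move=> oO Ox [df /(_ u)[dg _]].
set C := 2 * `|u| + `|v| + 1.
have C0 : 0 < C by rewrite ltr_wpDl// addr_ge0// mulr_ge0.
exists C => // e e0.
have /near_ballP[d1 d10 B1] := open_near oO Ox.
have /near_ballP[d2 d20 B2] := diff_bound (dg x Ox) e0.
exists (Num.min d1 d2 / C); first by rewrite divr_gt0// lt_min d10.
move=> h /andP[h0]; rewrite ltr_pdivlMr// lt_min => /andP[hd1 hd2].
have small (a b : R) : 0 <= a <= h -> 0 <= b <= h -> `|a *: u + b *: v| <= h * (`|u| + `|v|).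
  move=> /andP[a0 ah] /andP[b0 bh]; rewrite (le_trans (ler_normD _ _))// !normrZ mulrDr.
  by rewrite !ger0_norm// lerD// ler_wpM2r.
have smallC : h * (`|u| + `|v|) < h * C.
  by rewrite ltr_pM2l// /C; have := normr_ge0 u; lra.
have inO (a b : R) : 0 <= a <= h -> 0 <= b <= h -> O (x + a *: u + b *: v).
  move=> ha hb; apply: B1; rewrite -[x + _ + _]addrA addrAC subrr add0r.
  exact: le_lt_trans (small _ _ ha hb) (lt_trans smallC hd1).
have hh : 0 <= h <= h by rewrite lexx ltW.
have h00 : 0 <= (0:R) <= h by rewrite lexx ltW.
pose p (b a : R) := f (x + a *: u + b *: v).
have dp b a : 0 <= a <= h -> 0 <= b <= h -> is_derive a (1 : R) (p b) ('D_u f (x + a *: u + b *: v)).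
  move=> ha hb; have dfz := df _ (inO _ _ ha hb).
  have : is_derive a (1 : R) (fun a : R => x + a *: u + b *: v) u.
    rewrite (_ : (fun a => _) = fun a : R => (x + b *: v) + a *: u).
      exact: is_derive_line.
    by apply/funext => c; rewrite addrAC.
  move=> [da ea]; have daf : differentiable (fun a : R => x + a *: u + b *: v) a.
    exact/derivable1_diffP.
  split; first by apply/derivable1_diffP; exact: differentiable_comp.
  by rewrite (D_comp _ daf dfz) ea deriveE.
have [c] : exists2 c, c \in `]0, h[%R & (p h h - p 0 h) - (p h 0 - p 0 0) =
   ('D_u f (x + c *: u + h *: v) - 'D_u f (x + c *: u + 0 *: v)) * (h - 0).
  apply: (@MVT _ (fun a => p h a - p 0 a)
    (fun c => 'D_u f (x + c *: u + h *: v) - 'D_u f (x + c *: u + 0 *: v))) => //.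
    move=> a; rewrite in_itv/= => /andP[a0 ah].
    have ha : 0 <= a <= h by rewrite !ltW.
    by apply: is_deriveB; exact: dp.
  apply: derivable_within_continuous => a; rewrite in_itv/= => ha.
  by apply: derivableB; [have [] := dp h a ha hh|have [] := dp 0 a ha h00].
rewrite in_itv/= => /andP[c0 ch].
rewrite /p !scale0r !addr0 subr0 => ->.
have hc : 0 <= c <= h by rewrite !ltW.
have bnd b : 0 <= b <= h -> `|'D_u f (x + c *: u + b *: v) - 'D_u f x -
   'd ('D_u f) x (c *: u + b *: v)| <= e * (h * (`|u| + `|v|)).
  move=> hb; have := B2 (x + c *: u + b *: v); rewrite -[x + _ + _]addrA addrAC subrr add0r.
  move=> H; apply: le_trans (H _) _; last by rewrite ler_pM2l// small.
  exact: le_lt_trans (small _ _ hc hb) (lt_trans smallC hd2).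
have B := bnd _ hh; have B' : `|'D_u f (x + c *: u) - 'D_u f x -
   'd ('D_u f) x (c *: u)| <= e * (h * `|u|).
  have := B2 (x + c *: u); rewrite addrAC subrr add0r => H.
  have nc : `|c *: u| <= h * `|u| by rewrite normrZ (ger0_norm (ltW c0)); apply: ler_wpM2r => //; exact: ltW.
  apply: le_trans (H _) _; last by rewrite ler_pM2l.
  apply: le_lt_trans nc _; apply: le_lt_trans (lt_trans smallC hd2).
  by rewrite ler_pM2l// lerDl.
rewrite linearD !linearZ/= in B B'; rewrite (deriveE v (dg x Ox)).
rewrite expr2 -mulrA [X in `|X - _|]mulrC -mulrBr normrM gtr0_norm// [e * C * _]mulrCA ler_pM2l//.
rewrite /GRing.scale/= in B B'.
move: B B'; set A1 := 'D_u f (_ + _); set A2 := 'D_u f (_ + _); set A3 := 'D_u f x.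
set L1 := 'd _ _ u; set L2 := 'd _ _ v => B B'.
have -> : A1 - A2 - h * L2 = (A1 - A3 - (c * L1 + h * L2)) - (A2 - A3 - c * L1) by ring.
rewrite mulrN in B'.
rewrite (le_trans (ler_normB _ _))// (le_trans (lerD B B'))// -mulrDr.
rewrite -mulrA ler_pM2l// [C * h]mulrC -mulrDr ler_pM2l// /C.
by have := normr_ge0 u; lra.
Qed.

(** Used for the symmetry of second derivatives: both of them satisfy the
    same estimate. *)
Lemma small_o_unique (Z : R -> R) (a b C C' : R) : 0 < C -> 0 < C' ->
  (forall e, 0 < e -> exists2 d, 0 < d & forall h, 0 < h < d ->
     `|Z h - h ^+ 2 * a| <= e * C * h ^+ 2) ->
  (forall e, 0 < e -> exists2 d, 0 < d & forall h, 0 < h < d ->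
     `|Z h - h ^+ 2 * b| <= e * C' * h ^+ 2) -> a = b.
Proof.
move=> C0 C0' H H'.
apply/eqP; rewrite -subr_eq0 -normr_eq0; apply/negP => /negP ne.
have n0 : 0 < `|a - b| by rewrite lt_def ne normr_ge0.
pose e := `|a - b| / (2 * (C + C')).
have e0 : 0 < e by rewrite divr_gt0// mulr_gt0// addr_gt0.
have [d d0 {}H] := H e e0; have [d' d0' {}H'] := H' e e0.
pose h := Num.min d d' / 2.
have h0 : 0 < h by rewrite divr_gt0// lt_min d0.
have hd : h < d /\ h < d'.
  split; rewrite /h ltr_pdivrMr// /Num.min; case: ifP; move: d0 d0'; clear; lra.
have := H h; rewrite h0 hd.1 => /(_ isT) B.
have := H' h; rewrite h0 hd.2 => /(_ isT) B'.
have : `|a - b| * h ^+ 2 <= e * (C + C') * h ^+ 2.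
  rewrite -[h ^+ 2 in leLHS]ger0_norm ?sqr_ge0// -normrM.
  have -> : (a - b) * h ^+ 2 = (Z h - h ^+ 2 * b) - (Z h - h ^+ 2 * a).
    by move: (Z h) (h) => z k; ring.
  rewrite (le_trans (ler_normB _ _))// (le_trans (lerD B' B))//.
  by rewrite -mulrDl -mulrDr [C' + C]addrC.
rewrite ler_pM2r ?exprn_gt0//.
have -> : e * (C + C') = `|a - b| / 2.
  rewrite /e; move: `|a - b| (addr_gt0 C0 C0') => n; move: (C + C') => D D0.
  by field; rewrite gt_eqF.
move: n0; clear; lra.
Qed.

(** Symmetry of second derivatives: both sides are the limit of the same
    second difference divided by [h ^+ 2]. *)
Lemma D_sym (V : normedModType R) (O : set V) (f : V -> R) x u v :
  open O -> O x -> Ck 2 O f -> 'D_v ('D_u f) x = 'D_u ('D_v f) x.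
Proof.
move=> oO Ox C2.
have [C C0 H] := second_difference u v oO Ox C2.
have [C' C0' H'] := second_difference v u oO Ox C2.
apply: (small_o_unique C0 C0' H) => e /H'[d d0 {}H']; exists d => // h /H'.
rewrite [x + h *: v + _]addrAC.
move: (f (_ + _ + _)) (f (x + h *: u)) (f (x + h *: v)) (f x) => a b c k.
by have -> : a - c - (b - k) = a - b - (c - k) by ring.
Qed.

End Differentials.

(** * Smooth maps *)

Section Smooth.
Context {R : realType}.
Implicit Types V U : normedModType R.

Lemma smooth_sub V (W : normedModType R) (O O' : set V) (f : V -> W) :
  O `<=` O' -> smooth O' f -> smooth O f.
Proof. by move=> OO H k; exact: Ck_sub (H k). Qed.

Lemma smooth_ext V (W : normedModType R) (O : set V) (f g : V -> W) :
  open O -> (forall x, O x -> f x = g x) -> smooth O f -> smooth O g.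
Proof. by move=> oO fg H k; exact: Ck_ext (H k). Qed.

Lemma smooth_local V (W : normedModType R) (O : set V) (f : V -> W) :
  (forall x, O x -> exists U : set V, [/\ open U, U x & smooth U f]) ->
  smooth O f.
Proof.
move=> H k; apply: Ck_local => x /H[U [oU Ux sf]].
by exists U; split=> //; exact: sf.
Qed.

Lemma smooth_cst V (W : normedModType R) (O : set V) (c : W) : smooth O (fun=> c).
Proof. by move=> k; exact: Ck_cst. Qed.

Lemma smooth_id V (O : set V) : smooth O (@id V).
Proof. by move=> k; exact: Ck_id. Qed.

Lemma smooth_lin V (W : normedModType R) (O : set V) (f : {linear V -> W}) :
  continuous f -> smooth O f.
Proof. by move=> fc k; exact: Ck_lin. Qed.

Lemma smoothD V (W : normedModType R) (O : set V) (f g : V -> W) : open O ->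
  smooth O f -> smooth O g -> smooth O (fun x => f x + g x).
Proof. by move=> oO sf sg k; exact: CkD. Qed.

Lemma smooth_sum V (W : normedModType R) (O : set V) (I : Type) (r : seq I)
  (F : I -> V -> W) : open O ->
  (forall i, smooth O (F i)) -> smooth O (fun x => \sum_(i <- r) F i x).
Proof. by move=> oO sF k; apply: Ck_sum => // i; exact: sF. Qed.

Lemma smooth_prod V (O : set V) (I : Type) (r : seq I) (F : I -> V -> R) :
  open O -> (forall i, smooth O (F i)) -> smooth O (fun x => \prod_(i <- r) F i x).
Proof. by move=> oO sF k; apply: Ck_prod => // i; exact: sF. Qed.

Lemma smoothM V (O : set V) (f g : V -> R) : open O ->
  smooth O f -> smooth O g -> smooth O (fun x => f x * g x).
Proof. by move=> oO sf sg k; exact: CkM. Qed.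

Lemma smoothN V (O : set V) (f : V -> R) : open O ->
  smooth O f -> smooth O (fun x => - f x).
Proof. by move=> oO sf k; exact: CkN. Qed.

Lemma smoothB V (O : set V) (f g : V -> R) : open O ->
  smooth O f -> smooth O g -> smooth O (fun x => f x - g x).
Proof. by move=> oO sf sg k; exact: CkB. Qed.

Lemma smoothV V (O : set V) (f : V -> R) : open O ->
  (forall x, O x -> f x != 0) -> smooth O f -> smooth O (fun x => (f x)^-1).
Proof. by move=> oO f0 sf k; exact: CkV. Qed.

Lemma smooth_comp V U (O : set V) (O' : set U) (f : V -> U) (g : U -> R) :
  has_coords U -> open O -> (forall x, O x -> O' (f x)) ->
  smooth O f -> smooth O' g -> smooth O (g \o f).
Proof. by move=> hU oO ff sf sg k; exact: Ck_comp (sf k) (sg k). Qed.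

Lemma smooth_comp_row V U n (O : set V) (O' : set U) (f : V -> U)
    (g : U -> 'rV[R]_n) :
  has_coords U -> open O -> (forall x, O x -> O' (f x)) -> open O' ->
  smooth O f -> smooth O' g -> smooth O (g \o f).
Proof. by move=> hU oO ff oO' sf sg k; exact: Ck_comp_row (sf k) (sg k). Qed.

Lemma smooth_row V n (O : set V) (f : V -> 'rV[R]_n) : open O ->
  (forall i, smooth O (fun x => f x 0 i)) -> smooth O f.
Proof. by move=> oO H k; apply: Ck_row => // i; exact: H. Qed.

Lemma smooth_coord V n (O : set V) (f : V -> 'rV[R]_n) i : open O ->
  smooth O f -> smooth O (fun x => f x 0 i).
Proof. by move=> oO H k; apply: Ck_coord => //; exact: H. Qed.

Lemma smooth_pair V U (W : normedModType R) (O : set V) (f : V -> U) (g : V -> W) :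
  open O -> smooth O f -> smooth O g -> smooth O (fun x => (f x, g x)).
Proof. by move=> oO sf sg k; exact: Ck_pair. Qed.

Lemma smooth_D V (W : normedModType R) (O : set V) (f : V -> W) v :
  smooth O f -> smooth O ('D_v f).
Proof. by move=> H k; have [_ ] := H k.+1; exact. Qed.

Lemma smooth_differentiable V (W : normedModType R) (O : set V) (f : V -> W) x :
  smooth O f -> O x -> differentiable f x.
Proof. by move=> /(_ 1%N)[H _]; exact: H. Qed.

Lemma smooth_continuous V (W : normedModType R) (O : set V) (f : V -> W) x :
  smooth O f -> O x -> {for x, continuous f}.
Proof. by move=> /(_ 0%N); exact. Qed.

Lemma smooth_scale V n (O : set V) (c : V -> R) (f : V -> 'rV[R]_n) : open O ->
  smooth O c -> smooth O f -> smooth O (fun x => c x *: f x).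
Proof.
move=> oO sc sf; apply: smooth_row => // i.
apply: (smooth_ext oO _ (smoothM oO sc (smooth_coord i oO sf))) => x _.
by rewrite mxE.
Qed.

(** Expanding the direction in the standard basis leaves partial derivatives
    of [f] composed with [h], times coordinates of [w]. *)
Lemma smooth_diff V m n (O : set V) (O' : set 'rV[R]_m) (f : 'rV[R]_m -> 'rV[R]_n)
    (h w : V -> 'rV[R]_m) : open O -> open O' -> (forall x, O x -> O' (h x)) ->
  smooth O' f -> smooth O h -> smooth O w ->
  smooth O (fun x => 'd f (h x) (w x)).
Proof.
move=> oO oO' hO sf sh sw.
have S : smooth O (fun x => \sum_(i < m) w x 0 i *: 'D_(delta_mx 0 i) f (h x)).
  apply: smooth_sum => // i; apply: smooth_scale => //; first exact: smooth_coord.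
  apply: (@smooth_comp_row _ _ _ O O' h ('D_(delta_mx 0 i) f)) => //; [exact: has_coords_rV|exact: smooth_D].
apply: smooth_ext S => // x Ox.
rewrite [in RHS](row_sum_delta (w x)) linear_sum; apply: eq_bigr => i _.
by rewrite linearZ deriveE//; exact: smooth_differentiable sf (hO _ Ox).
Qed.

Lemma smooth_det V n (O : set V) (M : V -> 'M[R]_n) : open O ->
  (forall i j, smooth O (fun x => M x i j)) -> smooth O (fun x => \det (M x)).
Proof.
move=> oO H; apply: smooth_sum => // s; apply: smoothM => //; first exact: smooth_cst.
by apply: smooth_prod => // i; exact: H.
Qed.

(** Cramer's rule. *)
Lemma smooth_invmx V n (O : set V) (M : V -> 'M[R]_n) i j : open O ->
  (forall x, O x -> M x \in unitmx) ->
  (forall i j, smooth O (fun x => M x i j)) -> smooth O (fun x => invmx (M x) i j).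
Proof.
move=> oO U H.
have S : smooth O (fun x => (\det (M x))^-1 * \adj (M x) i j).
  apply: smoothM => //.
    apply: smoothV => //; last exact: smooth_det.
    by move=> x /U; rewrite unitmxE unitfE.
  rewrite (_ : (fun x => _) = fun x => (-1) ^+ (j + i) * \det (row' j (col' i (M x)))).
    apply: smoothM => //; first exact: smooth_cst.
    apply: smooth_det => // k l.
    rewrite (_ : (fun x => _) = fun x => M x (lift j k) (lift i l)); first exact: H.
    by apply/funext => x; rewrite !mxE.
  by apply/funext => x; rewrite mxE.
apply: smooth_ext S => // x /U Ux.
by rewrite /invmx Ux [RHS]mxE.
Qed.

Lemma smooth_mulmx V m n (O : set V) (w : V -> 'rV[R]_m) (M : V -> 'M[R]_(m, n)) :
  open O -> smooth O w -> (forall i j, smooth O (fun x => M x i j)) ->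
  smooth O (fun x => w x *m M x).
Proof.
move=> oO sw sM; apply: smooth_row => // j.
have S : smooth O (fun x => \sum_i w x 0 i * M x i j).
  by apply: smooth_sum => // i; apply: smoothM => //; exact: smooth_coord.
by apply: smooth_ext S => // x _; rewrite mxE.
Qed.

End Smooth.

(** * Continuous solutions of smooth equations *)
Section ContinuousSolutions.
Context {R : realType}.

Lemma jacobianE m n (G : 'rV[R]_m -> 'rV[R]_n) y v : 'd G y v = v *m 'J G y.
Proof. by rewrite /jacobian mul_rV_lin1. Qed.

Lemma smooth_jacobian m n (U : set 'rV[R]_m) (G : 'rV[R]_m -> 'rV[R]_n) i j :
  open U -> smooth U G -> smooth U (fun y => 'J G y i j).
Proof.
move=> oU sG.
apply: (smooth_ext oU _ (smooth_coord j oU (smooth_D (delta_mx 0 i) sG))) => y Uy.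
by rewrite deriveE ?[RHS]mxE//; exact: smooth_differentiable sG Uy.
Qed.

(** Applying the inverse Jacobian to the linearisation of [G] at [q o] bounds
    the increment of [q] by that of [h], up to a small multiple of itself,
    which is absorbed since [q] is continuous. *)
Lemma differentiable_implicit (V : normedModType R) m (q h : V -> 'rV[R]_m)
    (G : 'rV[R]_m -> 'rV[R]_m) (o : V) :
  {for o, continuous q} -> differentiable G (q o) -> 'J G (q o) \in unitmx ->
  differentiable h o -> (\forall o' \near o, G (q o') = h o') ->
  differentiable q o /\
  'd q o = (fun v => 'd h o v *m invmx ('J G (q o))) :> (V -> _).
Proof.
move=> cq dG uA dh Gh; set A := 'J G (q o) in uA *.
have lin : linear (fun v => 'd h o v *m invmx A).
  by move=> k u v; rewrite linearP/= mulmxDl scalemxAl.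
pose T : {linear 'rV[R]_m -> 'rV[R]_m} := mulmxr (invmx A).
have Tc : continuous T by exact: linear_rV_continuous.
have [K K0 HK] := linear_lipschitz Tc.
have hc := diff_continuous_lin dh.
have [N N0 HN] := linear_lipschitz hc.
have Gho := nbhs_singleton Gh.
(* the error of the linearisation of [G], pulled back by [q] *)
have err e : 0 < e -> \forall o' \near o,
    `|h o' - h o - (q o' - q o) *m A| <= e * `|q o' - q o|.
  move=> e0; have B := cq _ (diff_bound dG e0).
  near=> o'.
  have <- : G (q o') = h o' by near: o'; exact: Gh.
  by rewrite -Gho -jacobianE; near: o'; exact: B.
have dec o' : q o' - q o = T (h o' - h o) - T (h o' - h o - (q o' - q o) *m A).
  rewrite -linearB opprB addrCA subrr addr0.
  by rewrite /T /= mulmxK.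
pose M := 2 * K * (N + 1).
have M0 : 0 < M by rewrite !mulr_gt0// addr_gt0.
have lip : \forall o' \near o, `|q o' - q o| <= M * `|o' - o|.
  have E0 : 0 < (2 * K)^-1 by rewrite invr_gt0 mulr_gt0.
  near=> o'.
  have E : `|h o' - h o - (q o' - q o) *m A| <= (2 * K)^-1 * `|q o' - q o|.
    by near: o'; exact: err.
  have H : `|h o' - h o - 'd h o (o' - o)| <= 1 * `|o' - o|.
    by near: o'; exact: diff_bound.
  have H' : `|h o' - h o| <= (N + 1) * `|o' - o|.
    rewrite -[h o' - h o](subrK ('d h o (o' - o))).
    by rewrite (le_trans (ler_normD _ _))// addrC mulrDl lerD.
  have D : `|q o' - q o| <= K * `|h o' - h o| + `|q o' - q o| / 2.
    rewrite {1}dec (le_trans (ler_normB _ _))// lerD//.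
    rewrite (le_trans (HK _))//.
    apply: le_trans (_ : K * ((2 * K)^-1 * `|q o' - q o|) <= _).
      by rewrite ler_pM2l.
    by rewrite invfM mulrCA mulrA mulfVK ?gt_eqF// mulrC.
  have D' : K * `|h o' - h o| <= K * ((N + 1) * `|o' - o|) by rewrite ler_pM2l.
  rewrite /M -!mulrA.
  by move: D D'; move: (`|q o' - q o|) (K * _) (K * _) => x y z; clear; lra.
have [] := @diff_of_bound R V _ q (mk_linear lin) o.
- move=> v; apply: (@continuous_comp _ _ _ ('d h o) T); [exact: hc|exact: Tc].
- move=> e e0.
  have e1 : 0 < e / (2 * K) by rewrite divr_gt0// mulr_gt0.
  have e2 : 0 < e / (2 * K * M) by apply: divr_gt0 => //; apply: mulr_gt0 => //; apply: mulr_gt0.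
  near=> o'.
  rewrite {1}dec /=.
  have -> : T (h o' - h o) - T (h o' - h o - (q o' - q o) *m A) -
     'd h o (o' - o) *m invmx A = T (h o' - h o - 'd h o (o' - o)) -
       T (h o' - h o - (q o' - q o) *m A).
    by rewrite addrAC -[X in _ - X - _]/(T _) -linearB.
  have E : `|h o' - h o - (q o' - q o) *m A| <= e / (2 * K * M) * `|q o' - q o|.
    by near: o'; exact: err.
  have H : `|h o' - h o - 'd h o (o' - o)| <= e / (2 * K) * `|o' - o|.
    by near: o'; exact: diff_bound.
  have L : `|q o' - q o| <= M * `|o' - o| by near: o'; exact: lip.
  rewrite (le_trans (ler_normB _ _))// (le_trans (lerD (HK _) (HK _)))//.
  rewrite -mulrDr mulrC -ler_pdivlMr// (le_trans (lerD H E))//.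
  have L' : e / (2 * K * M) * `|q o' - q o| <= e / (2 * K * M) * (M * `|o' - o|).
    by rewrite ler_pM2l.
  rewrite (le_trans (lerD (lexx _) L'))//.
  have K1 : K != 0 by rewrite gt_eqF.
  have M1 : M != 0 by rewrite gt_eqF.
  move: K1 M1; move: (`|o' - o|) (M) (K) (e) => x y z w; clear => *.
  by rewrite le_eqVlt; apply/orP; left; apply/eqP; field; apply/andP.
by move=> dq E; split; [exact: dq|exact: E].
Unshelve. all: by end_near. Qed.

(** Where the Jacobian of [G] is invertible, a continuous solution [q] of
    [G (q o) = h o] is smooth: continuity makes the linearised equation solvable
    at each point, so [q] is differentiable, and the formula for its
    differential then gives the higher derivatives by induction. *)
Lemma smooth_implicit (V : normedModType R) m (O : set V) (U : set 'rV[R]_m)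
    (q h : V -> 'rV[R]_m) (G : 'rV[R]_m -> 'rV[R]_m) :
  open O -> open U -> (forall o, O o -> U (q o)) ->
  (forall o, O o -> {for o, continuous q}) -> smooth U G ->
  (forall y, U y -> 'J G y \in unitmx) -> smooth O h ->
  (forall o, O o -> G (q o) = h o) -> smooth O q.
Proof.
move=> oO oU qU cq sG uG sh Gh.
have D o : O o -> differentiable q o /\
  'd q o = (fun v => 'd h o v *m invmx ('J G (q o))) :> (V -> _).
  move=> Oo; apply: differentiable_implicit; [exact: cq| | | |].
  - exact: smooth_differentiable sG (qU _ Oo).
  - exact: uG (qU _ Oo).
  - exact: smooth_differentiable sh Oo.
  - exact: filterS Gh (open_near oO Oo).
elim=> [//|k IH]; split=> [p Op|v]; first by have [] := D p Op.
have S : Ck k O (fun o => \row_j (\sum_i 'D_v h o 0 i * invmx ('J G (q o)) i j)).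
  apply: Ck_row => // j.
  apply: (Ck_ext oO _ (Ck_sum (index_enum 'I_m) oO (fun i => CkM oO
    (Ck_coord i oO (smooth_D v sh k)) (@Ck_comp _ _ _ k O U q
     (fun y => invmx ('J G y) i j) (has_coords_rV m) oO qU IH _)))).
    by move=> o _; rewrite mxE.
  move=> i; apply: smooth_invmx => // a b; exact: smooth_jacobian.
apply: Ck_ext S => // o Oo.
have [dq E] := D o Oo; rewrite (deriveE _ dq) E.
apply/rowP => j; rewrite !mxE; apply: eq_bigr => i _.
by rewrite deriveE//; exact: smooth_differentiable sh Oo.
Qed.

End ContinuousSolutions.

(** * Manifolds with smooth transition maps *)
Section ChainRule.
Context {R : realType} {U V W : normedModType R}.

(** The base point of [g] is kept as a variable [y], which spares the rewriting
    of base points inside differentials. *)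
Lemma diff_chain (f : U -> V) (g : V -> W) (h : U -> W) x y : f x = y ->
  (\forall z \near x, h z = g (f z)) ->
  differentiable f x -> differentiable g y ->
  differentiable h x /\ forall a, 'd h x a = 'd g y ('d f x a).
Proof.
move=> <- N df dg.
have [dh E] := near_eq_diff (filterS (fun y => @esym _ _ _) N) (differentiable_comp df dg).
by split=> // a; rewrite E -[RHS](congr1 (fun F : U -> W => F a) (diff_comp df dg)).
Qed.

Lemma diff_compE (f : U -> V) (g : V -> W) x a :
  differentiable f x -> differentiable g (f x) ->
  'd (g \o f) x a = 'd g (f x) ('d f x a).
Proof. by move=> df dg; rewrite -[RHS](congr1 (fun F : U -> W => F a) (diff_comp df dg)). Qed.

Lemma diff_linear_comp (f : U -> V) (L : {linear V -> W}) x a :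
  continuous L -> differentiable f x -> 'd (L \o f) x a = L ('d f x a).
Proof.
move=> Lc df; rewrite diff_compE//; last exact: linear_differentiable.
by rewrite diff_lin.
Qed.

End ChainRule.

Section RegularAtlas.
Context {R : realType} {n : nat}.
Implicit Types M : premanifold R n.

(** The part of [is_manifold] that concerns charts, common to [X] and to all
    the manifolds built from it. *)
Definition regular_atlas M : Prop :=
  (forall c, atlas M c ->
     [/\ dom c `<=` body M, {in dom c, cancel (coord c) (param c)}
       & open (cimg c setT)]) /\
  (forall c d, atlas M c -> atlas M d ->
     open (cimg c (dom d)) /\ smooth (cimg c (dom d)) (transition c d)).

Lemma manifold_regular M : is_manifold M -> regular_atlas M.
Proof. by case. Qed.

Variable M : premanifold R n.
Hypothesis hM : regular_atlas M.
Implicit Types (c d e : chart R (mpoint M) n) (x : mpoint M).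

Lemma paramK c x : atlas M c -> dom c x -> param c (coord c x) = x.
Proof. by move=> /hM.1[_ K _] dx; apply: K; exact: mem_set. Qed.

Lemma cimgP c A y : atlas M c -> cimg c A y ->
  [/\ A (param c y), dom c (param c y) & coord c (param c y) = y].
Proof. by move=> ac [x [Ax dx] <-]; rewrite paramK. Qed.

Lemma cimg_coord T (c : chart R T n) (A : set T) (x : T) : A x -> dom c x -> cimg c A (coord c x).
Proof. by exists x. Qed.

Lemma cimgT T (c : chart R T n) (A : set T) y : cimg c A y -> cimg c setT y.
Proof. by move=> [x [_ dx] <-]; exists x. Qed.

Lemma open_cimgT c : atlas M c -> open (cimg c setT).
Proof. by move=> /hM.1[]. Qed.

Lemma open_overlap c d : atlas M c -> atlas M d -> open (cimg c (dom d)).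
Proof. by move=> ac ad; have [] := hM.2 c d ac ad. Qed.

Lemma smooth_transition c d : atlas M c -> atlas M d ->
  smooth (cimg c (dom d)) (transition c d).
Proof. by move=> ac ad; have [] := hM.2 c d ac ad. Qed.

Lemma transitionE c d x : chart_at x c -> transition c d (coord c x) = coord d x.
Proof. by move=> [ac dx]; rewrite /transition/= paramK. Qed.

Lemma differentiable_transition c d x : chart_at x c -> chart_at x d ->
  differentiable (transition c d) (coord c x).
Proof.
move=> [ac cx] [ad dx]; apply: smooth_differentiable (smooth_transition ac ad) _.
exact: cimg_coord.
Qed.

Lemma near_transition c d e x : chart_at x c -> chart_at x d ->
  \forall y \near coord c x, transition c e y = transition d e (transition c d y).
Proof.
move=> [ac cx] [ad dx].
have /filterS := open_near (open_overlap ac ad) (cimg_coord dx cx); apply.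
move=> y /(cimgP ac)[dy cy _].
by rewrite /transition/= paramK.
Qed.

Lemma diff_transition_comp c d e x a : chart_at x c -> chart_at x d ->
  chart_at x e -> 'd (transition c e) (coord c x) a =
  'd (transition d e) (coord d x) ('d (transition c d) (coord c x) a).
Proof.
move=> hc hd he.
have dcd := differentiable_transition hc hd.
have dde := differentiable_transition hd he.
have [_ E] := @diff_chain _ _ _ _ (transition c d) (transition d e)
  (transition c e) _ _ (transitionE d hc) (near_transition e hc hd) dcd dde.
exact: E.
Qed.

Lemma diff_transition_id c x a : chart_at x c ->
  'd (transition c c) (coord c x) a = a.
Proof.
move=> [ac cx].
have N : \forall y \near coord c x, y = transition c c y.
  have /filterS := open_near (open_cimgT ac) (cimg_coord (I : setT x) cx); apply.
  by move=> y /(cimgP ac)[_ _ E].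
have [|_ ->] := near_eq_diff N; first exact: ex_diff.
have -> : 'd id (coord c x) = id :> (_ -> _); last by [].
have lin : linear (@id 'rV[R]_n) by [].
by apply: (@diff_lin _ _ _ (mk_linear lin)) => z; exact: cvg_id.
Qed.

Lemma vec_ofE c x a : chart_at x c -> vec_of c x a c = a.
Proof. by move=> hc; rewrite /vec_of asboolT// diff_transition_id. Qed.

Lemma tangent_vec_of c x a : chart_at x c -> tangent x (vec_of c x a).
Proof.
move=> hc; split.
- by case: hc => ac cx; have [H _ _] := hM.1 c ac; exact: H.
- move=> d e hd he; rewrite /vec_of !asboolT//; exact: diff_transition_comp.
- by move=> d hd; rewrite /vec_of asboolF.
Qed.

Lemma tangentE c x v : tangent x v -> chart_at x c -> v = vec_of c x (v c).
Proof.
move=> [_ H H0] hc; apply/funext => d; rewrite /vec_of; case: asboolP => hd.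
  exact: H.
exact: H0.
Qed.

Lemma tangent_eq c x v w : tangent x v -> tangent x w -> chart_at x c ->
  v c = w c -> v = w.
Proof. by move=> tv tw hc E; rewrite (tangentE tv hc) E -(tangentE tw hc). Qed.

Lemma tangentP x (k : R) v w : tangent x v -> tangent x w -> tangent x (k *: v + w).
Proof.
move=> [bx H H0] [_ G G0]; split=> //.
- move=> c d hc hd; have E b : (k *: v + w) b = k *: v b + w b by [].
  by rewrite !E linearP -(H c d)// -(G c d).
- move=> c hc; have -> : (k *: v + w) c = k *: v c + w c by [].
  by rewrite G0// H0// scaler0 addr0.
Qed.

Lemma tangentZ x (k : R) v : tangent x v -> tangent x (k *: v).
Proof.
move=> tv; have -> : k *: v = (k - 1) *: v + v by rewrite scalerBl scale1r subrK.
exact: tangentP.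
Qed.

Lemma tangentD x v w : tangent x v -> tangent x w -> tangent x (v + w).
Proof. by move=> tv tw; rewrite -[v]scale1r; exact: tangentP. Qed.

Lemma vec_ofP c x (k : R) a b : vec_of c x (k *: a + b) = k *: vec_of c x a + vec_of c x b.
Proof.
apply/funext => d.
have -> : (k *: vec_of c x a + vec_of c x b) d = k *: vec_of c x a d + vec_of c x b d.
  by [].
rewrite /vec_of; case: asboolP => _; first by rewrite linearP.
by rewrite scaler0 addr0.
Qed.

Lemma some_chartP x c : chart_at x c -> chart_at x (some_chart x).
Proof.
rewrite /some_chart; case: pselect => [h _|h hc]; last by case: h; exists c.
by case: (cid h).
Qed.

Section Parametrised.
Context {V : normedModType R}.
Implicit Types (O U : set V) (f : V -> mpoint M).

Lemma smooth_into_chart O f p c : smooth_into O f -> O p -> chart_at (f p) c ->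
  exists U, [/\ open U, U p, U `<=` O, (forall q, U q -> dom c (f q))
    & smooth U (coord c \o f)].
Proof.
move=> sf Op [ac cp]; have [d [[ad dp] [U [oU Up UO dU sU]]]] := sf p Op.
pose U' := U `&` (coord d \o f) @^-1` cimg d (dom c).
have oU' : open U'.
  rewrite openE => q [Uq Wq].
  apply: filterI; first exact: open_near.
  have cq := smooth_continuous sU Uq.
  apply: cq; exact: open_near (open_overlap ad ac) Wq.
have dU' q : U' q -> dom c (f q).
  by move=> [Uq /(cimgP ad)[+ _ _]]; rewrite paramK//; exact: dU.
exists U'; split=> //.
- by split=> //; exact: cimg_coord.
- by move=> q [/UO].
have S : smooth U' (transition d c \o (coord d \o f)).
  apply: (smooth_comp_row (has_coords_rV n) oU' _ (open_overlap ad ac)) => //.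
  - by move=> q [].
  - by apply: smooth_sub sU => q [].
  - exact: smooth_transition.
apply: smooth_ext S => // q [Uq _] /=.
by rewrite transitionE//; split=> //; exact: dU.
Qed.

Lemma smooth_into_sub O U f : open U -> U `<=` O -> smooth_into O f -> smooth_into U f.
Proof.
move=> oU UO sf p Up; have [d [hd [W [oW Wp WO dW sW]]]] := sf p (UO _ Up).
exists d; split=> //; exists (W `&` U); split.
- exact: openI.
- by split.
- by move=> q [_ Uq].
- by move=> q [/dW].
- by apply: smooth_sub sW => q [].
Qed.

Lemma smooth_into_ext O f g : open O -> (forall p, O p -> f p = g p) ->
  smooth_into O f -> smooth_into O g.
Proof.
move=> oO fg sf p Op; have [d [hd [W [oW Wp WO dW sW]]]] := sf p Op.
exists d; split; first by rewrite -fg.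
exists W; split=> //.
- by move=> q Wq; rewrite -fg; [exact: dW|exact: WO].
- by apply: smooth_ext sW => // q Wq /=; rewrite fg//; exact: WO.
Qed.

Lemma smooth_into_of_chart O f c : atlas M c -> open O ->
  (forall q, O q -> dom c (f q)) -> smooth O (coord c \o f) -> smooth_into O f.
Proof.
move=> ac oO dO sO p Op; exists c; split; first by split=> //; exact: dO.
by exists O; split.
Qed.

Lemma smooth_into_local O f :
  (forall p, O p -> exists U, [/\ open U, U p, U `<=` O & smooth_into U f]) ->
  smooth_into O f.
Proof.
move=> H p Op; have [U [oU Up UO sU]] := H p Op.
have [d [hd [W [oW Wp WO dW sW]]]] := sU p Up.
exists d; split=> //; exists W; split=> //.
by move=> q /WO/UO.
Qed.

Lemma smooth_into_mopen O f p A : smooth_into O f -> O p -> mopen A -> A (f p) ->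
  exists U, [/\ open U, U p, U `<=` O & forall q, U q -> A (f q)].
Proof.
move=> sf Op [_ oA] Ap; have [d [[ad dp] [U [oU Up UO dU sU]]]] := sf p Op.
pose U' := U `&` (coord d \o f) @^-1` cimg d A.
exists U'; split=> //.
- rewrite openE => q [Uq Wq].
  apply: filterI; first exact: open_near.
  have cq := smooth_continuous sU Uq.
  apply: cq; exact: open_near (oA d ad) Wq.
- by split=> //; exact: cimg_coord.
- by move=> q [/UO].
- by move=> q [Uq /(cimgP ad)[+ _ _]]; rewrite paramK//; exact: dU.
Qed.

Lemma near_coord_transition O f p c d : smooth_into O f -> O p ->
  chart_at (f p) c -> 
  \forall q \near p, coord d (f q) = transition c d (coord c (f q)).
Proof.
move=> sf Op hc; have [U [oU Up UO dU sU]] := smooth_into_chart sf Op hc.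
apply: filterS (open_near oU Up) => q Uq.
by rewrite transitionE//; split; [case: hc|exact: dU].
Qed.

Lemma differentiable_coord_into O f p c : smooth_into O f -> O p ->
  chart_at (f p) c -> differentiable (coord c \o f) p.
Proof.
move=> sf Op hc; have [U [oU Up UO dU sU]] := smooth_into_chart sf Op hc.
exact: smooth_differentiable sU Up.
Qed.

Lemma pushvecE f p w c : chart_at (f p) c -> pushvec f p w c = 'd (coord c \o f) p w.
Proof. by move=> hc; rewrite /pushvec asboolT. Qed.

Lemma pushvec_vec_of O f p w c : smooth_into O f -> O p -> chart_at (f p) c ->
  pushvec f p w = vec_of c (f p) ('d (coord c \o f) p w).
Proof.
move=> sf Op hc; apply/funext => d; rewrite /pushvec /vec_of.
case: asboolP => hd //.
have dc := differentiable_coord_into sf Op hc.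
have N := near_coord_transition d sf Op hc.
have dt : differentiable (transition c d) ((coord c \o f) p).
  exact: differentiable_transition.
have [_ E] := @diff_chain _ _ _ _ (coord c \o f) (transition c d) (coord d \o f) _ _ erefl N dc dt.
exact: E.
Qed.

Lemma tangent_pushvec O f p w : smooth_into O f -> O p -> tangent (f p) (pushvec f p w).
Proof.
move=> sf Op; have [d [hd _]] := sf p Op.
by rewrite (pushvec_vec_of w sf Op hd); exact: tangent_vec_of.
Qed.

Lemma pushvecP O f p (k : R) w w' : smooth_into O f -> O p ->
  pushvec f p (k *: w + w') = k *: pushvec f p w + pushvec f p w'.
Proof.
move=> sf Op; have [d [hd _]] := sf p Op.
by rewrite !(pushvec_vec_of _ sf Op hd) linearP vec_ofP.
Qed.

End Parametrised.

Lemma pushvec_comp {V V' : normedModType R} (O : set V) (f : V -> mpoint M)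
    (h : V' -> V) p w :
  smooth_into O f -> O (h p) -> differentiable h p ->
  pushvec (f \o h) p w = pushvec f (h p) ('d h p w).
Proof.
move=> sf Op dh; apply/funext => d; rewrite /pushvec/=; case: asboolP => // hd.
have dc := differentiable_coord_into sf Op hd.
have [_ E] := @diff_chain _ _ _ _ h (coord d \o f) (coord d \o (f \o h)) _ _
  erefl (nearW _ (fun y => erefl)) dh dc.
exact: E.
Qed.

Lemma smooth_into_comp {V : normedModType R} {m} (O : set V) (U : set 'rV[R]_m)
    (f : 'rV[R]_m -> mpoint M) (h : V -> 'rV[R]_m) :
  open O -> open U -> smooth_into U f -> smooth O h -> (forall p, O p -> U (h p)) ->
  smooth_into O (f \o h).
Proof.
move=> oO oU sf sh hU p Op.
have [d [[ad dp] [W [oW Wp WU dW sW]]]] := sf _ (hU _ Op).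
exists d; split=> //.
pose O' := O `&` h @^-1` W.
have oO' : open O'.
  rewrite openE => q [Oq Wq]; apply: filterI; first exact: open_near.
  have cq := smooth_continuous sh Oq.
  apply: cq; exact: open_near oW Wq.
exists O'; split=> //.
- by move=> q [].
- by move=> q [_ Wq]; exact: dW.
- apply: (@smooth_comp_row _ _ _ _ O' W h (coord d \o f)) => //.
  + exact: has_coords_rV.
  + by move=> q [].
  + by apply: smooth_sub sh => q [].
Qed.

End RegularAtlas.

(** * Smooth maps between manifolds *)
Section SmoothMaps.
Context {R : realType} {n m : nat} {M : premanifold R n} {N : premanifold R m}.
Hypotheses (hM : regular_atlas M) (hN : regular_atlas N).
Implicit Types (f : mpoint M -> mpoint N) (x : mpoint M)
  (c d : chart R (mpoint M) n).

(** Smoothness at a point is asked of the expression of [f] in one chart of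
    the source; the chain rule moves it to the others. *)
Definition smooth_at f x : Prop :=
  exists c U, [/\ chart_at x c, open U, U (coord c x), U `<=` cimg c setT
    & smooth_into (M := N) U (f \o param c)].

Lemma smooth_at_chart f x c : chart_at x c -> smooth_at f x ->
  exists U, [/\ open U, U (coord c x), U `<=` cimg c setT
    & smooth_into (M := N) U (f \o param c)].
Proof.
move=> [ac cx] [d [U [[ad dx] oU Ux UT sU]]].
pose W := cimg c (dom d) `&` (transition c d) @^-1` U.
have oW : open W.
  rewrite openE => q [Wq Uq]; apply: filterI.
    exact: open_near (open_overlap hM ac ad) Wq.
  apply: (smooth_continuous (smooth_transition hM ac ad) Wq).
  exact: open_near oU Uq.
exists W; split=> //.
- split; first exact: cimg_coord.
  by rewrite /preimage/= transitionE.
- by move=> y [/cimgT].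
have S := @smooth_into_comp _ _ N _ _ W U (f \o param d) (transition c d) oW oU sU.
apply: smooth_into_ext oW _ (S _ _).
- move=> q [/(cimgP hM ac)[dq _ _] _] /=.
  by rewrite /transition/= (paramK hM).
- apply: smooth_sub (smooth_transition hM ac ad); by move=> q [].
- by move=> q [].
Qed.

Lemma near_map_chart {V : normedModType R} (O : set V) (h : V -> mpoint M) f p c :
  smooth_into O h -> O p -> chart_at (h p) c ->
  \forall q \near p, (f \o h) q = (f \o param c) (coord c (h q)).
Proof.
move=> sh Op hc; have [U [oU Up UO dU sU]] := smooth_into_chart hM sh Op hc.
apply: filterS (open_near oU Up) => q Uq /=.
by rewrite (paramK hM)//; [case: hc|exact: dU].
Qed.

Lemma pushvec_map_chart {V : normedModType R} (O : set V) (h : V -> mpoint M) f p w c :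
  smooth_into O h -> O p -> chart_at (h p) c -> smooth_at f (h p) ->
  pushvec (M := N) (f \o h) p w =
  pushvec (M := N) (f \o param c) (coord c (h p)) ('d (coord c \o h) p w).
Proof.
move=> sh Op hc sf; have [U [oU Ux UT sU]] := smooth_at_chart hc sf.
apply/funext => d; rewrite /pushvec/= (paramK hM); [|by case: hc|by case: hc].
case: asboolP => // hd.
have dh := differentiable_coord_into hM sh Op hc.
have hd' : chart_at ((f \o param c) (coord c (h p))) d.
  by rewrite /= (paramK hM); [|by case: hc|by case: hc].
have df := differentiable_coord_into hN sU Ux hd'.
have Nr : \forall q \near p, (coord d \o (f \o h)) q =
    (coord d \o (f \o param c)) ((coord c \o h) q).
  by apply: filterS (near_map_chart f sh Op hc) => q /= ->.
have [_ E] := @diff_chain _ _ _ _ (coord c \o h) (coord d \o (f \o param c))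
  (coord d \o (f \o h)) _ _ erefl Nr dh df.
exact: E.
Qed.

Lemma smooth_into_param c : atlas M c -> smooth_into (M := M) (cimg c setT) (param c).
Proof.
move=> ac; apply: (smooth_into_of_chart ac); first exact: open_cimgT.
  by move=> q /(cimgP hM ac)[].
apply: smooth_ext (smooth_id _); first exact: open_cimgT.
by move=> q /(cimgP hM ac)[_ _ /= ->].
Qed.

Lemma pushvec_param c y a : atlas M c -> cimg c setT y ->
  pushvec (M := M) (param c) y a = vec_of c (param c y) a.
Proof.
move=> ac Uy; have [_ dy E] := cimgP hM ac Uy.
apply/funext => d; rewrite /pushvec /vec_of E; case: asboolP => hd; last by [].
reflexivity.
Qed.

Lemma dmapE f x v c : tangent x v -> chart_at x c -> smooth_at f x ->
  dmap (N := N) f x v = pushvec (M := N) (f \o param c) (coord c x) (v c).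
Proof.
move=> tv hc sf; rewrite /dmap; have hs := some_chartP hc.
set s := some_chart x in hs *; have [as_ sx] := hs; have [ac cx] := hc.
have E : param s (coord s x) = x by rewrite (paramK hM).
have hc' : chart_at (param s (coord s x)) c by rewrite E.
have sf' : smooth_at f (param s (coord s x)) by rewrite E.
have Ux : cimg s setT (coord s x) by exists x.
rewrite (pushvec_map_chart (v s) (smooth_into_param as_) Ux hc' sf') E.
congr (pushvec _ _ _).
by have [_ H _] := tv; rewrite (H s c hs hc).
Qed.

(** Functoriality of the differential, which does not depend on the chart
    chosen in [dmap]. *)
Lemma dmap_pushvec {V : normedModType R} (O : set V) (h : V -> mpoint M) f p w :
  smooth_into O h -> O p -> smooth_at f (h p) ->
  dmap (N := N) f (h p) (pushvec h p w) = pushvec (M := N) (f \o h) p w.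
Proof.
move=> sh Op sf; have [c [hc _]] := sh p Op.
rewrite (dmapE (tangent_pushvec hM w sh Op) hc sf) (pushvec_map_chart w sh Op hc sf).
by rewrite pushvecE.
Qed.

Lemma smooth_into_map {V : normedModType R} (O : set V) (h : V -> mpoint M) f :
  open O -> smooth_into O h -> (forall p, O p -> smooth_at f (h p)) ->
  smooth_into (M := N) O (f \o h).
Proof.
move=> oO sh sf; apply: smooth_into_local => p Op.
have [c [hc _]] := sh p Op.
have [U [oU Up UO dU sU]] := smooth_into_chart hM sh Op hc.
have [W [oW Wp WT sW]] := smooth_at_chart hc (sf p Op).
pose U' := U `&` (coord c \o h) @^-1` W.
have oU' : open U'.
  rewrite openE => q [Uq Wq]; apply: filterI; first exact: open_near.
  apply: (smooth_continuous sU Uq); exact: open_near oW Wq.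
exists U'; split=> //; first by move=> q [/UO].
have S := @smooth_into_comp _ _ N _ _ U' W (f \o param c) (coord c \o h) oU' oW sW.
apply: smooth_into_ext oU' _ (S _ _).
- by move=> q [Uq _] /=; rewrite (paramK hM)//; [case: hc|exact: dU].
- by apply: smooth_sub sU => q [].
- by move=> q [].
Qed.

Lemma tangent_dmap f x v : tangent x v -> smooth_at f x -> tangent (f x) (dmap (N := N) f x v).
Proof.
move=> tv sf; have [c [_ [hc _ _ _ _]]] := sf.
have [U [oU Ux UT sU]] := smooth_at_chart hc sf.
rewrite (dmapE tv hc sf).
have := tangent_pushvec hN (v c) sU Ux.
by rewrite /= (paramK hM); [|by case: hc|by case: hc].
Qed.

Lemma dmapP f x (k : R) v w : smooth_at f x -> tangent x v -> tangent x w ->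
  dmap (N := N) f x (k *: v + w) = k *: dmap (N := N) f x v + dmap (N := N) f x w.
Proof.
move=> sf tv tw; have [c [_ [hc _ _ _ _]]] := sf.
have [U [oU Ux UT sU]] := smooth_at_chart hc sf.
rewrite (dmapE (tangentP k tv tw) hc sf) (dmapE tv hc sf) (dmapE tw hc sf).
exact: (pushvecP hN k (v c) (w c) sU Ux).
Qed.

End SmoothMaps.

(** * Tangent bundle and product with a line *)
Section Blocks.
Context {R : realType} {n m : nat}.

Lemma lsubmx_linear : linear (@lsubmx R 1 n m).
Proof. by move=> k u v; rewrite linearP. Qed.

Lemma continuous_lsubmx : continuous (@lsubmx R 1 n m : 'rV_(n + m) -> 'rV_n).
Proof. exact: (@linear_rV_continuous R _ _ (mk_linear lsubmx_linear)). Qed.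

Lemma smooth_lsubmx (O : set 'rV[R]_(n + m)) : smooth O (@lsubmx R 1 n m : 'rV_(n + m) -> 'rV_n).
Proof.
by apply: (@smooth_lin R _ _ O (mk_linear lsubmx_linear)); exact: continuous_lsubmx.
Qed.

Lemma rsubmx_linear : linear (@rsubmx R 1 n m).
Proof. by move=> k u v; rewrite linearP. Qed.

Lemma continuous_rsubmx : continuous (@rsubmx R 1 n m : 'rV_(n + m) -> 'rV_m).
Proof. exact: (@linear_rV_continuous R _ _ (mk_linear rsubmx_linear)). Qed.

Lemma smooth_rsubmx (O : set 'rV[R]_(n + m)) : smooth O (@rsubmx R 1 n m : 'rV_(n + m) -> 'rV_m).
Proof.
by apply: (@smooth_lin R _ _ O (mk_linear rsubmx_linear)); exact: continuous_rsubmx.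
Qed.

Lemma smooth_row_mx (V : normedModType R) (O : set V) (f : V -> 'rV[R]_n)
    (g : V -> 'rV[R]_m) : open O -> smooth O f -> smooth O g ->
  smooth O (fun x => row_mx (f x) (g x)).
Proof.
move=> oO sf sg; apply: smooth_row => // i.
case: (split_ordP i) => j ->.
  by apply: smooth_ext (smooth_coord j oO sf) => // x _; rewrite row_mxEl.
by apply: smooth_ext (smooth_coord j oO sg) => // x _; rewrite row_mxEr.
Qed.

End Blocks.

Section TangentBundle.
Context {R : realType} {n : nat} {M : premanifold R n}.
Hypothesis hM : regular_atlas M.

Lemma cimg_tangent_chart c (A : set (mpoint M)) : atlas M c ->
  cimg (tangent_chart c) [set u : mpoint M * tfam M | A u.1] =
  [set z | cimg c A (lsubmx z)].
Proof.
move=> ac; apply/seteqP; split=> z.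
  by move=> [[x v] [/= Ax [cx tv]] <-]; rewrite row_mxKl; exists x.
move=> [x [Ax cx] E]; exists (x, vec_of c x (rsubmx z)).
  by split=> //; split=> //=; exact: (tangent_vec_of hM).
by rewrite /= vec_ofE// E hsubmxK.
Qed.

(** In the charts of the tangent bundle the transition maps are a transition
    map of [M] together with its differential. *)
Lemma regular_tangent_bundle : regular_atlas (tangent_bundle M).
Proof.
have C c : atlas M c -> {in dom (tangent_chart c), cancel (coord (tangent_chart c)) (param (tangent_chart c))}.
  move=> ac [x v] /set_mem[/= cx tv]; rewrite row_mxKl row_mxKr.
  by rewrite (paramK hM)// -(tangentE tv).
split.
  move=> _ [c ac <-]; split.
  - by move=> u [].
  - exact: C.
  - rewrite (_ : setT = [set u | setT u.1])// cimg_tangent_chart//.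
    by have /continuousP := @continuous_lsubmx R n n; apply; exact: open_cimgT.
move=> _ _ [c ac <-] [d ad <-].
have E : cimg (tangent_chart c) (dom (tangent_chart d)) = [set z | cimg c (dom d) (lsubmx z)].
  rewrite -cimg_tangent_chart//; apply/seteqP; split=> z [u [Hu du] <-].
    by exists u; [split; [case: Hu|exact: du]|reflexivity].
  by exists u; [split; [split; [exact: Hu|case: du]|exact: du]|reflexivity].
have oE : open [set z : 'rV[R]_(n + n) | cimg c (dom d) (lsubmx z)].
  by have /continuousP := @continuous_lsubmx R n n; apply; exact: open_overlap.
rewrite E; split=> //.
have S : smooth [set z : 'rV[R]_(n + n) | cimg c (dom d) (lsubmx z)]
   (fun z => row_mx (transition c d (lsubmx z))
     ('d (transition c d) (lsubmx z) (rsubmx z))).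
  apply: smooth_row_mx => //.
    apply: (smooth_comp_row (has_coords_rV n) oE _ (open_overlap hM ac ad)) => //.
      exact: smooth_lsubmx.
    exact: smooth_transition.
  apply: (smooth_diff oE (open_overlap hM ac ad)) => //.
  - exact: smooth_transition.
  - exact: smooth_lsubmx.
  - exact: smooth_rsubmx.
apply: smooth_ext S => // z /(cimgP hM ac)[dz cz Ez].
rewrite /transition/= /vec_of asboolT; last by split.
by rewrite Ez.
Qed.

End TangentBundle.

Section TimesLine.
Context {R : realType} {n : nat} {M : premanifold R n}.
Hypothesis hM : regular_atlas M.

Lemma cimg_line_chart c (A : set (mpoint M)) : atlas M c ->
  cimg (line_chart c) [set u : mpoint M * R | A u.1] =
  [set z | cimg c A (lsubmx z)].
Proof.
move=> ac; apply/seteqP; split=> z.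
  by move=> [[x v] [/= Ax cx] <-]; rewrite row_mxKl; exists x.
move=> [x [Ax cx] E]; exists (x, rsubmx z 0 0); first by split.
rewrite /= E -[RHS]hsubmxK; congr row_mx.
by apply/rowP => i; rewrite !mxE !ord1.
Qed.

Lemma regular_times_line : regular_atlas (times_line M).
Proof.
split.
  move=> _ [c ac <-]; split.
  - by move=> u /= cu; have [H _ _] := hM.1 c ac; exact: H.
  - move=> [x v] /set_mem/= cx; rewrite row_mxKl row_mxKr.
    by rewrite (paramK hM)// mxE.
  - rewrite (_ : setT = [set u | setT u.1])// cimg_line_chart//.
    by have /continuousP := @continuous_lsubmx R n 1; apply; exact: open_cimgT.
move=> _ _ [c ac <-] [d ad <-].
have E : cimg (line_chart c) (dom (line_chart d)) = [set z | cimg c (dom d) (lsubmx z)].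
  by rewrite -cimg_line_chart.
have oE : open [set z : 'rV[R]_(n + 1) | cimg c (dom d) (lsubmx z)].
  by have /continuousP := @continuous_lsubmx R n 1; apply; exact: open_overlap.
rewrite E; split=> //.
have S : smooth [set z : 'rV[R]_(n + 1) | cimg c (dom d) (lsubmx z)]
   (fun z => row_mx (transition c d (lsubmx z)) (rsubmx z)).
  apply: smooth_row_mx => //; last exact: smooth_rsubmx.
  apply: (smooth_comp_row (has_coords_rV n) oE _ (open_overlap hM ac ad)) => //.
    exact: smooth_lsubmx.
  exact: smooth_transition.
apply: smooth_ext S => // z _.
rewrite /transition/=; congr row_mx.
by apply/rowP => i; rewrite !mxE !ord1.
Qed.

End TimesLine.

(** * Embedded submanifolds *)
Lemma open_preimage_on {V T : topologicalType} (O : set V) (g : V -> T) (W : set T) :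
  open O -> open W -> (forall x, O x -> {for x, continuous g}) ->
  open (O `&` g @^-1` W).
Proof.
move=> oO oW cg; rewrite openE => x [Ox Wx]; apply: filterI.
  exact: open_nbhs_nbhs.
by apply: (cg x Ox); exact: open_nbhs_nbhs.
Qed.

Section Submanifold.
Context {R : realType} {n m : nat} {N : premanifold R n}.
Variable S : set (mpoint N).
Hypothesis hN : regular_atlas N.
Implicit Types d : chart R (mpoint N) m.

Lemma sub_cimgP d y : submanifold_chart S d -> cimg d setT y ->
  [/\ dom d (param d y), S (param d y) & coord d (param d y) = y].
Proof.
move=> [DS K _ _ _] [x [_ dx] <-].
by rewrite K ?mem_set//; split=> //; exact: DS.
Qed.

Lemma sub_paramK d x : submanifold_chart S d -> dom d x -> param d (coord d x) = x.
Proof. by move=> [_ K _ _ _] dx; rewrite K ?mem_set. Qed.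

(** A smooth map into the ambient manifold with values in [S] is smooth in the
    charts of [S]: a chart of [S] is a homeomorphism, so the coordinate
    expression is continuous, and a left inverse of the immersion turns it into
    a continuous solution of a smooth equation. *)
Lemma smooth_lift {V : normedModType R} (O : set V) (f : V -> mpoint N) p d :
  smooth_into O f -> (forall q, O q -> S (f q)) -> O p ->
  submanifold_chart S d -> dom d (f p) ->
  exists U, [/\ open U, U p, U `<=` O, (forall q, U q -> dom d (f q))
    & smooth U (coord d \o f)].
Proof.
move=> sf fS Op hd dp; have [DS K [oB sB] imm homeo] := hd.
set y0 := coord d (f p); have E0 : param d y0 = f p by exact: sub_paramK.
have By0 : cimg d setT y0 by exists (f p).
have [k [hk _]] := sf p Op.
have hk0 : chart_at (param d y0) k by rewrite E0.
have [W [oW Wy0 WB dW sW]] := smooth_into_chart hN sB By0 hk0.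
set P := coord k \o param d in sW.
have dP := smooth_differentiable sW Wy0.
have /row_freeP[L JL] : row_free ('J P y0).
  apply: inj_row_free => v Jv; apply: (imm y0 v By0).
  rewrite (pushvec_vec_of hN v sB By0 hk0).
  have -> : 'd (coord k \o param d) y0 v = 0 by rewrite jacobianE.
  have := vec_ofP k (param d y0) (- 1) 0 0.
  by rewrite scaler0 addr0 scaleN1r addNr.
pose TL : {linear 'rV[R]_n -> 'rV[R]_m} := mulmxr L.
have TLc : continuous TL by exact: linear_rV_continuous.
(* [G] has invertible Jacobian near [y0], and [G \o (coord d \o f)] is the smooth map [TL \o (coord k \o f)] *)
pose G := TL \o P.
have sG : smooth W G.
  apply: (@smooth_comp_row _ _ _ _ W setT P TL) => //; first exact: has_coords_rV.
    exact: openT.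
  exact: smooth_lin.
have dG y : W y -> forall a, 'd G y a = 'd P y a *m L.
  move=> Wy a; rewrite [LHS](diff_linear_comp a TLc)//.
  exact: smooth_differentiable sW Wy.
have JG : 'J G y0 = 1%:M.
  apply/row_matrixP => i; rewrite !rowE -jacobianE dG// jacobianE -mulmxA JL.
  by rewrite !mulmx1.
pose W' := W `&` [set y | \det ('J G y) != 0].
have sdet : smooth W (fun y => \det ('J G y)).
  by apply: smooth_det => // i j; exact: smooth_jacobian.
have oW' : open W'.
  apply: (@open_preimage_on _ _ W _ [set z : R | z != 0] oW); first exact: open_neq.
  by move=> y Wy; exact: smooth_continuous sdet Wy.
have W'y0 : W' y0 by split=> //=; rewrite JG det1 oner_neq0.
have W'B : W' `<=` cimg d setT by move=> y [/WB].
(* the part of [S] charted by a given open set is cut out by an open set *)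
have cut A : open A -> A `<=` cimg d setT -> forall q, O q -> dom d (f q) ->
    A (coord d (f q)) -> exists U, [/\ open U, U q, U `<=` O &
      forall q', U q' -> dom d (f q') /\ A (coord d (f q'))].
  move=> oA AB q Oq dq Aq; have [W3 [oW3 E3]] := homeo A oA AB.
  have W3q : W3 (f q).
    suff [] : (S `&` W3) (f q) by [].
    by rewrite -E3; exists (coord d (f q)) => //; exact: sub_paramK.
  have [U [oU Uq UO HU]] := smooth_into_mopen hN sf Oq oW3 W3q.
  exists U; split=> // q' Uq'.
  have : (param d @` A) (f q') by rewrite E3; split; [exact/fS/UO|exact: HU].
  move=> [y Ay <-]; have [dy _ ->] := sub_cimgP hd (AB _ Ay).
  by split.
have [U1 [oU1 U1p U1O HU1]] := cut W' oW' W'B p Op dp W'y0.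
have [U2 [oU2 U2p U2O dU2 sU2]] := smooth_into_chart hN sf Op hk.
pose U := U1 `&` U2.
have oU : open U by exact: openI.
have sh : smooth U (TL \o (coord k \o f)).
  apply: (@smooth_comp_row _ _ _ _ U setT (coord k \o f) TL) => //.
  - exact: has_coords_rV.
  - exact: openT.
  - by apply: smooth_sub sU2 => q [].
  - exact: smooth_lin.
exists U; split=> //.
- by move=> q [/U1O].
- by move=> q [/HU1[]].
apply: (@smooth_implicit R V m U W' (coord d \o f) _ G oU oW' _ _ _ _ sh).
- by move=> q [/HU1[]].
- move=> q [U1q U2q]; have [dq W'q] := HU1 q U1q.
  move=> B; rewrite /= nbhsE => -[B' [oB' B'q] B'B].
  have oB'W : open (B' `&` W') by exact: openI.
  have sub : B' `&` W' `<=` cimg d setT by move=> y [_ /W'B].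
  have [U3 [oU3 U3q U3O HU3]] := cut _ oB'W sub q (U1O _ U1q) dq (conj B'q W'q).
  apply: filterS (open_near oU3 U3q) => q' /HU3[_ [B'q' _]].
  exact: B'B.
- by apply: smooth_sub sG => y [].
- by move=> y [_ /= dy]; rewrite unitmxE unitfE.
- move=> q [/HU1[dq _] _].
  by rewrite /G /P /= (sub_paramK hd dq).
Qed.

(** A transition map of [S] is the parametrisation of one chart seen in the
    other, to which [smooth_lift] applies. *)
Lemma regular_submanifold : regular_atlas (submanifold S m).
Proof.
split.
  by move=> d [DS K [oB sB] imm homeo]; split.
move=> c d hc hd; have [DS K [oB sB] imm homeo] := hc.
have H y : cimg c (dom d) y -> exists U, [/\ open U, U y, U `<=` cimg c (dom d)
    & smooth U (transition c d)].
  move=> [x [dx cx] <-].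
  have Bx : cimg c setT (coord c x) by exists x.
  have BS q : cimg c setT q -> S (param c q) by move=> /(sub_cimgP hc)[].
  have dpx : dom d (param c (coord c x)) by rewrite (sub_paramK hc).
  have [U [oU Ux UB dU sU]] := smooth_lift sB BS Bx hd dpx.
  exists U; split=> // q Uq; have [cq _ Eq] := sub_cimgP hc (UB _ Uq).
  by exists (param c q) => //; split=> //; exact: dU.
split.
  rewrite openE => y /H[U [oU Uy UC _]]; apply: filterS (open_near oU Uy).
  exact: UC.
by apply: smooth_local => y /H[U [oU Uy _ sU]]; exists U.
Qed.

End Submanifold.

(** * The indicatrix bundle *)
Section RowDifferential.
Context {R : realType}.

Lemma diff_row_mx (V : normedModType R) n m (f : V -> 'rV[R]_n) (g : V -> 'rV[R]_m) x a :
  differentiable (fun y => row_mx (f y) (g y)) x ->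
  'd (fun y => row_mx (f y) (g y)) x a = row_mx ('d f x a) ('d g x a).
Proof.
move=> dh; rewrite -[LHS]hsubmxK; congr row_mx.
  rewrite -[LHS](diff_linear_comp (L := mk_linear (@lsubmx_linear R n m)) a _ dh).
    by have -> : mk_linear (@lsubmx_linear R n m) \o (fun y => row_mx (f y) (g y)) = f
      by apply/funext => y; rewrite /= row_mxKl.
  exact: continuous_lsubmx.
rewrite -[LHS](diff_linear_comp (L := mk_linear (@rsubmx_linear R n m)) a _ dh).
  by have -> : mk_linear (@rsubmx_linear R n m) \o (fun y => row_mx (f y) (g y)) = g
    by apply/funext => y; rewrite /= row_mxKr.
exact: continuous_rsubmx.
Qed.

Lemma vec_of0 n (M : premanifold R n) (c : chart R (mpoint M) n) (x : mpoint M) :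
  vec_of (M := M) c x 0 = 0.
Proof.
have := vec_ofP c x (- 1) 0 0.
by rewrite scaler0 addr0 scaleN1r addNr.
Qed.

End RowDifferential.

Section FrameCoefficients.
Context {R : realType}.

(** A right inverse [L] of the matrix with rows [v1 p], [v2 p] gives two
    linear functionals that form with [v1], [v2] an invertible 2 by 2 system
    near [p]; Cramer's rule solves it. *)
Lemma smooth_frame_coeff (V : normedModType R) n (O : set V)
    (v1 v2 v : V -> 'rV[R]_n) p : open O -> smooth O v1 -> smooth O v2 ->
  smooth O v -> O p ->
  (forall a b : R, a *: v1 p + b *: v2 p = 0 -> a = 0 /\ b = 0) ->
  (forall q, O q -> exists a b : R, v q = a *: v1 q + b *: v2 q) ->
  exists (U : set V) (a b : V -> R), [/\ open U, U p, U `<=` O,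
    smooth U a /\ smooth U b & forall q, U q -> v q = a q *: v1 q + b q *: v2 q].
Proof.
move=> oO s1 s2 sv Op ind span.
have /row_freeP[L JL] : row_free (col_mx (v1 p) (v2 p)).
  apply: inj_row_free => w; rewrite -[w]hsubmxK mul_row_col.
  rewrite [lsubmx w]mx11_scalar [rsubmx w]mx11_scalar !mul_scalar_mx => /ind[-> ->].
  by rewrite -row_mx0; congr row_mx; apply/matrixP => i j; rewrite !mxE mul0rn.
pose l (w : 'rV[R]_n) (j : 'I_(1 + 1)) := (w *m L) 0 j.
have lP w w' a b j : l (a *: w + b *: w') j = a * l w j + b * l w' j.
  by rewrite /l mulmxDl -!scalemxAl !mxE.
have sl w j : smooth O w -> smooth O (fun q => l (w q) j).
  move=> sw; apply: smooth_coord => //; apply: smooth_mulmx => // i k.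
  exact: smooth_cst.
pose i0 : 'I_(1 + 1) := lshift 1 0; pose i1 : 'I_(1 + 1) := rshift 1 0.
pose dt q := l (v1 q) i0 * l (v2 q) i1 - l (v1 q) i1 * l (v2 q) i0.
have sdt : smooth O dt by apply: smoothB => //; apply: smoothM => //; exact: sl.
have dtp : dt p = 1.
  have E1 j : l (v1 p) j = (i0 == j)%:R.
    have := congr1 (fun M : 'M[R]_(1 + 1) => M i0 j) JL.
    by rewrite mul_col_mx col_mxEu [in RHS]mxE.
  have E2 j : l (v2 p) j = (i1 == j)%:R.
    have := congr1 (fun M : 'M[R]_(1 + 1) => M i1 j) JL.
    by rewrite mul_col_mx col_mxEd [in RHS]mxE.
  by rewrite /dt !E1 !E2 /= mulr1 mulr0 subr0.
pose U := O `&` dt @^-1` [set z : R | z != 0].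
have oU : open U.
  apply: (@open_preimage_on _ _ O dt [set z : R | z != 0] oO); first exact: open_neq.
  by move=> q Oq; exact: smooth_continuous sdt Oq.
have UO : U `<=` O by move=> q [].
exists U, (fun q => (l (v q) i0 * l (v2 q) i1 - l (v q) i1 * l (v2 q) i0) * (dt q)^-1),
  (fun q => (l (v1 q) i0 * l (v q) i1 - l (v1 q) i1 * l (v q) i0) * (dt q)^-1).
split=> //.
- by split=> //=; rewrite /preimage/= dtp oner_neq0.
- have sV : smooth U (fun q => (dt q)^-1).
    by apply: smoothV => //; [move=> q []|apply: smooth_sub sdt].
  have S w w' i j : smooth O w -> smooth O w' ->
      smooth U (fun q => l (w q) i * l (w' q) j - l (w q) j * l (w' q) i).
    move=> sw sw'; apply: (smooth_sub UO); apply: smoothB => //.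
      by apply: smoothM => //; exact: sl.
    by apply: smoothM => //; exact: sl.
  by split; apply: smoothM => //; exact: S.
- move=> q [Oq dq]; have [a [b E]] := span q Oq.
  rewrite [LHS]E E !lP /dt in dq *.
  move: dq; rewrite /preimage/=.
  move: (l (v1 q) i0) (l (v1 q) i1) (l (v2 q) i0) (l (v2 q) i1) => x y z w dq.
  by congr (_ *: _ + _ *: _); field.
Qed.

End FrameCoefficients.

Section Indicatrix.
Context {R : realType} {X : premanifold R 3}.
Variables (D : mpoint X -> set (tfam X)) (F : mpoint X -> tfam X -> R).
Hypothesis hX : regular_atlas X.
Hypotheses (D_contact : contact D) (F_sub_Finsler : sub_Finsler D F).

Local Notation TX := (tangent_bundle X).
Local Notation Sigma := (indicatrix D F).

Let hTX : regular_atlas TX := regular_tangent_bundle hX.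

Lemma regular_indicatrix : regular_atlas Sigma.
Proof. exact: regular_submanifold hTX. Qed.
Let hS := regular_indicatrix.

Lemma bodyX_chart x c : chart_at (M := X) x c -> body X x.
Proof. by move=> [ac cx]; have [H _ _] := hX.1 c ac; exact: H. Qed.

Lemma smooth_at_fst (u : mpoint TX) c : chart_at u.1 c -> tangent u.1 u.2 ->
  @smooth_at R 6 3 TX X fst u.
Proof.
move=> [ac cu] tu.
have atc : atlas TX (tangent_chart c) by exists c.
exists (tangent_chart c), (cimg (tangent_chart c) setT); split=> //.
- exact: (open_cimgT hTX).
- by exists u.
have oT := open_cimgT hTX atc.
apply: (smooth_into_of_chart ac oT).
  by move=> z /(cimgP hTX atc)[_ []].
apply: (smooth_ext oT _ (@smooth_lsubmx R 3 3 _)) => z /(cimgP hTX atc)[_ _] /= E.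
by rewrite -[in LHS]E /= row_mxKl.
Qed.

Lemma tangent_in_D x v : body X x -> D x v -> tangent x v.
Proof.
move=> bx Dv.
have [A [v1 [v2 [Ax [_ [t1 _] [t2 _] span _]]]]] := D_contact.1 x bx.
have [/(_ Dv)[a [b ->]] _] := span x Ax v.
by apply: tangentD; apply: tangentZ; [exact: t1|exact: t2].
Qed.

Lemma indicatrix_point u d : chart_at (M := Sigma) u d ->
  [/\ body X u.1, D u.1 u.2, F u.1 u.2 = 1 & tangent u.1 u.2].
Proof.
move=> [ad du]; have [H _ _] := hS.1 d ad.
have [bu Du Fu] := H u du; split=> //.
exact: tangent_in_D.
Qed.

(** The inclusion of the indicatrix bundle in the tangent bundle is a smooth
    immersion; this is the form in which its charts are used. *)
Lemma indicatrix_chart u d : chart_at (M := Sigma) u d ->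
  exists (c : chart R (mpoint X) 3) (W : set 'rV[R]_4),
    [/\ chart_at u.1 c, open W /\ W (coord d u), W `<=` cimg d setT,
       (forall y, W y -> dom c (param d y).1)
     & [/\ smooth W (fun y => coord c (param d y).1),
         smooth W (fun y => (param d y).2 c)
       & forall a, 'd (fun y => coord c (param d y).1) (coord d u) a = 0 ->
           'd (fun y => (param d y).2 c) (coord d u) a = 0 -> a = 0]].
Proof.
move=> hd; have [ad du] := hd; have [_ K [oB sB] imm _] := ad.
have By : cimg d setT (coord d u) by exists u.
have E0 : param d (coord d u) = u by rewrite (paramK hS).
have [_ [[[c ac <-] dk] _]] := sB _ By.
rewrite E0 in dk; have [cu tu] := dk.
have hk : chart_at (M := TX) (param d (coord d u)) (tangent_chart c).
  by rewrite E0; split; [exists c|].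
have [W [oW Wy WB dW sW]] := smooth_into_chart hTX sB By hk.
have s1 : smooth W (fun y => coord c (param d y).1).
  apply: smooth_ext oW _ (@smooth_comp_row R _ _ 3 W setT _ (@lsubmx R 1 3 3)
   (has_coords_rV 6) oW _ openT sW (@smooth_lsubmx R 3 3 _)) => // y Wy'.
  by rewrite /= row_mxKl.
have s2 : smooth W (fun y => (param d y).2 c).
  apply: smooth_ext oW _ (@smooth_comp_row R _ _ 3 W setT _ (@rsubmx R 1 3 3)
   (has_coords_rV 6) oW _ openT sW (@smooth_rsubmx R 3 3 _)) => // y Wy'.
  by rewrite /= row_mxKr.
exists c, W; split=> //.
  by move=> y /dW[].
split=> // a a1 a2; apply: (imm _ a By).
rewrite (pushvec_vec_of hTX a sB By hk).
rewrite [X in vec_of _ _ X](_ : _ = 0); first exact: vec_of0.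
have dc : differentiable (fun y => row_mx (coord c (param d y).1) ((param d y).2 c)) (coord d u).
  exact: smooth_differentiable sW Wy.
have E := diff_row_mx a dc.
have E' := congr2 (fun p q : 'rV[R]_3 => row_mx p q) a1 a2.
exact: etrans E (etrans E' (row_mx0 _ _ _ _)).
Qed.

Lemma smooth_at_basepoint u d : chart_at (M := Sigma) u d ->
  @smooth_at R 4 3 Sigma X (@basepoint R X D F) u.
Proof.
move=> hd; have [ad du] := hd; have [_ K [oB sB] _ _] := ad.
exists d, (cimg d setT); split=> //; first by exists u.
have S := @smooth_into_map R 6 3 TX X hTX _ _ (param d) fst oB sB.
apply: S => y By.
have [_ [[[c ac <-] [cu tu]] _]] := sB _ By.
exact: (@smooth_at_fst _ c).
Qed.

Lemma local_frame_smooth A v1 v2 c : local_frame D A v1 v2 -> atlas X c ->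
  smooth (cimg c A) (fun y => v1 (param c y) c) /\
  smooth (cimg c A) (fun y => v2 (param c y) c).
Proof. by move=> [_ [_ s1] [_ s2] _ _] ac; split; [exact: s1|exact: s2]. Qed.

Lemma local_frame_open A v1 v2 c : local_frame D A v1 v2 -> atlas X c -> open (cimg c A).
Proof. by move=> [[_ oA] _ _ _ _] ac; exact: oA. Qed.

Lemma local_frame_free A v1 v2 c x : local_frame D A v1 v2 -> chart_at x c -> A x ->
  forall a b : R, a *: v1 x c + b *: v2 x c = 0 -> a = 0 /\ b = 0.
Proof.
move=> [_ [t1 _] [t2 _] _ free] hc Ax a b E; apply: (free x Ax).
have t : tangent x (a *: v1 x + b *: v2 x).
  by apply: tangentD; apply: tangentZ; [exact: t1|exact: t2].
rewrite (tangentE t hc) -[RHS](vec_of0 c x); congr vec_of.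
by rewrite -[RHS]E.
Qed.

(** Coordinates in a local frame are unique, so the local solutions of the
    linear system in one chart of [X] are the coordinates. *)
Lemma smooth_in_frame (V : normedModType R) (O : set V) (x : V -> mpoint X)
    (v : V -> tfam X) A v1 v2 c p :
  local_frame D A v1 v2 -> atlas X c -> open O -> O p -> A (x p) ->
  (forall q, O q -> dom c (x q)) ->
  smooth O (fun q => coord c (x q)) -> smooth O (fun q => v q c) ->
  (forall q, O q -> D (x q) (v q)) ->
  exists (U : set V) (a b : V -> R), [/\ open U /\ U p, U `<=` O,
     (forall q, U q -> A (x q)), smooth U a /\ smooth U b
    & forall q, U q -> v q = a q *: v1 (x q) + b q *: v2 (x q)].
Proof.
move=> lf ac oO Op Ap dO sx sv Dv; have [_ [t1 _] [t2 _] span _] := lf.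
have oA := local_frame_open lf ac.
have [s1 s2] := local_frame_smooth lf ac.
pose O' := O `&` (fun q => coord c (x q)) @^-1` cimg c A.
have oO' : open O'.
  by apply: open_preimage_on => // q Oq; exact: smooth_continuous sx Oq.
have O'p : O' p by split; [|exact: (cimg_coord Ap (dO _ Op))].
have OO : O' `<=` O by move=> q [].
have xA q : O' q -> A (x q).
  by move=> [Oq /(cimgP hX ac)[+ _ _]]; rewrite (paramK hX ac (dO _ Oq)).
have sv' (w : vfield X) : smooth (cimg c A) (fun y => w (param c y) c) -> smooth O' (fun q => w (x q) c).
  move=> sw.
  have S := @smooth_comp_row R V 'rV[R]_3 3 O' (cimg c A) (fun q => coord c (x q))
    (fun y => w (param c y) c) (has_coords_rV 3) oO' _ oA (smooth_sub OO sx) sw.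
  apply: smooth_ext oO' _ (S _); last by move=> q [].
  by move=> q /OO Oq /=; rewrite (paramK hX ac (dO _ Oq)).
have free := local_frame_free lf (conj ac (dO _ Op)) Ap.
have [|U [a [b [oU Up UO' [sa sb] E]]]] := smooth_frame_coeff oO' (sv' v1 s1) (sv' v2 s2)
  (smooth_sub OO sv) O'p free.
  move=> q O'q; have [/(_ (Dv q (OO _ O'q)))[a [b ->]] _] := span _ (xA _ O'q) (v q).
  by exists a, b.
exists U, a, b; split=> //.
- by move=> q /UO'/OO.
- by move=> q /UO'/xA.
move=> q Uq; have Aq := xA _ (UO' _ Uq).
have hc : chart_at (x q) c by split=> //; exact/dO/OO/UO'.
have tv : tangent (x q) (v q).
  have [_ /(_ (ex_intro _ _ (ex_intro _ _ erefl)))] := span _ Aq (a q *: v1 (x q) + b q *: v2 (x q)).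
  have bq : body X (x q) by exact: bodyX_chart hc.
  by move=> _; apply: tangent_in_D => //; exact/Dv/OO/UO'.
apply: tangent_eq tv _ hc (E q Uq).
by apply: tangentD; apply: tangentZ; [exact: t1|exact: t2].
Qed.

End Indicatrix.

(** * Vertical vectors of the indicatrix bundle *)
Section PlaneAlgebra.
Context {R : realType}.

Lemma linear_combine (V W : lmodType R) (L : {linear V -> W}) (k k' : R) a b :
  L (k *: a + k' *: b) = k *: L a + k' *: L b.
Proof. by rewrite linearP linearZ. Qed.

Lemma diff_near_cst (V W : normedModType R) (f : V -> W) (k : W) x a :
  (\forall y \near x, f y = k) -> 'd f x a = 0.
Proof.
move=> N; have [_ H] := @near_eq_diff R V W (cst k) f x
  (filterS (fun y => @esym _ _ _) N) (differentiable_cst k x).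
by apply: etrans (congr1 (fun h => h a) H) _; rewrite diff_cst.
Qed.

Lemma kernel_dependent (l : {linear 'rV[R]_2 -> R}) z w w' : l z != 0 ->
  l w = 0 -> l w' = 0 ->
  exists k k' : R, (k != 0 \/ k' != 0) /\ k *: w + k' *: w' = 0.
Proof.
move=> lz lw lw'.
have [p [q lE]] : exists p q, forall v, l v = v 0 0 * p + v 0 1 * q.
  exists (l (delta_mx 0 0)), (l (delta_mx 0 1)) => v; rewrite [in LHS](row_sum_delta v) linear_sum !big_ord_recl big_ord0 addr0/=.
  by rewrite !linearZ/=; congr (v _ _ * l (delta_mx _ _) + v _ _ * l (delta_mx _ _)); apply/val_inj.
move: lz lw lw'; rewrite !lE.
set w0 := w 0 0; set w1 := w 0 1; set w0' := w' 0 0; set w1' := w' 0 1.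
move=> lz lw lw'.
have det0 : w0 * w1' = w1 * w0'.
  have [p0|p0] := eqVneq p 0.
    have q0 : q != 0 by apply: contraNneq lz => ->; rewrite p0 !mulr0 addr0.
    apply: (mulIf q0); rewrite p0 !mulr0 !add0r in lw lw' *.
    by move/eqP: lw; move/eqP: lw'; rewrite !mulf_eq0 (negbTE q0) !orbF => /eqP-> /eqP->; rewrite !(mulr0, mul0r).
  apply: (mulIf p0); apply/eqP; rewrite -subr_eq0; apply/eqP.
  have -> : w0 * w1' * p - w1 * w0' * p = (w0 * p + w1 * q) * w1' - (w0' * p + w1' * q) * w1 by ring.
  by rewrite lw lw' !mul0r subr0.
have dep (k k' : R) : k * w0 + k' * w0' = 0 -> k * w1 + k' * w1' = 0 -> k *: w + k' *: w' = 0.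
  move=> E0 E1; apply/rowP => i; rewrite !mxE.
  by case: i => [[|[|//]]] Hi; [rewrite (_ : Ordinal Hi = 0)|rewrite (_ : Ordinal Hi = 1)]; rewrite //; apply/val_inj.
have [w0z|w0n] := eqVneq w0 0; last first.
  exists w0', (- w0); split; first by right; rewrite oppr_eq0.
  by apply: dep; [ring|rewrite mulNr det0; ring].
have [w0z'|w0n'] := eqVneq w0' 0; last first.
  exists w0', (- w0); split; first by left.
  by apply: dep; [ring|rewrite mulNr det0; ring].
have [w1z|w1n] := eqVneq w1 0; last first.
  exists w1', (- w1); split; first by right; rewrite oppr_eq0.
  by apply: dep; [rewrite w0z w0z' !mulr0 addr0|ring].
exists 1, 0; split; first by left; rewrite oner_neq0.
by apply: dep; rewrite ?w0z ?w1z mul0r mulr0 addr0.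
Qed.

End PlaneAlgebra.

Section Vertical.
Context {R : realType} {X : premanifold R 3}.
Variables (D : mpoint X -> set (tfam X)) (F : mpoint X -> tfam X -> R).
Hypothesis hX : regular_atlas X.
Hypotheses (D_contact : contact D) (F_sub_Finsler : sub_Finsler D F).

Local Notation TX := (tangent_bundle X).
Local Notation Sigma := (indicatrix D F).
Local Notation base := (@basepoint R X D F).

Let hTX : regular_atlas TX := regular_tangent_bundle hX.
Let hS : regular_atlas Sigma := regular_indicatrix D F hX.

Lemma dmap_base_chart u d c xi : chart_at (M := Sigma) u d -> chart_at u.1 c ->
  tangent u xi -> dmap (N := X) base u xi c =
  'd (fun y => coord c (param d y).1) (coord d u) (xi d).
Proof.
move=> hd hc txi.
rewrite (dmapE hS hX txi hd (smooth_at_basepoint hX hd)).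
have hc' : chart_at ((base \o param d) (coord d u)) c.
  by rewrite /= (paramK hS); [|case: hd|case: hd].
exact: pushvecE.
Qed.

Lemma sub_Finsler_homogeneous x v (k : R) : body X x -> D x v -> 0 < k ->
  F x (k *: v) = k * F x v.
Proof. by have [_ _ H _] := F_sub_Finsler; exact: H. Qed.

Definition frame_norm (v1 v2 : vfield X) (c : chart R (mpoint X) 3)
    (p : 'rV[R]_3 * 'rV[R]_2) : R :=
  F (param c p.1) (p.2 0 0 *: v1 (param c p.1) + p.2 0 1 *: v2 (param c p.1)).

Lemma smooth_frame_norm A v1 v2 c : local_frame D A v1 v2 -> atlas X c ->
  smooth [set p : 'rV[R]_3 * 'rV[R]_2 | cimg c A p.1 /\ p.2 != 0]
    (frame_norm v1 v2 c).
Proof. by have [_ H _ _] := F_sub_Finsler; exact: H. Qed.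

(** Euler's identity for the homogeneous function [F], in a local frame. *)
Lemma frame_norm_radial A v1 v2 c x (w : 'rV[R]_2) :
  local_frame D A v1 v2 -> chart_at x c -> A x ->
  F x (w 0 0 *: v1 x + w 0 1 *: v2 x) = 1 ->
  w != 0 /\ 'd (frame_norm v1 v2 c) (coord c x, w) ((0 : 'rV[R]_3), w) = 1.
Proof.
move=> lf [ac cx] Ax F1.
have bx := bodyX_chart hX (conj ac cx).
have [_ _ _ span _] := lf.
have w0 : w != 0.
  apply/eqP => w0; move: F1; rewrite w0 !mxE !scale0r addr0 => F0.
  have D00 : D x 0 by apply/(span _ Ax); exists 0, 0; rewrite !scale0r addr0.
  have := sub_Finsler_homogeneous bx D00 (ltr0Sn R 1); rewrite scaler0 F0.
  by move=> /eqP; rewrite mulr1 eq_sym -subr_eq0 addrK oner_eq0.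
split=> //.
have dF : differentiable (frame_norm v1 v2 c) (coord c x, w).
  apply: (smooth_differentiable (smooth_frame_norm lf ac)).
  by split=> //=; exact: cimg_coord.
pose p0 : 'rV[R]_3 * 'rV[R]_2 := (coord c x, w).
pose e : 'rV[R]_3 * 'rV[R]_2 := (0, w).
pose line (t : R) : ('rV[R]_3 * 'rV[R]_2)%type := p0 + t *: e.
have [dl el] := is_derive_line p0 e 0.
have dl' : differentiable line (0 : R) by exact/derivable1_diffP.
have line0 : line 0 = p0 by rewrite /line scale0r addr0.
have [dl1 el1] := is_derive_line (1 : R) (1 : R) 0.
have dl1' : differentiable (fun t : R => 1 + t *: (1 : R)) (0 : R) by exact/derivable1_diffP.
have N : \forall t \near (0 : R), 1 + t *: (1 : R) = frame_norm v1 v2 c (line t).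
  have : \forall t \near (0 : R), -1 < t by apply: lt_nbhsr; rewrite ltrN10.
  apply: filterS => t t1; have k0 : 0 < 1 + t by rewrite -ltrBlDl sub0r.
  rewrite /frame_norm.
  have -> : (line t).1 = coord c x by rewrite /line /= scaler0 addr0.
  have -> : (line t).2 = (1 + t) *: w by rewrite /line /= scalerDl scale1r.
  rewrite (paramK hX ac cx) !mxE -!scalerA -scalerDr.
  rewrite sub_Finsler_homogeneous//; first by rewrite F1 mulr1 /GRing.scale/= mulr1.
  by apply/(span _ Ax); exists (w 0 0), (w 0 1).
have [_ E1] := @diff_chain _ _ _ _ line (frame_norm v1 v2 c) (fun t : R => 1 + t *: (1 : R)) 0 _ line0 N dl' dF.
have E2 : 'd line (0 : R) 1 = e by rewrite -deriveE.
have E3 : 'd (fun t : R => 1 + t *: (1 : R)) (0 : R) 1 = 1 by rewrite -deriveE.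
by have := etrans (esym (E1 1)) E3; rewrite E2.
Qed.

Lemma diff_fst_zero (f : 'rV[R]_4 -> 'rV[R]_3) (g : 'rV[R]_4 -> 'rV[R]_2) y a :
  differentiable f y -> differentiable g y -> 'd f y a = 0 ->
  'd (fun y => (f y, g y)) y a = (0, 'd g y a).
Proof.
move=> df dg fa; apply: etrans (congr1 (fun h => h a) (diff_pair df dg)) _.
by congr pair.
Qed.

(** The fibres of the indicatrix bundle are curves: a vertical vector moves [u]
    inside [D] along a level set of [F], and [F] has nonzero radial derivative. *)
Lemma vertical_dependent u d xi xi' : chart_at (M := Sigma) u d ->
  tangent u xi -> tangent u xi' ->
  dmap (N := X) base u xi = 0 -> dmap (N := X) base u xi' = 0 ->
  exists k k' : R, (k != 0 \/ k' != 0) /\ k *: xi + k' *: xi' = 0.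
Proof.
move=> hd txi txi' v0 v0'.
have [c [W [hc [oW Wy] WB dW [s1 s2 imm]]]] := indicatrix_chart hX hd.
have [ac cu] := hc; have [ad du] := hd.
have E0 : param d (coord d u) = u by rewrite (paramK hS).
set y0 := coord d u in Wy imm *.
have inS y : W y -> D (param d y).1 (param d y).2 /\ F (param d y).1 (param d y).2 = 1.
  move=> /WB/(cimgP hS ad)[_ dy _]; have [H _ _] := hS.1 d ad.
  by have [] := H _ dy.
have [A [v1 [v2 [Au lf]]]] := D_contact.1 u.1 (bodyX_chart hX hc).
have Ay0 : A (param d y0).1 by rewrite E0.
have [U [a [b [[oU Uy0] UW UA [sa sb] E]]]] := smooth_in_frame hX D_contact lf ac
  oW Wy Ay0 dW s1 s2 (fun y Wy => (inS y Wy).1).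
pose ab y : 'rV[R]_2 := \row_i (if i == 0 then a y else b y).
pose kp y := (coord c (param d y).1, ab y).
have sk : smooth U kp.
  apply: smooth_pair => //; first exact: smooth_sub s1.
  apply: smooth_row => // i.
  by case: (eqVneq i 0) => i0; apply: (smooth_ext oU _ _); [move=> y _; rewrite mxE i0|exact: sa|move=> y _; rewrite mxE (negbTE i0)|exact: sb].
pose Ps (p : 'rV[R]_3 * 'rV[R]_2) := p.2 0 0 *: v1 (param c p.1) c + p.2 0 1 *: v2 (param c p.1) c.
have xE y : U y -> param c (coord c (param d y).1) = (param d y).1.
  by move=> /UW/dW dy; rewrite (paramK hX).
have EF y : U y -> frame_norm v1 v2 c (kp y) = 1.
  move=> Uy; rewrite /frame_norm /kp /= xE// !mxE /= -E//; exact: (inS y (UW _ Uy)).2.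
have [D0 F1] := inS _ Wy.
have hc0 : chart_at (param d y0).1 c by rewrite E0.
have [ab0 l1] : ab y0 != 0 /\ 'd (frame_norm v1 v2 c) (kp y0) ((0 : 'rV[R]_3), ab y0) = 1.
  by apply: (frame_norm_radial lf hc0 Ay0); rewrite !mxE /= -E.
have cimgx0 : cimg c A (coord c (param d y0).1) by exact: (cimg_coord Ay0 (dW _ Wy)).
have dF : differentiable (frame_norm v1 v2 c) (kp y0).
  by apply: (smooth_differentiable (smooth_frame_norm lf ac)).
have dk := smooth_differentiable sk Uy0.
have dx := smooth_differentiable s1 Wy.
have sab : smooth U ab.
  apply: smooth_row => // i.
  by case: (eqVneq i 0) => i0; apply: (smooth_ext oU _ _); [move=> y _; rewrite mxE i0|exact: sa|move=> y _; rewrite mxE (negbTE i0)|exact: sb].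
have dab := smooth_differentiable sab Uy0.
have llin : linear (fun w => 'd (frame_norm v1 v2 c) (kp y0) ((0 : 'rV[R]_3), w)).
  move=> k w w'; rewrite -linearP; congr ('d _ _ _).
  by rewrite -[RHS]/(k *: (0 : 'rV[R]_3) + 0, k *: w + w') scaler0 addr0.
pose l := mk_linear llin.
(* [F = 1] on the indicatrix bundle, so the differential of [F] kills the fibre coordinates of a vertical vector *)
have ker z : 'd (fun y => coord c (param d y).1) y0 z = 0 -> l ('d ab y0 z) = 0.
  move=> xa; have Ek := diff_fst_zero dx dab xa.
  have Hz : 'd (frame_norm v1 v2 c \o kp) y0 z = 0.
    exact: diff_near_cst (filterS EF (open_near oU Uy0)).
  exact: etrans (congr1 ('d (frame_norm v1 v2 c) (kp y0)) (esym Ek))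
    (etrans (esym (diff_compE z dk dF)) Hz).
have oS : open [set p : 'rV[R]_3 * 'rV[R]_2 | cimg c A p.1].
  by apply: (@open_comp _ _ fst); [move=> z _; exact: cvg_fst|exact: local_frame_open lf ac].
have sP : smooth [set p : 'rV[R]_3 * 'rV[R]_2 | cimg c A p.1] Ps.
  have [t1 t2] := local_frame_smooth lf ac.
  have s2' : smooth [set p : 'rV[R]_3 * 'rV[R]_2 | cimg c A p.1] snd.
    apply: (@smooth_lin _ _ _ _ [the {linear _ -> _} of snd]).
    by move=> z; exact: cvg_snd.
  have s1' : smooth [set p : 'rV[R]_3 * 'rV[R]_2 | cimg c A p.1] fst.
    apply: (@smooth_lin _ _ _ _ [the {linear _ -> _} of fst]).
    by move=> z; exact: cvg_fst.
  apply: smoothD => //; apply: smooth_scale => //; [exact: smooth_coord| |exact: smooth_coord|].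
    apply: (@smooth_comp_row _ _ _ _ _ (cimg c A) fst (fun y => v1 (param c y) c)) => //.
      exact: has_coords_rV.
    exact: local_frame_open lf ac.
  apply: (@smooth_comp_row _ _ _ _ _ (cimg c A) fst (fun y => v2 (param c y) c)) => //.
    exact: has_coords_rV.
  exact: local_frame_open lf ac.
(* the base point and the fibre coordinates determine the point of the tangent bundle, in which the chart is immersed *)
have inj z : 'd (fun y => coord c (param d y).1) y0 z = 0 -> 'd ab y0 z = 0 -> z = 0.
  move=> xa wa; apply: (imm z xa).
  have Ek := etrans (diff_fst_zero dx dab xa) (congr1 (pair 0) wa).
  have N : \forall y \near y0, (param d y).2 c = Ps (kp y).
    apply: filterS (open_near oU Uy0) => y Uy.
    by rewrite (E y Uy) /Ps /kp /= xE// !mxE.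
  have dP : differentiable Ps (kp y0) by exact: smooth_differentiable sP _.
  have [_ H] := @diff_chain _ _ _ _ kp Ps (fun y => (param d y).2 c) y0 _ erefl N dk dP.
  exact: etrans (H z) (etrans (congr1 ('d Ps (kp y0)) Ek) (linear0 _)).
have xi0 : 'd (fun y => coord c (param d y).1) y0 (xi d) = 0.
  by rewrite -(dmap_base_chart hd hc txi) v0.
have xi0' : 'd (fun y => coord c (param d y).1) y0 (xi' d) = 0.
  by rewrite -(dmap_base_chart hd hc txi') v0'.
have [|k [k' [kk K0]]] := @kernel_dependent _ l (ab y0) _ _ _ (ker _ xi0) (ker _ xi0').
  by rewrite [l _]l1 oner_neq0.
exists k, k'; split=> //.
have teta : tangent u (k *: xi + k' *: xi') by apply: tangentD; exact: tangentZ.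
rewrite (tangentE teta hd) -[RHS](vec_of0 d u); congr vec_of.
have E' : (k *: xi + k' *: xi') d = k *: xi d + k' *: xi' d by [].
rewrite E'; apply: inj.
  apply: etrans (linear_combine _ _ _ _ _) _.
  apply: etrans (congr2 (fun p q => k *: p + k' *: q) xi0 xi0') _.
  by rewrite !scaler0 addr0.
exact: etrans (linear_combine _ _ _ _ _) K0.
Qed.

End Vertical.

(** * Adapted coframings and the projection to the base *)
Section KernelRank.
Context {F : fieldType}.

(** Rank and nullity: the kernel has dimension at least one by the size of
    [J], and at most one by assumption. *)
Lemma dependent_kernel_full n (J : 'M[F]_(n.+1, n)) :
  (forall a a' : 'rV[F]_n.+1, a *m J = 0 -> a' *m J = 0 ->
     exists k k' : F, (k != 0 \/ k' != 0) /\ k *: a + k' *: a' = 0) ->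
  row_full J /\ exists2 a : 'rV[F]_n.+1, a != 0 & a *m J = 0.
Proof.
move=> dep; have rJ := rank_leq_col J.
have [i ki] : exists i, row i (kermx J) != 0.
  apply/existsP; rewrite -negb_forall; apply/negP => /forallP H.
  have K0 : kermx J = 0 by apply/row_matrixP => i; rewrite row0; exact/eqP.
  have := mxrank_ker J; rewrite K0 mxrank0 => /esym/eqP.
  by rewrite subn_eq0 => /leq_trans/(_ rJ); rewrite ltnn.
have kz j : row j (kermx J) *m J = 0 by rewrite -row_mul mulmx_ker row0.
split; last by exists (row i (kermx J)).
have sub : (kermx J <= row i (kermx J))%MS.
  apply/row_subP => j; have [k [k' [kk E]]] := dep _ _ (kz j) (kz i).
  have k0 : k != 0.
    apply/negP => /eqP k0; move: E; rewrite k0 scale0r add0r => /eqP.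
    rewrite scaler_eq0 (negbTE ki) orbF => /eqP k0'.
    by move: kk; rewrite k0 k0' eqxx; case.
  apply/sub_rVP; exists (- (k' / k)).
  apply: (scalerI k0); rewrite scalerA mulrN mulrCA mulfV// mulr1 scaleNr.
  by apply/eqP; rewrite -addr_eq0; apply/eqP.
have := leq_trans (mxrankS sub) (rank_leq_row _).
rewrite mxrank_ker /row_full eqn_leq rJ /= leq_subLR addn1.
by rewrite ltnS.
Qed.

End KernelRank.

Section Base.
Context {R : realType} {X : premanifold R 3}.
Variables (D : mpoint X -> set (tfam X)) (F : mpoint X -> tfam X -> R).
Hypothesis hX : regular_atlas X.
Hypotheses (D_contact : contact D) (F_sub_Finsler : sub_Finsler D F).

Local Notation Sigma := (indicatrix D F).
Local Notation base := (@basepoint R X D F).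
Local Notation dbase := (dmap (M := Sigma) (N := X) base).

Let hS : regular_atlas Sigma := regular_indicatrix D F hX.

Lemma dbaseP u d (k : R) v w : chart_at (M := Sigma) u d -> tangent u v -> tangent u w ->
  dbase u (k *: v + w) = k *: dbase u v + dbase u w.
Proof.
move=> hd tv tw; exact (dmapP hS hX k (smooth_at_basepoint hX hd) tv tw).
Qed.

Lemma tangent0 u v : tangent (M := Sigma) u v -> tangent (M := Sigma) u 0.
Proof. by move=> tv; rewrite -(scale0r v); exact: tangentZ. Qed.

Lemma dbase0 u d : chart_at (M := Sigma) u d -> dbase u 0 = 0.
Proof.
move=> hd; have t0 := tangent0 (tangent_vec_of hS 0 hd).
have := dbaseP (- 1) hd t0 t0.
by rewrite scaler0 addr0 scaleN1r addNr.
Qed.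

Lemma dbaseZ u d (k : R) v : chart_at (M := Sigma) u d -> tangent u v ->
  dbase u (k *: v) = k *: dbase u v.
Proof.
move=> hd tv; have := dbaseP k hd tv (tangent0 tv).
by rewrite !addr0 (dbase0 hd) addr0.
Qed.

Lemma tangent_dbase u d v : chart_at (M := Sigma) u d -> tangent u v ->
  tangent u.1 (dbase u v).
Proof. move=> hd tv; exact (tangent_dmap hS hX tv (smooth_at_basepoint hX hd)). Qed.

(** The indicatrix bundle has dimension 4 and its vertical spaces have
    dimension at most one, so the projection to the 3-manifold [X] is a
    submersion. *)
Lemma dbase_full u d : chart_at (M := Sigma) u d ->
  (forall w, tangent u.1 w -> exists2 v, tangent u v & dbase u v = w) /\
  (exists v, [/\ tangent u v, v <> 0 & dbase u v = 0]).
Proof.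
move=> hd; have [c [W [hc _ _ _ _]]] := indicatrix_chart hX hd.
pose x y := coord c (param d y).1.
have E a : dbase u (vec_of d u a) c = a *m 'J x (coord d u).
  rewrite (dmap_base_chart hX hd hc (tangent_vec_of hS a hd)) -jacobianE.
  by rewrite (vec_ofE hS a hd).
have tb a : tangent u.1 (dbase u (vec_of d u a)).
  exact: tangent_dbase hd (tangent_vec_of hS a hd).
have Z a : a *m 'J x (coord d u) = 0 -> dbase u (vec_of d u a) = 0.
  by move=> a0; rewrite (tangentE (tb a) hc) E a0; exact: vec_of0.
have [] := @dependent_kernel_full R 3 ('J x (coord d u)).
  move=> a a' /Z za /Z za'.
  have [k [k' [kk K]]] := vertical_dependent hX D_contact F_sub_Finsler hd
    (tangent_vec_of hS a hd) (tangent_vec_of hS a' hd) za za'.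
  exists k, k'; split=> //; have := congr1 (fun f => f d) K.
  rewrite -[LHS]/(k *: vec_of d u a d + k' *: vec_of d u a' d).
  by rewrite !(vec_ofE hS _ hd).
move=> /row_fullP[B JB] [a a0 aJ]; split.
  move=> w tw; exists (vec_of d u (w c *m B)); first exact: (tangent_vec_of hS _ hd).
  apply: (tangent_eq (tb _) tw hc).
  by rewrite E -mulmxA JB mulmx1.
exists (vec_of d u a); split; [exact: (tangent_vec_of hS _ hd)| |exact: Z].
move=> /(congr1 (fun f => f d)); rewrite (vec_ofE hS _ hd) => E0.
by rewrite E0 eqxx in a0.
Qed.

Section Adapted.
Variables (A : set (mpoint Sigma)) (e : coframing Sigma).
Hypothesis ae : adapted0 A e.
Variables (u : mpoint Sigma) (d : chart R (mpoint Sigma) 4).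
Hypotheses (Au : A u) (hd : chart_at (M := Sigma) u d).

Lemma coframe_linear (w : form Sigma) (k : R) v v' : smooth_form A w ->
  tangent u v -> tangent u v' -> w u (k *: v + v') = k * w u v + w u v'.
Proof. by move=> [H _] tv tv'; have [L _] := H u Au; exact: L. Qed.

Lemma coframe_zero (w : form Sigma) v : smooth_form A w -> tangent u v -> w u 0 = 0.
Proof.
move=> sw tv; have := coframe_linear (- 1) sw tv tv.
by rewrite scaleN1r addNr mulN1r addNr.
Qed.

Lemma coframe_scale (w : form Sigma) (k : R) v : smooth_form A w -> tangent u v ->
  w u (k *: v) = k * w u v.
Proof.
move=> sw tv; have := coframe_linear k sw tv (tangent0 tv).
by rewrite addr0 (coframe_zero sw tv) addr0.
Qed.

Lemma coframe_inj v v' : tangent u v -> tangent u v' ->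
  eta1 (e u) v = eta1 (e u) v' -> eta2 (e u) v = eta2 (e u) v' ->
  eta3 (e u) v = eta3 (e u) v' -> phi (e u) v = phi (e u) v' -> v = v'.
Proof.
move=> tv tv' E1 E2 E3 E4; have [[_ _ _ H] _ _ _ _] := ae.
have [z [_ uz]] := H u Au (eta1 (e u) v) (eta2 (e u) v) (eta3 (e u) v) (phi (e u) v).
by rewrite -(uz v) ?(uz v')//.
Qed.

Lemma coframe_smooth : [/\ smooth_form A (form_eta1 e), smooth_form A (form_eta2 e),
  smooth_form A (form_eta3 e) & smooth_form A (form_phi e)].
Proof. by have [[_ [s1 s2] [s3 s4] _] _ _ _ _] := ae. Qed.

Lemma monic_exists : exists m, monic_vector u m.
Proof.
have [_ _ _ tu] := indicatrix_point hX D_contact hd.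
by have [H _] := dbase_full hd; have [m tm E] := H _ tu; exists m.
Qed.

(** Adding a vertical vector to a monic vector gives a monic vector, so the
    forms [eta1], [eta2], [eta3] vanish on vertical vectors. *)
Lemma coframe_vertical v : tangent u v -> dbase u v = 0 ->
  [/\ eta1 (e u) v = 0, eta2 (e u) v = 0 & eta3 (e u) v = 0].
Proof.
move=> tv v0; have [m [tm Em]] := monic_exists.
have mm : monic_vector u (1 *: v + m).
  by split; [exact: tangentP|rewrite (dbaseP 1 hd)// v0 scaler0 add0r].
have [_ m1 [_ m2] [_ m3] _] := ae; have [s1 s2 s3 _] := coframe_smooth.
have N1 := m1 u _ Au mm; have N2 := m2 u _ Au mm; have N3 := m3 u _ Au mm.
have M1 := m1 u m Au (conj tm Em); have M2 := m2 u m Au (conj tm Em).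
have M3 := m3 u m Au (conj tm Em).
rewrite (coframe_linear 1 s1)// mul1r M1 in N1.
rewrite (coframe_linear 1 s2)// mul1r M2 addr0 in N2.
rewrite (coframe_linear 1 s3)// mul1r M3 addr0 in N3.
by split=> //; apply/(addIr 1); rewrite N1 add0r.
Qed.

(** The forms take prescribed values on monic vectors and vanish on vertical
    ones, and the vectors over multiples of [u.2] are combinations of these. *)
Lemma coframe_monic_multiple v (k : R) : tangent u v -> dbase u v = k *: u.2 ->
  [/\ eta1 (e u) v = k, eta2 (e u) v = 0 & eta3 (e u) v = 0].
Proof.
move=> tv Ev; have [m [tm Em]] := monic_exists.
have tz : tangent u (- k *: m + v) by exact: tangentP.
have Ez : dbase u (- k *: m + v) = 0.
  by rewrite (dbaseP (- k) hd)// Em Ev scaleNr addNr.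
have [_ m1 [_ m2] [_ m3] _] := ae; have [s1 s2 s3 _] := coframe_smooth.
have M1 := m1 u m Au (conj tm Em); have M2 := m2 u m Au (conj tm Em).
have M3 := m3 u m Au (conj tm Em).
have [] := coframe_vertical tz Ez.
rewrite -[eta1 _]/(form_eta1 e u) -[eta2 _]/(form_eta2 e u) -[eta3 _]/(form_eta3 e u).
rewrite (coframe_linear (- k) s1)// (coframe_linear (- k) s2)// (coframe_linear (- k) s3)//.
rewrite M1 M2 M3 !mulr0 !add0r mulr1 => E1 -> ->; split=> //.
by apply/eqP; rewrite -subr_eq0 addrC E1.
Qed.

(** Modulo vertical vectors and a multiple of a monic vector, a vector
    annihilated by [eta2] and [eta3] has all four coframe values zero. *)
Lemma coframe_kernel v : tangent u v -> eta2 (e u) v = 0 -> eta3 (e u) v = 0 ->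
  dbase u v = eta1 (e u) v *: u.2.
Proof.
move=> tv v2 v3; have [m [tm Em]] := monic_exists.
have [_ [z [tz z0 Ez]]] := dbase_full hd.
have [z1 z2 z3] := coframe_vertical tz Ez.
have [_ m1 [_ m2] [_ m3] _] := ae; have [s1 s2 s3 s4] := coframe_smooth.
have M1 := m1 u m Au (conj tm Em); have M2 := m2 u m Au (conj tm Em).
have M3 := m3 u m Au (conj tm Em).
have z4 : phi (e u) z != 0.
  apply/negP => /eqP z4; apply: z0.
  have t0 := tangent0 tz.
  have L w : smooth_form A w -> w u 0 = 0 by move=> sw; exact: coframe_zero sw tz.
  apply: coframe_inj => //; rewrite ?z1 ?z2 ?z3 ?z4; symmetry.
  - exact: (L _ s1).
  - exact: (L _ s2).
  - exact: (L _ s3).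
  - exact: (L _ s4).
set k := eta1 (e u) v; pose q := (phi (e u) v - k * phi (e u) m) / phi (e u) z.
have tq : tangent u (q *: z) by exact: tangentZ.
have E : v = k *: m + q *: z.
  have L w : smooth_form A w -> w u (k *: m + q *: z) = k * w u m + q * w u z.
    by move=> sw; rewrite (coframe_linear k sw)// (coframe_scale q sw).
  apply: coframe_inj => //; first exact: tangentP.
  - by rewrite -[RHS]/(form_eta1 e u _) (L _ s1) M1 [form_eta1 e u z]z1 mulr0 addr0 mulr1.
  - by rewrite v2 -[RHS]/(form_eta2 e u _) (L _ s2) M2 [form_eta2 e u z]z2 !mulr0 addr0.
  - by rewrite v3 -[RHS]/(form_eta3 e u _) (L _ s3) M3 [form_eta3 e u z]z3 !mulr0 addr0.
  - rewrite -[RHS]/(form_phi e u _) (L _ s4) /q /form_phi.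
    by rewrite divfK// addrC subrK.
by rewrite {1}E (dbaseP k hd)// Em (dbaseZ q hd tz) Ez scaler0 addr0.
Qed.

End Adapted.

End Base.

(** * Uniqueness of positive 4-adapted coframes *)
Lemma leibniz_regroup (S : comRingType)
    (p1 p2 p3 p4 q1 q2 q3 q4 a1 a2 a3 a4 b1 b2 b3 b4 : S)
    (t1 t2 t3 t4 x1 x2 x3 x4 y1 y2 y3 y4 : S) :
  (p1 * b1 + t1 * x1) + (p2 * b2 + t2 * x2) + (p3 * b3 + t3 * x3) + (p4 * b4 + t4 * x4)
  - ((q1 * a1 + t1 * y1) + (q2 * a2 + t2 * y2) + (q3 * a3 + t3 * y3) + (q4 * a4 + t4 * y4)) =
  (p1 * b1 - q1 * a1 + t1 * (x1 - y1)) + (p2 * b2 - q2 * a2 + t2 * (x2 - y2)) +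
  (p3 * b3 - q3 * a3 + t3 * (x3 - y3)) + (p4 * b4 - q4 * a4 + t4 * (x4 - y4)).
Proof. ring. Qed.

(** Eliminating gives [(1 + 2 * i ^+ 2) * f = 0], and squares are
    nonnegative. *)
Lemma skew_zero (S : realDomainType) (i s q f g : S) :
  s = - f -> q = - g - i * f -> q = i * f -> s = - (i * g) ->
  [/\ s = 0, q = 0, f = 0 & g = 0].
Proof.
move=> sf qg qf sg; have g2 : g = - (2 * (i * f)) by lra.
have : (1 + 2 * i ^+ 2) * f = 0.
  have : f = i * g by rewrite -[LHS]opprK -sf sg opprK.
  rewrite g2 => ff; rewrite mulrDl mul1r {1}ff; ring.
have i0 : 0 <= i ^+ 2 by exact: sqr_ge0.
move=> /eqP; rewrite mulf_eq0 => /orP[/eqP h|/eqP f0]; first by exfalso; lra.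
by split; rewrite ?sf ?qf ?g2 f0 ?oppr0 ?mulr0 ?oppr0.
Qed.

Section ExteriorDerivative.
Context {R : realType} {n : nat} {M : premanifold R n}.
Hypothesis hM : regular_atlas M.
Variables (u : mpoint M) (d : chart R (mpoint M) n) (B : set (mpoint M)).
Hypotheses (hd : chart_at u d) (oB : mopen B) (Bu : B u).

Let c := some_chart u.
Let y0 := coord c u.
Let hc : chart_at u c := some_chartP hd.

(** Directional derivative at [u], in the chart used by [dext]. *)
Definition pderive (v : tfam M) (t : mpoint M -> R) : R := 'D_(v c) (t \o param c) y0.

Lemma pderive_const v t (k : R) : (forall x, B x -> t x = k) -> pderive v t = 0.
Proof.
move=> tk; have [ac cu] := hc; rewrite /pderive -(derive_cst k y0 (v c)).
apply: near_eq_D; have /filterS := open_near (oB.2 c ac) (cimg_coord Bu cu).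
by apply=> y /(cimgP hM ac)[By _ _] /=; exact: tk.
Qed.

Lemma param_some_chart : param c (coord c u) = u.
Proof. by have [ac cu] := hc; rewrite (paramK hM). Qed.

Lemma derivable_component w b v : smooth_form B w ->
  derivable (fun y => w (param c y) (vec_of c (param c y) b)) y0 v.
Proof.
have [ac cu] := hc => -[_ sw]; apply: diff_derivable.
apply: (smooth_differentiable (sw c ac b)); exact: cimg_coord.
Qed.

(** Leibniz' rule for exterior derivatives: it turns the equality of two
    expressions of a coframing into relations between its structure
    functions. *)
Lemma dext_combination (w w1 w2 w3 w4 : form M) (t1 t2 t3 t4 : mpoint M -> R) v z :
  [/\ smooth_form B w1, smooth_form B w2, smooth_form B w3 & smooth_form B w4] ->
  [/\ differentiable (t1 \o param c) y0, differentiable (t2 \o param c) y0,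
      differentiable (t3 \o param c) y0 & differentiable (t4 \o param c) y0] ->
  (forall x, B x -> forall v, tangent x v ->
     w x v = t1 x * w1 x v + t2 x * w2 x v + t3 x * w3 x v + t4 x * w4 x v) ->
  tangent u v -> tangent u z ->
  dext w u v z =
    (pderive v t1 * w1 u z - pderive z t1 * w1 u v + t1 u * dext w1 u v z) +
    (pderive v t2 * w2 u z - pderive z t2 * w2 u v + t2 u * dext w2 u v z) +
    (pderive v t3 * w3 u z - pderive z t3 * w3 u v + t3 u * dext w3 u v z) +
    (pderive v t4 * w4 u z - pderive z t4 * w4 u v + t4 u * dext w4 u v z).
Proof.
move=> [s1 s2 s3 s4] [d1 d2 d3 d4] wE tv tz; have [ac cu] := hc.
have half b b' : 'D_b (fun y => w (param c y) (vec_of c (param c y) b')) y0 =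
   ('D_b (t1 \o param c) y0 * w1 u (vec_of c u b') + t1 u * 'D_b (fun y => w1 (param c y) (vec_of c (param c y) b')) y0) +
   ('D_b (t2 \o param c) y0 * w2 u (vec_of c u b') + t2 u * 'D_b (fun y => w2 (param c y) (vec_of c (param c y) b')) y0) +
   ('D_b (t3 \o param c) y0 * w3 u (vec_of c u b') + t3 u * 'D_b (fun y => w3 (param c y) (vec_of c (param c y) b')) y0) +
   ('D_b (t4 \o param c) y0 * w4 u (vec_of c u b') + t4 u * 'D_b (fun y => w4 (param c y) (vec_of c (param c y) b')) y0).
  have one (t : mpoint M -> R) (wi : form M) : differentiable (t \o param c) y0 -> smooth_form B wi ->
      is_derive y0 b (fun y => t (param c y) * wi (param c y) (vec_of c (param c y) b'))
       ('D_b (t \o param c) y0 * wi u (vec_of c u b') + t u * 'D_b (fun y => wi (param c y) (vec_of c (param c y) b')) y0).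
    move=> dt swi; have D1 : derivable (t \o param c) y0 b by exact: diff_derivable.
    have D2 : derivable (fun y => wi (param c y) (vec_of c (param c y) b')) y0 b.
      exact: (derivable_component swi).
    split; first exact: (derivableM D1 D2).
    rewrite [LHS](deriveM D1 D2) /= param_some_chart addrC.
    by congr (_ + _); rewrite mulrC.
  have [e1 E1] := one t1 w1 d1 s1; have [e2 E2] := one t2 w2 d2 s2.
  have [e3 E3] := one t3 w3 d3 s3; have [e4 E4] := one t4 w4 d4 s4.
  rewrite -E1 -E2 -E3 -E4.
  rewrite -(deriveD e1 e2) -(deriveD (derivableD e1 e2) e3)
    -(deriveD (derivableD (derivableD e1 e2) e3) e4).
  apply: near_eq_D; have /filterS := open_near (oB.2 c ac) (cimg_coord Bu cu).
  apply=> y /(cimgP hM ac)[By cy _]; apply: wE => //.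
  exact: (tangent_vec_of hM).
have Ev : vec_of c u (v c) = v by rewrite -(tangentE tv hc).
have Ez : vec_of c u (z c) = z by rewrite -(tangentE tz hc).
rewrite /dext -/c -/y0 /pderive !half Ev Ez; exact: leibniz_regroup.
Qed.

End ExteriorDerivative.

Section Uniqueness.
Context {R : realType} {X : premanifold R 3}.
Variables (D : mpoint X -> set (tfam X)) (F : mpoint X -> tfam X -> R).
Variable o : mpoint X -> tfam X -> tfam X -> Prop.
Hypothesis hX : regular_atlas X.
Hypotheses (D_contact : contact D) (F_sub_Finsler : sub_Finsler D F).
Hypothesis D_oriented : orientation D o.

Local Notation Sigma := (indicatrix D F).
Local Notation base := (@basepoint R X D F).
Local Notation dbase := (dmap (M := Sigma) (N := X) base).

Let hS : regular_atlas Sigma := regular_indicatrix D F hX.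

Section Dual.
Variables (A : set (mpoint Sigma)) (e : coframing Sigma).
Hypothesis ae : adapted0 A e.

(** The four indices of a coframe, in a form that computes. *)
Definition k0 : 'I_4 := @Ordinal 4 0 isT.
Definition k1 : 'I_4 := @Ordinal 4 1 isT.
Definition k2 : 'I_4 := @Ordinal 4 2 isT.
Definition k3 : 'I_4 := @Ordinal 4 3 isT.

Definition coform (e : coframing Sigma) (i : 'I_4) : form Sigma :=
  match val i with
  | 0%N => form_eta1 e | 1%N => form_eta2 e | 2%N => form_eta3 e | _ => form_phi e
  end.

Lemma smooth_coform i : smooth_form A (coform e i).
Proof.
have [s1 s2 s3 s4] := coframe_smooth ae.
by case: i => [[|[|[|[|//]]]] Hi].
Qed.

Definition dual (x : mpoint Sigma) (j : 'I_4) : tfam Sigma :=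
  xget 0 [set v | tangent x v /\ forall i, coform e i x v = (i == j)%:R].

Lemma dualP x j : A x -> tangent x (dual x j) /\
  forall i, coform e i x (dual x j) = (i == j)%:R.
Proof.
move=> Ax; have [[_ _ _ H] _ _ _ _] := ae.
have [v [[tv [v1 v2 v3 v4]] _]] := H x Ax (0 == val j)%N%:R (1 == val j)%N%:R
  (2 == val j)%N%:R (3 == val j)%N%:R.
apply: (@xgetPex _ 0 [set v | tangent x v /\ forall i, coform e i x v = (i == j)%:R]).
exists v; split=> //.
by case=> [[|[|[|[|//]]]] Hi]; rewrite -val_eqE.
Qed.

Lemma coform_inj x v v' : A x -> tangent x v -> tangent x v' ->
  (forall i, coform e i x v = coform e i x v') -> v = v'.
Proof.
move=> Ax tv tv' E; apply: (coframe_inj ae Ax tv tv').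
- exact: (E k0).
- exact: (E k1).
- exact: (E k2).
- exact: (E k3).
Qed.

Lemma coform_comb x (w : form Sigma) (B : set (mpoint Sigma)) (k : 'I_4 -> R) (v : 'I_4 -> tfam Sigma) :
  B x -> smooth_form B w -> (forall i, tangent x (v i)) ->
  tangent x (\sum_i k i *: v i) /\ w x (\sum_i k i *: v i) = \sum_i k i * w x (v i).
Proof.
move=> Bx [L _] tv; have [Lw _] := L x Bx.
have t0 : tangent x 0 by exact: (tangent0 (tv k0)).
have w0 : w x 0 = 0.
  by have := Lw (- 1) _ _ t0 t0; rewrite scaler0 addr0 mulN1r addNr.
elim: (index_enum _) => [|i r [IHt IHw]]; first by rewrite !big_nil.
rewrite !big_cons; split; first exact: tangentP.
by rewrite Lw// IHw.
Qed.

Lemma dual_expand x v : A x -> tangent x v ->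
  v = \sum_j coform e j x v *: dual x j.
Proof.
move=> Ax tv; have tD j : tangent x (dual x j) by have [] := dualP j Ax.
have C i := @coform_comb x _ A (fun j => coform e j x v) _ Ax (smooth_coform i) tD.
apply: (coform_inj Ax tv); first by have [] := C k0.
move=> i; have [_ ->] := C i; rewrite (bigD1 i)//= big1 => [|j ji].
  by have [_ ->] := dualP i Ax; rewrite eqxx mulr1 addr0.
by have [_ ->] := dualP j Ax; rewrite eq_sym (negbTE ji) mulr0.
Qed.

Lemma form_expand x (w : form Sigma) (B : set (mpoint Sigma)) v : A x -> B x ->
  smooth_form B w -> tangent x v ->
  w x v = \sum_j w x (dual x j) * coform e j x v.
Proof.
move=> Ax Bx sw tv; have tD j : tangent x (dual x j) by have [] := dualP j Ax.
rewrite {1}(dual_expand Ax tv).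
have [_ ->] := @coform_comb x _ B (fun j => coform e j x v) _ Bx sw tD.
by apply: eq_bigr => j _; rewrite mulrC.
Qed.

(** The dual frame is only defined pointwise; the coefficients are recovered
    from the components of [w] by inverting the matrix of components of the
    coframing, which is smooth. *)
Lemma smooth_coefficient (w : form Sigma) (B : set (mpoint Sigma)) c x j :
  chart_at (M := Sigma) x c -> mopen B -> A x -> B x -> smooth_form B w ->
  differentiable ((fun x => w x (dual x j)) \o param c) (coord c x).
Proof.
move=> hc oB Ax Bx sw; have [ac cx] := hc.
have oA : mopen A by have [[]] := ae.
pose U := cimg c A `&` cimg c B.
have oU : open U by apply: openI; [exact: oA.2|exact: oB.2].
have Ux : U (coord c x) by split; exact: cimg_coord.
pose Mt (y : 'rV[R]_4) : 'M[R]_4 := \matrix_(i, k) coform e i (param c y) (vec_of c (param c y) (delta_mx 0 k)).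
pose wt (y : 'rV[R]_4) : 'rV[R]_4 := \row_k w (param c y) (vec_of c (param c y) (delta_mx 0 k)).
have pt y : U y -> [/\ A (param c y), B (param c y) & chart_at (M := Sigma) (param c y) c].
  by move=> [/(cimgP hS ac)[Ay cy _] /(cimgP hS ac)[By _ _]].
have lin y (z : form Sigma) (B' : set (mpoint Sigma)) (b : 'rV[R]_4) : U y -> B' (param c y) -> smooth_form B' z ->
    z (param c y) (vec_of c (param c y) b) = \sum_k b 0 k * z (param c y) (vec_of c (param c y) (delta_mx 0 k)).
  move=> Uy B'y sz; have [Ay By hy] := pt y Uy.
  have tk k := tangent_vec_of hS (delta_mx 0 k) hy.
  have [tS <-] := @coform_comb (param c y) _ B' (fun k => b 0 k) _ B'y sz tk; congr (z _ _).
  apply: (tangent_eq (tangent_vec_of hS b hy) tS hy).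
  rewrite (vec_ofE hS b hy) [LHS]row_sum_delta.
  have -> (f : 'I_4 -> tfam Sigma) : (\sum_k f k) c = \sum_k f k c by rewrite fct_sumE.
  by apply: eq_bigr => k _; rewrite -[RHS]/(b 0 k *: vec_of c (param c y) (delta_mx 0 k) c) (vec_ofE hS _ hy).
have uM y : U y -> Mt y \in unitmx.
  move=> Uy; have [Ay By hy] := pt y Uy; rewrite -unitmx_tr -row_free_unit.
  apply: inj_row_free => b bM.
  rewrite -(vec_ofE hS b hy); have t0 := tangent_vec_of hS 0 hy.
  have -> : vec_of c (param c y) b = vec_of c (param c y) 0.
    apply: (coform_inj Ay (tangent_vec_of hS b hy) t0) => i.
    rewrite !(lin y _ A _ Uy Ay (smooth_coform i)) [RHS]big1 => [|k _]; last by rewrite mxE mul0r.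
    have := congr1 (fun z : 'rV[R]_4 => z 0 i) bM; rewrite !mxE => {2}<-.
    by apply: eq_bigr => k _; rewrite !mxE.
  by rewrite (vec_ofE hS).
have E y : U y -> w (param c y) (dual (param c y) j) = (wt y *m invmx (Mt y)) 0 j.
  move=> Uy; have [Ay By hy] := pt y Uy.
  suff H : wt y = (\row_j w (param c y) (dual (param c y) j)) *m Mt y.
    by rewrite H mulmxK ?uM// mxE.
  apply/rowP => k; rewrite !mxE (form_expand Ay By sw (tangent_vec_of hS _ hy)).
  by apply: eq_bigr => i _; rewrite !mxE.
have S : smooth U (fun y => (wt y *m invmx (Mt y)) 0 j).
  apply: smooth_coord => //; apply: smooth_mulmx => //.
    apply: smooth_row => // k; have [_ sk] := sw.
    have := sk c ac (delta_mx 0 k) => s.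
    apply: smooth_ext oU _ (smooth_sub _ s); first by move=> y _; rewrite mxE.
    by move=> y [].
  move=> i k; apply: smooth_invmx => // i' k'.
  have [_ sk] := smooth_coform i'; have := sk c ac (delta_mx 0 k') => s.
  apply: smooth_ext oU _ (smooth_sub _ s); first by move=> y _; rewrite mxE.
  by move=> y [].
apply: (@smooth_differentiable _ _ _ U) => //.
by apply: smooth_ext oU _ S => y Uy /=; rewrite E.
Qed.

End Dual.

Lemma structure_values (M : premanifold R 4) (B : set (mpoint M)) (e : coframing M)
    I J1 J2 K A1 A2 S0 S1 S2 x v w :
  structure_equations B e I J1 J2 K A1 A2 S0 S1 S2 -> B x ->
  tangent x v -> tangent x w ->
  let a1 := form_eta1 e x v in let a2 := form_eta2 e x v in
  let a3 := form_eta3 e x v in let a4 := form_phi e x v in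
  let b1 := form_eta1 e x w in let b2 := form_eta2 e x w in
  let b3 := form_eta3 e x w in let b4 := form_phi e x w in
  [/\ dext (form_eta1 e) x v w = (a2 * b4 - b2 * a4) + A1 x * (a2 * b3 - b2 * a3)
        + (A2 x + 2^-1 * I x * K x) * (a3 * b1 - b3 * a1) + J1 x * (a3 * b4 - b3 * a4),
      dext (form_eta2 e) x v w = - (a1 * b4 - b1 * a4)
        + (A2 x - 2^-1 * I x * K x) * (a2 * b3 - b2 * a3) - A1 x * (a3 * b1 - b3 * a1)
        + J2 x * (a3 * b4 - b3 * a4) + I x * (a2 * b4 - b2 * a4)
    & dext (form_eta3 e) x v w = (a1 * b2 - b1 * a2) + I x * (a3 * b4 - b3 * a4)].
Proof. by move=> H Bx tv tw; have [-> -> -> _] := H x Bx v w tv tw. Qed.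

Section Gauge.
Variables (A A' : set (mpoint Sigma)) (e e' : coframing Sigma).
Hypotheses (ae : adapted0 A e) (ae' : adapted0 A' e').
Variables (I J1 J2 K A1 A2 S0 S1 S2 : mpoint Sigma -> R).
Variables (I' J1' J2' K' A1' A2' S0' S1' S2' : mpoint Sigma -> R).
Hypothesis se : structure_equations A e I J1 J2 K A1 A2 S0 S1 S2.
Hypothesis se' : structure_equations A' e' I' J1' J2' K' A1' A2' S0' S1' S2'.
Hypotheses (pe : positive o A e) (pe' : positive o A' e').
Variable d : chart R (mpoint Sigma) 4.
Hypothesis ad : atlas Sigma d.

Let B := A `&` A' `&` dom d.

Lemma chart_gauge x : B x -> chart_at (M := Sigma) x d.
Proof. by move=> [_ dx]. Qed.

Lemma mopen_gauge : mopen B.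
Proof.
have oA : mopen A by have [[]] := ae.
have oA' : mopen A' by have [[]] := ae'.
split; first by move=> x [[Ax _] _]; exact: oA.1.
move=> c ac; have -> : cimg c B = cimg c A `&` cimg c A' `&` cimg c (dom d).
  apply/seteqP; split=> y.
    by move=> [x [[[Ax A'x] dx] cx] <-]; split; [split|]; exact: cimg_coord.
  move=> [[/(cimgP hS ac)[Ay cy E] /(cimgP hS ac)[A'y _ _]] /(cimgP hS ac)[dy _ _]].
  by exists (param c y).
apply: openI; last exact: (open_overlap hS).
by apply: openI; [exact: oA.2|exact: oA'.2].
Qed.

Lemma smooth_form_restrict (B' : set (mpoint Sigma)) w : B `<=` B' -> smooth_form B' w ->
  smooth_form B w.
Proof.
move=> BB [L sw]; split; first by move=> x /BB; exact: L.
move=> c ac b; apply: smooth_sub (sw c ac b) => y [x [Bx cx] <-].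
by exists x => //; split=> //; exact: BB.
Qed.

(** The matrix of [e'] with respect to [e]. The forms [eta1], [eta2], [eta3]
    of two 0-adapted coframings agree on vertical and on monic vectors, and
    those called [eta3] have the same kernel; this gives seven of its
    entries, and the structure equations determine the others. *)
Definition gauge (i j : 'I_4) (x : mpoint Sigma) : R := coform e' i x (dual e x j).

Lemma tangent_dual x j : B x -> tangent x (dual e x j).
Proof. by move=> [[Ax _] _]; have [] := dualP ae j Ax. Qed.

Lemma coform_dual x i j : B x -> coform e i x (dual e x j) = (i == j)%:R.
Proof. by move=> [[Ax _] _]; have [_] := dualP ae j Ax. Qed.

Lemma gauge_zeros x : B x ->
  [/\ gauge k0 k0 x = 1, gauge k1 k0 x = 0 & gauge k2 k0 x = 0] /\
  [/\ gauge k0 k3 x = 0, gauge k1 k3 x = 0, gauge k2 k3 x = 0 & gauge k2 k1 x = 0].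
Proof.
move=> Bx; have [[Ax A'x] dx] := Bx; have hd := chart_gauge Bx.
have t := tangent_dual _ Bx; have C i j := coform_dual i j Bx.
have K1 := coframe_kernel hX D_contact F_sub_Finsler ae Ax hd (t k0) (C k1 k0) (C k2 k0).
rewrite [eta1 _ _](C k0 k0) /= in K1.
have [m1 m2 m3] := coframe_monic_multiple hX D_contact F_sub_Finsler ae' A'x hd (t k0) K1.
have K4 := coframe_kernel hX D_contact F_sub_Finsler ae Ax hd (t k3) (C k1 k3) (C k2 k3).
rewrite [eta1 _ _](C k0 k3) /= in K4.
have [n1 n2 n3] := coframe_monic_multiple hX D_contact F_sub_Finsler ae' A'x hd (t k3) K4.
split; first by split.
split=> //.
have [_ _ _ _ k] := ae; have [_ _ _ _ k'] := ae'.
have D2 : D (base x) (dbase x (dual e x k1)) by apply/(k x _ Ax (t k1)); exact: (C k2 k1).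
exact: ((k' x _ A'x (t k1)).2 D2).
Qed.

Lemma gauge_expand i x v : B x -> tangent x v ->
  coform e' i x v = gauge i k0 x * form_eta1 e x v + gauge i k1 x * form_eta2 e x v +
    gauge i k2 x * form_eta3 e x v + gauge i k3 x * form_phi e x v.
Proof.
move=> [[Ax A'x] dx] tv; rewrite (form_expand ae Ax A'x (smooth_coform ae' i) tv).
rewrite !big_ord_recl big_ord0 addr0 !addrA.
by congr (_ * _ + _ * _ + _ * _ + _ * _); rewrite /gauge; congr (coform _ _ _ (dual _ _ _)); apply/val_inj.
Qed.

Lemma dext_gauge i x v z : B x -> tangent x v -> tangent x z ->
  dext (coform e' i) x v z =
    (pderive x v (gauge i k0) * form_eta1 e x z - pderive x z (gauge i k0) * form_eta1 e x v
       + gauge i k0 x * dext (form_eta1 e) x v z) +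
    (pderive x v (gauge i k1) * form_eta2 e x z - pderive x z (gauge i k1) * form_eta2 e x v
       + gauge i k1 x * dext (form_eta2 e) x v z) +
    (pderive x v (gauge i k2) * form_eta3 e x z - pderive x z (gauge i k2) * form_eta3 e x v
       + gauge i k2 x * dext (form_eta3 e) x v z) +
    (pderive x v (gauge i k3) * form_phi e x z - pderive x z (gauge i k3) * form_phi e x v
       + gauge i k3 x * dext (form_phi e) x v z).
Proof.
move=> Bx tv tz; have hd := chart_gauge Bx; have hc := some_chartP hd.
have [[Ax A'x] dx] := Bx; have oA' : mopen A' by have [[]] := ae'.
have [s1 s2 s3 s4] := coframe_smooth ae.
have BA : B `<=` A by move=> y [[]].
have dg j : differentiable (gauge i j \o param (some_chart x)) (coord (some_chart x) x).
  exact: (smooth_coefficient ae j hc oA' Ax A'x (smooth_coform ae' i)).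
apply: (dext_combination hS hd mopen_gauge Bx) => //.
  by split; exact: smooth_form_restrict BA _.
by move=> y By w tw; exact: gauge_expand.
Qed.

Lemma pderive_gauge i j x v (k : R) : B x -> (forall y, B y -> gauge i j y = k) ->
  pderive x v (gauge i j) = 0.
Proof. by move=> Bx H; exact: (pderive_const hS (chart_gauge Bx) mopen_gauge Bx v H). Qed.

Lemma pderive_gauge_zeros x v : B x ->
  [/\ pderive x v (gauge k0 k0) = 0, pderive x v (gauge k1 k0) = 0
    & pderive x v (gauge k2 k0) = 0] /\
  [/\ pderive x v (gauge k0 k3) = 0, pderive x v (gauge k1 k3) = 0,
      pderive x v (gauge k2 k3) = 0 & pderive x v (gauge k2 k1) = 0].
Proof.
move=> Bx; split; split.
- by apply: (pderive_gauge v Bx (k := 1)) => y /gauge_zeros[[]].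
- by apply: (pderive_gauge v Bx (k := 0)) => y /gauge_zeros[[]].
- by apply: (pderive_gauge v Bx (k := 0)) => y /gauge_zeros[[]].
- by apply: (pderive_gauge v Bx (k := 0)) => y /gauge_zeros[_ []].
- by apply: (pderive_gauge v Bx (k := 0)) => y /gauge_zeros[_ []].
- by apply: (pderive_gauge v Bx (k := 0)) => y /gauge_zeros[_ []].
- by apply: (pderive_gauge v Bx (k := 0)) => y /gauge_zeros[_ []].
Qed.

Let simp01 := (mulr0, mul0r, mulr1, mul1r, addr0, add0r, subr0, sub0r, oppr0).

Local Notation dl k a := (((k : 'I_4) == (a : 'I_4))%:R : R).

(** The three comparisons below equate two expressions of [d eta1], [d eta2],
    [d eta3] of the second coframing on two vectors of the dual frame of the
    first: its own structure equations, and the Leibniz rule. *)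
Lemma compare_eta1 (a b : 'I_4) x : B x ->
  (gauge k1 a x * gauge k3 b x - gauge k1 b x * gauge k3 a x)
  + A1' x * (gauge k1 a x * gauge k2 b x - gauge k1 b x * gauge k2 a x)
  + (A2' x + 2^-1 * I' x * K' x) * (gauge k2 a x * gauge k0 b x - gauge k2 b x * gauge k0 a x)
  + J1' x * (gauge k2 a x * gauge k3 b x - gauge k2 b x * gauge k3 a x) =
  ((dl k1 a * dl k3 b - dl k1 b * dl k3 a) + A1 x * (dl k1 a * dl k2 b - dl k1 b * dl k2 a)
  + (A2 x + 2^-1 * I x * K x) * (dl k2 a * dl k0 b - dl k2 b * dl k0 a)
  + J1 x * (dl k2 a * dl k3 b - dl k2 b * dl k3 a)) +
  (pderive x (dual e x a) (gauge k0 k1) * dl k1 b - pderive x (dual e x b) (gauge k0 k1) * dl k1 a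
   + gauge k0 k1 x * (- (dl k0 a * dl k3 b - dl k0 b * dl k3 a)
   + (A2 x - 2^-1 * I x * K x) * (dl k1 a * dl k2 b - dl k1 b * dl k2 a)
   - A1 x * (dl k2 a * dl k0 b - dl k2 b * dl k0 a)
   + J2 x * (dl k2 a * dl k3 b - dl k2 b * dl k3 a) + I x * (dl k1 a * dl k3 b - dl k1 b * dl k3 a))) +
  (pderive x (dual e x a) (gauge k0 k2) * dl k2 b - pderive x (dual e x b) (gauge k0 k2) * dl k2 a
   + gauge k0 k2 x * (dl k0 a * dl k1 b - dl k0 b * dl k1 a + I x * (dl k2 a * dl k3 b - dl k2 b * dl k3 a))).
Proof.
move=> Bx; have [[Ax A'x] dx] := Bx; have C i j := coform_dual i j Bx.
have G := dext_gauge k0 Bx (tangent_dual a Bx) (tangent_dual b Bx).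
have [E1 E2 E3] := structure_values se Ax (tangent_dual a Bx) (tangent_dual b Bx).
have [E1' E2' E3'] := structure_values se' A'x (tangent_dual a Bx) (tangent_dual b Bx).
have [[z1 _ _] [z2 _ _ _]] := gauge_zeros Bx.
have [[p1 _ _] [p2 _ _ _]] := pderive_gauge_zeros (dual e x a) Bx.
have [[q1 _ _] [q2 _ _ _]] := pderive_gauge_zeros (dual e x b) Bx.
rewrite E1 E2 E3 p1 p2 q1 q2 z1 z2 !simp01 in G.
rewrite ![form_eta1 e x _](C k0) ![form_eta2 e x _](C k1) ![form_eta3 e x _](C k2) ![form_phi e x _](C k3) in G.
exact: etrans (esym E1') G.
Qed.

Lemma compare_eta2 (a b : 'I_4) x : B x ->
  - (gauge k0 a x * gauge k3 b x - gauge k0 b x * gauge k3 a x)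
  + (A2' x - 2^-1 * I' x * K' x) * (gauge k1 a x * gauge k2 b x - gauge k1 b x * gauge k2 a x)
  - A1' x * (gauge k2 a x * gauge k0 b x - gauge k2 b x * gauge k0 a x)
  + J2' x * (gauge k2 a x * gauge k3 b x - gauge k2 b x * gauge k3 a x)
  + I' x * (gauge k1 a x * gauge k3 b x - gauge k1 b x * gauge k3 a x) =
  (pderive x (dual e x a) (gauge k1 k1) * dl k1 b - pderive x (dual e x b) (gauge k1 k1) * dl k1 a
   + gauge k1 k1 x * (- (dl k0 a * dl k3 b - dl k0 b * dl k3 a)
   + (A2 x - 2^-1 * I x * K x) * (dl k1 a * dl k2 b - dl k1 b * dl k2 a)
   - A1 x * (dl k2 a * dl k0 b - dl k2 b * dl k0 a)
   + J2 x * (dl k2 a * dl k3 b - dl k2 b * dl k3 a) + I x * (dl k1 a * dl k3 b - dl k1 b * dl k3 a))) +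
  (pderive x (dual e x a) (gauge k1 k2) * dl k2 b - pderive x (dual e x b) (gauge k1 k2) * dl k2 a
   + gauge k1 k2 x * (dl k0 a * dl k1 b - dl k0 b * dl k1 a + I x * (dl k2 a * dl k3 b - dl k2 b * dl k3 a))).
Proof.
move=> Bx; have [[Ax A'x] dx] := Bx; have C i j := coform_dual i j Bx.
have G := dext_gauge k1 Bx (tangent_dual a Bx) (tangent_dual b Bx).
have [E1 E2 E3] := structure_values se Ax (tangent_dual a Bx) (tangent_dual b Bx).
have [E1' E2' E3'] := structure_values se' A'x (tangent_dual a Bx) (tangent_dual b Bx).
have [[_ z1 _] [_ z2 _ _]] := gauge_zeros Bx.
have [[_ p1 _] [_ p2 _ _]] := pderive_gauge_zeros (dual e x a) Bx.
have [[_ q1 _] [_ q2 _ _]] := pderive_gauge_zeros (dual e x b) Bx.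
rewrite E1 E2 E3 p1 p2 q1 q2 z1 z2 !simp01 in G.
rewrite ![form_eta1 e x _](C k0) ![form_eta2 e x _](C k1) ![form_eta3 e x _](C k2) ![form_phi e x _](C k3) in G.
exact: etrans (esym E2') G.
Qed.

Lemma compare_eta3 (a b : 'I_4) x : B x ->
  (gauge k0 a x * gauge k1 b x - gauge k0 b x * gauge k1 a x)
  + I' x * (gauge k2 a x * gauge k3 b x - gauge k2 b x * gauge k3 a x) =
  pderive x (dual e x a) (gauge k2 k2) * dl k2 b - pderive x (dual e x b) (gauge k2 k2) * dl k2 a
   + gauge k2 k2 x * (dl k0 a * dl k1 b - dl k0 b * dl k1 a + I x * (dl k2 a * dl k3 b - dl k2 b * dl k3 a)).
Proof.
move=> Bx; have [[Ax A'x] dx] := Bx; have C i j := coform_dual i j Bx.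
have G := dext_gauge k2 Bx (tangent_dual a Bx) (tangent_dual b Bx).
have [E1 E2 E3] := structure_values se Ax (tangent_dual a Bx) (tangent_dual b Bx).
have [E1' E2' E3'] := structure_values se' A'x (tangent_dual a Bx) (tangent_dual b Bx).
have [[_ _ z1] [_ _ z2 z3]] := gauge_zeros Bx.
have [[_ _ p1] [_ _ p2 p3]] := pderive_gauge_zeros (dual e x a) Bx.
have [[_ _ q1] [_ _ q2 q3]] := pderive_gauge_zeros (dual e x b) Bx.
rewrite E1 E2 E3 p1 p2 p3 q1 q2 q3 z1 z2 z3 !simp01 in G.
rewrite ![form_eta1 e x _](C k0) ![form_eta2 e x _](C k1) ![form_eta3 e x _](C k2) ![form_phi e x _](C k3) in G.
exact: etrans (esym E3') G.
Qed.

Local Ltac generalize_reals x :=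
  repeat match goal with
  | |- context [pderive ?u ?v ?f] => generalize (pderive u v f)
  | |- context [gauge ?i ?j x] => generalize (gauge i j x)
  end;
  generalize (A1 x) (A2 x) (I x) (K x) (J1 x) (J2 x);
  generalize (A1' x) (A2' x) (I' x) (K' x) (J1' x) (J2' x).

(** The coefficient of [eta1 /\ phi] in [d eta1] is zero for both coframings. *)
Lemma gauge_eta1_eta2 x : B x -> gauge k0 k1 x = 0.
Proof.
move=> Bx; have [[z1 z2 z3] [z4 z5 z6 z7]] := gauge_zeros Bx.
have := compare_eta1 k0 k3 Bx; rewrite /= z1 z2 z3 z4 z5 z6.
by generalize_reals x => *; lra.
Qed.

(** The area forms of the two coframings on the oriented planes differ by
    this factor. *)
Lemma gauge_eta2_positive x : B x -> 0 < gauge k1 k1 x.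
Proof.
move=> Bx; have [[Ax A'x] dx] := Bx; have hd := chart_gauge Bx.
have [bx _ _ _] := indicatrix_point hX D_contact hd.
have [A0 [v1 [v2 [A0x lf H]]]] := D_oriented bx.
have [_ [t1 _] [t2 _] span _] := lf.
have [full _] := dbase_full hX D_contact F_sub_Finsler hd.
have [v tv Ev] := full _ (t1 _ A0x); have [w tw Ew] := full _ (t2 _ A0x).
have ov : o (base x) (dbase x v) (dbase x w).
  apply/(H _ A0x); exists 1, 0, 0, 1; rewrite Ev Ew !scale1r !scale0r addr0 add0r.
  by rewrite !mulr1 mulr0 subr0 ltr01.
have P := pe Ax tv tw ov; have P' := pe' A'x tv tw ov.
have [_ _ _ _ k] := ae.
have v3 : form_eta3 e x v = 0.
  by apply: (k x v Ax tv).2; apply/(span _ A0x); exists 1, 0; rewrite Ev scale1r scale0r addr0.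
have w3 : form_eta3 e x w = 0.
  by apply: (k x w Ax tw).2; apply/(span _ A0x); exists 0, 1; rewrite Ew scale1r scale0r add0r.
have [[z1 z2 z3] [z4 z5 z6 z7]] := gauge_zeros Bx.
have G i u tu := @gauge_expand i x u Bx tu.
have := G k0 _ tv; have := G k0 _ tw; have := G k1 _ tv; have := G k1 _ tw.
rewrite v3 w3 z1 z2 z4 z5 !simp01 => E1w E1v E0w E0v.
have : wedge (form_eta1 e') (form_eta2 e') x v w =
   gauge k1 k1 x * wedge (form_eta1 e) (form_eta2 e) x v w.
  rewrite /wedge [form_eta1 e' x v]E0v [form_eta1 e' x w]E0w [form_eta2 e' x v]E1v [form_eta2 e' x w]E1w.
  by move: (gauge k0 k1 x) (gauge k1 k1 x) (form_eta1 e x v) (form_eta1 e x w) (form_eta2 e x v) (form_eta2 e x w) => *; ring.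
by move=> E; move: P'; rewrite E pmulr_lgt0.
Qed.

(** The products [eta1 /\ eta2] in [d eta3], [eta1 /\ phi] in [d eta2] and
    [eta2 /\ phi] in [d eta1] have normalised coefficients, which leaves a
    sign, fixed by the orientation. *)
Lemma gauge_diagonal x : B x ->
  [/\ gauge k1 k1 x = 1, gauge k2 k2 x = 1 & gauge k3 k3 x = 1].
Proof.
move=> Bx; have [[z1 z2 z3] [z4 z5 z6 z7]] := gauge_zeros Bx.
have r := gauge_eta1_eta2 Bx; have p0 := gauge_eta2_positive Bx.
have pr v : pderive x v (gauge k0 k1) = 0.
  by apply: (pderive_gauge v Bx (k := 0)) => y; exact: gauge_eta1_eta2.
have E1 : gauge k1 k1 x = gauge k2 k2 x.
  have := compare_eta3 k0 k1 Bx; rewrite /= z1 z2 z3 z7.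
  by generalize_reals x => *; lra.
have E2 : gauge k3 k3 x = gauge k1 k1 x.
  have := compare_eta2 k0 k3 Bx; rewrite /= z1 z2 z3 z4 z5 z6.
  by generalize_reals x => *; lra.
have E3 : gauge k1 k1 x * gauge k3 k3 x = 1.
  have := compare_eta1 k1 k3 Bx; rewrite /= z5 z6 z7 r !pr.
  by generalize_reals x => *; lra.
have E : gauge k1 k1 x = 1.
  apply/eqP; rewrite -(@eqrXn2 _ 2%N)// ?ltW//.
  by rewrite expr1n expr2 -{2}E2 E3.
by rewrite E2 -E1 E.
Qed.

(** Comparing the remaining normalised coefficients gives a homogeneous
    linear system that has only the zero solution, see [skew_zero]. *)
Lemma gauge_skew x : B x -> [/\ gauge k0 k2 x = 0, gauge k1 k2 x = 0,
  gauge k3 k0 x = 0 & gauge k3 k1 x = 0].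
Proof.
move=> Bx; have [[z1 z2 z3] [z4 z5 z6 z7]] := gauge_zeros Bx.
have r := gauge_eta1_eta2 Bx; have [p1 c1 f1] := gauge_diagonal Bx.
have pr v : pderive x v (gauge k0 k1) = 0.
  by apply: (pderive_gauge v Bx (k := 0)) => y; exact: gauge_eta1_eta2.
have pp v : pderive x v (gauge k1 k1) = 0.
  by apply: (pderive_gauge v Bx (k := 1)) => y /gauge_diagonal[].
have pc v : pderive x v (gauge k2 k2) = 0.
  by apply: (pderive_gauge v Bx (k := 1)) => y /gauge_diagonal[].
have E1 : gauge k0 k2 x = - gauge k3 k0 x.
  have := compare_eta1 k0 k1 Bx; rewrite /= z1 z2 z3 z7 r !pr p1.
  by generalize_reals x => *; lra.
have E2 : gauge k1 k2 x = - gauge k3 k1 x - I' x * gauge k3 k0 x.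
  have := compare_eta2 k0 k1 Bx; rewrite /= z1 z2 z3 z7 r !pp p1.
  by generalize_reals x => *; lra.
have E3 : I' x = I x.
  have := compare_eta3 k2 k3 Bx; rewrite /= z4 z5 z6 c1 f1 !pc.
  by generalize_reals x => *; lra.
have E4 : gauge k1 k2 x = I' x * gauge k3 k0 x.
  have := compare_eta3 k2 k0 Bx; rewrite /= z1 z2 z3 c1 !pc.
  by generalize_reals x => *; lra.
have E5 : gauge k0 k2 x = - (I' x * gauge k3 k1 x).
  have := compare_eta3 k1 k2 Bx; rewrite /= z7 r c1 p1 !pc.
  by generalize_reals x => *; lra.
exact: skew_zero E1 E2 E4 E5.
Qed.

(** The function [A1] occurs with opposite signs in [d eta1] and [d eta2]. *)
Lemma gauge_last x : B x -> gauge k3 k2 x = 0.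
Proof.
move=> Bx; have [[z1 z2 z3] [z4 z5 z6 z7]] := gauge_zeros Bx.
have r := gauge_eta1_eta2 Bx; have [p1 c1 f1] := gauge_diagonal Bx.
have [s0 q0 g1 g2] := gauge_skew Bx.
have pr v : pderive x v (gauge k0 k1) = 0.
  by apply: (pderive_gauge v Bx (k := 0)) => y; exact: gauge_eta1_eta2.
have pp v : pderive x v (gauge k1 k1) = 0.
  by apply: (pderive_gauge v Bx (k := 1)) => y /gauge_diagonal[].
have ps v : pderive x v (gauge k0 k2) = 0.
  by apply: (pderive_gauge v Bx (k := 0)) => y /gauge_skew[].
have pq v : pderive x v (gauge k1 k2) = 0.
  by apply: (pderive_gauge v Bx (k := 0)) => y /gauge_skew[].
have E1 : gauge k3 k2 x + A1' x = A1 x.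
  have := compare_eta1 k1 k2 Bx; rewrite /= z7 r c1 p1 s0 q0 g2 !pr !ps.
  by generalize_reals x => *; lra.
have E2 : gauge k3 k2 x - A1' x = - A1 x.
  have := compare_eta2 k2 k0 Bx; rewrite /= z1 z2 z3 c1 p1 s0 q0 g1 !pp !pq.
  by generalize_reals x => *; lra.
by move: E1 E2; generalize_reals x => *; lra.
Qed.

Lemma gauge_id i x v : B x -> tangent x v -> coform e' i x v = coform e i x v.
Proof.
move=> Bx tv; rewrite (gauge_expand i Bx tv).
have [[z1 z2 z3] [z4 z5 z6 z7]] := gauge_zeros Bx.
have r := gauge_eta1_eta2 Bx; have [p1 c1 f1] := gauge_diagonal Bx.
have [s0 q0 g1 g2] := gauge_skew Bx; have l := gauge_last Bx.
have El : forall j : 'I_4, [\/ j = k0, j = k1, j = k2 | j = k3].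
  move=> [[|[|[|[|//]]]] Hi]; [constructor 1|constructor 2|constructor 3|constructor 4]; exact: val_inj.
have [->|->|->|->] := El i; rewrite ?z1 ?z2 ?z3 ?z4 ?z5 ?z6 ?z7 ?r ?p1 ?c1 ?f1 ?s0 ?q0 ?g1 ?g2 ?l
  !mul0r ?mul1r ?addr0 ?add0r //.
Qed.

End Gauge.

(** This makes the fibres of [B4] over the indicatrix bundle have at most one
    point, so that two charts of [B4] overlap over the whole overlap of the
    underlying domains. *)
Lemma coframe_unique A A' e e' u d : adapted4 A e -> positive o A e ->
  adapted4 A' e' -> positive o A' e' -> A u -> A' u -> chart_at (M := Sigma) u d ->
  e u = e' u.
Proof.
move=> [ae [I [J1 [J2 [K [A1 [A2 [S0 [S1 [S2 se]]]]]]]]]] pe.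
move=> [ae' [I' [J1' [J2' [K' [A1' [A2' [S0' [S1' [S2' se']]]]]]]]]] pe' Au A'u [ad du].
have H i v : coform e' i u v = coform e i u v.
  have [tv|nt] := pselect (tangent (M := Sigma) u v).
    exact: (gauge_id ae ae' se se' pe pe' ad i (conj (conj Au A'u) du) tv).
  have [_ z] := (smooth_coform ae i).1 u Au; have [_ z'] := (smooth_coform ae' i).1 u A'u.
  by rewrite z// z'.
have E1 : eta1 (e u) = eta1 (e' u) by apply/funext => v; exact: esym (H k0 v).
have E2 : eta2 (e u) = eta2 (e' u) by apply/funext => v; exact: esym (H k1 v).
have E3 : eta3 (e u) = eta3 (e' u) by apply/funext => v; exact: esym (H k2 v).
have E4 : phi (e u) = phi (e' u) by apply/funext => v; exact: esym (H k3 v).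
by case: (e u) (e' u) E1 E2 E3 E4 => [? ? ? ?] [? ? ? ?] /= -> -> -> ->.
Qed.

End Uniqueness.

(** * Forms along maps and the manifold of coframes *)
Section Derivatives.
Context {R : realType} {V : normedModType R}.

Lemma D_coord n (y : V -> 'rV[R]_n) p v k : differentiable y p ->
  differentiable (fun q => y q 0 k) p /\ 'D_v (fun q => y q 0 k) p = ('D_v y p) 0 k.
Proof.
move=> dy; have lin : linear (fun x : 'rV[R]_n => x 0 k) by move=> c a b; rewrite !mxE.
pose L := mk_linear lin; have cL : continuous L by exact: linear_rV_continuous.
have dL x : differentiable L x by exact: linear_differentiable.
split; first exact: (differentiable_comp (f := y) (g := L)).
have := D_comp v dy (dL (y p)); rewrite diff_lin//; exact.
Qed.

Lemma D_sum n (h : 'I_n -> V -> R) p v : (forall i, differentiable (h i) p) ->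
  'D_v (fun q => \sum_i h i q) p = \sum_i 'D_v (h i) p.
Proof.
move=> dh; rewrite -derive_sum => [|i]; last exact/diff_derivable/dh.
by congr ('D_v _ p); apply/funext => q; rewrite fct_sumE.
Qed.

Lemma D_mul (g h : V -> R) p v : differentiable g p -> differentiable h p ->
  'D_v (fun q => g q * h q) p = g p * 'D_v h p + h p * 'D_v g p.
Proof. by move=> dg dh; have := deriveM (diff_derivable (v := v) dg) (diff_derivable (v := v) dh). Qed.

End Derivatives.

Lemma commutator_regroup (S : comRingType) (a b e f g : S) : f = g ->
  a - b = a + e * g - (b + e * f).
Proof. by move=> ->; ring. Qed.

Section SmoothForms.
Context {R : realType} {n : nat} {M : premanifold R n}.
Hypothesis hM : regular_atlas M.

(** Linearity is asked on tangent vectors, where the canonical forms of the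
    coframe bundle have it by construction. *)
Definition smooth_1form (w : form M) : Prop :=
  (forall x c (k : R) v v', chart_at x c -> tangent x v -> tangent x v' ->
     w x (k *: v + v') = k * w x v + w x v') /\
  (forall c, atlas M c -> forall a,
     smooth (cimg c setT) (fun y => w (param c y) (vec_of c (param c y) a))).

Lemma form_component_expand w c x (a : 'rV[R]_n) : smooth_1form w -> chart_at x c ->
  w x (vec_of c x a) = \sum_k a 0 k * w x (vec_of c x (delta_mx 0 k)).
Proof.
move=> [L _] hc; have t b := tangent_vec_of hM b hc.
have w0 : w x 0 = 0.
  have t0 : tangent x (0 : tfam M) by have := t 0; rewrite vec_of0.
  by have := L x c (- 1) _ _ hc t0 t0; rewrite scaler0 addr0 mulN1r addNr.
rewrite {1}(row_sum_delta a).
suff [_ //] : tangent x (vec_of c x (\sum_k a 0 k *: delta_mx 0 k)) /\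
   w x (vec_of c x (\sum_k a 0 k *: delta_mx 0 k)) =
  \sum_k a 0 k * w x (vec_of c x (delta_mx 0 k)).
elim: (index_enum _) => [|i r [IHt IHw]].
  by rewrite !big_nil; split; [exact: t|rewrite vec_of0].
by rewrite !big_cons; split; [exact: t|rewrite vec_ofP (L x c)// IHw].
Qed.

Section Pulled.
Context {V : normedModType R}.
Variables (O : set V) (f : V -> mpoint M) (w : form M).
Hypotheses (oO : open O) (sf : smooth_into O f) (sw : smooth_1form w).

Definition pulled (v q : V) : R := w (f q) (pushvec f q v).

Lemma pulled_chart p c : O p -> chart_at (f p) c ->
  exists U, [/\ open U, U p, U `<=` O, smooth U (coord c \o f) &
    (forall q, U q -> cimg c setT (coord c (f q))) /\
    forall v q, U q -> pulled v q = \sum_k ('D_v (coord c \o f) q) 0 k *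
      w (param c (coord c (f q))) (vec_of c (param c (coord c (f q))) (delta_mx 0 k))].
Proof.
move=> Op hc; have [U [oU Up UO dU sU]] := smooth_into_chart hM sf Op hc.
have [ac _] := hc; exists U; split=> //; split=> [q Uq|v q Uq].
  by apply: cimg_coord => //; exact: dU.
have hq : chart_at (f q) c by split=> //; exact: dU.
rewrite /pulled (pushvec_vec_of hM v sf (UO _ Uq) hq) (form_component_expand _ sw hq).
rewrite (paramK hM ac (dU _ Uq)); apply: eq_bigr => k _; congr (_ * _).
by rewrite deriveE//; exact: smooth_differentiable sU Uq.
Qed.

Lemma smooth_pulled v : smooth O (pulled v).
Proof.
apply: smooth_local => p Op; have [c [hc _]] := sf Op.
have [U [oU Up UO sU [iU E]]] := pulled_chart Op hc; exists U; split=> //.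
apply: (smooth_ext oU (fun q Uq => esym (E v q Uq))).
apply: smooth_sum => // k; apply: smoothM => //.
  by apply: smooth_coord => //; exact: smooth_D.
apply: (@smooth_comp _ _ _ U (cimg c setT) (coord c \o f)
  (fun y => w (param c y) (vec_of c (param c y) (delta_mx 0 k)))) => //.
  exact: has_coords_rV.
by apply: sw.2; case: hc.
Qed.

(** The exterior derivative on two velocities is a commutator of derivatives:
    the second derivatives of the parametrisation cancel by symmetry. *)
Lemma dext_pushvec p v v' : O p ->
  dext w (f p) (pushvec f p v) (pushvec f p v') = 'D_v (pulled v') p - 'D_v' (pulled v) p.
Proof.
move=> Op; have [c0 [hc0 _]] := sf Op; have hc := some_chartP hc0.
have [ac cp] := hc; set c := some_chart (f p) in hc ac cp *.
have [U [oU Up UO sU [iU E]]] := pulled_chart Op hc.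
pose y := coord c \o f; pose C k z := w (param c z) (vec_of c (param c z) (delta_mx 0 k)).
have sC k : smooth (cimg c setT) (C k) by apply: sw.2.
have oT := open_cimgT hM ac.
have dC k : differentiable (C k) (y p) by exact: smooth_differentiable (sC k) (iU _ Up).
have dy : differentiable y p by exact: smooth_differentiable sU Up.
have half a b : 'D_a (pulled b) p = \sum_k (('D_b y p) 0 k * 'D_('D_a y p) (C k) (y p) +
    C k (y p) * 'D_a ('D_b (fun q => y q 0 k)) p).
  have sy k : smooth U (fun q => y q 0 k) by exact: smooth_coord.
  have dDy k : differentiable ('D_b (fun q => y q 0 k)) p.
    by apply: (smooth_differentiable _ Up); exact: smooth_D.
  have dCy k : differentiable (C k \o y) p by exact: differentiable_comp.
  have -> : 'D_a (pulled b) p = 'D_a (fun q => \sum_k 'D_b (fun q => y q 0 k) q * (C k \o y) q) p.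
    apply: near_eq_D; apply: filterS (open_near oU Up) => q Uq; rewrite E//.
    apply: eq_bigr => k _; congr (_ * _); apply: esym; apply: (D_coord b k _).2.
    exact: smooth_differentiable sU Uq.
  rewrite D_sum => [|k]; last exact: differentiableM.
  apply: eq_bigr => k _; apply: etrans (D_mul a (dDy k) (dCy k)) _.
  have F1 := (D_coord b k dy).2.
  have F2 : 'D_a (C k \o y) p = 'D_('D_a y p) (C k) (y p).
    exact: etrans (D_comp a dy (dC k)) (esym (deriveE _ (dC k))).
  exact: (congr2 +%R (congr2 *%R F1 F2) (erefl _)).
rewrite !half -sumrB /dext -/c.
have comp a b : 'D_a (fun z => w (param c z) (vec_of c (param c z) b)) (coord c (f p)) =
   \sum_k b 0 k * 'D_a (C k) (y p).
  have -> : 'D_a (fun z => w (param c z) (vec_of c (param c z) b)) (coord c (f p)) =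
     'D_a (fun z => \sum_k b 0 k * C k z) (coord c (f p)).
    apply: near_eq_D; apply: filterS (open_near oT (iU _ Up)) => z /(cimgP hM ac)[_ cz _].
    by rewrite (form_component_expand b sw (conj ac cz)).
  rewrite D_sum => [|k]; last by apply: differentiableM => //; exact: dC.
  by apply: eq_bigr => k _; rewrite D_mul// derive_cst mulr0 addr0.
rewrite !comp -sumrB; apply: eq_bigr => k _.
rewrite !(fun u => pushvecE u hc) -!deriveE//.
have C2 : Ck 2 U (fun q => y q 0 k) by have := smooth_coord k oU sU; exact.
have S := D_sym v v' oU Up C2.
by rewrite -/y; exact: commutator_regroup.
Qed.

End Pulled.
End SmoothForms.

Section CoframeBundle.
Context {R : realType} {X : premanifold R 3}.
Variables (D : mpoint X -> set (tfam X)) (F : mpoint X -> tfam X -> R).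
Variable o : mpoint X -> tfam X -> tfam X -> Prop.
Hypothesis hX : regular_atlas X.
Hypotheses (D_contact : contact D) (F_sub_Finsler : sub_Finsler D F).
Hypothesis D_oriented : orientation D o.

Local Notation Sigma := (indicatrix D F).
Local Notation B := (B4 D F o).
Local Notation toSigma := (@B4_to_Sigma R X D F o).

Let hS : regular_atlas Sigma := regular_indicatrix D F hX.

Lemma cimg_B4_chart A e c : cimg (B4_chart (D := D) (F := F) A e c) setT = cimg c A.
Proof.
apply/seteqP; split=> y.
  by move=> [b [_ [Ab cb _]] <-]; exists b.1.
by move=> [u [Au cu] <-]; exists (u, e u).
Qed.

(** By [coframe_unique] the overlap of two charts of [B4] is cut out by the
    domains in the indicatrix bundle, and the transition maps are the same. *)
Lemma regular_B4 : regular_atlas B.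
Proof.
split.
  move=> _ [A [e [c [ae pe ac ->]]]]; have oA : mopen A by have [[[]]] := ae.
  split.
  - by move=> b [Ab cb be]; exists A, e.
  - move=> [u f] /set_mem[/= Ab cb be]; rewrite (paramK hS ac cb).
    by rewrite -be.
  - by rewrite cimg_B4_chart; exact: oA.2.
move=> _ _ [A [e [c [ae pe ac ->]]]] [A' [e' [c' [ae' pe' ac' ->]]]].
have oA : mopen A by have [[[]]] := ae.
have oA' : mopen A' by have [[[]]] := ae'.
have E : cimg (B4_chart A e c) (dom (B4_chart A' e' c')) =
    cimg c A `&` cimg c A' `&` cimg c (dom c').
  apply/seteqP; split=> y.
    by move=> [b [[A'b c'b be'] [Ab cb be]] <-]; split; [split|]; exact: cimg_coord.
  move=> [[/(cimgP hS ac)[Ay cy E] /(cimgP hS ac)[A'y _ _]] /(cimgP hS ac)[c'y _ _]].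
  exists (param c y, e (param c y)) => //; split=> //; split=> //=.
  exact: (coframe_unique hX D_contact F_sub_Finsler D_oriented ae pe ae' pe' Ay A'y (conj ac cy)).
rewrite E; split.
  apply: openI; last exact: (open_overlap hS).
  by apply: openI; [exact: oA.2|exact: oA'.2].
by apply: smooth_sub (smooth_transition hS ac ac') => y [].
Qed.

Lemma B4_chart_at (b : mpoint B) k : chart_at b k -> exists A e c,
  [/\ adapted4 A e, positive o A e, k = B4_chart A e c &
    [/\ A b.1, chart_at (M := Sigma) b.1 c & b.2 = e b.1]].
Proof.
by move=> [[A [e [c [ae pe ac ->]]]] [Ab cb be]]; exists A, e, c.
Qed.

Lemma smooth_at_toSigma (b : mpoint B) k : chart_at b k -> smooth_at (N := Sigma) toSigma b.
Proof.
move=> hk; exists k, (cimg k setT); split=> //.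
- by apply: (open_cimgT regular_B4); case: hk.
- by apply: cimg_coord => //; case: hk.
have [A [e [c [ae pe -> [Ab [ac cb] be]]]]] := B4_chart_at hk.
have := smooth_into_param hS ac; rewrite cimg_B4_chart.
apply: smooth_into_sub => //; last exact: cimgT.
by have [[[oA _ _ _] _ _ _ _] _] := ae; exact: oA.2.
Qed.

Lemma dmap_toSigma (b : mpoint B) A e c v : chart_at b (B4_chart A e c) -> atlas Sigma c ->
  A `<=` setT -> mopen (M := Sigma) A -> tangent b v ->
  dmap (N := Sigma) toSigma b v = vec_of c b.1 (v (B4_chart A e c)).
Proof.
move=> hk ac _ oA tv; rewrite (dmapE regular_B4 hS tv hk (smooth_at_toSigma hk)).
have [_ [Ab cb be]] := hk.
rewrite -[LHS]/(pushvec (M := Sigma) (param c) (coord c b.1) _).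
have E : param c (coord c b.1) = b.1 by exact: (paramK hS).
apply: etrans (pushvec_param hS (v (B4_chart A e c)) ac (cimg_coord I cb)) _.
by rewrite E.
Qed.

Lemma tangent_toSigma (b : mpoint B) k v : chart_at b k -> tangent b v ->
  tangent (M := Sigma) b.1 (dmap (N := Sigma) toSigma b v).
Proof. by move=> hk tv; exact: (tangent_dmap regular_B4 hS tv (smooth_at_toSigma hk)). Qed.

(** In a chart of the coframe bundle the canonical forms are the forms of a
    local coframing. *)
Lemma smooth_canonical (P : coframe R (tfam Sigma) -> tfam Sigma -> R) :
  (forall A e, adapted0 A e -> smooth_form A (fun u => P (e u))) ->
  smooth_1form (fun b : mpoint B => fun v => P b.2 (dmap (N := Sigma) toSigma b v)).
Proof.
move=> HP; split.
  move=> b k r v v' hk tv tv'.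
  have [A [e [c [ae pe Ek [Ab hc be]]]]] := B4_chart_at hk.
  rewrite (dmapP regular_B4 hS r (smooth_at_toSigma hk) tv tv') be.
  have [L _] := HP A e ae.1; apply: (L _ Ab).1.
  - exact: tangent_toSigma hk tv.
  - exact: tangent_toSigma hk tv'.
move=> _ [A [e [c [ae pe ac ->]]]] a; rewrite cimg_B4_chart.
have oA : mopen A by have [[[]]] := ae.
have [_ sP] := HP A e ae.1; apply: smooth_ext (sP c ac a); first exact: oA.2.
move=> y /(cimgP hS ac)[Ay cy Ey] /=; congr (P _ _).
have hk : chart_at (M := B) (param c y, e (param c y)) (B4_chart A e c).
  by split; [exists A, e, c|].
rewrite (dmap_toSigma hk ac)//; last exact: (tangent_vec_of regular_B4).
by rewrite (vec_ofE regular_B4 _ hk).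
Qed.

End CoframeBundle.

(** * Integrals depending on a parameter *)
Section Slices.
Context {R : realType} {W : normedModType R}.

Lemma diff_slice_s (s t : R) : differentiable (fun s : R => (s, t)) s /\
  forall v, 'd (fun s : R => (s, t)) s v = (v, 0).
Proof.
have d1 : differentiable (@id R) s by exact: ex_diff.
have d2 : differentiable (cst t : R -> R) s by exact: differentiable_cst.
split=> [|v]; first exact: differentiable_pair.
apply: etrans (congr1 (fun h => h v) (diff_pair d1 d2)) _.
rewrite /= diff_cst; congr pair; apply: (congr1 (fun h => h v) (@diff_lin _ _ _ idfun _ _)).
by move=> ?; exact: cvg_id.
Qed.

Lemma diff_slice_t (s t : R) : differentiable (fun t : R => (s, t)) t /\
  forall v, 'd (fun t : R => (s, t)) t v = (0, v).
Proof.
have d1 : differentiable (cst s : R -> R) t by exact: differentiable_cst.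
have d2 : differentiable (@id R) t by exact: ex_diff.
split=> [|v]; first exact: differentiable_pair.
apply: etrans (congr1 (fun h => h v) (diff_pair d1 d2)) _.
rewrite /= diff_cst; congr pair; apply: (congr1 (fun h => h v) (@diff_lin _ _ _ idfun _ _)).
by move=> ?; exact: cvg_id.
Qed.

Lemma is_derive_slice_s (h : R * R -> W) (s t : R) : differentiable h (s, t) ->
  is_derive s 1 (fun s => h (s, t)) ('D_(1, 0) h (s, t)).
Proof.
move=> dh; have [d1 E] := diff_slice_s s t.
have dc : differentiable (h \o (fun s => (s, t))) s by exact: differentiable_comp.
split; first exact: diff_derivable.
rewrite (deriveE _ dc); apply: etrans (diff_compE _ d1 dh) _.
by rewrite E deriveE.
Qed.

Lemma is_derive_slice_t (h : R * R -> W) (s t : R) : differentiable h (s, t) ->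
  is_derive t 1 (fun t => h (s, t)) ('D_(0, 1) h (s, t)).
Proof.
move=> dh; have [d1 E] := diff_slice_t s t.
have dc : differentiable (h \o (fun t => (s, t))) t by exact: differentiable_comp.
split; first exact: diff_derivable.
rewrite (deriveE _ dc); apply: etrans (diff_compE _ d1 dh) _.
by rewrite E deriveE.
Qed.

End Slices.

Section Calculus.
Context {R : realType}.
Local Notation mu := (@lebesgue_measure R).

Lemma continuous_integrable (h : R -> R) (a b : R) :
  (forall t, t \in `[a, b] -> {for t, continuous h}) ->
  mu.-integrable `[a, b] (EFin \o h).
Proof.
move=> ch; apply: continuous_compact_integrable; first exact: segment_compact.
by apply: continuous_in_subspaceT => t /set_mem; exact: ch.
Qed.

Lemma FTC (f F : R -> R) (a b : R) : a < b ->
  (forall t, t \in `[a, b] -> {for t, continuous f}) ->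
  (forall t, t \in `[a, b] -> {for t, continuous F}) ->
  (forall t, t \in `]a, b[ -> is_derive t 1 F (f t)) ->
  Rintegral mu `[a, b] f = F b - F a.
Proof.
move=> ab cf cF dF; rewrite /Rintegral (@continuous_FTC2 _ f F)//.
- by apply: continuous_in_subspaceT => t /set_mem; exact: cf.
- split.
  + by move=> t tab; have [] := dF t tab.
  + by apply: cvg_at_right_filter; apply: cF; rewrite in_itv/= lexx ltW.
  + by apply: cvg_at_left_filter; apply: cF; rewrite in_itv/= lexx ltW.
- by move=> t tab; rewrite derive1E; have [_ ->] := dF t tab.
Qed.

(** Differentiation under the integral sign by dominated convergence: the
    partial derivative is bounded on a compact neighbourhood of the segment
    [s = 0]. *)
Lemma leibniz_rule (O : set (R * R)) (h : R * R -> R) (a b eps : R) :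
  0 < eps -> open O -> (forall s t, `|s| < eps -> t \in `[a, b] -> O (s, t)) ->
  smooth O h ->
  is_derive (0 : R) 1 (fun s => Rintegral mu `[a, b] (fun t => h (s, t)))
    (Rintegral mu `[a, b] (fun t => 'D_(1, 0) h (0, t))).
Proof.
move=> e0 oO H sh; pose e := eps / 2; have e'0 : 0 < e by rewrite divr_gt0.
have ee : e < eps by rewrite /e ltr_pdivrMr// ltr_pMr// ltr1n.
have dh s t : `|s| < eps -> t \in `[a, b] -> differentiable h (s, t).
  by move=> se tab; apply: (smooth_differentiable sh); exact: H.
have [M M0 HM] : exists2 M : R, 0 <= M & forall s t, `|s| <= e -> t \in `[a, b] ->
    `|'D_(1, 0) h (s, t)| <= M.
  pose K := `[- e, e] `*` `[a, b] : set (R * R).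
  have cK : compact K by apply: compact_setX; exact: segment_compact.
  have KO : K `<=` O.
    move=> [s t] [/= sI tI]; apply: H => //.
    by apply: le_lt_trans ee; rewrite ler_norml; move: sI; rewrite in_itv.
  have cf : {within K, continuous ('D_(1, 0) h)}.
    apply: continuous_in_subspaceT => p /set_mem /KO Op.
    exact: (smooth_continuous (smooth_D _ sh)).
  have [M [_ HM]] := compact_bounded (continuous_compact cf cK).
  exists (Num.max 0 (M + 1)); first by rewrite le_max lexx.
  move=> s t se tI; apply: HM.
    by rewrite lt_max ltrDl ltr01 orbT.
  by exists (s, t) => //; split=> //=; rewrite in_itv/= -ler_norml.
have I0 : [set` `]- e, e[] 0 by rewrite /= in_itv/= oppr_lt0 e'0.
have sI (s : R) : [set` `]- e, e[] s -> `|s| < eps.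
  by rewrite /= in_itv/= -ltr_norml => /lt_trans; exact.
have A1 : forall s, [set` `]- e, e[] s -> mu.-integrable `[a, b] (EFin \o (fun t => h (s, t))).
  move=> s Is; apply: continuous_integrable => t tab.
  apply/differentiable_continuous.
  have [d1 _] := diff_slice_t s t.
  apply: (@differentiable_comp _ _ _ _ (fun t => (s, t)) h) => //.
  by apply: dh => //; exact: sI.
have A2 : forall s t, [set` `]- e, e[] s -> [set` `[a, b]] t -> derivable (fun s => h (s, t)) s 1.
  by move=> s t Is It; have [] := is_derive_slice_s (dh s t (sI _ Is) It).
have A3 : mu.-integrable `[a, b] (EFin \o cst M).
  by apply: continuous_integrable => t _; exact: cvg_cst.
have A4 : forall s t, [set` `]- e, e[] s -> [set` `[a, b]] t ->
    `|(partial1of2 (fun s t => h (s, t))) s t| <= (cst M : R -> R) t.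
  move=> s t Is It; rewrite partial1of2E.
  have [_ ->] := is_derive_slice_s (dh s t (sI _ Is) It).
  by apply: HM => //; move: Is; rewrite /= in_itv/= -ltr_norml => /ltW.
have E : Rintegral mu `[a, b] (fun t => 'D_(1, 0) h (0, t)) =
    Rintegral mu `[a, b] ((partial1of2 (fun s t => h (s, t))) 0).
  apply: eq_Rintegral => t /set_mem It.
  have [_ Et] := is_derive_slice_s (dh 0 t (sI _ I0) It).
  exact: etrans (esym Et) (esym (derive1E _ _)).
have m : measurable [set` `[a, b]] by exact: measurable_itv.
split.
  exact: (@derivable_under_integral R _ _ mu (fun s t => h (s, t)) _ m 0 (- e) e I0 A1 A2 _ (fun=> M0) A3 A4).
rewrite E -derive1E.
exact: (@differentiation_under_integral R _ _ mu (fun s t => h (s, t)) _ m 0 (- e) e I0 A1 A2 _ (fun=> M0) A3 A4).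
Qed.

End Calculus.

(** * The first variation of length *)
Lemma variation_regroup (S : comRingType) (n1 n3 d1s d1t d3s l l' fC : S) :
  (d1t - d1s) + l * (0 - d3s) = fC * n3 -> d1s + (l * d3s + n3 * l') = d1t - (fC - l') * n3.
Proof. by move=> E; rewrite mulrBl -E; ring. Qed.

Section FirstVariation.
Context {R : realType} {X : premanifold R 3}.
Variables (D : mpoint X -> set (tfam X)) (F : mpoint X -> tfam X -> R).
Variable o : mpoint X -> tfam X -> tfam X -> Prop.
Hypothesis hX : regular_atlas X.
Hypotheses (D_contact : contact D) (F_sub_Finsler : sub_Finsler D F).
Hypothesis D_oriented : orientation D o.

Local Notation Sigma := (indicatrix D F).
Local Notation B := (B4 D F o).
Local Notation toSigma := (@B4_to_Sigma R X D F o).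
Local Notation toX := (@B4_to_X R X D F o).
Local Notation can := (canonical_coframing D F o).
Local Notation base := (@basepoint R X D F).

Let hS : regular_atlas Sigma := regular_indicatrix D F hX.
Let hB : regular_atlas B := regular_B4 hX D_contact F_sub_Finsler D_oriented.

Lemma smooth_eta1 : smooth_1form (form_eta1 can).
Proof. by apply: (smooth_canonical hX D_contact F_sub_Finsler D_oriented (P := @eta1 R _)) => A e /coframe_smooth[]. Qed.

Lemma smooth_eta3 : smooth_1form (form_eta3 can).
Proof. by apply: (smooth_canonical hX D_contact F_sub_Finsler D_oriented (P := @eta3 R _)) => A e /coframe_smooth[]. Qed.

Lemma smooth_phi : smooth_1form (form_phi can).
Proof. by apply: (smooth_canonical hX D_contact F_sub_Finsler D_oriented (P := @phi R _)) => A e /coframe_smooth[]. Qed.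

Section Maps.
Context {V : normedModType R}.
Variables (O : set V) (f : V -> mpoint B).
Hypotheses (oO : open O) (sf : smooth_into O f).

Lemma smooth_into_toSigma : smooth_into (M := Sigma) O (toSigma \o f).
Proof.
apply: (smooth_into_map (f := toSigma) hB oO sf) => p Op; have [k [hk _]] := sf Op.
exact: (smooth_at_toSigma hX D_contact F_sub_Finsler D_oriented hk).
Qed.

Lemma smooth_into_toX : smooth_into (M := X) O (toX \o f).
Proof.
apply: (smooth_into_map (f := base) hS oO smooth_into_toSigma) => p Op.
have [k [hk _]] := smooth_into_toSigma Op.
exact: (smooth_at_basepoint hX hk).
Qed.

Lemma dmap_toSigma_push p v : O p ->
  dmap (N := Sigma) toSigma (f p) (pushvec (M := B) f p v) = pushvec (M := Sigma) (toSigma \o f) p v.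
Proof.
move=> Op; have [k [hk _]] := sf Op.
exact: (dmap_pushvec hB hS v sf Op (smooth_at_toSigma hX D_contact F_sub_Finsler D_oriented hk)).
Qed.

Lemma dmap_base_push p v : O p ->
  dmap (N := X) base (toSigma (f p)) (pushvec (M := Sigma) (toSigma \o f) p v) =
  pushvec (M := X) (toX \o f) p v.
Proof.
move=> Op; have [k [hk _]] := smooth_into_toSigma Op.
exact: (dmap_pushvec hS hX v smooth_into_toSigma Op (smooth_at_basepoint hX hk)).
Qed.

(** A point of the coframe bundle is the value of a local coframing, so what
    is known of coframings of the indicatrix bundle applies to the canonical
    forms. *)
Lemma local_coframing p : O p -> exists A e, [/\ adapted0 A e, positive o A e,
  A (f p).1, (f p).2 = e (f p).1 & exists c, chart_at (M := Sigma) (f p).1 c].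
Proof.
move=> Op; have [k [hk _]] := sf Op.
by have [A [e [c [[ae _] pe _ [Ab hc be]]]]] := B4_chart_at hk; exists A, e; split=> //; exists c.
Qed.

Lemma body_image p : O p -> body B (f p).
Proof.
move=> Op; have [k [hk _]] := sf Op; have [ak kp] := hk.
by have [H _ _] := hB.1 k ak; exact: H.
Qed.

Lemma pulled_vertical p v : O p -> pushvec (M := X) (toX \o f) p v = 0 ->
  [/\ pulled f (form_eta1 can) v p = 0, pulled f (form_eta2 can) v p = 0
    & pulled f (form_eta3 can) v p = 0].
Proof.
move=> Op v0; have [A [e [ae pe Ab be [c hc]]]] := local_coframing Op.
have t : tangent (M := Sigma) (f p).1 (pushvec (M := Sigma) (toSigma \o f) p v).
  exact: (tangent_pushvec hS v smooth_into_toSigma Op).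
rewrite /pulled /form_eta1 /form_eta2 /form_eta3 /= (dmap_toSigma_push v Op) be.
apply: (coframe_vertical hX D_contact F_sub_Finsler ae Ab hc t).
by rewrite -[LHS]/(dmap (N := X) base (toSigma (f p)) (pushvec (M := Sigma) (toSigma \o f) p v)) dmap_base_push.
Qed.

End Maps.

Section Structure.
Variables I J1 J2 K A1 A2 S0 S1 S2 : mpoint B -> R.
Hypothesis hse : structure_equations (body B) can I J1 J2 K A1 A2 S0 S1 S2.

Definition Clambda (l : R) (b : mpoint B) : R :=
  l ^+ 2 * I b + l * J1 b + A2 b + 2^-1 * I b * K b.

(** Where the equation for [C] comes from: along an integral curve on which
    [phi = l eta1], the form [d eta1 + l d eta3] contracted with the velocity
    is a multiple of [eta3]. *)
Lemma structure_pairing b x g l : body B b -> tangent b x -> tangent b g ->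
  form_eta2 can b g = 0 -> form_eta3 can b g = 0 ->
  form_phi can b g = l * form_eta1 can b g ->
  dext (form_eta1 can) b x g + l * dext (form_eta3 can) b x g =
  form_eta1 can b g * Clambda l b * form_eta3 can b x.
Proof.
move=> bb tx tg g2 g3 g4.
have [-> _ ->] := structure_values hse bb tx tg.
rewrite g2 g3 g4 /Clambda.
move: (form_eta1 can b x) (form_eta2 can b x) (form_eta3 can b x) (form_phi can b x) (form_eta1 can b g).
move: (I b) (J1 b) (A1 b) (A2 b) (K b) => *.
by field.
Qed.

Lemma velocity_slice (O : set (R * R)) (V : R -> R -> mpoint B) s t :
  smooth_into (M := B) O (fun p => V p.1 p.2) -> O (s, t) ->
  velocity (M := B) (V s) t = pushvec (M := B) (fun p : R * R => V p.1 p.2) (s, t) (0, 1).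
Proof.
move=> sV Ost; have [d E] := diff_slice_t s t; have := pushvec_comp hB (1 : R) sV Ost d.
by rewrite E.
Qed.

Lemma velocity_near (O : set R) (g g' : R -> mpoint B) t : smooth_into (M := B) O g -> O t ->
  (\forall u \near t, g u = g' u) -> velocity (M := B) g' t = velocity (M := B) g t.
Proof.
move=> sg Ot gg; apply/funext => d; rewrite /velocity /pushvec.
have gt : g t = g' t by exact: nbhs_singleton gg.
rewrite -gt; case: asboolP => [hd|_]; last by [].
have dg := differentiable_coord_into hB sg Ot hd.
have N : \forall u \near t, (coord d \o g) u = (coord d \o g') u.
  by apply: filterS gg => u /= ->.
have [_ E] := near_eq_diff N dg.
exact: (congr1 (fun h : R -> 'rV[R]_4 => h 1) E).
Qed.

Lemma smooth_into_slice (O : set (R * R)) (f : R * R -> mpoint B) s : open O ->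
  smooth_into (M := B) O f -> smooth_into (M := B) [set t | O (s, t)] (fun t => f (s, t)).
Proof.
move=> oO sf t Ot; have [d [hd [U [oU Ut UO dU sU]]]] := sf _ Ot.
have oU' : open [set t | U (s, t)].
  rewrite (_ : [set t | U (s, t)] = setT `&` (fun t => (s, t)) @^-1` U); last by rewrite setTI.
  apply: (@open_preimage_on _ _ setT (fun t : R => (s, t)) U openT oU) => x _.
  exact: differentiable_continuous (diff_slice_t s x).1.
exists d; split=> //; exists [set t | U (s, t)]; split=> //.
- by move=> q /UO.
- by move=> q /dU.
- apply: (smooth_comp_row (O' := U) (f := fun t => (s, t)) (g := coord d \o f)) => //.
    by apply: has_coords_prod; exact: has_coords_R.
  by apply: smooth_pair => //; [exact: smooth_cst|exact: smooth_id].
Qed.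

Section Variation.
Variables (a b eps : R) (g : R -> mpoint B) (V : R -> R -> mpoint B) (O : set (R * R)).
Hypotheses (ab : a < b) (eps0 : 0 < eps) (oO : open O).
Hypothesis HO : forall s t, `|s| < eps -> t \in `[a, b] -> O (s, t).
Hypothesis sV : smooth_into (M := B) O (fun p => V p.1 p.2).
Hypothesis V0 : forall t, t \in `[a, b] -> V 0 t = g t.
Hypothesis VI : forall s, `|s| < eps -> @Ibar_curve R X D F o a b (V s).
Hypothesis Va : forall s, `|s| < eps -> toX (V s a) = toX (g a).
Hypothesis Vb : forall s, `|s| < eps -> toX (V s b) = toX (g b).

Let f (p : R * R) := V p.1 p.2.
Let n1s := pulled (M := B) f (form_eta1 can) (1, 0).
Let n1t := pulled (M := B) f (form_eta1 can) (0, 1).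
Let n2t := pulled (M := B) f (form_eta2 can) (0, 1).
Let n3s := pulled (M := B) f (form_eta3 can) (1, 0).
Let n3t := pulled (M := B) f (form_eta3 can) (0, 1).

Lemma smooth_n1s : smooth O n1s.
Proof. exact (smooth_pulled hB sV smooth_eta1 (1, 0)). Qed.
Lemma smooth_n1t : smooth O n1t.
Proof. exact (smooth_pulled hB sV smooth_eta1 (0, 1)). Qed.
Lemma smooth_n3s : smooth O n3s.
Proof. exact (smooth_pulled hB sV smooth_eta3 (1, 0)). Qed.
Lemma smooth_n3t : smooth O n3t.
Proof. exact (smooth_pulled hB sV smooth_eta3 (0, 1)). Qed.

Let eps00 : `|0 : R| < eps. Proof. by rewrite normr0. Qed.

Lemma horizontal_variation s t : `|s| < eps -> t \in `[a, b] -> n2t (s, t) = 0 /\ n3t (s, t) = 0.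
Proof.
move=> se tab; have [[_ H] _] := VI se.
have vE := velocity_slice sV (HO se tab); rewrite /n2t /n3t /pulled /f -vE.
by split; apply: H => //; [left|right].
Qed.

Lemma D_n3t t : t \in `[a, b] -> 'D_(1, 0) n3t (0, t) = 0.
Proof.
move=> tab; have [_ <-] := is_derive_slice_s (smooth_differentiable smooth_n3t (HO eps00 tab)).
rewrite -[RHS](derive_cst (0 : R) (0 : R) (1 : R)); apply: near_eq_D.
apply/near_ballP; exists eps => // s; rewrite subr0 => se.
by have [_] := horizontal_variation se tab.
Qed.

(** If the base point does not move, the variation is vertical, and [eta1],
    [eta3] vanish on it. *)
Lemma endpoint_variation t : t \in `[a, b] -> (forall s, `|s| < eps -> toX (V s t) = toX (V 0 t)) ->
  n1s (0, t) = 0 /\ n3s (0, t) = 0.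
Proof.
move=> tab H; have Ot := HO eps00 tab.
suff [] : [/\ n1s (0, t) = 0, pulled (M := B) f (form_eta2 can) (1, 0) (0, t) = 0 & n3s (0, t) = 0].
  by [].
apply: (pulled_vertical oO sV Ot).
have [d1 E] := diff_slice_s 0 t.
have sX := smooth_into_toX oO sV.
have := pushvec_comp hX (1 : R) sX (h := fun s => (s, t)) (p := 0) Ot d1.
rewrite E => <-; apply/funext => d; rewrite /pushvec; case: asboolP => // _.
apply: (@diff_near_cst _ _ _ _ (coord d (toX (V 0 t)))).
apply/near_ballP; exists eps => // s; rewrite subr0 => se /=.
by rewrite H.
Qed.

(** The two exterior derivatives of [structure_pairing] are commutators of
    partial derivatives of the values of the forms; in that of [eta3] one
    term is zero because every curve of the variation is horizontal. *)
Lemma first_variation t (l : R -> R) (l' : R) : t \in `[a, b] -> is_derive t 1 l l' ->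
  pulled (M := B) f (form_phi can) (0, 1) (0, t) = l t * n1t (0, t) ->
  is_derive t 1 (fun t => n1s (0, t) + l t * n3s (0, t))
   ('D_(1, 0) n1t (0, t) - (n1t (0, t) * Clambda (l t) (V 0 t) - l') * n3s (0, t)).
Proof.
move=> tab dl g4; have Ot := HO eps00 tab.
have [g2 g3] := horizontal_variation eps00 tab.
have d1 := is_derive_slice_t (smooth_differentiable smooth_n1s Ot).
have d3 := is_derive_slice_t (smooth_differentiable smooth_n3s Ot).
have E1 := dext_pushvec hB sV smooth_eta1 ((1, 0) : R * R)%type (0, 1) Ot.
have E3 := dext_pushvec hB sV smooth_eta3 ((1, 0) : R * R)%type (0, 1) Ot.
have tx := tangent_pushvec hB ((1, 0) : R * R)%type sV Ot.
have tg := tangent_pushvec hB ((0, 1) : R * R)%type sV Ot.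
have P := structure_pairing (body_image sV Ot) tx tg g2 g3 g4.
have D3 := D_n3t tab.
have {}P : ('D_(1, 0) n1t (0, t) - 'D_(0, 1) n1s (0, t)) + l t * (0 - 'D_(0, 1) n3s (0, t)) =
    n1t (0, t) * Clambda (l t) (V 0 t) * n3s (0, t).
  apply: etrans P; apply: (congr2 +%R (esym E1) (congr1 ( *%R (l t)) _)).
  by apply: esym; apply: etrans E3 _; apply: (congr2 (fun x y => x - y) D3 (erefl _)).
have H := is_deriveD d1 (is_deriveM dl d3).
apply: is_derive_eq H _; exact: variation_regroup P.
Qed.

Lemma continuous_slice_t (O' : set (R * R)) (h : R * R -> R) t : smooth O' h -> O' (0, t) ->
  {for t, continuous (fun t => h (0, t))}.
Proof.
move=> sh Ot; apply/differentiable_continuous/derivable1_diffP.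
by have [] := is_derive_slice_t (smooth_differentiable sh Ot).
Qed.

Definition length_rate (t : R) : R := 'D_(1, 0) n1t (0, t).

Lemma continuous_length_rate t : t \in `[a, b] -> {for t, continuous length_rate}.
Proof.
move=> tab; rewrite /length_rate.
exact: (@continuous_slice_t O ('D_(1, 0) n1t) t (smooth_D _ smooth_n1t) (HO eps00 tab)).
Qed.

Lemma is_derive_length : is_derive (0 : R) (1 : R) (fun s => @Lbar R X D F o a b (V s))
  (Rintegral lebesgue_measure `[a, b] length_rate).
Proof.
have H := leibniz_rule eps0 oO HO smooth_n1t.
apply: near_eq_is_derive H.
apply/near_ballP; exists eps => // s; rewrite subr0 => se.
apply: eq_Rintegral => t /set_mem tab.
by rewrite (velocity_slice sV (HO se tab)).
Qed.

Lemma endpoints_fixed : [/\ n1s (0, a) = 0, n3s (0, a) = 0, n1s (0, b) = 0 & n3s (0, b) = 0].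
Proof.
have aab : a \in `[a, b] by rewrite in_itv/= lexx ltW.
have bab : b \in `[a, b] by rewrite in_itv/= lexx ltW.
have [-> ->] : n1s (0, a) = 0 /\ n3s (0, a) = 0.
  by apply: endpoint_variation => // s se; rewrite Va// (V0 aab).
by have [-> ->] : n1s (0, b) = 0 /\ n3s (0, b) = 0
  by apply: endpoint_variation => // s se; rewrite Vb// (V0 bab).
Qed.

Definition boundary_term (l : R -> R) (t : R) : R := n1s (0, t) + l t * n3s (0, t).

Lemma boundary_term_ends l : boundary_term l a = 0 /\ boundary_term l b = 0.
Proof.
by rewrite /boundary_term; have [-> -> -> ->] := endpoints_fixed; rewrite !mulr0 addr0.
Qed.

Lemma continuous_boundary_term l t : t \in `[a, b] -> {for t, continuous l} ->
  {for t, continuous (boundary_term l)}.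
Proof.
move=> tab lc; have Ot := HO eps00 tab.
apply: cvgD; first exact: (continuous_slice_t smooth_n1s Ot).
by apply: cvgM; [exact: lc|exact: (continuous_slice_t smooth_n3s Ot)].
Qed.

(** A multiplier solving [l' = C eta1] makes the length stationary: the rate
    of change of the length is then the derivative of a boundary term. *)
Lemma multiplier_stationary (l : R -> R) : (forall t, t \in `[a, b] -> {for t, continuous l}) ->
  (forall t, t \in `]a, b[ -> form_phi can (g t) (velocity (M := B) g t) =
     l t * form_eta1 can (g t) (velocity (M := B) g t)) ->
  (forall t, t \in `]a, b[ -> is_derive t 1 l
     (form_eta1 can (g t) (velocity (M := B) g t) * Clambda (l t) (g t))) ->
  Rintegral lebesgue_measure `[a, b] length_rate = 0.
Proof.
move=> cl phil dl; have E t : t \in `]a, b[ -> velocity (M := B) (V 0) t = velocity (M := B) g t.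
  move=> tab; apply: esym; apply: (velocity_near (smooth_into_slice (s := 0) oO sV) (t := t)).
    by apply: HO => //; move: tab; rewrite !in_itv/= => /andP[/ltW-> /ltW->].
  apply: filterS (near_in_itvoo tab) => u uab; apply: V0.
  by move: uab; rewrite !in_itv/= => /andP[/ltW-> /ltW->].
have N t (w : form B) : t \in `]a, b[ -> pulled (M := B) f w (0, 1) (0, t) = w (g t) (velocity (M := B) g t).
  move=> tab; have tab' : t \in `[a, b] by move: tab; rewrite !in_itv/= => /andP[/ltW-> /ltW->].
  have := velocity_slice sV (HO eps00 tab'); rewrite /pulled /f /= E// (V0 tab') => <-.
  by [].
have [B0 B1] := boundary_term_ends l.
apply: etrans (_ : boundary_term l b - boundary_term l a = 0); last by rewrite B0 B1 subrr.
apply: FTC => // [t tab|t tab|t tab].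
- exact: continuous_length_rate.
- by apply: continuous_boundary_term => //; exact: cl.
have tab' : t \in `[a, b] by move: tab; rewrite !in_itv/= => /andP[/ltW-> /ltW->].
have D1 := dl t tab.
apply: is_derive_eq (first_variation tab' D1 _) _.
  by rewrite /n1t !N//; exact: phil.
by rewrite /n1t N// (V0 tab') subrr mul0r subr0.
Qed.

End Variation.
End Structure.
End FirstVariation.

(** * Primitives and monotone functions *)
Section MeanValue.
Context {R : realType}.
Local Notation mu := (@lebesgue_measure R).

Lemma le_of_derive (f f' : R -> R) (a b : R) : a <= b ->
  (forall t, t \in `[a, b] -> {for t, continuous f}) ->
  (forall t, t \in `]a, b[ -> is_derive t 1 f (f' t)) ->
  (forall t, t \in `]a, b[ -> 0 <= f' t) -> f a <= f b.
Proof.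
move=> ab cf df f0; have [->|ab'] := eqVneq a b; first exact: lexx.
have {}ab : a < b by rewrite lt_neqAle ab' ab.
have [|c cab E] := MVT ab df.
  by apply: continuous_in_subspaceT => t /set_mem; exact: cf.
by rewrite -subr_ge0 E mulr_ge0 ?f0// subr_ge0 ltW.
Qed.

Lemma is_derive_continuous (f : R -> R) (t l : R) : is_derive t 1 f l -> {for t, continuous f}.
Proof. by move=> [d _]; apply/differentiable_continuous/derivable1_diffP. Qed.

Lemma le_of_derive_full (f f' : R -> R) (a b : R) : a <= b ->
  (forall t, a <= t <= b -> is_derive t 1 f (f' t)) ->
  (forall t, a <= t <= b -> 0 <= f' t) -> f a <= f b.
Proof.
move=> ab df f0; apply: (le_of_derive (f' := f') ab) => t.
- by rewrite in_itv/= => /df; exact: is_derive_continuous.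
- by rewrite in_itv/= => /andP[/ltW at0 /ltW tb]; apply: df; rewrite at0.
- by rewrite in_itv/= => /andP[/ltW at0 /ltW tb]; apply: f0; rewrite at0.
Qed.

Lemma eq_of_derive (f g h : R -> R) (T : R) : f 0 = g 0 ->
  (forall t : R, `|t| < T -> is_derive t 1 f (h t)) ->
  (forall t : R, `|t| < T -> is_derive t 1 g (h t)) ->
  forall t, `|t| < T -> f t = g t.
Proof.
move=> fg0 df dg t tT.
have dfg (u : R) : `|u| < T -> is_derive u 1 (fun u => f u - g u) 0.
  move=> uT; have D := is_deriveB (df u uT) (dg u uT).
  by apply: is_derive_eq D _; rewrite subrr.
have dgf (u : R) : `|u| < T -> is_derive u 1 (fun u => g u - f u) 0.
  move=> uT; have D := is_deriveB (dg u uT) (df u uT).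
  by apply: is_derive_eq D _; rewrite subrr.
have mono (k : R -> R) (x y : R) : x <= y -> `|x| < T -> `|y| < T ->
    (forall u : R, `|u| < T -> is_derive u 1 k 0) -> k x <= k y.
  move=> xy xT yT dk; apply: (le_of_derive_full (f' := fun=> 0) xy) => // u /andP[xu uy].
  apply: dk; rewrite ltr_norml; move: xT yT; rewrite !ltr_norml => /andP[x1 _] /andP[_ y2].
  by rewrite (lt_le_trans x1 xu) (le_lt_trans uy y2).
have T0 : `|0 : R| < T by rewrite normr0; exact: le_lt_trans tT.
have [t0|/ltW t0] := leP 0 t.
  have := mono _ _ _ t0 T0 tT dfg; have := mono _ _ _ t0 T0 tT dgf.
  by rewrite fg0 subrr !subr_ge0 => g1 g2; apply/eqP; rewrite eq_le g1 g2.
have := mono _ _ _ t0 tT T0 dfg; have := mono _ _ _ t0 tT T0 dgf.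
by rewrite fg0 subrr !subr_le0 => g1 g2; apply/eqP; rewrite eq_le g1 g2.
Qed.

Lemma primitive_exists (f : R -> R) : continuous f ->
  exists P : R -> R, P 0 = 0 /\ forall t : R, is_derive t 1 P (f t).
Proof.
move=> cf.
pose Q T x := Rintegral mu `[- T, x] f.
have dQ (T x : R) : `|x| < T -> is_derive x 1 (fun x => Q T x - Q T 0) (f x).
  rewrite ltr_norml => /andP[Tx xT].
  have int : mu.-integrable `[- T, T] (EFin \o f).
    by apply: continuous_integrable => t _; exact: cf.
  have [d E] := continuous_FTC1_closed xT int Tx (cf x).
  have D1 : is_derive x 1 (Q T) (f x) by split; [exact: d|rewrite -E derive1E].
  have := is_deriveB D1 (is_derive_cst (Q T 0) x 1).
  by move=> D; apply: is_derive_eq D _; rewrite subr0.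
have EQ T T' x : `|x| < T -> `|x| < T' -> Q T x - Q T 0 = Q T' x - Q T' 0.
  move=> xT xT'.
  apply: (@eq_of_derive (fun x => Q T x - Q T 0) (fun x => Q T' x - Q T' 0) f (Num.min T T')) => //.
  - by rewrite !subrr.
  - by move=> t; rewrite lt_min => /andP[tT _]; exact: dQ.
  - by move=> t; rewrite lt_min => /andP[_ tT]; exact: dQ.
  - by rewrite lt_min xT.
exists (fun x => Q (`|x| + 1) x - Q (`|x| + 1) 0); split; first by rewrite subrr.
move=> t; have tT : `|t| < `|t| + 1 by rewrite ltrDl.
apply: near_eq_is_derive (dQ (`|t| + 1) t tT).
apply/near_ballP; exists 1 => // x xt; apply: EQ; last by rewrite ltrDl.
rewrite -(subrK t x) addrC; apply: le_lt_trans (ler_normD _ _) _.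
by rewrite ltrD2l.
Qed.

End MeanValue.

(** * Mean value and Gronwall inequalities *)
Section Rows.
Context {R : realType} {n : nat}.
Implicit Types (v w y : 'rV[R]_n) (z : R -> 'rV[R]_n).

Lemma ler_coord v i : `|v 0 i| <= `|v|.
Proof.
rewrite [leRHS]/Num.norm/= mx_normrE.
by rewrite (bigmaxD1 (0, i))//= le_max lexx.
Qed.

Lemma ler_rowP v (k : R) : 0 <= k -> (forall i, `|v 0 i| <= k) -> `|v| <= k.
Proof.
move=> k0 H; rewrite [leLHS]/Num.norm/= mx_normrE.
by apply: bigmax_le => // -[i j] _ /=; rewrite ord1.
Qed.

Lemma is_derive_coord z (t : R) y i : is_derive t 1 z y -> is_derive t 1 (fun t => z t 0 i) (y 0 i).
Proof.
move=> [dz Ez]; have dz' : differentiable z t by exact/derivable1_diffP.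
have [dc Ec] := D_coord (1 : R) i dz'.
by split; [exact/derivable1_diffP|rewrite Ec Ez].
Qed.

Lemma is_derive_row z (t : R) y : (forall i, is_derive t 1 (fun t => z t 0 i) (y 0 i)) ->
  is_derive t 1 z y.
Proof.
move=> H.
have dz : differentiable z t.
  have -> : z = (fun u => \sum_i (z u 0 i) *: delta_mx 0 i :> 'rV[R]_n).
    by apply/funext => u; rewrite -row_sum_delta.
  have -> : (fun u => \sum_i (z u 0 i) *: delta_mx 0 i) = \sum_i (fun u => (z u 0 i) *: delta_mx 0 i : 'rV[R]_n).
    by apply/funext => u; rewrite fct_sumE.
  apply: differentiable_sum => i; have [di _] := H i.
  have di' : differentiable (fun t => z t 0 i) t by exact/derivable1_diffP.
  have lin : linear (fun c : R => c *: delta_mx (0 : 'I_1) (i : 'I_n)).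
    by move=> k u v; rewrite scalerDl scalerA.
  have dL : differentiable (mk_linear lin) (z t 0 i).
    by apply: linear_differentiable => x; apply: continuousZr_tmp; exact: cvg_id.
  exact: (differentiable_comp (f := fun t => z t 0 i) (g := mk_linear lin)).
split; first exact/derivable1_diffP.
apply/rowP => i; have [_ <-] := H i.
by have [_ ->] := D_coord (1 : R) i dz.
Qed.

Lemma is_derive_reflect (z : R -> 'rV[R]_n) (t : R) y : is_derive (- t) 1 z y ->
  is_derive t 1 (fun t => z (- t)) (- y).
Proof.
move=> [dz Ez]; have dz' : differentiable z (- t) by exact/derivable1_diffP.
have dN : differentiable (-%R : R -> R) t by apply/derivable1_diffP; exact: derivableN.
have dc : differentiable (z \o -%R) t by exact: differentiable_comp.
split; first exact/derivable1_diffP.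
have E := D_comp (1 : R) dN dz'; apply: etrans E _.
have -> : 'D_1 (-%R : R -> R) t = - 1 by rewrite deriveN// derive_id.
by rewrite linearN -(deriveE _ dz') Ez.
Qed.

(** By comparison with a scalar function, coordinate by coordinate. *)
Lemma mean_value_bound (z z' : R -> 'rV[R]_n) (G G' : R -> R) (T : R) :
  (forall t, 0 <= t <= T -> is_derive t 1 z (z' t)) ->
  (forall t, 0 <= t <= T -> is_derive t 1 G (G' t)) ->
  (forall t, 0 <= t <= T -> `|z' t| <= G' t) ->
  forall t, 0 <= t <= T -> `|z t - z 0| <= G t - G 0.
Proof.
move=> dz dG H t /andP[t0 tT].
have sub u : 0 <= u <= t -> 0 <= u <= T by move=> /andP[-> ut]; exact: le_trans tT.
have G0 : 0 <= G t - G 0.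
  rewrite subr_ge0; apply: (le_of_derive_full t0 (fun u U => dG u (sub u U))) => u /sub U.
  exact: le_trans (H u U).
apply: ler_rowP => // i; rewrite !mxE ler_norml; apply/andP; split.
  rewrite -subr_ge0 opprK.
  have := @le_of_derive_full _ (fun u => z u 0 i + G u) (fun u => z' u 0 i + G' u) 0 t t0.
  have -> : z t 0 i - z 0 0 i + (G t - G 0) = (z t 0 i + G t) - (z 0 0 i + G 0) by ring.
  rewrite subr_ge0; apply=> u /sub U.
    by apply: is_deriveD; [exact: is_derive_coord (dz u U)|exact: dG].
  rewrite -lerBlDr sub0r; have := le_trans (ler_coord (z' u) i) (H u U).
  by rewrite ler_norml => /andP[].
rewrite -subr_ge0.
have := @le_of_derive_full _ (fun u => G u - z u 0 i) (fun u => G' u - z' u 0 i) 0 t t0.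
have -> : G t - G 0 - (z t 0 i - z 0 0 i) = (G t - z t 0 i) - (G 0 - z 0 0 i) by ring.
rewrite subr_ge0; apply=> u /sub U.
  by apply: is_deriveB; [exact: dG|exact: is_derive_coord (dz u U)].
rewrite subr_ge0; have := le_trans (ler_coord (z' u) i) (H u U).
by rewrite ler_norml => /andP[].
Qed.

Lemma is_derive_exp_linear (k t : R) : is_derive t 1 (fun u => expR (k * u)) (k * expR (k * t)).
Proof.
have dk : is_derive t 1 (fun u => k * u) k.
  by apply: is_derive_eq (is_deriveZ k (is_derive_id t 1)) _; rewrite /GRing.scale/= mulr1.
have D := is_derive1_comp (is_derive_expR (k * t)) dk.
by rewrite mulrC; exact: D.
Qed.

Definition sumsq v : R := \sum_i v 0 i ^+ 2.

Lemma norm_sumsq v : `|v| ^+ 2 <= sumsq v /\ sumsq v <= n%:R * `|v| ^+ 2.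
Proof.
split.
  rewrite -[leRHS]sqr_sqrtr; last by apply: sumr_ge0 => i _; exact: sqr_ge0.
  rewrite lerXn2r ?nnegrE ?sqrtr_ge0//; apply: ler_rowP; first exact: sqrtr_ge0.
  move=> i; rewrite -sqrtr_sqr ler_wsqrtr// /sumsq (bigD1 i)//= lerDl.
  by apply: sumr_ge0 => j _; exact: sqr_ge0.
have : sumsq v <= \sum_(i < n) `|v| ^+ 2.
  apply: ler_sum => i _; rewrite -(real_normK (num_real _)).
  by rewrite lerXn2r ?nnegrE//; exact: ler_coord.
by rewrite sumr_const card_ord mulr_natl.
Qed.

(** Growth rate of the sum of squares of the coordinates of [z]: with [2 <z,
    z'> <= |z|^2 + |z'|^2], the bound on [z'] gives a linear inequality for
    it. *)
Definition gronwall_rate (L : R) : R := 1 + 2 * n%:R * L ^+ 2.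

(** The sum of squares is used instead of the norm because it is
    differentiable; the factors [n] compare it with the maximum norm. *)
Lemma gronwall (z z' : R -> 'rV[R]_n) (L d T : R) : 0 <= L -> 0 <= d ->
  (forall t, 0 <= t <= T -> is_derive t 1 z (z' t)) ->
  (forall t, 0 <= t <= T -> `|z' t| <= L * `|z t| + d) ->
  forall t, 0 <= t <= T ->
  `|z t| ^+ 2 <= expR (gronwall_rate L * t) * (n%:R * `|z 0| ^+ 2 + 2 * n%:R * d ^+ 2 * t).
Proof.
move=> L0 d0 dz H t /andP[t0 tT].
set K := gronwall_rate L; set e := 2 * n%:R * d ^+ 2.
have e0 : 0 <= e by rewrite mulr_ge0 ?sqr_ge0// mulr_ge0.
have K0 : 0 <= K by rewrite addr_ge0// mulr_ge0 ?sqr_ge0// mulr_ge0.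
pose p u := sumsq (z u); pose p' u := \sum_i (2 * z u 0 i * z' u 0 i).
have sub u : 0 <= u <= t -> 0 <= u <= T by move=> /andP[-> ut]; exact: le_trans tT.
have dp u : 0 <= u <= t -> is_derive u 1 p (p' u).
  move=> /sub U; have dzi i := is_derive_coord i (dz u U).
  have -> : p = \sum_i (fun u => z u 0 i * z u 0 i).
    by apply/funext => x; rewrite /p /sumsq fct_sumE; apply: eq_bigr => i _; rewrite expr2.
  apply: is_derive_sum => i.
  have D := is_deriveM (dzi i) (dzi i).
  apply: is_derive_eq D _.
  by rewrite /GRing.scale/=; ring.
have pK u : 0 <= u <= t -> p' u <= K * p u + e.
  move=> /sub U; have [n1 n2] := norm_sumsq (z u); have [m1 m2] := norm_sumsq (z' u).
  have : p' u <= p u + sumsq (z' u).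
    rewrite /p /sumsq -big_split/=; apply: ler_sum => i _.
    by rewrite -subr_ge0; have := sqr_ge0 (z u 0 i - z' u 0 i); rewrite sqrrB; lra.
  move=> h; apply: le_trans h _; rewrite /K /gronwall_rate mulrDl mul1r -addrA lerD2l.
  apply: le_trans m2 _.
  have h : `|z' u| ^+ 2 <= 2 * L ^+ 2 * `|z u| ^+ 2 + 2 * d ^+ 2.
    apply: (@le_trans _ _ ((L * `|z u| + d) ^+ 2)).
      by rewrite lerXn2r ?nnegrE ?H// addr_ge0// mulr_ge0.
    by rewrite -subr_ge0; have := sqr_ge0 (L * `|z u| - d); rewrite sqrrB sqrrD exprMn; lra.
  have n0 : 0 <= n%:R :> R by [].
  apply: (@le_trans _ _ (n%:R * (2 * L ^+ 2 * p u + 2 * d ^+ 2))).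
    apply: ler_wpM2l => //; apply: le_trans h _; rewrite lerD2r; apply: ler_wpM2l => //.
    by rewrite mulr_ge0 ?sqr_ge0.
  by rewrite /e /p; lra.
pose q u := - (expR (- K * u) * p u) + e * u.
pose q' u := - (expR (- K * u) * p' u - K * expR (- K * u) * p u) + e.
have dq u : 0 <= u <= t -> is_derive u 1 q (q' u).
  move=> U.
  have dK : is_derive u 1 (fun u => - K * u) (- K).
    by apply: is_derive_eq (is_deriveZ (- K) (is_derive_id u 1)) _; rewrite /GRing.scale/= mulr1.
  have dE : is_derive u 1 (fun u => expR (- K * u)) (- K * expR (- K * u)).
    exact: is_derive_exp_linear.
  have D1 := is_deriveN (is_deriveM dE (dp u U)).
  have D2 : is_derive u 1 (fun u => e * u) e.
    by apply: is_derive_eq (is_deriveZ e (is_derive_id u 1)) _; rewrite /GRing.scale/= mulr1.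
  apply: is_derive_eq (is_deriveD D1 D2) _.
  by rewrite /q' /GRing.scale/=; ring.
have q0 u : 0 <= u <= t -> 0 <= q' u.
  move=> U; have h := pK u U; rewrite /q' addrC subr_ge0.
  have E0 := expR_gt0 (- K * u).
  have E1 : expR (- K * u) <= 1.
    by rewrite -expR0 ler_expR mulNr oppr_le0 mulr_ge0//; case/andP: U.
  have : expR (- K * u) * (p' u - K * p u) <= e.
    apply: (@le_trans _ _ (expR (- K * u) * e)).
      by apply: ler_wpM2l; [exact: ltW|lra].
    by rewrite ler_piMl.
  by move: (expR (- K * u)) (p' u) (p u) => E P' P; lra.
have := le_of_derive_full t0 dq q0.
rewrite /q !mulr0 expR0 mul1r addr0 => h.
have [n1 _] := norm_sumsq (z t); have [_ n2] := norm_sumsq (z 0).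
apply: le_trans n1 _; rewrite -ler_pdivrMl ?expR_gt0// -expRN -mulNr.
by move: h n2; rewrite /p; move: (expR (- K * t) * _) (e * t) => x y; lra.
Qed.

End Rows.

(** * Existence of solutions of differential equations *)
Section Picard.
Context {R : realType} {n : nat}.
Implicit Types (v w y : 'rV[R]_n).

(** The intervals with centre [u k] and radius [2 * C / 2 ^+ k] are nested. *)
Lemma geometric_limit_R (u : nat -> R) (C : R) : (forall k, `|u k.+1 - u k| <= C / 2 ^+ k) ->
  exists l, forall k, `|u k - l| <= 2 * C / 2 ^+ k.
Proof.
move=> H; pose lo k := u k - 2 * C / 2 ^+ k; pose hi k := u k + 2 * C / 2 ^+ k.
have half k : 2 * C / 2 ^+ k = C / 2 ^+ k + 2 * C / 2 ^+ k.+1.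
  by rewrite exprS; field; rewrite expf_neq0.
have C0 k : 0 <= C / 2 ^+ k := le_trans (normr_ge0 _) (H k).
have lo_mono : {homo lo : i j / (i <= j)%N >-> i <= j}.
  apply: homo_leq => // [i j k|i]; first exact: le_trans.
  have := H i; rewrite ler_norml /lo (half i); move: (C / 2 ^+ i) (2 * C / 2 ^+ i.+1) => x x'; lra.
have hi_mono : {homo hi : i j / (i <= j)%N >-> j <= i}.
  have h i : hi i.+1 <= hi i.
    by have := H i; rewrite ler_norml /hi (half i); move: (C / 2 ^+ i) (2 * C / 2 ^+ i.+1) => x x'; lra.
  move=> i j ij; rewrite -(subnK ij); elim: (j - i)%N => [|m IH]; first exact: lexx.
  by rewrite addSn; exact: le_trans (h _) IH.
have lohi i j : lo i <= hi j.
  apply: (@le_trans _ _ (lo (maxn i j))); first by apply: lo_mono; exact: leq_maxl.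
  apply: (@le_trans _ _ (hi (maxn i j))); last by apply: hi_mono; exact: leq_maxr.
  by rewrite /lo /hi; have := C0 (maxn i j); move: (u _) => ?; rewrite -mulrA; move: (C / _) => ? ?; lra.
have sS : has_sup (range lo) by split; [exists (lo 0%N), 0%N|exists (hi 0%N) => _ [i _ <-]].
exists (sup (range lo)) => k; rewrite ler_norml; apply/andP; split.
  have : sup (range lo) <= hi k by apply: ge_sup; [case: sS|move=> _ [i _ <-]].
  by rewrite /hi; lra.
have : lo k <= sup (range lo) by apply: sup_upper_bound => //; exists k.
by rewrite /lo; lra.
Qed.

Lemma pow2_small (A e : R) : 0 < e -> exists N, A / 2 ^+ N <= e.
Proof.
move=> e0; pose x := `|A| / e; have x0 : 0 <= x by apply: divr_ge0 => //; exact: ltW.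
have p2 (j : nat) : 0 < 2 ^+ j :> R by rewrite exprn_gt0.
exists (Num.bound x); rewrite ler_pdivrMr ?p2// [leRHS]mulrC.
apply: (@le_trans _ _ `|A|); first exact: ler_norm.
rewrite -ler_pdivrMr//; apply: le_trans (ltW (archi_boundP x0)) _.
by rewrite -natrX ler_nat ltnW// ltn_expl.
Qed.

Lemma geometric_limit (u : nat -> 'rV[R]_n) : exists l, forall C : R,
  (forall k, `|u k.+1 - u k| <= C / 2 ^+ k) -> forall k, `|u k - l| <= 2 * C / 2 ^+ k.
Proof.
have [[C0 H0]|no] := pselect (exists C : R, forall k, `|u k.+1 - u k| <= C / 2 ^+ k); last first.
  by exists 0 => C H; case: no; exists C.
have Hi C i : (forall k, `|u k.+1 - u k| <= C / 2 ^+ k) -> forall k, `|u k.+1 0 i - u k 0 i| <= C / 2 ^+ k.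
  by move=> H k; apply: le_trans (H k); have := ler_coord (u k.+1 - u k) i; rewrite !mxE.
have [l Hl] := choice (fun i => geometric_limit_R (Hi C0 i H0)).
exists (\row_i l i) => C H k.
have p2 (j : nat) : 0 < 2 ^+ j :> R by rewrite exprn_gt0.
have C0' : 0 <= C by have := le_trans (normr_ge0 _) (H 0%N); rewrite expr0 divr1.
apply: ler_rowP => [|i]; first by apply: divr_ge0; [exact: mulr_ge0|exact: ltW].
rewrite !mxE; have [l' Hl'] := geometric_limit_R (Hi C i H).
suff -> : l i = l' by exact: Hl'.
apply/eqP; rewrite -subr_eq0 -normr_le0; apply/ler_addgt0Pl => e e0; rewrite addr0.
have [N HN] := pow2_small (2 * `|C0| + 2 * C) e0.
rewrite (_ : l i - l' = (u N 0 i - l') - (u N 0 i - l i)); last by ring.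
apply: le_trans HN; apply: le_trans (ler_normB _ _) _.
rewrite mulrDl addrC; apply: lerD; last exact: Hl'.
apply: le_trans (Hl i N) _; rewrite ler_pM2r ?invr_gt0// ler_pM2l//; exact: ler_norm.
Qed.

Variable f : R -> 'rV[R]_n -> 'rV[R]_n.
Hypothesis cf : continuous (fun p : R * 'rV[R]_n => f p.1 p.2).

Lemma continuous_row (T : topologicalType) (z : T -> 'rV[R]_n) (t : T) :
  (forall i, {for t, continuous (fun u => z u 0 i)}) -> {for t, continuous z}.
Proof.
move=> H.
have -> : z = (fun u => \sum_i (z u 0 i) *: delta_mx 0 i :> 'rV[R]_n).
  by apply/funext => u; rewrite -row_sum_delta.
apply: continuous_sum => i _; apply: continuousZr_tmp; exact: H.
Qed.

Lemma continuous_coord_fun (z : R -> 'rV[R]_n) i : continuous z -> continuous (fun u => z u 0 i).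
Proof.
move=> cz t; have lin : linear (fun v : 'rV[R]_n => v 0 i) by move=> k u v; rewrite !mxE.
have cl : continuous (mk_linear lin) by exact: linear_rV_continuous.
exact: (continuous_comp (f := z) (g := mk_linear lin) (cz t) (cl _)).
Qed.

Lemma continuous_along (z : R -> 'rV[R]_n) : continuous z -> continuous (fun t => f t (z t)).
Proof.
move=> cz t; apply: (continuous_comp (f := fun t => (t, z t)) (g := fun p => f p.1 p.2)).
  exact: (cvg_pair (@cvg_id _ (nbhs t)) (cz t)).
exact: cf.
Qed.

Lemma primitive_row (h : R -> 'rV[R]_n) y : continuous h ->
  exists z : R -> 'rV[R]_n, z 0 = y /\ forall t : R, is_derive t 1 z (h t).
Proof.
move=> ch; have [P HP] := choice (fun i => primitive_exists (@continuous_coord_fun h i ch)).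
exists (fun t => \row_i (y 0 i + P i t)); split.
  by apply/rowP => i; rewrite mxE (HP i).1 addr0.
move=> t; apply: is_derive_row => i.
have -> : (fun t => (\row_i (y 0 i + P i t)) 0 i) = (fun t => y 0 i + P i t).
  by apply/funext => u; rewrite mxE.
by apply: is_derive_eq (is_deriveD (is_derive_cst (y 0 i) t 1) ((HP i).2 t)) _; rewrite add0r.
Qed.

Lemma derivable_continuous_row (z : R -> 'rV[R]_n) z' : (forall t : R, is_derive t 1 z (z' t)) -> continuous z.
Proof.
move=> H t; have [d _] := H t.
by apply/differentiable_continuous/derivable1_diffP.
Qed.

Lemma picard_sequence y : exists z : nat -> R -> 'rV[R]_n,
  (forall t, z 0%N t = y) /\ forall k, z k.+1 0 = y /\
  forall t : R, is_derive t 1 (z k.+1) (f t (z k t)).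
Proof.
have step (u : {z : R -> 'rV[R]_n | continuous z}) : exists u' : {z : R -> 'rV[R]_n | continuous z},
    sval u' 0 = y /\ forall t : R, is_derive t 1 (sval u') (f t (sval u t)).
  have [z [z0 dz]] := primitive_row y (continuous_along (svalP u)).
  by exists (exist _ z (derivable_continuous_row dz)).
have [next Hnext] := choice step.
have cy : continuous (fun _ : R => y) by move=> t; exact: cvg_cst.
exists (fun k => sval (iter k next (exist _ (fun _ : R => y) cy))); split=> // k.
exact: Hnext.
Qed.

End Picard.

(** The weight [expR (2 * L * t)] makes each step of the iteration a
    contraction by one half on the whole interval, so that no short time
    steps have to be patched. *)
Lemma picard_estimate {R : realType} {n : nat} (f : R -> 'rV[R]_n -> 'rV[R]_n) (L M T : R) y
    (z : nat -> R -> 'rV[R]_n) : 1 <= L -> 0 <= M ->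
  (forall t v w, 0 <= t <= T -> `|f t v - f t w| <= L * `|v - w|) ->
  (forall t, 0 <= t <= T -> `|f t y| <= M) ->
  (forall t, z 0%N t = y) ->
  (forall k, z k.+1 0 = y) ->
  (forall k (t : R), is_derive t 1 (z k.+1) (f t (z k t))) ->
  forall k t, 0 <= t <= T -> `|z k.+1 t - z k t| <= M / 2 ^+ k * expR (2 * L * t).
Proof.
move=> L1 M0 lf fM z0 zy dz; elim=> [|k IH] t tT.
  have tt := tT; case/andP: tt => t0 _.
  rewrite z0 expr0 divr1; have := @mean_value_bound R n (z 1%N) (fun t => f t y) (fun t => M * t) (fun=> M) T _ _ fM t tT.
  rewrite zy mulr0 subr0 => H; apply: le_trans (H _ _) _.
  - by move=> u _; have := dz 0%N u; rewrite z0.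
  - by move=> u _; apply: is_derive_eq (is_deriveZ M (is_derive_id u 1)) _; rewrite /GRing.scale/= mulr1.
  apply: ler_wpM2l => //; apply: le_trans (expR_ge1Dx _); apply: (@le_trans _ _ (2 * L * t)).
    by rewrite ler_peMl//; lra.
  by rewrite lerDr.
pose G u := M / 2 ^+ k.+1 * expR (2 * L * u).
pose G' u := M / 2 ^+ k * L * expR (2 * L * u).
have dG (u : R) : is_derive u 1 G (G' u).
  apply: is_derive_eq (is_deriveZ (M / 2 ^+ k.+1) (is_derive_exp_linear (2 * L) u)) _.
  by rewrite /G' /GRing.scale/= exprS; field; rewrite expf_neq0.
have G0 : 0 <= G 0 by rewrite /G mulr0 expR0 mulr1 divr_ge0// exprn_ge0.
apply: (@le_trans _ _ (G t - G 0)); last by rewrite lerBlDr lerDl.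
have dd (u : R) : 0 <= u <= T -> is_derive u 1 (fun u => z k.+2 u - z k.+1 u) (f u (z k.+1 u) - f u (z k u)).
  by move=> _; exact: is_deriveB (dz k.+1 u) (dz k u).
have := mean_value_bound dd (fun u _ => dG u) _ tT.
rewrite !zy subrr subr0; apply=> u uT.
apply: le_trans (lf _ _ _ uT) _; apply: (@le_trans _ _ (L * (M / 2 ^+ k * expR (2 * L * u)))).
  by apply: ler_wpM2l; [lra|exact: IH].
by rewrite /G' [leLHS]mulrA [L * _]mulrC.
Qed.

Section PicardTheorem.
Context {R : realType} {n : nat}.
Variable f : R -> 'rV[R]_n -> 'rV[R]_n.
Hypothesis cf : continuous (fun p : R * 'rV[R]_n => f p.1 p.2).
Hypothesis lf : forall T : R, exists2 L : R, 1 <= L &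
  forall t v w, `|t| <= T -> `|f t v - f t w| <= L * `|v - w|.

Lemma mean_value_bound_sym (z z' : R -> 'rV[R]_n) (B T : R) :
  (forall t : R, `|t| <= T -> is_derive t 1 z (z' t)) ->
  (forall t : R, `|t| <= T -> `|z' t| <= B) ->
  forall t, `|t| <= T -> `|z t - z 0| <= B * `|t|.
Proof.
move=> dz Hz t tT.
have lin (u : R) : is_derive u 1 (fun u => B * u) B.
  by apply: is_derive_eq (is_deriveZ B (is_derive_id u 1)) _; rewrite /GRing.scale/= mulr1.
have [t0|/ltW t0] := leP 0 t.
  have inT u : 0 <= u <= T -> `|u| <= T by move=> /andP[u0 uT]; rewrite ger0_norm.
  have := @mean_value_bound R n z z' (fun u => B * u) (fun=> B) T (fun u U => dz u (inT u U))
    (fun u _ => lin u) (fun u U => Hz u (inT u U)) t.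
  rewrite mulr0 subr0 (ger0_norm t0); apply; rewrite t0 /=.
  by rewrite (ger0_norm t0) in tT.
have inT u : 0 <= u <= T -> `|- u| <= T by move=> /andP[u0 uT]; rewrite normrN ger0_norm.
have := @mean_value_bound R n (fun u => z (- u)) (fun u => - z' (- u)) (fun u => B * u) (fun=> B) T
  (fun u U => is_derive_reflect (dz _ (inT u U))) (fun u _ => lin u) _ (- t).
rewrite mulr0 subr0 opprK oppr0 (ler0_norm t0); apply.
  by move=> u U; rewrite normrN; exact: Hz (inT u U).
by rewrite oppr_ge0 t0 -(ler0_norm t0).
Qed.

Lemma continuous_bounded (h : R -> 'rV[R]_n) (T : R) : continuous h ->
  exists2 M : R, 0 <= M & forall t, `|t| <= T -> `|h t| <= M.
Proof.
move=> ch; have cw : {within `[- T, T], continuous h}.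
  by apply: continuous_in_subspaceT => t _; exact: ch.
have [M [_ HM]] := compact_bounded (continuous_compact cw (@segment_compact _ _ _)).
exists (Num.max 0 (M + 1)); first by rewrite le_max lexx.
move=> t tT; apply: HM; first by rewrite lt_max ltrDl ltr01 orbT.
by exists t => //=; rewrite in_itv/= -ler_norml.
Qed.

(** The Lipschitz bound is uniform in the space variable for each time
    interval, hence solutions exist for all times. *)
Lemma picard (y : 'rV[R]_n) : exists z : R -> 'rV[R]_n, z 0 = y /\
  forall t : R, is_derive t 1 z (f t (z t)).
Proof.
have [z [z0 Hz]] := picard_sequence cf y.
have zy k : z k.+1 0 = y by have [] := Hz k.
have dz k (t : R) : is_derive t 1 (z k.+1) (f t (z k t)) by have [_] := Hz k.
have cy : continuous (fun _ : R => y) by move=> t; exact: cvg_cst.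
have bound T : exists2 C : R, 0 <= C & forall k t, `|t| <= T -> `|z k.+1 t - z k t| <= C / 2 ^+ k.
  have [L L1 lT] := lf T; have L0 : 0 <= L := le_trans ler01 L1.
  have [M M0 HM] := continuous_bounded T (continuous_along cf cy).
  exists (M * expR (2 * L * T)); first by rewrite mulr_ge0 ?expR_ge0.
  move=> k t tT.
  have E (u : R) : u <= T -> M / 2 ^+ k * expR (2 * L * u) <= M * expR (2 * L * T) / 2 ^+ k.
    move=> uT; have -> : M * expR (2 * L * T) / 2 ^+ k = M / 2 ^+ k * expR (2 * L * T) by rewrite mulrAC.
    apply: ler_wpM2l; first by rewrite divr_ge0// exprn_ge0.
    by rewrite ler_expR; apply: ler_wpM2l => //; exact: mulr_ge0.
  have [t0|/ltW t0] := leP 0 t.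
    rewrite (ger0_norm t0) in tT.
    apply: le_trans (E t tT); apply: (picard_estimate L1 M0 _ _ z0 zy dz (T := T)); last by rewrite t0.
      by move=> u v w /andP[u0 uT]; apply: lT; rewrite ger0_norm.
    by move=> u /andP[u0 uT]; apply: HM; rewrite ger0_norm.
  rewrite (ler0_norm t0) in tT; apply: le_trans (E (- t) tT).
  have lf' u v w : 0 <= u <= T -> `|- f (- u) v - - f (- u) w| <= L * `|v - w|.
    by move=> /andP[u0 uT]; rewrite -opprD normrN; apply: lT; rewrite normrN ger0_norm.
  have fM u : 0 <= u <= T -> `|- f (- u) y| <= M.
    by move=> /andP[u0 uT]; rewrite normrN; apply: HM; rewrite normrN ger0_norm.
  have dz' j (u : R) : is_derive u 1 (fun u => z j.+1 (- u)) (- f (- u) (z j (- u))).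
    exact: is_derive_reflect (dz j (- u)).
  have := @picard_estimate R n (fun u v => - f (- u) v) L M T y (fun j u => z j (- u)) L1 M0 lf' fM
    (fun u => z0 (- u)) _ dz' k (- t).
  rewrite opprK; apply; last by rewrite oppr_ge0 t0.
  by move=> j; rewrite oppr0.
have [l Hl] := choice (fun t => geometric_limit (fun k => z k t)).
have unif T C : (forall k t, `|t| <= T -> `|z k.+1 t - z k t| <= C / 2 ^+ k) ->
    forall k t, `|t| <= T -> `|z k t - l t| <= 2 * C / 2 ^+ k.
  by move=> H k t tT; apply: Hl => j; exact: H.
have cz k : continuous (z k).
  case: k => [|k]; last exact: derivable_continuous_row (dz k).
  by have -> : z 0%N = (fun _ : R => y) by exact/funext.
have cl : continuous l.
  move=> t; apply/cvgrPdist_le => e e0.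
  have [C C0 HC] := bound (`|t| + 1); have U := unif _ _ HC.
  have e3 : 0 < e / 3 by rewrite divr_gt0.
  have [N HN] := pow2_small (2 * C) e3.
  have /cvgrPdist_le/(_ _ e3) NZ := cz N t.
  have NT : \forall u \near t, `|u| <= `|t| + 1.
    apply/near_ballP; exists 1 => // u ut; rewrite -(subrK t u) addrC.
    by apply: le_trans (ler_normD _ _) _; rewrite lerD2l ltW.
  apply: filterS2 NZ NT => u zu uT.
  have -> : l t - l u = (z N u - l u) + (z N t - z N u) - (z N t - l t).
    by apply/rowP => i; rewrite !mxE; ring.
  apply: le_trans (ler_normB _ _) _; apply: (@le_trans _ _ (e / 3 + e / 3 + e / 3)); last by lra.
  apply: lerD; last by apply: le_trans HN; apply: U; rewrite lerDl.
  apply: le_trans (ler_normD _ _) _; apply: lerD => //.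
  by apply: le_trans HN; exact: U.
have [Z [Z0 dZ]] := primitive_row y (continuous_along cf cl).
suff E : l = Z by exists l; split=> [|t]; [rewrite E|rewrite {1}E; exact: dZ].
apply/funext => t; apply/eqP; rewrite -subr_eq0 -normr_le0; apply/ler_addgt0Pl => e e0; rewrite addr0.
have [C C0 HC] := bound `|t|; have U := unif _ _ HC.
have [L L1 lT] := lf `|t|; have L0 : 0 <= L := le_trans ler01 L1.
have [N HN] := pow2_small (2 * C + L * (2 * C) * `|t|) e0.
have dd (u : R) : `|u| <= `|t| -> is_derive u 1 (fun u => z N.+1 u - Z u) (f u (z N u) - f u (l u)).
  by move=> _; exact: is_deriveB (dz N u) (dZ u).
have B (u : R) : `|u| <= `|t| -> `|f u (z N u) - f u (l u)| <= L * (2 * C / 2 ^+ N).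
  by move=> ut; apply: le_trans (lT _ _ _ ut) _; apply: ler_wpM2l; [by []|exact: U].
have := mean_value_bound_sym dd B (lexx _); rewrite zy Z0 subrr subr0 => H.
have -> : l t - Z t = (z N.+1 t - Z t) - (z N.+1 t - l t).
  by apply/rowP => i; rewrite !mxE; ring.
apply: le_trans (ler_normB _ _) _; apply: le_trans HN.
rewrite addrC [leRHS]mulrDl; apply: lerD; last first.
  by have -> : L * (2 * C) * `|t| / 2 ^+ N = L * (2 * C / 2 ^+ N) * `|t| by ring.
apply: le_trans (U N.+1 t (lexx _)) _; apply: ler_wpM2l; first exact: mulr_ge0.
by rewrite lef_pV2 ?posrE ?exprn_gt0// exprS ler_peMl ?exprn_ge0//; lra.
Qed.

End PicardTheorem.

(** * Local bounds for smooth maps *)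
Section GronwallConsequences.
Context {R : realType} {n : nat}.

Definition gronwall_const (L T : R) : R :=
  1 + expR (gronwall_rate (n := n) L * T) * (2 * n%:R * (1 + T)).

Lemma gronwall_const_ge0 L T : 0 <= T -> 0 <= gronwall_const L T.
Proof.
move=> T0; apply: addr_ge0 => //; apply: mulr_ge0; first exact: expR_ge0.
by apply: mulr_ge0; [exact: mulr_ge0|exact: addr_ge0].
Qed.

Lemma gronwall_sym (z z' : R -> 'rV[R]_n) (L d T : R) : 0 <= L -> 0 <= d ->
  (forall t : R, `|t| <= T -> is_derive t 1 z (z' t)) ->
  (forall t : R, `|t| <= T -> `|z' t| <= L * `|z t| + d) ->
  forall t, `|t| <= T -> `|z t| <= gronwall_const L T * (`|z 0| + d).
Proof.
move=> L0 d0 dz H t tT; have T0 : 0 <= T := le_trans (normr_ge0 _) tT.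
have C0 := gronwall_const_ge0 L T0.
have E : `|z t| ^+ 2 <= expR (gronwall_rate (n := n) L * `|t|) * (n%:R * `|z 0| ^+ 2 + 2 * n%:R * d ^+ 2 * `|t|).
  have [t0|/ltW t0] := leP 0 t.
    have inT u : 0 <= u <= T -> `|u| <= T by move=> /andP[u0 uT]; rewrite ger0_norm.
    rewrite (ger0_norm t0); rewrite (ger0_norm t0) in tT.
    by apply: (gronwall L0 d0 (fun u U => dz u (inT u U)) (fun u U => H u (inT u U))); rewrite t0.
  have inT u : 0 <= u <= T -> `|- u| <= T by move=> /andP[u0 uT]; rewrite normrN ger0_norm.
  rewrite (ler0_norm t0); rewrite (ler0_norm t0) in tT.
  have H' u : 0 <= u <= T -> `|- z' (- u)| <= L * `|z (- u)| + d.
    by move=> U; rewrite normrN; exact: H (inT u U).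
  have := gronwall L0 d0 (fun u U => is_derive_reflect (dz _ (inT u U))) H' (t := - t).
  by rewrite opprK oppr0; apply; rewrite oppr_ge0 t0.
have K0 : 0 <= gronwall_rate (n := n) L by rewrite addr_ge0// mulr_ge0 ?sqr_ge0// mulr_ge0.
pose c := expR (gronwall_rate (n := n) L * T) * (2 * n%:R * (1 + T)).
have c0 : 0 <= c.
  by apply: mulr_ge0; [exact: expR_ge0|apply: mulr_ge0; [exact: mulr_ge0|exact: addr_ge0]].
have : `|z t| ^+ 2 <= ((1 + c) * (`|z 0| + d)) ^+ 2.
  apply: le_trans E _; apply: (@le_trans _ _ (c * (`|z 0| + d) ^+ 2)).
    rewrite /c -[leRHS]mulrA; apply: ler_pM; first exact: expR_ge0.
    - by rewrite addr_ge0 ?mulr_ge0 ?sqr_ge0.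
    - by rewrite ler_expR; apply: ler_wpM2l.
    - have n0 : 0 <= n%:R :> R by [].
      have h1 : 2 * n%:R * d ^+ 2 * `|t| <= 2 * n%:R * d ^+ 2 * T.
        by apply: ler_wpM2l => //; apply: mulr_ge0; [exact: mulr_ge0|exact: sqr_ge0].
      have h2 : 0 <= n%:R * (T * `|z 0| ^+ 2) by rewrite !mulr_ge0 ?sqr_ge0.
      have h3 : 0 <= n%:R * `|z 0| ^+ 2 by rewrite !mulr_ge0 ?sqr_ge0.
      have h4 : 0 <= n%:R * (`|z 0| * d) by rewrite !mulr_ge0.
      have h5 : 0 <= n%:R * (T * (`|z 0| * d)) by rewrite !mulr_ge0.
      have h6 : 0 <= n%:R * d ^+ 2 by rewrite !mulr_ge0 ?sqr_ge0.
      apply: le_trans (lerD (lexx _) h1) _; rewrite -subr_ge0.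
      rewrite (_ : _ - _ = n%:R * `|z 0| ^+ 2 + 2 * (n%:R * (T * `|z 0| ^+ 2)) + 4 * (n%:R * (`|z 0| * d))
         + 4 * (n%:R * (T * (`|z 0| * d))) + 2 * (n%:R * d ^+ 2)); last by ring.
      by rewrite !addr_ge0// mulr_ge0.
  rewrite exprMn; apply: ler_wpM2r; first exact: sqr_ge0.
  by rewrite sqrrD expr1n mul1r; have := sqr_ge0 c; lra.
have c2 : 0 <= (1 + c) * (`|z 0| + d) by rewrite mulr_ge0// addr_ge0.
by rewrite ler_sqr ?nnegrE.
Qed.

End GronwallConsequences.

Section SmoothBounds.
Context {R : realType}.

Lemma ball_compact n (r : R) : compact [set v : 'rV[R]_n | `|v| <= r].
Proof.
have [r0|r0] := leP 0 r; last first.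
  rewrite (_ : [set v | _] = set0); first exact: compact0.
  by apply/seteqP; split=> // v /= h; have := le_trans (normr_ge0 v) h; rewrite leNgt r0.
rewrite (_ : [set v : 'rV[R]_n | `|v| <= r] = [set v : 'rV[R]_n | forall i, `[- r, r]%classic (v ord0 i)]).
  apply: (@rV_compact R n (fun=> `[- r, r]%classic)) => i; exact: segment_compact.
apply/seteqP; split=> v /= H.
  by move=> i; rewrite in_itv/= -ler_norml; exact: le_trans (ler_coord v i) H.
by apply: ler_rowP => // i; have := H i; rewrite in_itv/= -ler_norml.
Qed.

Lemma continuous_ball_bounded n (W : normedModType R) (g : 'rV[R]_n -> W) (r : R) :
  (forall v, `|v| <= r -> {for v, continuous g}) ->
  exists2 M : R, 0 <= M & forall v, `|v| <= r -> `|g v| <= M.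
Proof.
move=> cg; have cw : {within [set v : 'rV[R]_n | `|v| <= r], continuous g}.
  by apply: continuous_in_subspaceT => v /set_mem; exact: cg.
have [M [_ HM]] := compact_bounded (continuous_compact cw (@ball_compact n r)).
exists (Num.max 0 (M + 1)); first by rewrite le_max lexx.
move=> v vr; apply: HM; first by rewrite lt_max ltrDl ltr01 orbT.
by exists v.
Qed.

Lemma diff_coord_sum m n (G : 'rV[R]_m -> 'rV[R]_n) z v : differentiable G z ->
  'd G z v = \sum_i v 0 i *: 'D_(delta_mx 0 i) G z.
Proof.
move=> dG; rewrite {1}(row_sum_delta v) linear_sum; apply: eq_bigr => i _.
by rewrite linearZ deriveE.
Qed.

Lemma diff_bounded m n (G : 'rV[R]_m -> 'rV[R]_n) (r : R) : smooth setT G ->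
  exists2 B : R, 0 <= B & forall z v, `|z| <= r -> `|'d G z v| <= B * `|v|.
Proof.
move=> sG.
have H i : exists M : R, 0 <= M /\ forall z, `|z| <= r -> `|'D_(delta_mx 0 i) G z| <= M.
  have [M M0 HM] := continuous_ball_bounded (r := r)
    (fun v _ => smooth_continuous (smooth_D (delta_mx 0 i : 'rV[R]_m) sG) (I : setT v)).
  by exists M.
have [M HM] := choice H.
exists (\sum_i M i); first by apply: sumr_ge0 => i _; have [] := HM i.
move=> z v zr; rewrite diff_coord_sum; last exact: smooth_differentiable sG _.
rewrite mulr_suml; apply: le_trans (ler_norm_sum _ _ _) _; apply: ler_sum => i _.
rewrite normrZ mulrC; apply: ler_pM => //; first by have [_] := HM i; exact.
exact: ler_coord.
Qed.

Lemma is_derive_segment n (G : 'rV[R]_n -> 'rV[R]_n) m (H : 'rV[R]_n -> 'rV[R]_m) (p u : 'rV[R]_n) (s : R) :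
  smooth setT H -> is_derive s 1 (fun s => H (p + s *: u)) ('d H (p + s *: u) u).
Proof.
move=> sH; have dH : differentiable H (p + s *: u) by exact: smooth_differentiable sH _.
have [dl El] := is_derive_line p u s.
have dl' : differentiable (fun s : R => p + s *: u) s by exact/derivable1_diffP.
have dc : differentiable (H \o (fun s : R => p + s *: u)) s by exact: differentiable_comp.
split; first exact/derivable1_diffP.
have E := D_comp (1 : R) dl' dH; apply: etrans E _.
by rewrite El.
Qed.

Lemma segment_in_ball n (p q : 'rV[R]_n) (r s : R) : `|p| <= r -> `|q| <= r -> 0 <= s <= 1 ->
  `|p + s *: (q - p)| <= r.
Proof.
move=> pr qr /andP[s0 s1].
have -> : p + s *: (q - p) = (1 - s) *: p + s *: q.
  by apply/rowP => i; rewrite !mxE; ring.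
apply: le_trans (ler_normD _ _) _; rewrite !normrZ (ger0_norm s0) ger0_norm ?subr_ge0//.
have -> : r = (1 - s) * r + s * r by ring.
by apply: lerD; apply: ler_wpM2l => //; rewrite subr_ge0.
Qed.

Lemma smooth_lipschitz m n (G : 'rV[R]_m -> 'rV[R]_n) (r : R) : smooth setT G ->
  exists2 B : R, 0 <= B & forall p q, `|p| <= r -> `|q| <= r -> `|G p - G q| <= B * `|p - q|.
Proof.
move=> sG; have [B B0 HB] := diff_bounded r sG; exists B => // p q pr qr.
have lin (s : R) : is_derive s 1 (fun s => B * `|p - q| * s) (B * `|p - q|).
  by apply: is_derive_eq (is_deriveZ (B * `|p - q|) (is_derive_id s 1)) _; rewrite /GRing.scale/= mulr1.
have := @mean_value_bound R n (fun s => G (q + s *: (p - q))) (fun s => 'd G (q + s *: (p - q)) (p - q))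
  (fun s => B * `|p - q| * s) (fun=> B * `|p - q|) 1 (fun s _ => is_derive_segment id q (p - q) s sG)
  (fun s _ => lin s) _ 1.
have -> : q + 1 *: (p - q) = p by rewrite scale1r addrC subrK.
have -> : q + 0 *: (p - q) = q by rewrite scale0r addr0.
rewrite mulr1 mulr0 subr0; apply; last by rewrite ler01 lexx.
by move=> s s01; apply: HB; exact: segment_in_ball.
Qed.

(** Base point and direction are packed into one vector, so that the
    differential of a smooth map is a smooth map between spaces of rows. *)
Definition dpair m n (G : 'rV[R]_m -> 'rV[R]_n) (z : 'rV[R]_(m + m)) : 'rV[R]_n :=
  'd G (lsubmx z) (rsubmx z).

Lemma smooth_dpair m n (G : 'rV[R]_m -> 'rV[R]_n) : smooth setT G -> smooth setT (dpair G).
Proof.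
move=> sG; apply: (@smooth_diff _ _ _ _ setT setT) => //; first exact: openT.
- exact: openT.
- exact: smooth_lsubmx.
- exact: smooth_rsubmx.
Qed.

Lemma norm_row_mx m n (v : 'rV[R]_m) (w : 'rV[R]_n) (r : R) : 0 <= r -> `|v| <= r -> `|w| <= r ->
  `|row_mx v w| <= r.
Proof.
move=> r0 vr wr; apply: ler_rowP => // i; case: (split_ordP i) => j ->.
  by rewrite row_mxEl; exact: le_trans (ler_coord _ _) vr.
by rewrite row_mxEr; exact: le_trans (ler_coord _ _) wr.
Qed.

Lemma norm_lsubmx m n (z : 'rV[R]_(m + n)) : `|lsubmx z| <= `|z|.
Proof. by apply: ler_rowP => // i; rewrite mxE; exact: ler_coord. Qed.

Lemma norm_rsubmx m n (z : 'rV[R]_(m + n)) : `|rsubmx z| <= `|z|.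
Proof. by apply: ler_rowP => // i; rewrite mxE; exact: ler_coord. Qed.

Lemma linear_sub_scale (V W : lmodType R) (L L' : {linear V -> W}) (k : R) w :
  L (k *: w) - L' (k *: w) = k *: (L w - L' w).
Proof.
have E (M : {linear V -> W}) : M (k *: w) = k *: M w by exact: linearZ.
by rewrite !E scalerBr.
Qed.

Lemma diff_lipschitz m n (G : 'rV[R]_m -> 'rV[R]_n) (r : R) : smooth setT G ->
  exists2 B : R, 0 <= B & forall p q v, `|p| <= r -> `|q| <= r ->
    `|'d G p v - 'd G q v| <= B * `|p - q| * `|v|.
Proof.
move=> sG; have [B B0 HB] := smooth_lipschitz (Num.max r 1) (smooth_dpair sG).
exists B => // p q v pr qr.
pose w := `|v|^-1 *: v.
have vE : v = `|v| *: w.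
  by have [->|v0] := eqVneq v 0; rewrite ?normr0 ?scale0r// scalerA divff ?scale1r// normr_eq0.
have nw : `|w| <= 1.
  rewrite normrZ normfV normr_id; have [->|v0] := eqVneq v 0; first by rewrite normr0 mulr0.
  by rewrite mulVf// normr_eq0.
have -> : 'd G p v - 'd G q v = `|v| *: ('d G p w - 'd G q w).
  by rewrite {1 2}vE; exact: linear_sub_scale.
rewrite normrZ normr_id mulrC; apply: ler_wpM2r => //.
have m1 : 0 <= Num.max r 1 by rewrite le_max ler01 orbT.
have := HB (row_mx p w) (row_mx q w); rewrite /dpair !row_mxKl !row_mxKr => H.
apply: le_trans (H _ _) _.
- by apply: norm_row_mx => //; rewrite le_max ?pr ?nw ?orbT.
- by apply: norm_row_mx => //; rewrite le_max ?qr ?nw ?orbT.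
apply: ler_wpM2l => //; have -> : row_mx p w - row_mx q w = row_mx (p - q) 0.
  by rewrite opp_row_mx add_row_mx subrr.
by apply: norm_row_mx => //; rewrite normr0.
Qed.

Lemma taylor_bound n m (G : 'rV[R]_m -> 'rV[R]_n) (r : R) : smooth setT G ->
  exists2 B : R, 0 <= B & forall p q, `|p| <= r -> `|q| <= r ->
    `|G p - G q - 'd G q (p - q)| <= B * `|p - q| ^+ 2.
Proof.
move=> sG; have [B B0 HB] := diff_lipschitz r sG; exists B => // p q pr qr.
pose c := B * `|p - q| ^+ 2.
have lin (s : R) : is_derive s 1 (fun s => c * s) c.
  by apply: is_derive_eq (is_deriveZ c (is_derive_id s 1)) _; rewrite /GRing.scale/= mulr1.
suff gen u : (forall s : R, 0 <= s <= 1 -> `|'d G (q + s *: (p - q)) (p - q) - u| <= c) ->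
    `|G p - G q - u| <= c.
  apply: gen => s s01; apply: le_trans (HB _ _ _ (segment_in_ball qr pr s01) qr) _.
  rewrite /c expr2 mulrA; apply: ler_wpM2r => //; apply: ler_wpM2l => //.
  have -> : q + s *: (p - q) - q = s *: (p - q) by rewrite addrAC subrr add0r.
  by rewrite normrZ; case/andP: s01 => s0 s1; rewrite (ger0_norm s0) ler_piMl.
move=> H.
have lin2 (s : R) : is_derive s 1 (fun s : R => s *: u) u.
  by have := is_derive_line 0 u s; under eq_fun do rewrite add0r.
have dG (s : R) : is_derive s 1 (fun s => G (q + s *: (p - q)) - s *: u)
    ('d G (q + s *: (p - q)) (p - q) - u).
  exact: is_deriveB (is_derive_segment id q (p - q) s sG) (lin2 s).
have := @mean_value_bound R n _ _ (fun s => c * s) (fun=> c) 1 (fun s _ => dG s) (fun s _ => lin s) H 1.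
have -> : q + 1 *: (p - q) = p by rewrite scale1r addrC subrK.
have -> : q + 0 *: (p - q) = q by rewrite scale0r addr0.
have -> : G p - 1 *: u - (G q - 0 *: u) = G p - G q - u.
  by rewrite scale1r scale0r subr0 addrAC.
by rewrite mulr1 mulr0 subr0; apply; rewrite ler01 lexx.
Qed.

End SmoothBounds.

(** * Flows and their smoothness *)
Lemma linear_remainder (R : realType) (V W : lmodType R) (L : {linear V -> W}) (a b : V) (w : W) :
  w - L b = L (a - b) + (w - L a).
Proof.
have -> : L (a - b) = L a - L b by exact: linearB.
by rewrite addrCA; congr (_ + _); rewrite addrAC subrr add0r.
Qed.

Lemma linear_split (R : realType) (V W : lmodType R) (L : {linear V -> W}) (a b : V) (w : W) :
  L a - w = L (a - b) + (L b - w).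
Proof.
have -> : L (a - b) = L a - L b by exact: linearB.
by rewrite addrA subrK.
Qed.

Section Flows.
Context {R : realType}.

(** A complete flow of [W], with a Lipschitz bound in the initial condition on
    bounded sets; this is what is inherited by the linearised equation. *)
Definition is_flow n (W : 'rV[R]_n -> 'rV[R]_n) (P : R -> 'rV[R]_n -> 'rV[R]_n) : Prop :=
  [/\ (forall x, P 0 x = x),
      (forall x (t : R), is_derive t 1 (fun t => P t x) (W (P t x)))
    & (forall T r : R, exists2 L : R, 0 <= L & forall t x y, `|t| <= T ->
         `|x| <= r -> `|y| <= r -> `|P t x - P t y| <= L * `|x - y|)].

Lemma flow_continuous n (W : 'rV[R]_n -> 'rV[R]_n) P x : is_flow W P -> continuous (fun t => P t x).
Proof. by move=> [_ dP _]; exact: derivable_continuous_row (dP x). Qed.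

Lemma flow_bounded n (W : 'rV[R]_n -> 'rV[R]_n) P (T r : R) : is_flow W P ->
  exists2 M : R, 0 <= M & forall t x, `|t| <= T -> `|x| <= r -> `|P t x| <= M.
Proof.
move=> fl; have [_ _ lP] := fl; have [L L0 HL] := lP T r.
have [M M0 HM] := continuous_bounded T (@flow_continuous _ _ _ 0 fl).
exists (L * `|r| + M); first by rewrite addr_ge0// mulr_ge0.
move=> t x tT xr; have -> : P t x = (P t x - P t 0) + P t 0 by rewrite subrK.
apply: le_trans (ler_normD _ _) _; apply: lerD; last exact: HM.
apply: le_trans (HL t x 0 tT xr _) _.
  by rewrite normr0; exact: le_trans xr.
by rewrite subr0; apply: ler_wpM2l => //; apply: le_trans xr (ler_norm _).
Qed.

Section Tower.
Variables (n : nat) (W : 'rV[R]_n -> 'rV[R]_n) (P : R -> 'rV[R]_n -> 'rV[R]_n).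
Hypotheses (sW : smooth setT W) (fl : is_flow W P).

Lemma variational_exists x v : exists z : R -> 'rV[R]_n, z 0 = v /\
  forall t : R, is_derive t 1 z ('d W (P t x) (z t)).
Proof.
apply: (@picard R n (fun t w => 'd W (P t x) w)).
  have -> : (fun p : R * 'rV[R]_n => 'd W (P p.1 x) p.2) =
      dpair W \o (fun p : R * 'rV[R]_n => row_mx (P p.1 x) p.2).
    by apply/funext => p; rewrite /dpair /= row_mxKl row_mxKr.
  move=> p; apply: continuous_comp; last exact: smooth_continuous (smooth_dpair sW) _.
  apply: continuous_row => i; case: (split_ordP i) => j ->.
    have -> : (fun u : R * 'rV[R]_n => row_mx (P u.1 x) u.2 0 (lshift n j)) = (fun t => P t x 0 j) \o fst.
      by apply/funext => u; rewrite /= row_mxEl.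
    apply: continuous_comp; first exact: cvg_fst.
    exact: (@continuous_coord_fun _ _ (fun t => P t x) j (flow_continuous (x := x) fl)).
  have -> : (fun u : R * 'rV[R]_n => row_mx (P u.1 x) u.2 0 (rshift n j)) = (fun w : 'rV[R]_n => w 0 j) \o snd.
    by apply/funext => u; rewrite /= row_mxEr.
  apply: continuous_comp; first exact: cvg_snd.
  by apply: smooth_continuous (smooth_coord j openT (smooth_id setT)) _.
move=> T; have [M M0 HM] := flow_bounded T `|x| fl.
have [B B0 HB] := diff_bounded M sW.
exists (1 + B) => [|t v1 v2 tT]; first by rewrite lerDl.
rewrite -[X in `|X|]/('d W (P t x) v1 - 'd W (P t x) v2).
apply: (@le_trans _ _ (B * `|v1 - v2|)); last by apply: ler_wpM2r => //; rewrite lerDr.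
by have := HB (P t x) (v1 - v2) (HM t x tT (lexx _)); rewrite linearB.
Qed.

(** The solution of the linearised equation along the orbit of [x] with
    initial value [v]. *)
Definition variation (t : R) (x v : 'rV[R]_n) : 'rV[R]_n := sval (cid (variational_exists x v)) t.

Lemma variation0 x v : variation 0 x v = v.
Proof. by rewrite /variation; case: cid => z []. Qed.

Lemma is_derive_variation x v (t : R) :
  is_derive t 1 (fun t => variation t x v) ('d W (P t x) (variation t x v)).
Proof. by rewrite /variation; case: cid => z []. Qed.

Lemma variation_bounded (T r : R) : 0 <= T -> exists2 C : R, 0 <= C & forall t x v, `|t| <= T -> `|x| <= r ->
  `|variation t x v| <= C * `|v|.
Proof.
move=> T0; have [M M0 HM] := flow_bounded T r fl; have [B B0 HB] := diff_bounded M sW.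
exists (gronwall_const (n := n) B T); first exact: gronwall_const_ge0.
move=> t x v tT xr.
have := @gronwall_sym R n (fun t => variation t x v) _ B 0 T B0 (lexx _) (fun t _ => is_derive_variation x v t) _ t tT.
rewrite variation0 addr0; apply=> u uT; rewrite addr0; apply: HB; exact: HM.
Qed.

Lemma variation_linear t x : linear (variation t x).
Proof.
move=> k v w; apply/eqP; rewrite -subr_eq0 -normr_le0.
pose z u := variation u x (k *: v + w) - (k *: variation u x v + variation u x w).
have dz (u : R) : is_derive u 1 z ('d W (P u x) (z u)).
  have D1 := is_derive_variation x (k *: v + w) u.
  have D2 := is_deriveD (is_deriveZ k (is_derive_variation x v u)) (is_derive_variation x w u).
  apply: is_derive_eq (is_deriveB D1 D2) _.
  by apply: esym; apply: etrans (linearB _ _ _) _; congr (_ - _); exact: linearP.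
have [M M0 HM] := flow_bounded `|t| `|x| fl; have [B B0 HB] := diff_bounded M sW.
have := @gronwall_sym R n z _ B 0 `|t| B0 (lexx _) (fun u _ => dz u) _ t (lexx _).
have -> : z 0 = 0 by rewrite /z !variation0 subrr.
rewrite normr0 addr0 mulr0; apply=> u uT; rewrite addr0; apply: HB; exact: HM.
Qed.

(** The derivative of the flow in the initial condition solves the linearised
    equation: by Taylor's formula the remainder satisfies this equation up to
    a quadratic error, and Gronwall's inequality applies. *)
Lemma flow_differentiable t x : differentiable (P t) x /\
  forall v, 'd (P t) x v = variation t x v.
Proof.
have [P0 dP lP] := fl.
suff [dd E] : differentiable (P t) x /\ 'd (P t) x = mk_linear (variation_linear t x) :> ('rV[R]_n -> 'rV[R]_n).
  by split=> // v; exact: (congr1 (fun h : 'rV[R]_n -> 'rV[R]_n => h v) E).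
apply: diff_of_bound => [|e e0]; first exact: linear_rV_continuous.
have [M M0 HM] := flow_bounded `|t| (`|x| + 1) fl; have [B B0 HB] := diff_bounded M sW.
have [L L0 HL] := lP `|t| (`|x| + 1); have [C C0 HC] := taylor_bound M sW.
pose c := gronwall_const (n := n) B `|t| * (C * L ^+ 2).
have c0 : 0 <= c by rewrite mulr_ge0 ?gronwall_const_ge0// mulr_ge0// sqr_ge0.
have bound y : `|y - x| <= 1 -> `|P t y - P t x - variation t x (y - x)| <= c * `|y - x| ^+ 2.
  move=> yx; have xr : `|x| <= `|x| + 1 by rewrite lerDl.
  have yr : `|y| <= `|x| + 1.
    by rewrite -(subrK x y) addrC; apply: le_trans (ler_normD _ _) _; rewrite lerD2l.
  pose z u := P u y - P u x - variation u x (y - x).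
  have dz (u : R) : is_derive u 1 z (W (P u y) - W (P u x) - 'd W (P u x) (variation u x (y - x))).
    exact: is_deriveB (is_deriveB (dP y u) (dP x u)) (is_derive_variation x (y - x) u).
  have := @gronwall_sym R n z _ B (C * (L * `|y - x|) ^+ 2) `|t| B0 _ (fun u _ => dz u) _ t (lexx _).
  have -> : z 0 = 0 by rewrite /z !P0 variation0 subrr.
  rewrite normr0 add0r /c exprMn !mulrA; apply.
    by rewrite !mulr_ge0 ?sqr_ge0.
  move=> u uT; have Py := HM u y uT yr; have Px := HM u x uT xr.
  have -> : W (P u y) - W (P u x) - 'd W (P u x) (variation u x (y - x)) =
     'd W (P u x) (z u) + (W (P u y) - W (P u x) - 'd W (P u x) (P u y - P u x)).
    exact: linear_remainder.
  apply: le_trans (ler_normD _ _) _; apply: lerD; first exact: HB.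
  apply: le_trans (HC _ _ Py Px) _; have -> : C * L * L * `|y - x| * `|y - x| = C * (L * `|y - x|) ^+ 2 by ring.
  by apply: ler_wpM2l => //; rewrite lerXn2r ?nnegrE ?mulr_ge0//; exact: HL.
apply/near_ballP; exists (Num.min 1 (e / (c + 1))).
  by rewrite lt_min ltr01 divr_gt0// ltr_wpDl.
move=> y; rewrite lt_min => /andP[y1 ye]; apply: le_trans (bound y (ltW y1)) _.
rewrite expr2 mulrA; apply: ler_wpM2r => //.
apply: (@le_trans _ _ ((c + 1) * `|y - x|)); first by apply: ler_wpM2r => //; rewrite lerDl.
by rewrite mulrC -ler_pdivlMr ?ltW// ltr_wpDl.
Qed.

(** The field on the tangent bundle whose flow is the differential of the
    flow of [W]. *)
Definition tower_field (z : 'rV[R]_(n + n)) : 'rV[R]_(n + n) := row_mx (W (lsubmx z)) (dpair W z).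

Definition tower_flow (t : R) (z : 'rV[R]_(n + n)) : 'rV[R]_(n + n) :=
  row_mx (P t (lsubmx z)) (variation t (lsubmx z) (rsubmx z)).

Lemma smooth_tower_field : smooth setT tower_field.
Proof.
apply: smooth_row_mx; [exact: openT| |exact: smooth_dpair].
apply: (@smooth_comp_row _ _ _ _ setT setT) => //; [exact: has_coords_rV|exact: openT|exact: openT|].
exact: smooth_lsubmx.
Qed.

Lemma is_derive_row_mx m k (f : R -> 'rV[R]_m) (g : R -> 'rV[R]_k) (t : R) f' g' :
  is_derive t 1 f f' -> is_derive t 1 g g' ->
  is_derive t 1 (fun t => row_mx (f t) (g t)) (row_mx f' g').
Proof.
move=> df dg; apply: is_derive_row => i; case: (split_ordP i) => j ->; rewrite ?row_mxEl ?row_mxEr.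
  have -> : (fun t => row_mx (f t) (g t) 0 (lshift k j)) = (fun t => f t 0 j).
    by apply/funext => u; rewrite row_mxEl.
  exact: is_derive_coord.
have -> : (fun t => row_mx (f t) (g t) 0 (rshift m j)) = (fun t => g t 0 j).
  by apply/funext => u; rewrite row_mxEr.
exact: is_derive_coord.
Qed.

Lemma variation_lipschitz (T r : R) : exists2 C : R, 0 <= C & forall t x y v w, `|t| <= T ->
  `|x| <= r -> `|y| <= r -> `|v| <= r -> `|w| <= r ->
  `|variation t x v - variation t y w| <= C * (`|v - w| + `|x - y|).
Proof.
have [T0|T0] := leP 0 T; last first.
  by exists 0 => // t x y v w h; have := le_trans (normr_ge0 t) h; rewrite leNgt T0.
have [_ _ lP] := fl.
have [M M0 HM] := flow_bounded T r fl; have [B B0 HB] := diff_bounded M sW.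
have [L L0 HL] := lP T r; have [C C0 HC] := diff_lipschitz M sW.
have [K K0 HK] := variation_bounded r T0.
pose q := C * L * K * `|r|.
have q0 : 0 <= q by rewrite !mulr_ge0.
exists (gronwall_const (n := n) B T * (1 + q)).
  by rewrite mulr_ge0 ?gronwall_const_ge0// addr_ge0.
move=> t x y v w tT xr yr vr wr.
pose z u := variation u x v - variation u y w.
have dz (u : R) : is_derive u 1 z ('d W (P u x) (variation u x v) - 'd W (P u y) (variation u y w)).
  exact: is_deriveB (is_derive_variation x v u) (is_derive_variation y w u).
have := @gronwall_sym R n z _ B (q * `|x - y|) T B0 _ (fun u _ => dz u) _ t tT.
have -> : z 0 = v - w by rewrite /z !variation0.
move=> H; apply: le_trans (H _ _) _.
- by rewrite mulr_ge0.
- move=> u uT; have Py := HM u y uT yr; have Px := HM u x uT xr.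
  have -> : 'd W (P u x) (variation u x v) - 'd W (P u y) (variation u y w) =
     'd W (P u x) (z u) + ('d W (P u x) (variation u y w) - 'd W (P u y) (variation u y w)).
    exact: linear_split.
  apply: le_trans (ler_normD _ _) _; apply: lerD; first exact: HB.
  apply: le_trans (HC _ _ _ Px Py) _.
  have -> : q * `|x - y| = C * (L * `|x - y|) * (K * `|r|) by rewrite /q; ring.
  apply: ler_pM => //; [by rewrite mulr_ge0|by apply: ler_wpM2l => //; exact: HL|].
  apply: le_trans (HK u y w uT yr) _; apply: ler_wpM2l => //.
  exact: le_trans wr (ler_norm _).
rewrite -mulrA; apply: ler_wpM2l; first exact: gronwall_const_ge0.
have h1 := normr_ge0 (v - w); have h2 := normr_ge0 (x - y).
have h3 : 0 <= q * `|v - w| by rewrite mulr_ge0.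
rewrite mulrDl mul1r mulrDr -subr_ge0.
by rewrite (_ : _ - _ = q * `|v - w| + `|x - y|); [exact: addr_ge0|ring].
Qed.

Lemma tower_is_flow : is_flow tower_field tower_flow.
Proof.
have [P0 dP lP] := fl; split.
- by move=> z; rewrite /tower_flow P0 variation0 hsubmxK.
- move=> z t; rewrite /tower_field /dpair row_mxKl row_mxKr.
  exact: is_derive_row_mx (dP _ t) (is_derive_variation _ _ t).
move=> T r; have [L L0 HL] := lP T r; have [C C0 HC] := variation_lipschitz T r.
exists (L + 2 * C); first by rewrite addr_ge0// mulr_ge0.
move=> t z z' tT zr zr'; rewrite /tower_flow opp_row_mx add_row_mx.
have l1 : lsubmx z - lsubmx z' = lsubmx (z - z') by rewrite linearB.
have l2 : rsubmx z - rsubmx z' = rsubmx (z - z') by rewrite linearB.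
have N1 := norm_lsubmx (z - z'); have N2 := norm_rsubmx (z - z').
have n1 := le_trans (norm_lsubmx z) zr; have n2 := le_trans (norm_rsubmx z) zr.
have n3 := le_trans (norm_lsubmx z') zr'; have n4 := le_trans (norm_rsubmx z') zr'.
apply: norm_row_mx.
- by rewrite mulr_ge0// addr_ge0// mulr_ge0.
- apply: le_trans (HL t _ _ tT n1 n3) _; rewrite l1.
  apply: ler_pM => //; by rewrite lerDl mulr_ge0.
apply: le_trans (HC t _ _ _ _ tT n1 n3 n2 n4) _; rewrite l1 l2.
apply: (@le_trans _ _ (C * (`|z - z'| + `|z - z'|))); first by apply: ler_wpM2l => //; exact: lerD.
by have := mulr_ge0 L0 (normr_ge0 (z - z')); lra.
Qed.

End Tower.

(** Induction on the order over all fields: the derivative of the flow is a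
    component of the flow of [tower_field], which is again smooth. *)
Lemma flow_Ck k : forall n (W : 'rV[R]_n -> 'rV[R]_n) P t, smooth setT W -> is_flow W P ->
  Ck k setT (P t).
Proof.
elim: k => [|k IH] n W P t sW fl.
  by move=> x _; apply: differentiable_continuous; exact: (flow_differentiable sW fl t x).1.
split=> [x _|v]; first exact: (flow_differentiable sW fl t x).1.
have C := IH _ _ _ t (smooth_tower_field sW) (tower_is_flow sW fl).
have C1 : Ck k setT (fun x : 'rV[R]_n => row_mx x v).
  by apply: smooth_row_mx; [exact: openT|exact: smooth_id|exact: smooth_cst].
have C2 := Ck_comp_row (has_coords_rV (n + n)) openT (fun _ _ => I) openT C1 C.
have C3 : Ck k setT (@rsubmx R 1 n n : 'rV_(n + n) -> 'rV_n) by exact: smooth_rsubmx.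
have S := Ck_comp_row (has_coords_rV (n + n)) openT (fun _ _ => I) openT C2 C3.
apply: Ck_ext openT _ S => x _.
have [d1 d2] := flow_differentiable sW fl t x.
by rewrite deriveE// d2 /tower_flow /= !row_mxKl !row_mxKr.
Qed.

Section Time.
Variables (n : nat) (W : 'rV[R]_n -> 'rV[R]_n) (P : R -> 'rV[R]_n -> 'rV[R]_n).
Hypotheses (sW : smooth setT W) (fl : is_flow W P).

(** Time becomes an initial condition for the field scaled by an additional
    coordinate, so that smoothness in time follows from smoothness in space. *)
Definition time_field (z : 'rV[R]_(n + 1)) : 'rV[R]_(n + 1) :=
  row_mx ((rsubmx z) 0 0 *: W (lsubmx z)) 0.

Definition time_flow (t : R) (z : 'rV[R]_(n + 1)) : 'rV[R]_(n + 1) :=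
  row_mx (P (t * (rsubmx z) 0 0) (lsubmx z)) (rsubmx z).

Lemma smooth_time_field : smooth setT time_field.
Proof.
apply: smooth_row_mx; [exact: openT| |exact: smooth_cst].
apply: smooth_scale; first exact: openT.
  by apply: smooth_coord; [exact: openT|exact: smooth_rsubmx].
by have := smooth_comp_row (has_coords_rV n) openT (fun _ _ => I) openT (@smooth_lsubmx R n 1 setT) sW.
Qed.

Lemma is_derive_rescale (z : R -> 'rV[R]_n) (t k : R) y : is_derive (t * k) 1 z y ->
  is_derive t 1 (fun t => z (t * k)) (k *: y).
Proof.
move=> [dz Ez]; have dz' : differentiable z (t * k) by exact/derivable1_diffP.
have Dk : is_derive t 1 (fun t : R => t * k) k.
  have := is_deriveM (is_derive_id t 1) (is_derive_cst k t 1).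
  by move=> D; apply: is_derive_eq D _; rewrite /GRing.scale/= mulr0 add0r mulr1.
have [dk Ek] := Dk; have dk' : differentiable (fun t : R => t * k) t by exact/derivable1_diffP.
have dc : differentiable (z \o (fun t : R => t * k)) t by exact: differentiable_comp.
split; first exact/derivable1_diffP.
have E := D_comp (1 : R) dk' dz'; apply: etrans E _; rewrite Ek.
apply: esym; apply: etrans (congr1 ( *:%R k) (esym Ez)) _.
have E2 := deriveE (1 : R) dz'; rewrite E2.
have EL (L : {linear R -> 'rV[R]_n}) : k *: L 1 = L k.
  have E3 : L (k *: (1 : R)) = k *: L 1 by exact: linearZ.
  by rewrite -E3 /GRing.scale/= mulr1.
exact: EL.
Qed.

Lemma flow_time_lipschitz (T r : R) : 0 <= T -> exists2 C : R, 0 <= C & forall s t x, `|s| <= T -> `|t| <= T ->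
  `|x| <= r -> `|P s x - P t x| <= C * `|s - t|.
Proof.
move=> T0; have [M M0 HM] := flow_bounded (3 * T) r fl.
have [C C0 HC] := continuous_ball_bounded (r := M) (fun v _ => smooth_continuous sW (I : setT v)).
exists C => // s t x sT tT xr; have [_ dP _] := fl.
have dz (u : R) : `|u| <= `|s - t| -> is_derive u 1 (fun u => P (u + t) x) (W (P (u + t) x)).
  move=> _; have D := dP x (u + t); have [d E] := D.
  have d' : differentiable (fun t => P t x) (u + t) by exact/derivable1_diffP.
  have Dt : is_derive u 1 (fun u : R => u + t) 1.
    by apply: is_derive_eq (is_deriveD (is_derive_id u 1) (is_derive_cst t u 1)) _; rewrite addr0.
  have [dt Et] := Dt; have dt' : differentiable (fun u : R => u + t) u by exact/derivable1_diffP.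
  have dc : differentiable ((fun t => P t x) \o (fun u : R => u + t)) u by exact: differentiable_comp.
  split; first exact/derivable1_diffP.
  have E' := D_comp (1 : R) dt' d'; apply: etrans E' _; rewrite Et -E.
  exact: esym (deriveE _ d').
have := mean_value_bound_sym dz _ (lexx `|s - t|) (B := C); rewrite subrK add0r; apply.
move=> u us; apply: HC; apply: HM => //; apply: le_trans (ler_normD _ _) _.
have h := ler_normB s t; lra.
Qed.

Lemma time_is_flow : is_flow time_field time_flow.
Proof.
have [P0 dP lP] := fl; split.
- by move=> z; rewrite /time_flow mul0r P0 hsubmxK.
- move=> z t; rewrite /time_field row_mxKl row_mxKr.
  have D1 := is_derive_rescale (dP (lsubmx z) (t * (rsubmx z) 0 0)).
  exact: (is_derive_row_mx D1 (is_derive_cst (rsubmx z) t 1)).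
move=> T r; pose T' := `|T| * `|r|.
have T'0 : 0 <= T' by rewrite mulr_ge0.
have [L L0 HL] := lP T' r; have [C C0 HC] := flow_time_lipschitz r T'0.
exists (1 + L + C * `|T|); first by rewrite !addr_ge0// mulr_ge0.
move=> t z z' tT zr zr'; rewrite /time_flow opp_row_mx add_row_mx.
have l1 : lsubmx z - lsubmx z' = lsubmx (z - z') by rewrite linearB.
have l2 : rsubmx z - rsubmx z' = rsubmx (z - z') by rewrite linearB.
have N1 := norm_lsubmx (z - z'); have N2 := norm_rsubmx (z - z').
have n1 := le_trans (norm_lsubmx z) zr; have n3 := le_trans (norm_lsubmx z') zr'.
have s1 : `|(rsubmx z) 0 0| <= r by apply: le_trans (ler_coord _ _) (le_trans (norm_rsubmx z) zr).
have s2 : `|(rsubmx z') 0 0| <= r by apply: le_trans (ler_coord _ _) (le_trans (norm_rsubmx z') zr').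
have ts x : `|x| <= r -> `|t * x| <= T'.
  by move=> xr; rewrite normrM; apply: ler_pM => //; [exact: le_trans tT (ler_norm _)|exact: le_trans xr (ler_norm _)].
have nz := normr_ge0 (z - z').
have CT : 0 <= C * `|T| * `|z - z'| by rewrite !mulr_ge0.
have Lz : 0 <= L * `|z - z'| by rewrite !mulr_ge0.
apply: norm_row_mx.
- by rewrite mulr_ge0// !addr_ge0// mulr_ge0.
- have -> : P (t * (rsubmx z) 0 0) (lsubmx z) - P (t * (rsubmx z') 0 0) (lsubmx z') =
     (P (t * (rsubmx z) 0 0) (lsubmx z) - P (t * (rsubmx z) 0 0) (lsubmx z')) +
     (P (t * (rsubmx z) 0 0) (lsubmx z') - P (t * (rsubmx z') 0 0) (lsubmx z')) by rewrite addrA subrK.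
  apply: le_trans (ler_normD _ _) _.
  apply: (@le_trans _ _ (L * `|z - z'| + C * `|T| * `|z - z'|)); last by lra.
  apply: lerD.
    by apply: le_trans (HL _ _ _ (ts _ s1) n1 n3) _; rewrite l1; exact: ler_wpM2l.
  apply: le_trans (HC _ _ _ (ts _ s1) (ts _ s2) n3) _.
  rewrite -mulrBr normrM -mulrA; apply: ler_wpM2l => //; apply: ler_pM => //.
    exact: le_trans tT (ler_norm _).
  have -> : (rsubmx z) 0 0 - (rsubmx z') 0 0 = (rsubmx (z - z')) 0 0 by rewrite !mxE.
  exact: le_trans (ler_coord _ _) N2.
by rewrite l2; apply: le_trans N2 _; lra.
Qed.

Lemma flow_smooth : smooth setT (fun p : R * 'rV[R]_n => P p.1 p.2).
Proof.
have lin1 : linear (fun p : R * 'rV[R]_n => p.1) by [].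
have lin2 : linear (fun p : R * 'rV[R]_n => p.2) by [].
have s1 : smooth setT (fun p : R * 'rV[R]_n => p.1).
  by apply: (@smooth_lin _ _ _ setT (mk_linear lin1)) => p; exact: cvg_fst.
have s2 : smooth setT (fun p : R * 'rV[R]_n => p.2).
  by apply: (@smooth_lin _ _ _ setT (mk_linear lin2)) => p; exact: cvg_snd.
have hV := @has_coords_rV R (n + 1).
have S1 : smooth setT (fun p : R * 'rV[R]_n => row_mx p.2 (const_mx p.1 : 'rV_1)).
  apply: smooth_row_mx => //; first exact: openT.
  apply: smooth_row => [|i]; first exact: openT.
  by apply: smooth_ext s1 => [|p _]; [exact: openT|rewrite mxE].
have S2 : smooth setT (time_flow 1) by move=> k; exact: flow_Ck smooth_time_field time_is_flow.
have S3 := smooth_comp_row hV openT (fun _ _ => I) openT S1 S2.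
have S4 := smooth_comp_row hV openT (fun _ _ => I) openT S3 (@smooth_lsubmx R n 1 setT).
apply: smooth_ext S4 => [|p _]; first exact: openT.
by rewrite /= /time_flow !row_mxKl row_mxKr mxE mul1r.
Qed.

End Time.

(** A smooth field with bounded support is globally Lipschitz, so its
    integral curves are defined for all times. *)
Lemma flow_exists n (W : 'rV[R]_n -> 'rV[R]_n) (r : R) : smooth setT W ->
  (forall x, r <= `|x| -> W x = 0) -> exists P, is_flow W P.
Proof.
move=> sW W0.
have [B B0 HB] := smooth_lipschitz (r + 1) sW.
have [M M0 HM] := continuous_ball_bounded (r := r) (fun v _ => smooth_continuous sW (I : setT v)).
have one x y : `|x| <= r -> r + 1 <= `|y| -> `|W x - W y| <= M * `|x - y|.
  move=> xr yr; rewrite (W0 y) ?subr0; last by apply: le_trans yr; rewrite lerDl.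
  apply: le_trans (HM x xr) _; rewrite ler_peMr//.
  by have := lerB_dist y x; rewrite distrC; lra.
have lip x y : `|W x - W y| <= (1 + B + M) * `|x - y|.
  have n0 := normr_ge0 (x - y).
  have Bx : 0 <= B * `|x - y| by rewrite mulr_ge0.
  have Mx : 0 <= M * `|x - y| by rewrite mulr_ge0.
  rewrite !mulrDl mul1r.
  have [xr|xr] := leP `|x| (r + 1); have [yr|yr] := leP `|y| (r + 1).
  - by have := HB x y xr yr; lra.
  - have [xr'|xr'] := leP `|x| r; first by have := one x y xr' (ltW yr); lra.
    rewrite (W0 x) ?(W0 y) ?subrr ?normr0; [lra|apply: le_trans (ltW yr); rewrite lerDl|exact: ltW]. by [].
  - have [yr'|yr'] := leP `|y| r; first by have := one y x yr' (ltW xr); rewrite distrC [`|y - x|]distrC; lra.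
    rewrite (W0 x) ?(W0 y) ?subrr ?normr0; [lra|exact: ltW|apply: le_trans (ltW xr); rewrite lerDl]. by [].
  - rewrite (W0 x) ?(W0 y) ?subrr ?normr0; first lra; last first.
      by apply: le_trans (ltW xr); rewrite lerDl.
    by apply: le_trans (ltW yr); rewrite lerDl.
have L0 : 0 <= 1 + B + M by rewrite !addr_ge0.
have ex x : exists z : R -> 'rV[R]_n, z 0 = x /\ forall t : R, is_derive t 1 z (W (z t)).
  apply: (@picard R n (fun t v => W v)).
    move=> p; apply: (continuous_comp (f := snd) (g := W)); first exact: cvg_snd.
    exact: smooth_continuous sW (I : setT _).
  by move=> T; exists (1 + B + M) => [|t v w _]; [rewrite -addrA lerDl addr_ge0|exact: lip].
have [P HP] := choice ex; exists (fun t x => P x t); split.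
- by move=> x; have [] := HP x.
- by move=> x t; have [_] := HP x; exact.
move=> T r'; have [T0|T0] := leP 0 T; last first.
  by exists 0 => // t x y h; have := le_trans (normr_ge0 t) h; rewrite leNgt T0.
exists (gronwall_const (n := n) (1 + B + M) T); first exact: gronwall_const_ge0.
move=> t x y tT _ _.
have dz (u : R) : is_derive u 1 (fun u => P x u - P y u) (W (P x u) - W (P y u)).
  by apply: is_deriveB; [have [_] := HP x; exact|have [_] := HP y; exact].
have := @gronwall_sym R n _ _ (1 + B + M) 0 T L0 (lexx _) (fun u _ => dz u) _ t tT.
rewrite /= (HP x).1 (HP y).1 addr0; apply=> u _; rewrite addr0; exact: lip.
Qed.

End Flows.

(** * Flat functions and contact vector fields *)
Section Bump.
Context {R : realType}.

(** The functions [x^-k * exp(-1/x)], extended by zero to [x <= 0], are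
    stable under differentiation up to linear combinations, which proves
    their smoothness all at once. *)
Definition flat (k : nat) (x : R) : R := if 0 < x then x^-1 ^+ k * expR (- x^-1) else 0.

Lemma flat_bound k : exists2 C : R, 0 <= C & forall x, `|flat k x| <= C * x ^+ 2.
Proof.
pose m := k.+2; exists (m%:R ^+ m); first by rewrite exprn_ge0.
move=> x; rewrite /flat; case: ltP => [x0|_]; last by rewrite normr0 mulr_ge0 ?sqr_ge0 ?exprn_ge0.
rewrite ger0_norm; last by rewrite mulr_ge0 ?expR_ge0// exprn_ge0// invr_ge0 ltW.
have m0 : 0 < m%:R :> R by rewrite ltr0n.
have y0 : 0 < (m%:R * x)^-1 by rewrite invr_gt0 mulr_gt0.
have h : (m%:R * x) ^- m <= expR x^-1.
  have -> : x^-1 = m%:R * (m%:R * x)^-1 by rewrite invfM mulrA divff ?mul1r// gt_eqF.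
  rewrite expRM_natl -exprVn lerXn2r ?nnegrE ?expR_ge0 ?ltW//.
  by apply: lt_le_trans (expR_ge1Dx _); rewrite ltrDr.
have h' : expR (- x^-1) <= (m%:R * x) ^+ m.
  rewrite expRN -[leRHS]invrK lef_pV2 ?posrE ?expR_gt0//.
  by rewrite invr_gt0 exprn_gt0// mulr_gt0.
apply: (@le_trans _ _ (x^-1 ^+ k * (m%:R * x) ^+ m)).
  by apply: ler_wpM2l => //; rewrite exprn_ge0// invr_ge0 ltW.
rewrite exprMn /m -addn2 [x ^+ (k + 2)]exprD [leLHS]mulrCA.
by rewrite [x^-1 ^+ k * _]mulrA -exprMn mulVf ?expr1n ?mul1r// gt_eqF.
Qed.

Lemma is_derive_flat k (x : R) : is_derive x 1 (flat k) (- k%:R * flat k.+1 x + flat k.+2 x).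
Proof.
have [x0|x0|->] := ltgtP x 0.
- rewrite /flat !ltNge (ltW x0) /= mulr0 addr0.
  apply: near_eq_is_derive (is_derive_cst 0 x 1).
  by apply: filterS (lt_nbhsl x0) => y /= y0; rewrite ltNge (ltW y0).
- have nx : x != 0 by rewrite gt_eqF.
  have DV : is_derive x 1 (fun y : R => y^-1) (- x ^- 2).
    have := is_deriveV nx (is_derive_id x 1).
    by move=> D; apply: is_derive_eq D _; rewrite /GRing.scale/= mulr1.
  have DN : is_derive x 1 (fun y : R => - y^-1) (x ^- 2).
    by apply: is_derive_eq (is_deriveN DV) _; rewrite opprK.
  have DE := is_derive1_comp (f := expR) (g := fun y : R => - y^-1) (is_derive_expR (- x^-1)) DN.
  have DK : is_derive x 1 (fun y : R => y^-1 ^+ k) (k%:R * x^-1 ^+ k.-1 * - x ^- 2).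
    by have := is_deriveX k DV; rewrite exprfctE.
  have D := is_deriveM DK DE.
  apply: near_eq_is_derive (is_derive_eq D _).
    by apply: filterS (lt_nbhsr x0) => y y0; rewrite /flat y0.
  rewrite /flat x0 /GRing.scale/= -exprVn.
  move: (x^-1) (expR _) => y E.
  by case: (k) => [|k'] /=; rewrite !exprS ?expr0; ring.
have [C C0 HC] := flat_bound k.
have lin : linear (fun _ : R => 0 : R) by move=> a b c; rewrite scaler0 addr0.
have [|e e0|dd E] := @diff_of_bound R R R (flat k) (mk_linear lin) 0.
- by move=> y; exact: cvg_cst.
- have f0 : flat k 0 = 0 by rewrite /flat ltxx.
  apply/near_ballP; exists (e / (C + 1)); first by rewrite divr_gt0// ltr_wpDl.
  move=> y; rewrite subr0 => ye; rewrite f0 !subr0.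
  apply: le_trans (HC y) _; rewrite -real_normK ?num_real// expr2 mulrA; apply: ler_wpM2r => //.
  apply: (@le_trans _ _ ((C + 1) * `|y|)); first by apply: ler_wpM2r => //; rewrite lerDl.
  by rewrite mulrC -ler_pdivlMr ?ltW// ltr_wpDl.
split; first exact/derivable1_diffP.
by rewrite (deriveE _ dd) E /flat ltxx mulr0 addr0.
Qed.

Lemma Ck_flat j : forall k, Ck j setT (flat k).
Proof.
elim: j => [|j IH] k.
  by move=> x _; exact: is_derive_continuous (is_derive_flat k x).
split=> [x _|v]; first by apply/derivable1_diffP; have [] := is_derive_flat k x.
have C : Ck j setT (fun x => v * (- k%:R * flat k.+1 x + flat k.+2 x)).
  apply: CkM; [exact: openT|exact: Ck_cst|].
  apply: CkD; [exact: openT| |exact: IH].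
  by apply: CkM; [exact: openT|exact: Ck_cst|exact: IH].
apply: Ck_ext openT _ C => x _.
have [d E] := is_derive_flat k x; have d' : differentiable (flat k) x by exact/derivable1_diffP.
rewrite (deriveE _ d') -E (deriveE _ d').
have EL (L : {linear R -> R}) : v * L 1 = L v.
  have E3 : L (v *: (1 : R)) = v *: L 1 by exact: linearZ.
  by rewrite -[LHS]E3 /GRing.scale/= mulr1.
exact: EL.
Qed.

Lemma flat_pos x : 0 < x -> 0 < flat 0 x.
Proof. by move=> x0; rewrite /flat x0 expr0 mul1r expR_gt0. Qed.

Lemma flat_neg k x : x <= 0 -> flat k x = 0.
Proof. by move=> x0; rewrite /flat ltNge x0. Qed.

End Bump.

Lemma linear_sum_row (R : realType) n (L : {linear 'rV[R]_n -> R}) v :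
  L v = \sum_i v 0 i * L (delta_mx 0 i).
Proof.
rewrite {1}(row_sum_delta v) linear_sum; apply: eq_bigr => i _.
by have E : L (v 0 i *: delta_mx 0 i) = v 0 i *: L (delta_mx 0 i) by exact: linearZ.
Qed.

(** The exterior derivative of a 1-form whose components have the
    differentials [L i]. *)
Definition curl {R : realType} {n} (L : 'I_n -> {linear 'rV[R]_n -> R}) (u v : 'rV[R]_n) : R :=
  \sum_i (v 0 i * L i u - u 0 i * L i v).

Section Curl.
Context {R : realType} {n : nat}.
Variable L : 'I_n -> {linear 'rV[R]_n -> R}.

Lemma curl_linear (k : R) u u' v : curl L (k *: u + u') v = k * curl L u v + curl L u' v.
Proof.
rewrite /curl mulr_sumr -big_split/=; apply: eq_bigr => i _.
have -> : L i (k *: u + u') = k * L i u + L i u' by exact: linearP.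
by rewrite !mxE; ring.
Qed.

Lemma curlC u v : curl L u v = - curl L v u.
Proof. by rewrite /curl -sumrN; apply: eq_bigr => i _; rewrite opprB. Qed.

Lemma curl_diag u : curl L u u = 0.
Proof. by rewrite /curl big1 => [//|i _]; rewrite subrr. Qed.

Lemma curl0 v : curl L 0 v = 0.
Proof. by have := curl_linear (- 1) 0 0 v; rewrite scaler0 addr0 mulN1r addNr. Qed.

Lemma curl_combination (a b c : R) u1 u2 u3 v :
  curl L (a *: u1 + b *: u2 + c *: u3) v = a * curl L u1 v + b * curl L u2 v + c * curl L u3 v.
Proof.
by rewrite -addrA !curl_linear -[c *: u3]addr0 curl_linear curl0 addr0 addrA.
Qed.

End Curl.

Section ContactField.
Context {R : realType}.
Variables (U : set 'rV[R]_3) (w1 w2 w3 : 'rV[R]_3 -> 'rV[R]_3).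
Hypotheses (oU : open U) (s1 : smooth U w1) (s2 : smooth U w2) (s3 : smooth U w3).
Hypothesis br : forall y, U y -> w3 y = 'D_(w1 y) w2 y - 'D_(w2 y) w1 y.
Hypothesis span : forall y, U y -> forall v, exists a b c : R, v = a *: w1 y + b *: w2 y + c *: w3 y.

Let i0 : 'I_3 := @Ordinal 3 0 isT.
Let i1 : 'I_3 := @Ordinal 3 1 isT.
Let i2 : 'I_3 := @Ordinal 3 2 isT.

Definition frame_mx (y : 'rV[R]_3) : 'M[R]_3 :=
  \matrix_(i, j) (if val i == 0%N then w1 y else if val i == 1%N then w2 y else w3 y) 0 j.

(** The components of the contact form: the dual covector of [w3] in the frame
    [w1], [w2], [w3]. *)
Definition contact_comp (i : 'I_3) (y : 'rV[R]_3) : R := invmx (frame_mx y) i i2.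

Definition contact_form (y v : 'rV[R]_3) : R := \sum_i v 0 i * contact_comp i y.

Lemma frame_mx_comb y (a b c : R) :
  (\row_(i < 3) (if val i == 0%N then a else if val i == 1%N then b else c)) *m frame_mx y =
  a *: w1 y + b *: w2 y + c *: w3 y.
Proof.
by apply/rowP => j; rewrite !mxE !big_ord_recl big_ord0 !mxE /= addr0 addrA.
Qed.

Lemma frame_mx_unit y : U y -> frame_mx y \in unitmx.
Proof.
move=> Uy; rewrite -row_full_unit -sub1mx; apply/row_subP => i.
have [a [b [c ->]]] := span Uy (row i 1%:M).
by rewrite -frame_mx_comb; exact: submxMl.
Qed.

Lemma contact_formE y (a b c : R) : U y -> contact_form y (a *: w1 y + b *: w2 y + c *: w3 y) = c.
Proof.
move=> Uy; rewrite -frame_mx_comb; set r := \row_(i < 3) _.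
have -> : contact_form y (r *m frame_mx y) = (r *m frame_mx y *m invmx (frame_mx y)) 0 i2 by rewrite [RHS]mxE.
by rewrite mulmxK ?frame_mx_unit// mxE.
Qed.

Lemma smooth_contact_comp i : smooth U (contact_comp i).
Proof.
apply: smooth_invmx => //; first by move=> y; exact: frame_mx_unit.
move=> j k; have S : smooth U (fun y => (if val j == 0%N then w1 y else if val j == 1%N then w2 y else w3 y) 0 k).
  by apply: smooth_coord => //; case: (val j == 0%N) => //; case: (val j == 1%N).
by apply: smooth_ext S => // y _; rewrite mxE.
Qed.

Let dN y (i : 'I_3) : {linear 'rV[R]_3 -> R} := 'd (contact_comp i) y.

Lemma D_contact_form (q : 'rV[R]_3 -> 'rV[R]_3) y v : U y -> differentiable q y ->
  'D_v (fun z => contact_form z (q z)) y = \sum_i q y 0 i * dN y i v + contact_form y ('D_v q y).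
Proof.
move=> Uy dq; have dc i : differentiable (contact_comp i) y by exact: smooth_differentiable (smooth_contact_comp i) Uy.
have dqi i := (D_coord v i dq).1.
rewrite D_sum => [|i]; last by apply: differentiableM; [exact: dqi|exact: dc].
rewrite -big_split/=; apply: eq_bigr => i _.
apply: etrans (D_mul v (dqi i) (dc i)) _.
have F1 : 'D_v (contact_comp i) y = dN y i v by exact: deriveE.
have F2 := (D_coord v i dq).2.
apply: etrans (congr2 (fun a b => q y 0 i * a + contact_comp i y * b) F1 F2) _.
by congr (_ + _); rewrite mulrC.
Qed.

(** The formula [d w(u, v) = u w(v) - v w(u) - w([u, v])] for the contact
    form, which vanishes on [w1], [w2] and is 1 on their bracket. *)
Lemma curl_frame y : U y -> curl (dN y) (w1 y) (w2 y) = - 1.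
Proof.
move=> Uy; have d1 := smooth_differentiable s1 Uy; have d2 := smooth_differentiable s2 Uy.
have z1 : forall z, U z -> contact_form z (w1 z) = 0.
  by move=> z Uz; have := contact_formE 1 0 0 Uz; rewrite scale1r !scale0r !addr0.
have z2 : forall z, U z -> contact_form z (w2 z) = 0.
  by move=> z Uz; have := contact_formE 0 1 0 Uz; rewrite scale1r !scale0r add0r addr0.
have c1 v : 'D_v (fun z => contact_form z (w1 z)) y = 0.
  rewrite -(derive_cst (0 : R) y v); apply: near_eq_D.
  by apply: filterS (open_near oU Uy) => z Uz; rewrite z1.
have c2 v : 'D_v (fun z => contact_form z (w2 z)) y = 0.
  rewrite -(derive_cst (0 : R) y v); apply: near_eq_D.
  by apply: filterS (open_near oU Uy) => z Uz; rewrite z2.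
have E2 := c2 (w1 y); rewrite D_contact_form// in E2.
have E1 := c1 (w2 y); rewrite D_contact_form// in E1.
have E3 : contact_form y (w3 y) = 1.
  by have := contact_formE 0 0 1 Uy; rewrite scale1r !scale0r !add0r.
have lin u v : contact_form y (u - v) = contact_form y u - contact_form y v.
  by rewrite /contact_form -sumrB; apply: eq_bigr => i _; rewrite !mxE mulrBl.
rewrite br// lin in E3; rewrite /curl sumrB.
by move: E1 E2 E3; move: (contact_form _ _) (contact_form _ _) (\sum_i _) (\sum_i _) => p q p' q' *; lra.
Qed.

Variables (y0 : 'rV[R]_3) (rho : R).
Hypotheses (rho0 : 0 < rho) (ballU : forall y, sumsq (y - y0) <= rho ^+ 2 -> U y).

(** A function of the squared Euclidean distance, so that it is smooth and
    its support is the closed ball of radius [rho]. *)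
Definition bump (y : 'rV[R]_3) : R := flat 0 (rho ^+ 2 - sumsq (y - y0)).

Lemma smooth_height : smooth setT (fun y : 'rV[R]_3 => rho ^+ 2 - sumsq (y - y0)).
Proof.
have S : smooth setT (fun y : 'rV[R]_3 => \sum_i (y 0 i - y0 0 i) * (y 0 i - y0 0 i)).
  apply: smooth_sum => [|i]; first exact: openT.
  have Si : smooth setT (fun y : 'rV[R]_3 => y 0 i - y0 0 i).
    apply: smoothB; [exact: openT| |exact: smooth_cst].
    by apply: smooth_coord; [exact: openT|exact: smooth_id].
  by apply: smoothM => //; exact: openT.
apply: smoothB; [exact: openT|exact: smooth_cst|].
apply: smooth_ext S => [|y _]; first exact: openT.
by apply: eq_bigr => i _; rewrite !mxE expr2.
Qed.

Lemma smooth_bump : smooth setT bump.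
Proof.
apply: (smooth_comp (O' := setT) (f := fun y => rho ^+ 2 - sumsq (y - y0)) (g := flat 0)) => //.
- exact: has_coords_R.
- exact: openT.
- exact: smooth_height.
- by move=> k; exact: Ck_flat.
Qed.

Lemma diff_bump_outside y v : rho ^+ 2 <= sumsq (y - y0) -> bump y = 0 /\ 'd bump y v = 0.
Proof.
move=> out; have h0 : rho ^+ 2 - sumsq (y - y0) <= 0 by rewrite subr_le0.
split; first exact: flat_neg.
have dh : differentiable (fun y => rho ^+ 2 - sumsq (y - y0)) y by exact: smooth_differentiable smooth_height _.
have [d E] := is_derive_flat 0 (rho ^+ 2 - sumsq (y - y0)).
have df : differentiable (flat 0) (rho ^+ 2 - sumsq (y - y0)) by exact/derivable1_diffP.
apply: etrans (diff_compE v dh df) _.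
have EL (L : {linear R -> R}) (k : R) : L 1 = 0 -> L k = 0.
  move=> L1; have E3 : L (k *: (1 : R)) = k *: L 1 by exact: linearZ.
  by rewrite L1 scaler0 /GRing.scale/= mulr1 in E3.
apply: EL; apply: etrans (esym (deriveE _ df)) _.
by rewrite E !flat_neg// mulr0 addr0.
Qed.

Let dH y : {linear 'rV[R]_3 -> R} := 'd bump y.

(** The contact vector field with Hamiltonian [bump], in the frame. *)
Definition hamiltonian_frame (y : 'rV[R]_3) : 'rV[R]_3 :=
  (dH y (w2 y) + bump y * curl (dN y) (w3 y) (w2 y)) *: w1 y
  + (- (dH y (w1 y) + bump y * curl (dN y) (w3 y) (w1 y))) *: w2 y + bump y *: w3 y.

(** The field vanishes off the ball, which makes it smooth on the whole space
    although the frame only exists on [U]. *)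
Definition hamiltonian (y : 'rV[R]_3) : 'rV[R]_3 :=
  if sumsq (y - y0) < rho ^+ 2 then hamiltonian_frame y else 0.

Lemma hamiltonianE y : U y -> hamiltonian y = hamiltonian_frame y.
Proof.
move=> Uy; rewrite /hamiltonian; case: ltP => // out.
have [b0 db] := diff_bump_outside (w1 y) out; have [_ db'] := diff_bump_outside (w2 y) out.
have F1 : dH y (w1 y) = 0 by exact: db.
have F2 : dH y (w2 y) = 0 by exact: db'.
by rewrite /hamiltonian_frame F1 F2 b0 !mul0r !addr0 oppr0 !scale0r !addr0.
Qed.

Lemma smooth_diff_R (f : 'rV[R]_3 -> R) (w : 'rV[R]_3 -> 'rV[R]_3) : smooth U f -> smooth U w ->
  smooth U (fun y => 'd f y (w y)).
Proof.
move=> sf sw; have S : smooth U (fun y => \sum_i w y 0 i * 'D_(delta_mx 0 i) f y).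
  by apply: smooth_sum => // i; apply: smoothM => //; [exact: smooth_coord|exact: smooth_D].
apply: smooth_ext S => // y Uy; have df := smooth_differentiable sf Uy.
apply: esym; apply: etrans (linear_sum_row ('d f y) (w y)) _.
by apply: eq_bigr => i _; congr (_ * _); exact: esym (deriveE _ df).
Qed.

Lemma smooth_curl (u v : 'rV[R]_3 -> 'rV[R]_3) : smooth U u -> smooth U v ->
  smooth U (fun y => curl (dN y) (u y) (v y)).
Proof.
move=> su sv; apply: smooth_sum => // i.
have sc := smooth_contact_comp i.
apply: smoothB => //; apply: smoothM => //; try exact: smooth_coord.
  exact: smooth_diff_R sc su.
exact: smooth_diff_R sc sv.
Qed.

Lemma smooth_bumpU : smooth U bump.
Proof. by apply: smooth_sub smooth_bump. Qed.

Lemma smooth_hamiltonian_frame : smooth U hamiltonian_frame.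
Proof.
have sb := smooth_bumpU.
apply: smoothD => //; last exact: smooth_scale.
apply: smoothD => //; apply: smooth_scale => //.
  by apply: smoothD => //; [exact: smooth_diff_R|apply: smoothM => //; exact: smooth_curl].
apply: smoothN => //.
by apply: smoothD => //; [exact: smooth_diff_R|apply: smoothM => //; exact: smooth_curl].
Qed.

Lemma smooth_hamiltonian : smooth setT hamiltonian.
Proof.
apply: smooth_local => y _; have [Uy|nU] := pselect (U y).
  exists U; split=> //; apply: smooth_ext smooth_hamiltonian_frame => // z Uz.
  by rewrite hamiltonianE.
exists [set z | rho ^+ 2 - sumsq (z - y0) < 0]; split.
- rewrite (_ : [set z | _] = setT `&` (fun z : 'rV[R]_3 => rho ^+ 2 - sumsq (z - y0)) @^-1` [set x | x < 0]).
    apply: open_preimage_on; [exact: openT|exact: open_lt|].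
    by move=> z _; exact: smooth_continuous smooth_height _.
  by rewrite setTI.
- by rewrite /= ltNge; apply/negP => h; apply: nU; apply: ballU; rewrite -subr_ge0.
apply: smooth_ext (smooth_cst _ (0 : 'rV[R]_3)) => [|z /= out].
  rewrite (_ : [set z | _] = setT `&` (fun z : 'rV[R]_3 => rho ^+ 2 - sumsq (z - y0)) @^-1` [set x | x < 0]).
    apply: open_preimage_on; [exact: openT|exact: open_lt|].
    by move=> z _; exact: smooth_continuous smooth_height _.
  by rewrite setTI.
by rewrite /hamiltonian ltNge -subr_le0 ltW.
Qed.

Lemma hamiltonian_flow : exists P, is_flow hamiltonian P.
Proof.
apply: (flow_exists (r := `|y0| + rho) smooth_hamiltonian) => x xr.
rewrite /hamiltonian ltNge (_ : rho ^+ 2 <= _)//.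
have h : rho <= `|x - y0| by have := lerB_dist x y0; lra.
by apply: le_trans (norm_sumsq (x - y0)).1; rewrite lerXn2r ?nnegrE// ltW.
Qed.

Let Q y v : R := dH y v + curl (dN y) (hamiltonian y) v.

(** The defining property of a contact field: the Lie derivative of the
    contact form along it is a multiple of the contact form. *)
Lemma contact_Hamilton y v : U y -> Q y v = contact_form y v * Q y (w3 y).
Proof.
move=> Uy; have [a [b [c ->]]] := span Uy v; rewrite contact_formE//.
have linQ (k k' k'' : R) u u' u'' : Q y (k *: u + k' *: u' + k'' *: u'') = k * Q y u + k' * Q y u' + k'' * Q y u''.
  rewrite /Q curlC curl_combination !(curlC _ (hamiltonian y)).
  have -> : dH y (k *: u + k' *: u' + k'' *: u'') = k * dH y u + k' * dH y u' + k'' * dH y u''.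
    have E (k1 : R) x z : dH y (k1 *: x + z) = k1 * dH y x + dH y z by exact: linearP.
    rewrite -addrA !E -[k'' *: u'']addr0 E.
    have -> : dH y 0 = 0 by exact: linear0.
    by rewrite addr0 addrA.
  by ring.
have c12 := curl_frame Uy; have c21 := curlC (dN y) (w2 y) (w1 y).
have Q1 : Q y (w1 y) = 0.
  rewrite /Q hamiltonianE// curl_combination curl_diag c21 c12.
  by move: (dH y (w1 y)) (dH y (w2 y)) => *; ring.
have Q2 : Q y (w2 y) = 0.
  rewrite /Q hamiltonianE// curl_combination curl_diag c12.
  by move: (dH y (w1 y)) (dH y (w2 y)) => *; ring.
by rewrite linQ Q1 Q2 !mulr0 !add0r.
Qed.

Section Flow.
Variable P : R -> 'rV[R]_3 -> 'rV[R]_3.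
Hypothesis fl : is_flow hamiltonian P.

(** Uniqueness of solutions, by the Gronwall inequality. *)
Lemma flow_stationary y t1 : hamiltonian (P t1 y) = 0 -> forall s, P s y = P t1 y.
Proof.
move=> H0 s; have [_ dP _] := fl.
pose z u := P (u + t1) y - P t1 y.
have dz (u : R) : is_derive u 1 z (hamiltonian (P (u + t1) y)).
  have D := dP y (u + t1); have [d E] := D.
  have d' : differentiable (fun t => P t y) (u + t1) by exact/derivable1_diffP.
  have Dt : is_derive u 1 (fun u : R => u + t1) 1.
    by apply: is_derive_eq (is_deriveD (is_derive_id u 1) (is_derive_cst t1 u 1)) _; rewrite addr0.
  have [dt Et] := Dt; have dt' : differentiable (fun u : R => u + t1) u by exact/derivable1_diffP.
  have dc : differentiable ((fun t => P t y) \o (fun u : R => u + t1)) u by exact: differentiable_comp.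
  have D1 : is_derive u 1 (fun u => P (u + t1) y) (hamiltonian (P (u + t1) y)).
    split; first exact/derivable1_diffP.
    have E' := D_comp (1 : R) dt' d'; apply: etrans E' _; rewrite Et -E.
    exact: esym (deriveE _ d').
  by apply: is_derive_eq (is_deriveB D1 (is_derive_cst (P t1 y) u 1)) _; rewrite subr0.
have [M M0 HM] := flow_bounded (`|s - t1| + `|t1|) `|y| fl.
have [B B0 HB] := smooth_lipschitz M smooth_hamiltonian.
have := @gronwall_sym R 3 z _ B 0 `|s - t1| B0 (lexx _) (fun u _ => dz u) _ (s - t1) (lexx _).
have -> : z 0 = 0 by rewrite /z add0r subrr.
rewrite normr0 addr0 mulr0 /z subrK => H; apply/eqP; rewrite -subr_eq0 -normr_le0.
apply: H => u us; rewrite addr0 -[hamiltonian _]subr0 -H0; apply: HB; apply: HM => //.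
  by apply: le_trans (ler_normD _ _) _; rewrite lerD2r.
by rewrite lerDr.
Qed.

(** Orbits starting in [U] outside the support do not move, and the others
    remain in the support, which is contained in [U]. *)
Lemma flow_stays y : U y -> forall s, U (P s y).
Proof.
move=> Uy s; have [P0 _ _] := fl.
have [E|nz] := eqVneq (hamiltonian (P s y)) 0.
  by rewrite -(flow_stationary E 0) P0.
apply: ballU; move: nz; rewrite /hamiltonian; case: ltP => [/ltW//|_].
by rewrite eqxx.
Qed.

(** The flow of a contact vector field preserves the contact structure: the
    contact form on a transported vector solves a homogeneous linear equation. *)
Lemma flow_contact y v s : U y -> contact_form y v = 0 -> contact_form (P s y) ('d (P s) y v) = 0.
Proof.
move=> Uy v0; have [P0 dP _] := fl.
have [_ ->] := flow_differentiable smooth_hamiltonian fl s y.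
(* the transported vector solves the linearised equation *)
pose xi u := variation smooth_hamiltonian fl u y v.
pose u_ (t : R) : R := contact_form (P t y) (xi t).
have dxi (t : R) : is_derive t 1 xi ('d hamiltonian (P t y) (xi t)) by exact: is_derive_variation.
have du (t : R) : is_derive t 1 u_ (u_ t * Q (P t y) (w3 (P t y))).
  have UP := flow_stays Uy t; set p := P t y in UP *.
  have dc i : is_derive t 1 (fun t => contact_comp i (P t y)) (dN p i (hamiltonian p)).
    have [d E] := dP y t; have d' : differentiable (fun t => P t y) t by exact/derivable1_diffP.
    have dN' : differentiable (contact_comp i) (P t y) by exact: smooth_differentiable (smooth_contact_comp i) UP.
    have dcc : differentiable (contact_comp i \o (fun t => P t y)) t by exact: differentiable_comp.
    split; first exact/derivable1_diffP.
    have E' := D_comp (1 : R) d' dN'; apply: etrans E' _.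
    by rewrite E.
  have D i := is_deriveM (is_derive_coord i (dxi t)) (dc i).
  have Eu : u_ = \sum_i (fun t => xi t 0 i * contact_comp i (P t y)).
    by apply/funext => x; rewrite /u_ /contact_form fct_sumE.
  rewrite {1}Eu.
  apply: is_derive_eq (is_derive_sum D) _.
  have dW : differentiable hamiltonian p by exact: smooth_differentiable smooth_hamiltonian _.
  have DW := D_contact_form (xi t) UP dW.
  have DH : 'D_(xi t) (fun z => contact_form z (hamiltonian z)) p = dH p (xi t).
    have db : differentiable bump p by exact: smooth_differentiable smooth_bump _.
    apply: etrans (deriveE _ db); apply: near_eq_D.
    by apply: filterS (open_near oU UP) => z Uz; rewrite hamiltonianE// contact_formE.
  have EW : 'D_(xi t) hamiltonian p = 'd hamiltonian p (xi t) by exact: deriveE.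
  rewrite -/p.
  have E1 : contact_form p ('d hamiltonian p (xi t)) = dH p (xi t) - \sum_i hamiltonian p 0 i * dN p i (xi t).
    rewrite -DH [in RHS]DW addrC addKr.
    exact: (congr1 (fun a : 'rV[R]_3 => contact_form p a) (esym EW)).
  rewrite [RHS](_ : _ = Q p (xi t)); last first.
    exact: esym (contact_Hamilton (xi t) UP).
  rewrite /Q /curl sumrB addrA addrAC -[dH p (xi t) - _]E1 /contact_form -big_split/=.
  by apply: eq_bigr => i _; rewrite /GRing.scale/=; ring.
have cQ : continuous (fun t => Q (P t y) (w3 (P t y))).
  move=> t; apply: (continuous_comp (f := fun t => P t y) (g := fun p => Q p (w3 p))).
    exact: flow_continuous fl t.
  have S : smooth U (fun p => Q p (w3 p)).
    apply: smoothD => //; first exact: smooth_diff_R smooth_bumpU s3.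
    apply: smooth_curl => //; apply: smooth_sub smooth_hamiltonian; exact: subsetT.
  exact: smooth_continuous S (flow_stays Uy t).
pose z (t : R) : 'rV[R]_1 := const_mx (u_ t).
have dz (t : R) : is_derive t 1 z (const_mx (u_ t * Q (P t y) (w3 (P t y)))).
  apply: is_derive_row => i; rewrite mxE.
  have -> : (fun t => z t 0 i) = u_ by apply/funext => x; rewrite mxE.
  exact: du.
have cq1 : continuous (fun t => const_mx (Q (P t y) (w3 (P t y))) : 'rV[R]_1).
  move=> t; apply: continuous_row => i.
  have -> : (fun u => (const_mx (Q (P u y) (w3 (P u y))) : 'rV[R]_1) 0 i) = (fun t => Q (P t y) (w3 (P t y))).
    by apply/funext => x; rewrite mxE.
  exact: cQ.
have [B B0 HB] := continuous_bounded `|s| cq1.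
have := @gronwall_sym R 1 z _ B 0 `|s| B0 (lexx _) (fun u _ => dz u) _ s (lexx _).
have -> : z 0 = 0.
  by apply/rowP => i; rewrite !mxE /u_ /xi P0 variation0 v0.
rewrite normr0 addr0 mulr0 => H.
have : z s = 0.
  apply/eqP; rewrite -normr_le0; apply: H => u us; rewrite addr0.
  have c1 (x : R) : `|const_mx x : 'rV[R]_1| = `|x|.
    apply/eqP; rewrite eq_le; apply/andP; split.
      by apply: ler_rowP => // i; rewrite mxE.
    by have := ler_coord (const_mx x : 'rV[R]_1) 0; rewrite mxE.
  rewrite !c1 normrM mulrC; apply: ler_wpM2r => //.
  by have := HB u us; rewrite c1.
by move=> /rowP/(_ 0); rewrite !mxE.
Qed.

End Flow.
End ContactField.

(** * Continuity of the invariants along a curve *)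
Section Multiplier.
Context {R : realType} {X : premanifold R 3}.
Variables (D : mpoint X -> set (tfam X)) (F : mpoint X -> tfam X -> R).
Variable o : mpoint X -> tfam X -> tfam X -> Prop.
Hypothesis hX : regular_atlas X.
Hypotheses (D_contact : contact D) (F_sub_Finsler : sub_Finsler D F).
Hypothesis D_oriented : orientation D o.

Local Notation Sigma := (indicatrix D F).
Local Notation B := (B4 D F o).
Local Notation toSigma := (@B4_to_Sigma R X D F o).
Local Notation toX := (@B4_to_X R X D F o).
Local Notation can := (canonical_coframing D F o).
Local Notation base := (@basepoint R X D F).

Let hS : regular_atlas Sigma := regular_indicatrix D F hX.
Let hB : regular_atlas B := regular_B4 hX D_contact F_sub_Finsler D_oriented.

Variables I J1 J2 K A1 A2 S0 S1 S2 : mpoint B -> R.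
Hypothesis hse : structure_equations (body B) can I J1 J2 K A1 A2 S0 S1 S2.

(** Charts of the coframe bundle are charts of the indicatrix bundle, so
    tangent vectors lift. *)
Lemma toSigma_surjective (b : mpoint B) k v : chart_at b k -> tangent (M := Sigma) b.1 v ->
  exists2 x, tangent b x & dmap (N := Sigma) toSigma b x = v.
Proof.
move=> hk tv; have [A [e [c [ae pe Ek [Ab hc be]]]]] := B4_chart_at hk.
have oA : mopen A by have [[[]]] := ae.
have hk' : chart_at b (B4_chart A e c) by rewrite -Ek.
exists (vec_of (M := B) (B4_chart A e c) b (v c)); first exact: (tangent_vec_of hB).
have t := tangent_vec_of hB (v c) hk'; have [ac _] := hc.
apply: etrans (dmap_toSigma hX D_contact F_sub_Finsler D_oriented hk' ac (@subsetT _ _) oA t) _.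
by rewrite (vec_ofE hB _ hk') -(tangentE tv hc).
Qed.

Lemma eta3_nonzero (b : mpoint B) k : chart_at b k ->
  exists2 x, tangent b x & form_eta3 can b x != 0.
Proof.
move=> hk; have [A [e [c [ae pe Ek [Ab hc be]]]]] := B4_chart_at hk.
have [[_ _ _ [n3 _] _] _] := ae; have [v tv v0] := n3 _ Ab.
have [x tx xv] := toSigma_surjective hk tv; exists x => //.
by rewrite /form_eta3 /= xv be.
Qed.

Section Extension.
Variables (O : set R) (g : R -> mpoint B) (t1 : R).
Hypotheses (sg : smooth_into (M := B) O g) (Ot : O t1).

(** A surface containing the curve, on which the exterior derivatives of the
    canonical forms can be paired with the velocity of the curve and a given
    transverse vector. *)
Lemma extension_exists (x : tfam B) : tangent (g t1) x ->
  exists (f : R * R -> mpoint B) (W : set (R * R)), [/\ open W, W (0, t1), smooth_into W f,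
    (\forall t \near t1, W (0, t) /\ f (0, t) = g t) & pushvec (M := B) f (0, t1) (1, 0) = x].
Proof.
move=> tx; have [k [hk _]] := sg Ot; have [ak _] := hk.
have [U1 [oU Ut UO dU sU]] := smooth_into_chart hB sg Ot hk.
(* the curve translated in the chart *)
pose h (p : R * R) := coord k (g p.2) + p.1 *: x k.
pose V1 : set (R * R) := [set p | U1 p.2].
have oV1 : open V1.
  rewrite (_ : V1 = setT `&` snd @^-1` U1); last by rewrite setTI.
  by apply: (open_preimage_on openT oU) => p _; exact: cvg_snd.
have lin1 : linear (fun p : R * R => p.1) by [].
have lin2 : linear (fun p : R * R => p.2) by [].
have sh : smooth V1 h.
  apply: smoothD => //.
    apply: (smooth_comp_row (O' := U1) (f := snd) (g := coord k \o g)) => //; first exact: has_coords_R.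
    by apply: (@smooth_lin _ _ _ V1 (mk_linear lin2)) => p; exact: cvg_snd.
  apply: smooth_scale => //; last exact: smooth_cst.
  by apply: (@smooth_lin _ _ _ V1 (mk_linear lin1)) => p; exact: cvg_fst.
pose W := V1 `&` h @^-1` cimg k setT.
have oT := open_cimgT hB ak.
have oW : open W.
  by apply: (open_preimage_on oV1 oT) => p Vp; exact: (smooth_continuous sh Vp).
have h0 t : h (0, t) = coord k (g t) by rewrite /h /= scale0r addr0.
have W0 t : U1 t -> W (0, t).
  by move=> U1t; split=> //; rewrite /= h0; apply: cimg_coord => //; exact: dU.
have f0 t : U1 t -> param k (h (0, t)) = g t.
  by move=> U1t; rewrite h0 (paramK hB ak)//; exact: dU.
have sf : smooth_into (M := B) W (param k \o h).
  apply: (smooth_into_comp oW oT (smooth_into_param hB ak)); last by move=> p [].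
  by apply: smooth_sub sh => p [].
exists (param k \o h), W; split=> //; first exact: W0.
  by apply: filterS (open_near oU Ut) => t Ut'; split; [exact: W0|exact: f0].
have fW : (param k \o h) (0, t1) = g t1 by exact: f0.
have hk' : chart_at ((param k \o h) (0, t1)) k by rewrite fW.
have tp := tangent_pushvec hB ((1, 0) : R * R)%type sf (W0 _ Ut).
have tx' : tangent ((param k \o h) (0, t1)) x by rewrite fW.
apply: (tangent_eq tp tx' hk'); apply: etrans (pushvecE _ hk') _.
have dk := differentiable_coord_into hB sf (W0 _ Ut) hk'.
apply: etrans (esym (deriveE _ dk)) _.
have [_ <-] := is_derive_slice_s dk.
have [_ E] := is_derive_line (coord k (g t1)) (x k) 0.
apply: etrans _ E; apply: near_eq_D.
have [d1 _] := diff_slice_s 0 t1.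
have c1 : {for 0, continuous (fun s : R => (s, t1))} by exact: differentiable_continuous.
have N : \forall s \near (0 : R), W (s, t1) by apply: c1; exact: (open_near oW (W0 _ Ut)).
by apply: filterS N => s [_ /(cimgP hB ak)[_ _ E']].
Qed.

End Extension.

Section Continuity.
Variables (O : set R) (g : R -> mpoint B) (a b : R) (l : R -> R) (t1 : R).
Hypotheses (oO : open O) (sg : smooth_into (M := B) O g) (abO : `[a, b] `<=` O).
Hypothesis hI : forall t, t \in `[a, b] -> form_eta2 can (g t) (velocity (M := B) g t) = 0 /\
  form_eta3 can (g t) (velocity (M := B) g t) = 0.
Hypothesis hl : forall t, t \in `[a, b] -> form_phi can (g t) (velocity (M := B) g t) =
  l t * form_eta1 can (g t) (velocity (M := B) g t).
Hypotheses (t1ab : t1 \in `[a, b]) (cl : {for t1, continuous l}).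

(** The invariants are bare functions, but [structure_pairing] with a vector
    field on which [eta3] does not vanish expresses the combination that
    matters by exterior derivatives of smooth forms. *)
Lemma Clambda_continuous : exists q : R -> R, {for t1, continuous q} /\
  \forall t \near t1, t \in `[a, b] ->
    form_eta1 can (g t) (velocity (M := B) g t) * Clambda I J1 K A2 (l t) (g t) = q t.
Proof.
have Ot : O t1 by exact: abO.
have [k [hk _]] := sg Ot; have [x tx x3] := eta3_nonzero hk.
have [f [W [oW Wt sf fg px]]] := extension_exists sg Ot tx.
have s1 := smooth_eta1 hX D_contact F_sub_Finsler D_oriented.
have s3 := smooth_eta3 hX D_contact F_sub_Finsler D_oriented.
pose es : (R * R)%type := (1, 0); pose et : (R * R)%type := (0, 1).
pose n1s := pulled (M := B) f (form_eta1 can) es.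
pose n1t := pulled (M := B) f (form_eta1 can) et.
pose n3s := pulled (M := B) f (form_eta3 can) es.
pose n3t := pulled (M := B) f (form_eta3 can) et.
have S1s : smooth W n1s by exact (smooth_pulled hB sf s1 es).
have S1t : smooth W n1t by exact (smooth_pulled hB sf s1 et).
have S3s : smooth W n3s by exact (smooth_pulled hB sf s3 es).
have S3t : smooth W n3t by exact (smooth_pulled hB sf s3 et).
pose d1 (t : R) := 'D_es n1t (0, t) - 'D_et n1s (0, t).
pose d3 (t : R) := 'D_es n3t (0, t) - 'D_et n3s (0, t).
have cs (w : R * R -> R) : smooth W w -> {for t1, continuous (fun t => w (0, t))}.
  move=> sw; apply: (@continuous_comp _ _ _ (fun t : R => (0, t)) w).
    by apply: differentiable_continuous; exact: (diff_slice_t 0 t1).1.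
  exact: smooth_continuous sw Wt.
have c1 : {for t1, continuous d1} by apply: cvgB; [exact: (cs _ (smooth_D es S1t))|exact: (cs _ (smooth_D et S1s))].
have c3 : {for t1, continuous d3} by apply: cvgB; [exact: (cs _ (smooth_D es S3t))|exact: (cs _ (smooth_D et S3s))].
have f1 : f (0, t1) = g t1 by have [] := nbhs_singleton fg.
have n30 : n3s (0, t1) != 0 by rewrite /n3s /pulled px f1.
exists (fun t => (d1 t + l t * d3 t) / n3s (0, t)); split.
  apply: cvgM; first by apply: cvgD; [exact: c1|apply: cvgM; [exact: cl|exact: c3]].
  by apply: cvgV; [exact: n30|exact: cs].
have N3 : \forall t \near t1, n3s (0, t) != 0.
  have := cs _ S3s; move/(_ [set y | y != 0]); apply.
  exact: (open_nbhs_nbhs (conj (@open_neq R 0) n30)).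
have [e e0 fge] := (near_ballP _ _).1 fg.
have Ne : \forall t \near t1, `|t - t1| < e by apply/near_ballP; exists e.
apply: filterS (filterI N3 Ne) => t [nt te] tab.
have Wt' := (fge t te).1; have ft := (fge t te).2.
have E1 := dext_pushvec hB sf s1 es et Wt'; have E3 := dext_pushvec hB sf s3 es et Wt'.
have vE : pushvec (M := B) f (0, t) et = velocity (M := B) g t.
  have sf' : smooth_into (M := B) W (fun p => (fun s t => f (s, t)) p.1 p.2).
    by rewrite (_ : (fun p => _) = f)//; apply/funext => -[].
  have v1 := velocity_slice hX D_contact F_sub_Finsler D_oriented (V := fun s t => f (s, t)) sf' Wt'.
  have v2 := velocity_near hX D_contact F_sub_Finsler D_oriented (smooth_into_slice (s := 0) oW sf).
  have -> : f = (fun p => f (p.1, p.2)) by apply/funext => -[].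
  rewrite -v1; apply: esym; apply: v2 => //.
  apply/near_ballP; exists (e - `|t - t1|); first by rewrite subr_gt0.
  move=> u ue; have /fge[] // : `|u - t1| < e.
  by rewrite -(subrKA t) (le_lt_trans (ler_normD _ _))// -ltrBrDr.
have txs := tangent_pushvec hB es sf Wt'.
have txt := tangent_pushvec hB et sf Wt'.
have [h2 h3] := hI tab; have h4 := hl tab.
rewrite ft in E1 E3 txs txt; rewrite vE in E1 E3 txt.
have bb : body B (g t) by have [] := txt.
have P := structure_pairing hse bb txs txt h2 h3 h4.
have N3E : n3s (0, t) = form_eta3 can (g t) (pushvec (M := B) f (0, t) es) by rewrite /n3s /pulled ft.
apply: (canRL (mulfK nt)); rewrite [in LHS]N3E.
apply: etrans (esym P) _.
by apply: (congr2 +%R E1 (congr1 ( *%R (l t)) E3)).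
Qed.

End Continuity.
End Multiplier.

(** * Curves near a point *)
Section Tube.
Context {R : realType}.

Lemma tube (O : set (R * R)) (a b : R) : open O -> (forall t, t \in `[a, b] -> O (0, t)) ->
  exists2 eps : R, 0 < eps & forall s t, `|s| < eps -> t \in `[a, b] -> O (s, t).
Proof.
move=> oO H; have /compact_near_coveringP C := @segment_compact R a b.
have [|e e0 E] := (near_ballP (0 : R) (fun s => `[a, b] `<=` (fun t => O (s, t)))).1.
  apply: (C R (nbhs (0 : R)) (fun s t => O (s, t))) => t tab.
  have := open_near oO (H t tab); move=> [[/= P1 P2] [N1 N2] S].
  by exists (P2, P1) => // -[t' s'] [/= h1 h2]; apply: S.
by exists e => // s t se tab; apply: E => //; rewrite subr0.
Qed.

Lemma lt_of_derive (f f' : R -> R) (a b : R) : a < b ->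
  (forall t, t \in `[a, b] -> is_derive t 1 f (f' t)) ->
  (forall t, t \in `]a, b[ -> 0 < f' t) -> f a < f b.
Proof.
move=> ab df p.
have df' t : t \in `]a, b[ -> is_derive t 1 f (f' t).
  by rewrite in_itv/= => /andP[h1 h2]; apply: df; rewrite in_itv/= !ltW.
have [|c cab E] := MVT ab df'.
  by apply: continuous_in_subspaceT => t /set_mem tab; exact: is_derive_continuous (df t tab).
by rewrite -subr_gt0 E mulr_gt0 ?subr_gt0// p.
Qed.

Definition dotv {n} (u v : 'rV[R]_n) : R := \sum_i u 0 i * v 0 i.

Lemma is_derive_dotv n (z : R -> 'rV[R]_n) (t : R) y v : is_derive t 1 z y ->
  is_derive t 1 (fun t => dotv (z t) v) (dotv y v).
Proof.
move=> dz; have H (i : 'I_n) : is_derive t 1 (fun t => v 0 i * z t 0 i) (v 0 i * y 0 i).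
  have := is_deriveZ (v 0 i) (is_derive_coord i dz); exact.
have D : is_derive t 1 (\sum_(i < n) (fun t => v 0 i * z t 0 i)) (\sum_(i < n) v 0 i * y 0 i).
  by apply: is_derive_sum; exact: H.
move: D; rewrite /dotv.
rewrite (_ : \sum_(i < n) (fun t => v 0 i * z t 0 i) = (fun t => \sum_i z t 0 i * v 0 i)); last first.
  by apply/funext => x; rewrite fct_sumE; apply: eq_bigr => i _; rewrite mulrC.
by rewrite (_ : \sum_(i < n) v 0 i * y 0 i = \sum_i y 0 i * v 0 i)//; apply: eq_bigr => i _; rewrite mulrC.
Qed.

Lemma is_derive_sumsq n (z : R -> 'rV[R]_n) (t : R) y v : is_derive t 1 z y ->
  is_derive t 1 (fun t => sumsq (z t - v)) (2 * (dotv (z t) y - dotv v y)).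
Proof.
move=> dz; have H (i : 'I_n) : is_derive t 1 (fun t => (z t 0 i - v 0 i) ^+ 2) (2 * (z t 0 i - v 0 i) * y 0 i).
  have d1 := is_deriveB (is_derive_coord i dz) (is_derive_cst (v 0 i) t (1 : R)).
  have D := is_deriveM d1 d1; rewrite (_ : (fun t => _) = (fun t => z t 0 i - v 0 i) * (fun t => z t 0 i - v 0 i)); last first.
    by apply/funext => x; rewrite expr2.
  by apply: is_derive_eq D _; rewrite subr0 /GRing.scale/= /cst -[X in X * _ + _]/(z t 0 i - v 0 i) -[X in _ + X * _]/(z t 0 i - v 0 i); ring.
have D : is_derive t 1 (\sum_(i < n) (fun t => (z t 0 i - v 0 i) ^+ 2)) (\sum_(i < n) 2 * (z t 0 i - v 0 i) * y 0 i).
  by apply: is_derive_sum; exact: H.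
move: D; rewrite /dotv /sumsq.
rewrite (_ : \sum_(i < n) (fun t => (z t 0 i - v 0 i) ^+ 2) = (fun t => \sum_i (z t - v) 0 i ^+ 2)); last first.
  by apply/funext => x; rewrite fct_sumE; apply: eq_bigr => i _; rewrite !mxE.
move=> D; apply: is_derive_eq D _; rewrite -sumrB mulr_sumr; apply: eq_bigr => i _.
by rewrite -mulrA mulrBl.
Qed.

(** Near [t0] the velocities at any two times have positive inner product, so
    the squared distance from the point at [t0] is monotone on each side.
    This makes the times spent in a small ball an interval. *)
Lemma regular_curve_leaves n (z : R -> 'rV[R]_n) (O : set R) (t0 : R) : open O -> O t0 -> smooth O z ->
  'D_(1 : R) z t0 != 0 -> exists2 r : R, 0 < r & (forall t, `|t - t0| < r -> O t) /\
    forall t t', (t0 <= t /\ t < t' /\ t' < t0 + r) \/ (t0 - r < t' /\ t' < t /\ t <= t0) ->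
    sumsq (z t - z t0) < sumsq (z t' - z t0).
Proof.
move=> oO Ot sz z0; pose H (p : R * R) : R := dotv ('D_(1 : R) z p.1) ('D_(1 : R) z p.2).
pose O2 : set (R * R) := [set p | O p.1 /\ O p.2].
have cH : {for (t0, t0), continuous H}.
  apply: continuous_sum => i _; apply: cvgM.
    apply: (@continuous_comp _ _ _ (fun p : R * R => p.1) (fun x => ('D_(1 : R) z x) 0 i)); first exact: cvg_fst.
    exact: (smooth_continuous (smooth_coord i oO (smooth_D (1 : R) sz)) Ot).
  apply: (@continuous_comp _ _ _ (fun p : R * R => p.2) (fun x => ('D_(1 : R) z x) 0 i)); first exact: cvg_snd.
  exact: (smooth_continuous (smooth_coord i oO (smooth_D (1 : R) sz)) Ot).
have H0 : 0 < H (t0, t0).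
  have [h _] := norm_sumsq ('D_(1 : R) z t0); apply: lt_le_trans (exprn_gt0 2 _) (le_trans h _).
    by rewrite normr_gt0.
  by rewrite /H /dotv /sumsq; apply: ler_sum => i _; rewrite expr2.
have N : \forall p \near (t0, t0), 0 < H p by apply: (cvgr_gt _ cH).
have [r1 r10 E1] := (near_ballP _ _).1 N.
have [r2 r20 E2] := (near_ballP _ _).1 (open_near oO Ot).
pose r := Num.min r1 r2; have r0 : 0 < r by rewrite lt_min r10.
have Or t : `|t - t0| < r -> O t by rewrite lt_min => /andP[_ /E2].
have Hr x t : `|x - t0| < r -> `|t - t0| < r -> 0 < H (x, t).
  rewrite !lt_min => /andP[h1 _] /andP[h2 _]; apply: E1.
  by rewrite (_ : _ - _ = (x - t0, t - t0))// /Num.norm/= gt_max h1.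
have dz t : `|t - t0| < r -> is_derive (t : R) 1 z ('D_(1 : R) z t).
  by move=> tr; apply: derivableP; apply: diff_derivable; exact: (smooth_differentiable sz (Or t tr)).
exists r => //; split=> // t t'; case=> [[h1 [h2 h3]]|[h3 [h2 h1]]].
  apply: (@lt_of_derive (fun t => sumsq (z t - z t0)) (fun t => 2 * (dotv (z t) ('D_(1 : R) z t) - dotv (z t0) ('D_(1 : R) z t)))) => // x.
    rewrite in_itv/= => /andP[xt xt']; apply: is_derive_sumsq; apply: dz.
    by rewrite ger0_norm; lra.
  rewrite in_itv/= => /andP[xt xt']; rewrite pmulr_rgt0// subr_gt0.
  apply: (@lt_of_derive (fun y => dotv (z y) _) (fun y => dotv ('D_(1 : R) z y) _)) => [|y|y].
  - lra.
  - by rewrite in_itv/= => /andP[yt yt']; apply: is_derive_dotv; apply: dz; rewrite ger0_norm; lra.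
  - by rewrite in_itv/= => /andP[yt yt']; apply: Hr; rewrite ger0_norm; lra.
rewrite -ltrN2; apply: (@lt_of_derive (fun t => - sumsq (z t - z t0)) (fun t => - (2 * (dotv (z t) ('D_(1 : R) z t) - dotv (z t0) ('D_(1 : R) z t))))) => // x.
  rewrite in_itv/= => /andP[xt xt']; apply: is_deriveN; apply: is_derive_sumsq; apply: dz.
  by rewrite ler0_norm; lra.
rewrite in_itv/= => /andP[xt xt']; rewrite oppr_gt0 pmulr_rlt0// subr_lt0.
apply: (@lt_of_derive (fun y => dotv (z y) _) (fun y => dotv ('D_(1 : R) z y) _)) => [|y|y].
- lra.
- by rewrite in_itv/= => /andP[yt yt']; apply: is_derive_dotv; apply: dz; rewrite ler0_norm; lra.
- by rewrite in_itv/= => /andP[yt yt']; apply: Hr; rewrite ler0_norm; lra.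
Qed.

Lemma constant_sign (f : R -> R) (x y : R) :
  (forall t, Num.min x y <= t <= Num.max x y -> {for t, continuous f} /\ f t != 0) -> 0 < f x * f y.
Proof.
wlog xy : x y / x <= y.
  move=> W H; have [h|h] := leP x y; first exact: W.
  by rewrite mulrC; apply: W; [exact: ltW|rewrite minC maxC].
rewrite (min_idPl xy) (max_idPr xy) => H.
have n t : t \in `[x, y] -> f t != 0 by rewrite in_itv/= => /H[].
have nx : f x != 0 by apply: n; rewrite in_itv/= lexx.
have ny : f y != 0 by apply: n; rewrite in_itv/= lexx andbT.
rewrite lt_neqAle eq_sym mulf_neq0//=; rewrite leNgt; apply/negP => neg.
have cf : {within `[x, y], continuous f}.
  by apply: continuous_in_subspaceT => t; rewrite inE/= in_itv/= => /H[].
have [|t tab ft] := IVT xy cf (v := 0); last by have := n t tab; rewrite ft eqxx.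
rewrite ge_min le_max.
case: (ltgtP (f x) 0) => h; last by rewrite h eqxx in nx.
  by have := neg; rewrite nmulr_rlt0// => h'; rewrite (ltW h').
by have := neg; rewrite pmulr_rlt0// => h'; rewrite (ltW h') orbT.
Qed.

End Tube.

(** * Lifting horizontal maps to coframes *)
Section ContactChart.
Context {R : realType} {X : premanifold R 3}.
Variables (D : mpoint X -> set (tfam X)) (F : mpoint X -> tfam X -> R).
Variable o : mpoint X -> tfam X -> tfam X -> Prop.
Hypothesis hX : regular_atlas X.
Hypotheses (D_contact : contact D) (F_sub_Finsler : sub_Finsler D F).
Hypothesis D_oriented : orientation D o.

Local Notation TX := (tangent_bundle X).
Local Notation Sigma := (indicatrix D F).
Local Notation B := (B4 D F o).

Let hTX : regular_atlas TX := regular_tangent_bundle hX.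
Let hS : regular_atlas Sigma := regular_indicatrix D F hX.
Let hB : regular_atlas B := regular_B4 hX D_contact F_sub_Finsler D_oriented.

Variables (A : set (mpoint X)) (v1 v2 : vfield X) (c : chart R (mpoint X) 3).
Hypotheses (lf : local_frame D A v1 v2) (ac : atlas X c).

Definition frame_image : set 'rV[R]_3 := cimg c A.
Definition frame1 (y : 'rV[R]_3) : 'rV[R]_3 := v1 (param c y) c.
Definition frame2 (y : 'rV[R]_3) : 'rV[R]_3 := v2 (param c y) c.
Definition frame3 (y : 'rV[R]_3) : 'rV[R]_3 := bracket v1 v2 (param c y) c.

Lemma frame_imageP y : frame_image y ->
  [/\ A (param c y), chart_at (param c y) c & coord c (param c y) = y].
Proof. by move=> /(cimgP hX ac)[? ? ?]. Qed.

Lemma open_frame_image : open frame_image.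
Proof. exact: (local_frame_open lf ac). Qed.

Lemma frame3E y : frame_image y -> frame3 y = 'D_(frame1 y) frame2 y - 'D_(frame2 y) frame1 y.
Proof.
move=> Uy; have [Ay hc cy] := frame_imageP Uy.
rewrite /frame3 /bracket; case: asboolP => [_|h]; last by case: (h hc).
by rewrite /= cy; reflexivity.
Qed.

Lemma smooth_frames : [/\ smooth frame_image frame1, smooth frame_image frame2 & smooth frame_image frame3].
Proof.
have [s1 s2] := local_frame_smooth lf ac; split=> //.
have oU := open_frame_image.
have S (f w : 'rV[R]_3 -> 'rV[R]_3) : smooth frame_image f -> smooth frame_image w ->
    smooth frame_image (fun y => 'D_(w y) f y).
  move=> sf sw; apply: (smooth_ext oU _ (smooth_diff oU oU _ sf (@smooth_id _ _ _) sw)) => // y Uy.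
  by rewrite deriveE//; exact: smooth_differentiable sf Uy.
have S3 : smooth frame_image (fun y => 'D_(frame1 y) frame2 y + (-1) *: 'D_(frame2 y) frame1 y).
  apply: smoothD => //; first exact: S.
  by apply: smooth_scale => //; [exact: smooth_cst|exact: S].
apply: (smooth_ext oU _ S3) => y Uy; rewrite frame3E//.
by rewrite scaleN1r.
Qed.

Lemma frame_span y : frame_image y -> forall v, exists a b d : R,
  v = a *: frame1 y + b *: frame2 y + d *: frame3 y.
Proof.
move=> Uy v; have [Ay hc cy] := frame_imageP Uy.
have [a [b [d E]]] := D_contact.2 _ _ _ lf _ Ay _ (tangent_vec_of hX v hc).
exists a, b, d; have := congr1 (fun f : tfam X => f c) E.
by rewrite /= (vec_ofE hX _ hc).
Qed.

Local Notation cf := (contact_form frame1 frame2 frame3).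

(** In the frame the contact form is the third coordinate, and the first two
    vectors span [D]. *)
Lemma contact_formP y : frame_image y -> forall v,
  D (param c y) (vec_of c (param c y) v) <-> cf y v = 0.
Proof.
move=> Uy v; have [Ay hc cy] := frame_imageP Uy; have [_ sv1 sv2 DP _] := lf.
have t1 := sv1.1 _ Ay; have t2 := sv2.1 _ Ay; split=> [/(DP _ Ay)[a [b E]]|v0].
  have -> : v = a *: frame1 y + b *: frame2 y + 0 *: frame3 y.
    have := congr1 (fun f : tfam X => f c) E; rewrite /= (vec_ofE hX _ hc) => ->.
    by rewrite scale0r addr0.
  exact: (contact_formE frame_span).
have [a [b [d E]]] := frame_span Uy v; apply/(DP _ Ay); exists a, b.
have d0 : d = 0 by rewrite -v0 E (contact_formE frame_span).
apply: (tangent_eq (tangent_vec_of hX v hc) _ hc).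
  by apply: tangentP => //; exact: tangentZ.
by rewrite (vec_ofE hX _ hc) E d0 scale0r addr0.
Qed.

Section Lift.
Context {V : normedModType R}.
Variables (O : set V) (Psi omega : V -> 'rV[R]_3).
Hypotheses (oO : open O) (sP : smooth O Psi) (so : smooth O omega).
Hypotheses (PU : forall p, O p -> frame_image (Psi p)) (cfo : forall p, O p -> cf (Psi p) (omega p) = 0).

Definition lift_base (p : V) : mpoint X := param c (Psi p).
Definition lift_vector (p : V) : tfam X := vec_of c (lift_base p) (omega p).
Definition lift_norm (p : V) : R := F (lift_base p) (lift_vector p).
(** A horizontal direction at a point of [X] is made a point of the
    indicatrix bundle by dividing by its length. *)
Definition lift (p : V) : mpoint Sigma := (lift_base p, (lift_norm p)^-1 *: lift_vector p).

Lemma lift_chart p : O p -> chart_at (lift_base p) c.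
Proof. by move=> Op; have [] := frame_imageP (PU Op). Qed.

Lemma lift_coord p : O p -> coord c (lift_base p) = Psi p.
Proof. by move=> Op; have [] := frame_imageP (PU Op). Qed.

Lemma lift_vectorE p : O p -> lift_vector p c = omega p.
Proof. by move=> Op; exact: (vec_ofE hX _ (lift_chart Op)). Qed.

Lemma lift_in_D p : O p -> D (lift_base p) (lift_vector p).
Proof. by move=> Op; apply/(contact_formP (PU Op)); exact: cfo. Qed.

Lemma smooth_lift_norm : (forall p, O p -> omega p != 0) -> smooth O lift_norm.
Proof.
move=> o0; apply: smooth_local => // p Op.
have s1 : smooth O (fun q => coord c (lift_base q)).
  by apply: (smooth_ext oO _ sP) => q Oq; rewrite lift_coord.
have s2 : smooth O (fun q => lift_vector q c).
  by apply: (smooth_ext oO _ so) => q Oq; rewrite lift_vectorE.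
have Ap : A (lift_base p) by have [] := frame_imageP (PU Op).
have [U [a [b [[oU Up] UO UA [sa sb] E]]]] :=
  smooth_in_frame hX D_contact lf ac oO Op Ap (fun q Oq => (lift_chart Oq).2) s1 s2 lift_in_D.
exists U; split=> //.
pose w (q : V) : 'rV[R]_2 := \row_(i < 2) (if val i == 0%N then a q else b q).
have sw : smooth U w.
  by apply: smooth_row => // i; rewrite /w; case: i => -[|i] hi /=;
    [apply: (smooth_ext oU _ sa)|apply: (smooth_ext oU _ sb)] => q _; rewrite mxE.
pose T := [set p : 'rV[R]_3 * 'rV[R]_2 | cimg c A p.1 /\ p.2 != 0].
have S := smooth_frame_norm F_sub_Finsler lf ac.
have H : smooth U (frame_norm F v1 v2 c \o (fun q => (Psi q, w q))).
  apply: (smooth_comp (O' := T)) => //.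
  - by apply: has_coords_prod; exact: has_coords_rV.
  - move=> q Uq; split; first exact: PU (UO _ Uq).
    apply/eqP => /rowP w0; have := o0 _ (UO _ Uq).
    have a0 : a q = 0 by have := w0 ord0; rewrite /= !mxE.
    have b0 : b q = 0 by have := w0 (@Ordinal 2 1 isT); rewrite /= !mxE.
    rewrite -(lift_vectorE (UO _ Uq)) E//.
    by rewrite a0 b0 !scale0r addr0 eqxx.
  - by apply: smooth_pair => //; exact: smooth_sub sP.
apply: (smooth_ext oU _ H) => q Uq; rewrite /lift_norm E// /frame_norm/= !mxE /=.
by [].
Qed.

Hypotheses (sN : smooth O lift_norm) (N0 : forall p, O p -> 0 < lift_norm p).

Let bodyX p : O p -> body X (lift_base p).
Proof. by move=> Op; exact: bodyX_chart (lift_chart Op). Qed.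

Lemma lift_indicatrix p : O p ->
  [/\ body X (lift p).1, D (lift p).1 (lift p).2 & F (lift p).1 (lift p).2 = 1].
Proof.
move=> Op; have Dp := lift_in_D Op; have bp := bodyX Op.
have i0 : 0 < (lift_norm p)^-1 by rewrite invr_gt0 N0.
split=> //=; last by rewrite (sub_Finsler_homogeneous F_sub_Finsler)// mulVf// gt_eqF// N0.
have [_ _ _ DP _] := lf; have [Ap _ _] := frame_imageP (PU Op).
have [a [b E]] := (DP _ Ap _).1 Dp; apply/(DP _ Ap).
exists ((lift_norm p)^-1 * a), ((lift_norm p)^-1 * b).
by rewrite E scalerDr !scalerA.
Qed.

Lemma smooth_into_lift : smooth_into (M := TX) O lift.
Proof.
have at' : atlas TX (tangent_chart c) by exists c.
apply: (smooth_into_of_chart at' oO).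
  move=> q Oq; split; first by have [] := lift_chart Oq.
  by apply: tangentZ => //; exact: tangent_vec_of (lift_chart Oq).
have s1 : smooth O (fun q => (lift_norm q)^-1 *: omega q).
  apply: smooth_scale => //; apply: smoothV => // q Oq.
  by rewrite gt_eqF// N0.
apply: (smooth_ext oO _ (smooth_row_mx oO sP s1)) => q Oq /=.
by congr (row_mx _ _); [rewrite lift_coord|rewrite -[RHS]/(_ *: (lift_vector q c)) lift_vectorE].
Qed.

Variables (A' : set (mpoint Sigma)) (e : coframing Sigma) (d : chart R (mpoint Sigma) 4).
Hypotheses (ad : atlas Sigma d) (ae : adapted4 A' e) (pe : positive o A' e).

Definition lift_domain : set V := [set p | [/\ O p, dom d (lift p) & A' (lift p)]].

Lemma lift_domain_smooth : open lift_domain /\ smooth lift_domain (coord d \o lift).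
Proof.
have oA : mopen A' by have [[[]]] := ae.
have H p : lift_domain p -> exists U, [/\ open U, U p, U `<=` lift_domain & smooth U (coord d \o lift)].
  move=> [Op dp Ap].
  have [U [oU Up UO Ud sU]] := smooth_lift hTX smooth_into_lift lift_indicatrix Op ad dp.
  have sS : smooth_into (M := Sigma) U lift by exact: (smooth_into_of_chart ad oU Ud sU).
  have [W [oW Wp WU WA]] := smooth_into_mopen hS sS Up oA Ap.
  exists W; split=> //; last exact: smooth_sub sU.
  by move=> q Wq; split; [exact: UO (WU _ Wq)|exact: Ud (WU _ Wq)|exact: WA].
split; last by apply: smooth_local => p /H[U [oU Up _ sU]]; exists U; split.
rewrite openE => p /H[U [oU Up US _]].
by apply: filterS US _; exact: open_near oU Up.
Qed.

Definition coframe_lift (p : V) : mpoint B := (lift p, e (lift p)).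

Lemma smooth_into_coframe_lift : smooth_into (M := B) lift_domain coframe_lift.
Proof.
have [oL sL] := lift_domain_smooth.
have ak : atlas B (B4_chart A' e d) by exists A', e, d.
by apply: (smooth_into_of_chart ak oL) => // q [Oq dq Aq].
Qed.

End Lift.
End ContactChart.

(** * Deformation of an integral curve by a contact flow *)
Section Deformation.
Context {R : realType} {X : premanifold R 3}.
Variables (D : mpoint X -> set (tfam X)) (F : mpoint X -> tfam X -> R).
Variable o : mpoint X -> tfam X -> tfam X -> Prop.
Hypothesis hX : regular_atlas X.
Hypotheses (D_contact : contact D) (F_sub_Finsler : sub_Finsler D F).
Hypothesis D_oriented : orientation D o.

Local Notation TX := (tangent_bundle X).
Local Notation Sigma := (indicatrix D F).
Local Notation B := (B4 D F o).
Local Notation toSigma := (@B4_to_Sigma R X D F o).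
Local Notation toX := (@B4_to_X R X D F o).
Local Notation can := (canonical_coframing D F o).
Local Notation base := (@basepoint R X D F).

Let hTX : regular_atlas TX := regular_tangent_bundle hX.
Let hS : regular_atlas Sigma := regular_indicatrix D F hX.
Let hB : regular_atlas B := regular_B4 hX D_contact F_sub_Finsler D_oriented.

(** Null forms vanish on monic vectors, and only multiples of these remain,
    modulo vertical vectors, where [eta2] and [eta3] vanish. *)
Lemma velocity_base {V : normedModType R} (O : set V) (f : V -> mpoint B) p v : open O ->
  smooth_into (M := B) O f -> O p -> pulled (M := B) f (form_eta2 can) v p = 0 ->
  pulled (M := B) f (form_eta3 can) v p = 0 ->
  pushvec (M := X) (toX \o f) p v = pulled (M := B) f (form_eta1 can) v p *: (f p).1.2.
Proof.
move=> oO sf Op; have [A [e [ae pe Ab be [c hc]]]] := local_coframing sf Op.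
have E := dmap_toSigma_push hX D_contact F_sub_Finsler D_oriented sf v Op.
have t : tangent (M := Sigma) (f p).1 (pushvec (M := Sigma) (toSigma \o f) p v).
  exact: (tangent_pushvec hS v (smooth_into_toSigma hX D_contact F_sub_Finsler D_oriented oO sf) Op).
rewrite /pulled /form_eta1 /form_eta2 /form_eta3 /= E be => n2 n3.
rewrite -(dmap_base_push hX D_contact F_sub_Finsler D_oriented oO sf v Op).
exact: (coframe_kernel hX D_contact F_sub_Finsler ae Ab hc t n2 n3).
Qed.

Variables (A : set (mpoint X)) (v1 v2 : vfield X) (c : chart R (mpoint X) 3).
Hypotheses (lf : local_frame D A v1 v2) (ac : atlas X c).
Variables (A' : set (mpoint Sigma)) (e : coframing Sigma) (d : chart R (mpoint Sigma) 4).
Hypotheses (ad : atlas Sigma d) (ae : adapted4 A' e) (pe : positive o A' e).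

Variables (a b : R) (g : R -> mpoint B) (Og : set R) (t0 r sgn rho : R).
Let J : set R := [set t | `|t - t0| < r].
Let gam (t : R) : 'rV[R]_3 := coord c (toX (g t)).
Hypotheses (oOg : open Og) (sg : smooth_into (M := B) Og g) (abO : `[a, b] `<=` Og).
Hypothesis Ig : forall t, t \in `[a, b] ->
  [/\ form_eta2 can (g t) (velocity (M := B) g t) = 0,
      form_eta3 can (g t) (velocity (M := B) g t) = 0
    & form_eta1 can (g t) (velocity (M := B) g t) != 0].
Hypotheses (r0 : 0 < r) (Jab : forall t, J t -> t \in `]a, b[).
Hypothesis Jc : forall t, J t -> A (toX (g t)) /\ dom c (toX (g t)).
Hypothesis Jd : forall t, J t -> [/\ A' (g t).1, dom d (g t).1 & (g t).2 = e (g t).1].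
Hypothesis sgam : smooth J gam.
Hypothesis sgn2 : sgn * sgn = 1.
Hypothesis sgnP : forall t, J t -> 0 < sgn * form_eta1 can (g t) (velocity (M := B) g t).

Local Notation U := (frame_image A c).
Local Notation w1 := (frame1 v1 c).
Local Notation w2 := (frame2 v2 c).
Local Notation w3 := (frame3 v1 v2 c).
Local Notation cf := (contact_form w1 w2 w3).

Hypotheses (rho0 : 0 < rho) (ballU : forall y, sumsq (y - gam t0) <= rho ^+ 2 -> U y).
Hypothesis rho_out : forall t, J t -> r / 4 <= `|t - t0| -> rho ^+ 2 <= sumsq (gam t - gam t0).
Hypothesis rho_mono : forall t x, J t -> Num.min t0 t <= x <= Num.max t0 t ->
  sumsq (gam x - gam t0) <= sumsq (gam t - gam t0).
Variable P : R -> 'rV[R]_3 -> 'rV[R]_3.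
Hypothesis fl : is_flow (hamiltonian w1 w2 w3 (gam t0) rho) P.

Let oU : open U := open_frame_image lf ac.
Let s1 : smooth U w1. Proof. by have [] := smooth_frames hX lf ac. Qed.
Let s2 : smooth U w2. Proof. by have [] := smooth_frames hX lf ac. Qed.
Let s3 : smooth U w3. Proof. by have [] := smooth_frames hX lf ac. Qed.
Let span := frame_span hX D_contact lf ac.
Let br := @frame3E R X hX A v1 v2 c ac.
Let sH := smooth_hamiltonian oU s1 s2 s3 span ballU.

Lemma open_window : open J.
Proof.
rewrite (_ : J = ball t0 r); first exact: ball_open.
by apply/funext => t; rewrite -ball_normE/= distrC.
Qed.

Lemma base_curve_in_frame t : J t -> U (gam t) /\ param c (gam t) = toX (g t).
Proof.
move=> /Jc[At dt]; split; first exact: cimg_coord.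
by rewrite /gam (paramK hX ac).
Qed.

Let dgam (t : R) : 'rV[R]_3 := 'D_(1 : R) gam t.

Lemma base_curve_velocity t : J t -> dgam t = form_eta1 can (g t) (velocity (M := B) g t) *: (g t).1.2 c.
Proof.
move=> Jt; have tab := Jab Jt.
have tab' : t \in `[a, b] by move: tab; rewrite !in_itv/= => /andP[/ltW-> /ltW->].
have [n2 n3 _] := Ig tab'; have Ot := abO tab'.
have := velocity_base oOg sg Ot n2 n3.
move=> /(congr1 (fun f : tfam X => f c)).
have hc : chart_at (M := X) ((toX \o g) t) c by have [_] := Jc Jt.
move=> E; apply: etrans E; rewrite (pushvecE _ hc) /dgam deriveE//.
exact: (smooth_differentiable sgam Jt).
Qed.

Lemma curve_indicatrix t : J t -> [/\ body X (toX (g t)), D (toX (g t)) (g t).1.2,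
  F (toX (g t)) (g t).1.2 = 1 & tangent (toX (g t)) (g t).1.2].
Proof. by move=> /Jd[_ dt _]; exact: (indicatrix_point hX D_contact (conj ad dt)). Qed.

Lemma curve_direction_nonzero t : J t -> (g t).1.2 c != 0.
Proof.
move=> Jt; have [bX Du F1 tu] := curve_indicatrix Jt.
have hc : chart_at (M := X) (toX (g t)) c by have [_] := Jc Jt.
apply/eqP => u0; have v0 : (g t).1.2 = 0 by rewrite (tangentE tu hc) u0 vec_of0.
have := sub_Finsler_homogeneous F_sub_Finsler bX Du (@ltr0n R 2).
rewrite [X in F _ X](_ : _ = (g t).1.2); last by rewrite v0 scaler0.
by rewrite F1 => /eqP; rewrite mulr1 eq_sym -[1]/(1%:R) eqr_nat.
Qed.

Let Psi (p : R * R) : 'rV[R]_3 := P p.1 (gam p.2).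
Let omega (p : R * R) : 'rV[R]_3 := sgn *: 'D_((0, 1) : R * R) Psi p.
Let O1 : set (R * R) := [set p | J p.2].

Lemma open_snd (O : set R) : open O -> open [set p : R * R | O p.2].
Proof.
move=> oO; rewrite (_ : [set p : R * R | O p.2] = setT `&` snd @^-1` O); last by rewrite setTI.
by apply: (open_preimage_on openT oO) => p _; exact: cvg_snd.
Qed.

Let oO1 : open O1 := open_snd open_window.

Lemma smooth_snd_comp n (O : set R) (h : R -> 'rV[R]_n) : open O -> smooth O h ->
  smooth [set p : R * R | O p.2] (fun p => h p.2).
Proof.
move=> oO sh; have lin2 : linear (fun p : R * R => p.2) by [].
apply: (smooth_comp_row (O' := O) (f := snd) (g := h)) => //; [exact: has_coords_R|exact: open_snd|].
by apply: (@smooth_lin _ _ _ _ (mk_linear lin2)) => p; exact: cvg_snd.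
Qed.

Lemma smooth_moved_curve : smooth O1 Psi.
Proof.
have lin1 : linear (fun p : R * R => p.1) by [].
apply: (smooth_comp_row (O' := setT) (f := fun p : R * R => (p.1, gam p.2)) (g := fun q : R * 'rV[R]_3 => P q.1 q.2)) => //.
- by apply: has_coords_prod; [exact: has_coords_R|exact: has_coords_rV].
- exact: openT.
- apply: smooth_pair => //; last exact: (smooth_snd_comp open_window sgam).
  by apply: (@smooth_lin _ _ _ O1 (mk_linear lin1)) => p; exact: cvg_fst.
- exact: (flow_smooth sH fl).
Qed.

Lemma smooth_moved_velocity : smooth O1 omega.
Proof. by apply: smooth_scale => //; [exact: smooth_cst|exact: smooth_D smooth_moved_curve]. Qed.

Lemma moved_curve_in_frame p : O1 p -> U (Psi p).
Proof. by move=> /base_curve_in_frame[Up _]; exact: (flow_stays oU s1 s2 s3 span ballU fl Up). Qed.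

Lemma moved_curve_velocity s t : J t -> 'D_((0, 1) : R * R) Psi (s, t) = 'd (P s) (gam t) (dgam t).
Proof.
move=> Jt; have Op : O1 (s, t) by [].
have [_ <-] := is_derive_slice_t (smooth_differentiable smooth_moved_curve Op).
have dg := smooth_differentiable sgam Jt; have [dP _] := flow_differentiable sH fl s (gam t).
have dc : differentiable (P s \o gam) t by exact: differentiable_comp.
apply: etrans (deriveE _ dc) _; apply: etrans (diff_compE _ dg dP) _.
by apply: congr1; apply: esym; exact: deriveE.
Qed.

Lemma base_curve_horizontal t : J t -> cf (gam t) (dgam t) = 0.
Proof.
move=> Jt; have [Ut Et] := base_curve_in_frame Jt; have [bX Du _ tu] := curve_indicatrix Jt.
have hc : chart_at (M := X) (toX (g t)) c by have [_] := Jc Jt.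
have c0 : cf (gam t) ((g t).1.2 c) = 0.
  by apply/(contact_formP hX D_contact lf ac Ut); rewrite Et -(tangentE tu hc).
rewrite base_curve_velocity// /contact_form; apply: etrans (_ : _ * cf (gam t) ((g t).1.2 c) = 0); last by rewrite c0 mulr0.
by rewrite /contact_form mulr_sumr; apply: eq_bigr => i _; rewrite mxE mulrA.
Qed.

(** The flow preserves the contact distribution, so the moved curves are
    horizontal. *)
Lemma moved_velocity_horizontal p : O1 p -> cf (Psi p) (omega p) = 0.
Proof.
case: p => s t Jt; have [Ut _] := base_curve_in_frame Jt.
have H := flow_contact oU s1 s2 s3 br span ballU fl s Ut (base_curve_horizontal Jt).
rewrite /omega (moved_curve_velocity s Jt); apply: etrans (_ : sgn * cf (P s (gam t)) ('d (P s) (gam t) (dgam t)) = 0).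
  by rewrite /contact_form mulr_sumr; apply: eq_bigr => i _; rewrite mxE mulrA.
by rewrite H mulr0.
Qed.

Let O1' : set (R * R) := O1 `&` (fun p => `|omega p|) @^-1` [set y | 0 < y].
Let N := lift_norm F c Psi omega.
Let O2 : set (R * R) := O1' `&` N @^-1` [set y | 0 < y].

Lemma open_moving : open O1'.
Proof.
apply: (open_preimage_on oO1); first exact: open_gt.
by move=> p Op; apply: cvg_norm; exact: (smooth_continuous smooth_moved_velocity Op).
Qed.

Lemma smooth_moved_norm : smooth O1' N.
Proof.
have sub : O1' `<=` O1 by move=> p [].
apply: (smooth_lift_norm hX D_contact F_sub_Finsler lf ac open_moving) => [|| p /sub|p /sub|p [_]].
- exact: smooth_sub sub smooth_moved_curve.
- exact: smooth_sub sub smooth_moved_velocity.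
- exact: moved_curve_in_frame.
- exact: moved_velocity_horizontal.
- by rewrite /= normr_gt0.
Qed.

Lemma open_positive_norm : open O2.
Proof.
apply: (open_preimage_on open_moving); first exact: open_gt.
by move=> p Op; exact: (smooth_continuous smooth_moved_norm Op).
Qed.

Let sub2 : O2 `<=` O1. Proof. by move=> p [[]]. Qed.
Let sP2 : smooth O2 Psi. Proof. exact: smooth_sub sub2 smooth_moved_curve. Qed.
Let so2 : smooth O2 omega. Proof. exact: smooth_sub sub2 smooth_moved_velocity. Qed.
Let PU2 p : O2 p -> U (Psi p). Proof. by move=> /sub2; exact: moved_curve_in_frame. Qed.
Let cf2 p : O2 p -> cf (Psi p) (omega p) = 0. Proof. by move=> /sub2; exact: moved_velocity_horizontal. Qed.
Let sN2 : smooth O2 N. Proof. by apply: smooth_sub smooth_moved_norm => p []. Qed.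
Let N02 p : O2 p -> 0 < N p. Proof. by case. Qed.

Let OL : set (R * R) := lift_domain (D := D) (F := F) c O2 Psi omega A' d.
Let V1 (p : R * R) : mpoint B := coframe_lift (D := D) (F := F) o c Psi omega e p.

Lemma open_lifted : open OL.
Proof. by have [] := lift_domain_smooth hX D_contact F_sub_Finsler lf ac open_positive_norm sP2 so2 PU2 cf2 sN2 N02 ad ae. Qed.

Lemma smooth_lifted : smooth_into (M := B) OL V1.
Proof. exact: (smooth_into_coframe_lift hX D_contact F_sub_Finsler lf ac open_positive_norm sP2 so2 PU2 cf2 sN2 N02 ad ae pe). Qed.

(** This is why the variation agrees with [g] outside the support of the
    field, and can be continued by [g] beyond the window on which charts are
    available. *)
Lemma lift_unmoved s t : J t -> (\forall u \near t, Psi (s, u) = gam u) -> OL (s, t) /\ V1 (s, t) = g t.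
Proof.
move=> Jt H; have Pt : Psi (s, t) = gam t by exact: nbhs_singleton H.
have Op : O1 (s, t) by [].
have DP : 'D_((0, 1) : R * R) Psi (s, t) = dgam t.
  have [_ <-] := is_derive_slice_t (smooth_differentiable smooth_moved_curve Op).
  exact: near_eq_D.
have [Ut Et] := base_curve_in_frame Jt; have [bX Du F1 tu] := curve_indicatrix Jt.
have hc : chart_at (M := X) (toX (g t)) c by have [_] := Jc Jt.
set k := sgn * form_eta1 can (g t) (velocity (M := B) g t).
have k0 : 0 < k by exact: sgnP.
have oE : omega (s, t) = k *: (g t).1.2 c by rewrite /omega DP base_curve_velocity// scalerA.
have bE : lift_base c Psi (s, t) = toX (g t) by rewrite /lift_base Pt.
have vE : lift_vector c Psi omega (s, t) = k *: (g t).1.2.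
  rewrite /lift_vector bE oE; apply: (tangent_eq (tangent_vec_of hX _ hc) (tangentZ _ tu) hc) => //.
  by rewrite (vec_ofE hX _ hc).
have NE : N (s, t) = k.
  by rewrite /N /lift_norm bE vE (sub_Finsler_homogeneous F_sub_Finsler)// F1 mulr1.
have o0 : omega (s, t) != 0 by rewrite oE scaler_eq0 negb_or gt_eqF//= curve_direction_nonzero.
have hO2 : O2 (s, t) by split; [split=> //; rewrite /= normr_gt0|rewrite /= NE].
have lE : lift D F c Psi omega (s, t) = (g t).1.
  rewrite /lift -/(N (s, t)) NE bE vE scalerA mulVf ?gt_eqF// scale1r.
  by rewrite [RHS]surjective_pairing.
have [At dt et] := Jd Jt.
split; first by rewrite /OL /lift_domain /= lE.
by rewrite /V1 /coframe_lift lE -et [RHS]surjective_pairing.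
Qed.

Lemma moved_curve0 t : J t -> Psi (0, t) = gam t.
Proof. by move=> _; have [P0 _ _] := fl; exact: P0. Qed.

Lemma moved_curve_far s t : J t -> r / 4 <= `|t - t0| -> Psi (s, t) = gam t.
Proof.
move=> Jt rt; have [P0 _ _] := fl.
rewrite -[RHS](P0 (gam t)); apply: (flow_stationary oU s1 s2 s3 span ballU fl).
by rewrite P0 /hamiltonian ltNge rho_out.
Qed.

Lemma unmoved0 t : J t -> OL (0, t) /\ V1 (0, t) = g t.
Proof.
move=> Jt; apply: lift_unmoved => //.
by apply: filterS (open_near open_window Jt) => u; exact: moved_curve0.
Qed.

Lemma open_far_times : open [set u | r / 4 < `|u - t0|].
Proof.
rewrite (_ : [set u | _] = setT `&` (fun t => `|t - t0|) @^-1` [set x | r / 4 < x]); last by rewrite setTI.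
apply: (open_preimage_on openT); first exact: open_gt.
by move=> t _; apply: cvg_norm; apply: cvgB; [exact: cvg_id|exact: cvg_cst].
Qed.

Lemma unmoved_out s t : J t -> r / 4 < `|t - t0| -> OL (s, t) /\ V1 (s, t) = g t.
Proof.
move=> Jt rt; apply: lift_unmoved => //.
have N1 : \forall u \near t, r / 4 < `|u - t0|.
  exact: (open_near open_far_times rt).
by apply: filterS (filterI (open_near open_window Jt) N1) => u [Ju /ltW]; exact: moved_curve_far.
Qed.

Definition deformation (s t : R) : mpoint B := if `|t - t0| < r then V1 (s, t) else g t.

Let Z : set (R * R) := [set p | Og p.2 /\ r / 4 < `|p.2 - t0|].
Definition deformation_domain : set (R * R) := OL `|` Z.
Let f (p : R * R) := deformation p.1 p.2.

Lemma lifted_in_window p : OL p -> J p.2. Proof. by case=> -[[]]. Qed.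

Lemma deformation_lifted p : OL p -> f p = V1 p.
Proof. by move=> h; have := lifted_in_window h; rewrite /f /deformation /J /= => ->; case: (p). Qed.

Lemma deformation_far s t : r / 4 < `|t - t0| -> deformation s t = g t.
Proof. by move=> h; rewrite /deformation; case: ifP => // Jt; have [] := unmoved_out s Jt h. Qed.

Lemma open_far_domain : open Z.
Proof.
by apply: (open_snd (O := [set t | Og t /\ r / 4 < `|t - t0|])); exact: openI oOg open_far_times.
Qed.

Lemma open_deformation_domain : open deformation_domain.
Proof. by apply: openU; [exact: open_lifted|exact: open_far_domain]. Qed.

Lemma smooth_into_snd (O : set R) (h : R -> mpoint B) : open O -> smooth_into (M := B) O h ->
  smooth_into (M := B) [set p : R * R | O p.2] (fun p => h p.2).
Proof.
move=> oO sh p Op; have [k [hk [U' [oU' Up UO dU sU]]]] := sh _ Op.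
exists k; split=> //; exists [set p | U' p.2]; split=> //.
- exact: open_snd.
- by move=> q /UO.
- by move=> q /dU.
- exact: (smooth_snd_comp oU' sU).
Qed.

Lemma smooth_deformation : smooth_into (M := B) deformation_domain f.
Proof.
apply: smooth_into_local => p [OLp|Zp].
  exists OL; split=> //; [exact: open_lifted|by move=> q; left|].
  by apply: (smooth_into_ext open_lifted _ smooth_lifted) => q Oq; rewrite deformation_lifted.
exists Z; split=> //; [exact: open_far_domain|by move=> q; right|].
have ZO : Z `<=` [set p | Og p.2] by move=> q [].
apply: (smooth_into_ext open_far_domain _ (smooth_into_sub open_far_domain ZO (smooth_into_snd oOg sg))) => -[s t] [_ h].
by rewrite /f deformation_far.
Qed.

Let h : R * R -> 'rV[R]_3 := coord c \o (toX \o f).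

Lemma deformation_chart p : OL p -> chart_at (M := X) (toX (f p)) c.
Proof.
move=> OLp; rewrite deformation_lifted//; have [hO2 _ _] := OLp.
exact: (lift_chart hX ac PU2 hO2).
Qed.

Lemma deformation_coord p : OL p -> \forall q \near p, h q = Psi q.
Proof.
move=> OLp; apply: filterS (open_near open_lifted OLp) => q OLq.
rewrite /h /= deformation_lifted//; have [hO2q _ _] := OLq.
exact: (lift_coord hX ac PU2 hO2q).
Qed.

Lemma deformation_velocity p v : OL p -> pushvec (M := X) (toX \o f) p v c = 'D_v Psi p.
Proof.
move=> OLp; have [hO2 _ _] := OLp; apply: etrans (pushvecE _ (deformation_chart OLp)) _.
have dP := smooth_differentiable sP2 hO2.
have NN : \forall q \near p, Psi q = h q by apply: filterS (deformation_coord OLp) => q ->.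
have [dh E] := near_eq_diff NN dP.
apply: etrans (esym (deriveE _ dh)) _; exact: near_eq_D (deformation_coord OLp).
Qed.

(** The lift at each point is the normalised velocity of the moved curve, up
    to the sign [sgn], so the lifted curves are integral curves. *)
Lemma deformation_forms s t : OL (s, t) ->
  [/\ pulled (M := B) f (form_eta1 can) (0, 1) (s, t) = sgn * N (s, t),
      pulled (M := B) f (form_eta2 can) (0, 1) (s, t) = 0
    & pulled (M := B) f (form_eta3 can) (0, 1) (s, t) = 0].
Proof.
move=> OLp; have Op : deformation_domain (s, t) by left.
have [hO2 dp Ap] := OLp; have [a0 _] := ae.
have oD := open_deformation_domain; have sD := smooth_deformation.
have fE : f (s, t) = V1 (s, t) by exact: deformation_lifted.
have E := dmap_toSigma_push hX D_contact F_sub_Finsler D_oriented sD (0, 1) Op.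
have tp : tangent (M := Sigma) (f (s, t)).1 (pushvec (M := Sigma) (toSigma \o f) (s, t) (0, 1)).
  exact: (tangent_pushvec hS _ (smooth_into_toSigma hX D_contact F_sub_Finsler D_oriented oD sD) Op).
have hd : chart_at (M := Sigma) (f (s, t)).1 d by rewrite fE; split.
have Af : A' (f (s, t)).1 by rewrite fE.
have be : (f (s, t)).2 = e (f (s, t)).1 by rewrite fE.
rewrite /pulled /form_eta1 /form_eta2 /form_eta3 /= E be.
apply: (coframe_monic_multiple hX D_contact F_sub_Finsler a0 Af hd tp).
apply: etrans (dmap_base_push hX D_contact F_sub_Finsler D_oriented oD sD (0, 1) Op) _.
have hc := deformation_chart OLp.
have tX := tangent_pushvec hX ((0, 1) : R * R)%type (smooth_into_toX hX D_contact F_sub_Finsler D_oriented oD sD) Op.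
have [_ _ _ tu] := indicatrix_point hX D_contact hd.
apply: (tangent_eq tX (tangentZ _ tu) hc) => //.
apply: etrans (deformation_velocity (0, 1) OLp) _.
rewrite fE -[RHS]/((sgn * N (s, t)) *: ((N (s, t))^-1 *: lift_vector c Psi omega (s, t) c)).
rewrite (lift_vectorE hX ac omega PU2 hO2) scalerA -mulrA mulfV ?mulr1 ?gt_eqF ?N02//.
by rewrite /omega scalerA sgn2 scale1r.
Qed.

(** At [s = 0] the variation of the base curve is the contact field, whose
    contact form is the bump function. *)
Lemma deformation_eta3 t : J t -> deformation_domain (0, t) ->
  (pulled (M := B) f (form_eta3 can) (1, 0) (0, t) = 0 <-> rho ^+ 2 <= sumsq (gam t - gam t0)).
Proof.
move=> Jt _; have [OLp _] := unmoved0 Jt; have Op : deformation_domain (0, t) by left.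
have [hO2 dp Ap] := OLp; have [a0 _] := ae; have [_ _ _ _ kerD] := a0.
have oD := open_deformation_domain; have sD := smooth_deformation.
have fE : f (0, t) = V1 (0, t) by exact: deformation_lifted.
have E := dmap_toSigma_push hX D_contact F_sub_Finsler D_oriented sD (1, 0) Op.
have tp : tangent (M := Sigma) (f (0, t)).1 (pushvec (M := Sigma) (toSigma \o f) (0, t) (1, 0)).
  exact: (tangent_pushvec hS _ (smooth_into_toSigma hX D_contact F_sub_Finsler D_oriented oD sD) Op).
have Af : A' (f (0, t)).1 by rewrite fE.
have be : (f (0, t)).2 = e (f (0, t)).1 by rewrite fE.
rewrite /pulled /form_eta3 /= E be.
have E' := dmap_base_push hX D_contact F_sub_Finsler D_oriented oD sD (1, 0) Op.
have hc := deformation_chart OLp.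
have tX := tangent_pushvec hX ((1, 0) : R * R)%type (smooth_into_toX hX D_contact F_sub_Finsler D_oriented oD sD) Op.
have [Ut _] := base_curve_in_frame Jt; have [P0 dP _] := fl.
have DP : 'D_((1, 0) : R * R) Psi (0, t) = hamiltonian w1 w2 w3 (gam t0) rho (gam t).
  have [_ <-] := is_derive_slice_s (smooth_differentiable sP2 hO2).
  by have [_ ->] := dP (gam t) 0; rewrite P0.
have XE : toX (f (0, t)) = param c (gam t).
  by rewrite fE -[LHS]/(param c (Psi (0, t))) moved_curve0.
have cE : cf (gam t) (hamiltonian w1 w2 w3 (gam t0) rho (gam t)) = bump (gam t0) rho (gam t).
  by rewrite (hamiltonianE _ _ _ _ _ Ut) /hamiltonian_frame (contact_formE span).
have K := kerD _ _ Af tp; apply: (iff_trans K); rewrite E'.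
rewrite -[basepoint _]/(toX (f (0, t))) (tangentE tX hc).
have -> : pushvec (M := X) (toX \o f) (0, t) (1, 0) c = hamiltonian w1 w2 w3 (gam t0) rho (gam t).
  exact: etrans (deformation_velocity (1, 0) OLp) DP.
rewrite -[(toX \o f) (0, t)]/(toX (f (0, t))) XE.
apply: (iff_trans (contact_formP hX D_contact lf ac Ut _)); rewrite cE /bump.
split=> [b0|le]; last by apply: flat_neg; rewrite subr_le0.
rewrite leNgt; apply/negP => lt; have := @flat_pos R (rho ^+ 2 - sumsq (gam t - gam t0)).
by rewrite b0 subr_gt0 ltxx => /(_ lt).
Qed.

Lemma deformation0 t : deformation 0 t = g t.
Proof. by rewrite /deformation; case: ifP => // Jt; have [] := unmoved0 Jt. Qed.

Lemma deformation_ends s t : t \notin `]a, b[ -> deformation s t = g t.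
Proof. by move=> tab; rewrite /deformation; case: ifP => // Jt; rewrite (Jab Jt) in tab. Qed.

(** Only a compact interval of times is moved, and over it the lift exists on
    a neighbourhood of [s = 0]. *)
Lemma deformation_tube : exists2 eps : R, 0 < eps & forall s t, `|s| < eps -> t \in `[a, b] ->
  OL (s, t) \/ Z (s, t).
Proof.
have [|eps eps0 H] := @tube R OL (t0 - r / 3) (t0 + r / 3) open_lifted.
  move=> t; rewrite in_itv/= => /andP[h1 h2].
  have Jt : J t.
    by have r1 := r0; rewrite /J /= ltr_norml; apply/andP; split; lra.
  by have [] := unmoved0 Jt.
exists eps => // s t se tab; have [h1|h1] := leP `|t - t0| (r / 3).
  by left; apply: H => //; move: h1; rewrite ler_norml in_itv/=; lra.
by have r1 := r0; right; split; [exact: abO|rewrite /=; lra].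
Qed.

Section Range.
Variable eps : R.
Hypotheses (eps0 : 0 < eps) (tb : forall s t, `|s| < eps -> t \in `[a, b] -> OL (s, t) \/ Z (s, t)).

Lemma deformation_range s t : `|s| < eps -> t \in `[a, b] -> deformation_domain (s, t).
Proof. by move=> se tab; exact: tb. Qed.

Lemma deformation_curve s : `|s| < eps -> @Ibar_curve R X D F o a b (deformation s).
Proof.
move=> se; have oD := open_deformation_domain; have sD := smooth_deformation.
have Hf t : t \in `[a, b] -> [/\ form_eta2 can (deformation s t) (velocity (M := B) (deformation s) t) = 0,
    form_eta3 can (deformation s t) (velocity (M := B) (deformation s) t) = 0 &
    form_eta1 can (deformation s t) (velocity (M := B) (deformation s) t) != 0].
  move=> tab; have [OLp|[Ot far]] := tb se tab.
    have [n1 n2 n3] := deformation_forms OLp.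
    have -> := velocity_slice hX D_contact F_sub_Finsler D_oriented sD (deformation_range se tab).
    split; [exact: n2|exact: n3|].
    rewrite -[X in X != 0]/(pulled (M := B) f (form_eta1 can) (0, 1) (s, t)) n1 mulf_neq0//.
      by apply/eqP => s0; move: sgn2; rewrite s0 mulr0 => /eqP; rewrite eq_sym oner_eq0.
    by rewrite gt_eqF//; apply: N02; have [hO2 _ _] := OLp.
  have -> : velocity (M := B) (deformation s) t = velocity (M := B) g t.
    apply: (velocity_near hX D_contact F_sub_Finsler D_oriented sg Ot).
    by apply: filterS (open_near open_far_times far) => u /deformation_far ->.
  by rewrite deformation_far//; exact: Ig.
split; last by move=> t /Hf[].
split; last by move=> w t [->|->] /Hf[].
exists [set t | deformation_domain (s, t)]; split.
- rewrite (_ : [set t | _] = setT `&` (fun t => (s, t)) @^-1` deformation_domain); last by rewrite setTI.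
  apply: (open_preimage_on openT oD) => t _.
  exact: differentiable_continuous (diff_slice_t s t).1.
- by move=> t tab; exact: deformation_range.
- exact: (smooth_into_slice (s := s) oD sD).
Qed.

Let n3s := pulled (M := B) f (form_eta3 can) (1, 0).

Lemma deformation_eta3_far t : t \in `[a, b] -> r / 4 < `|t - t0| -> n3s (0, t) = 0.
Proof.
move=> tab far.
have [] := endpoint_variation hX D_contact F_sub_Finsler D_oriented eps0 open_deformation_domain
  deformation_range smooth_deformation tab; last by [].
by move=> s se; rewrite !deformation_far.
Qed.

(** The value of [eta3] on the variation is continuous, and nonzero exactly
    while the curve is inside the ball, that is, on an interval of times. *)
Lemma deformation_sign t : t \in `[a, b] -> 0 <= n3s (0, t0) * n3s (0, t).
Proof.
move=> tab; have [far|near] := ltP (r / 4) `|t - t0|; first by rewrite (deformation_eta3_far tab far) mulr0.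
have Jt : J t by have r1 := r0; rewrite /J /=; lra.
have mid x : Num.min t0 t <= x <= Num.max t0 t -> J x.
  have r1 := r0; move: near; rewrite ler_norml => /andP[? ?].
  rewrite /J /= ltr_norml; case: (leP t0 t) => ? /andP[? ?]; apply/andP; split; lra.
have D0 x : J x -> deformation_domain (0, x) by move=> Jx; left; have [] := unmoved0 Jx.
have [le|lt] := leP (rho ^+ 2) (sumsq (gam t - gam t0)).
  by have [_ E] := deformation_eta3 Jt (D0 _ Jt); rewrite [n3s (0, t)]E// mulr0.
apply/ltW; apply: (@constant_sign R (fun t => n3s (0, t))) => x xt; have Jx := mid _ xt; split.
  apply: (continuous_slice_t (O' := deformation_domain)); last exact: D0.
  exact (smooth_pulled hB smooth_deformation (smooth_eta3 hX D_contact F_sub_Finsler D_oriented) (1, 0)).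
apply/eqP => n0; have [E _] := deformation_eta3 Jx (D0 _ Jx).
by have := E n0; rewrite leNgt (le_lt_trans (rho_mono Jt xt) lt).
Qed.

Lemma deformation_moves : n3s (0, t0) != 0.
Proof.
have J0 : J t0 by rewrite /J /= subrr normr0.
apply/eqP => n0; have [E _] := deformation_eta3 J0 (or_introl (unmoved0 J0).1).
have := E n0; rewrite subrr /sumsq big1 => [|i _]; last by rewrite mxE expr0n.
by rewrite leNgt exprn_gt0.
Qed.

End Range.

Lemma localized_variation delta : r <= delta -> exists eps V O,
  [/\ 0 < eps, open O, (forall s t, `|s| < eps -> t \in `[a, b] -> O (s, t)),
      smooth_into (M := B) O (fun p => V p.1 p.2) & @Ibar_variation R X D F o a b g eps V] /\
  let n3s := pulled (M := B) (fun p => V p.1 p.2) (form_eta3 can) ((1, 0) : R * R) in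
  [/\ n3s (0, t0) != 0, (forall t, t \in `[a, b] -> 0 <= n3s (0, t0) * n3s (0, t))
    & forall t, t \in `[a, b] -> delta <= `|t - t0| -> n3s (0, t) = 0].
Proof.
move=> rd; have [eps eps0 tb] := deformation_tube.
exists eps, deformation, deformation_domain; split.
  split; [exact: eps0|exact: open_deformation_domain|exact: tb|exact: smooth_deformation|].
  split; last 1 first.
  - by move=> s se; rewrite deformation_ends// in_itv/= ltxx andbF.
  - exists deformation_domain; split; [exact: open_deformation_domain|exact: tb|].
    exact: smooth_deformation.
  - by move=> t _; exact: deformation0.
  - by move=> s se; exact: (deformation_curve tb se).
  - by move=> s se; rewrite deformation_ends// in_itv/= ltxx.
split; [exact: deformation_moves|by move=> t tab; exact: (deformation_sign eps0 tb tab)|].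
move=> t tab dt; apply: (deformation_eta3_far eps0 tb tab).
by have r1 := r0; lra.
Qed.

End Deformation.

(** * Localized variations *)
Section Localized.
Context {R : realType} {X : premanifold R 3}.
Variables (D : mpoint X -> set (tfam X)) (F : mpoint X -> tfam X -> R).
Variable o : mpoint X -> tfam X -> tfam X -> Prop.
Hypothesis hX : regular_atlas X.
Hypotheses (D_contact : contact D) (F_sub_Finsler : sub_Finsler D F).
Hypothesis D_oriented : orientation D o.

Local Notation Sigma := (indicatrix D F).
Local Notation B := (B4 D F o).
Local Notation toSigma := (@B4_to_Sigma R X D F o).
Local Notation toX := (@B4_to_X R X D F o).
Local Notation can := (canonical_coframing D F o).

Let hS : regular_atlas Sigma := regular_indicatrix D F hX.
Let hB : regular_atlas B := regular_B4 hX D_contact F_sub_Finsler D_oriented.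

Lemma curve_forms (a b : R) (g : R -> mpoint B) t : @Ibar_curve R X D F o a b g -> t \in `[a, b] ->
  [/\ form_eta2 can (g t) (velocity (M := B) g t) = 0,
      form_eta3 can (g t) (velocity (M := B) g t) = 0
    & form_eta1 can (g t) (velocity (M := B) g t) != 0].
Proof.
move=> [[_ H] T] tab; split; [| |exact: T].
  by apply: H => //; left.
by apply: H => //; right.
Qed.

Lemma smooth_along (Og : set R) (g : R -> mpoint B) (w : form B) :
  smooth_into (M := B) Og g -> smooth_1form w -> smooth Og (fun t => w (g t) (velocity (M := B) g t)).
Proof. by move=> sg sw; exact (smooth_pulled hB sg sw (1 : R)). Qed.

Lemma ball_sumsq (U : set 'rV[R]_3) y0 : open U -> U y0 ->
  exists2 r : R, 0 < r & forall rho, 0 <= rho <= r -> forall y, sumsq (y - y0) <= rho ^+ 2 -> U y.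
Proof.
move=> oU Uy; have [e e0 H] := (near_ballP _ _).1 (open_near oU Uy).
exists (e / 2); first by rewrite divr_gt0.
move=> rho /andP[rho0 re] y le; apply: H; have [n1 _] := norm_sumsq (y - y0).
have : `|y - y0| ^+ 2 <= rho ^+ 2 by exact: le_trans n1 le.
by rewrite ler_sqr ?nnegrE// => h; lra.
Qed.

(** The variations that the fundamental lemma of the calculus of variations
    needs: they move the curve near [t0] only, and to one side of the contact
    planes. *)
Lemma bump_variation (a b : R) (g : R -> mpoint B) (t0 delta : R) :
  @Ibar_curve R X D F o a b g -> t0 \in `]a, b[ -> 0 < delta -> exists eps V O,
  [/\ 0 < eps, open O, (forall s t, `|s| < eps -> t \in `[a, b] -> O (s, t)),
      smooth_into (M := B) O (fun p => V p.1 p.2) & @Ibar_variation R X D F o a b g eps V] /\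
  let n3s := pulled (M := B) (fun p => V p.1 p.2) (form_eta3 can) ((1, 0) : R * R) in
  [/\ n3s (0, t0) != 0, (forall t, t \in `[a, b] -> 0 <= n3s (0, t0) * n3s (0, t))
    & forall t, t \in `[a, b] -> delta <= `|t - t0| -> n3s (0, t) = 0].
Proof.
move=> Ig t0ab delta0; have If t := @curve_forms a b g t Ig.
have [[[Og [oOg abO sg]] _] _] := Ig.
have t0ab' : t0 \in `[a, b] by move: t0ab; rewrite !in_itv/= => /andP[/ltW-> /ltW->].
have Ot := abO _ t0ab'.
have sX := smooth_into_toX hX D_contact F_sub_Finsler D_oriented oOg sg.
have [c [hc _]] := sX _ Ot; have [ac _] := hc.
have [A [v1 [v2 [Ax lf]]]] := D_contact.1 _ (bodyX_chart hX hc).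
have oA : mopen A by case: lf.
have [U1 [oU1 U1t _ U1c sU1]] := smooth_into_chart hX sX Ot hc.
have [U2 [oU2 U2t _ U2A]] := smooth_into_mopen hX sX Ot oA Ax.
have [k [hk _]] := sg _ Ot.
have [A' [e [d [ae pe Ek [A'x hd be]]]]] := B4_chart_at hk; have [ad _] := hd.
have [U3 [oU3 U3t _ U3k _]] := smooth_into_chart hB sg Ot hk.
pose n1 t := form_eta1 can (g t) (velocity (M := B) g t).
have sn1 : smooth Og n1 by exact: smooth_along sg (smooth_eta1 hX D_contact F_sub_Finsler D_oriented).
(* [g] may run against the direction that its coframe marks; [sgn] makes the lift of the velocity that direction *)
pose sgn : R := if 0 < n1 t0 then 1 else -1.
have sgn2 : sgn * sgn = 1 by rewrite /sgn; case: ifP => _; rewrite ?mulr1// mulrNN mulr1.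
pose U4 := Og `&` (fun t => sgn * n1 t) @^-1` [set x | 0 < x].
have oU4 : open U4.
  apply: (open_preimage_on oOg); first exact: open_gt.
  by move=> t Ogt; apply: cvgM; [exact: cvg_cst|exact: (smooth_continuous sn1 Ogt)].
have U4t : U4 t0.
  split=> //=; have [_ _ n0] := If _ t0ab'; rewrite /sgn; case: ifP => h; first by rewrite mul1r.
  by rewrite mulN1r oppr_gt0 lt_neqAle n0 leNgt h.
have Nr : \forall t \near t0, (U1 t /\ U2 t) /\ ((U3 t /\ U4 t) /\ t \in `]a, b[).
  exact: filterI (filterI (open_near oU1 U1t) (open_near oU2 U2t))
  (filterI (filterI (open_near oU3 U3t) (open_near oU4 U4t)) (near_in_itvoo t0ab)).
have [r1 r10 H1] := (near_ballP _ _).1 Nr.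
have openJ (r : R) : open [set t | `|t - t0| < r].
  rewrite (_ : [set t | _] = ball t0 r); first exact: ball_open.
  by apply/funext => t; rewrite -ball_normE/= distrC.
pose gam t := coord c (toX (g t)).
have Jab (r : R) : r <= r1 -> forall t, `|t - t0| < r -> t \in `]a, b[.
  by move=> rr t tr; have [_ []] := H1 t (lt_le_trans tr rr).
have Jc (r : R) : r <= r1 -> forall t, `|t - t0| < r -> A (toX (g t)) /\ dom c (toX (g t)).
  by move=> rr t tr; have [[/U1c ? /U2A ?] _] := H1 t (lt_le_trans tr rr).
have Jd (r : R) : r <= r1 -> forall t, `|t - t0| < r -> [/\ A' (g t).1, dom d (g t).1 & (g t).2 = e (g t).1].
  by move=> rr t tr; have [_ [[/U3k h _] _]] := H1 t (lt_le_trans tr rr); move: h; rewrite Ek.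
have Js (r : R) : r <= r1 -> smooth [set t | `|t - t0| < r] gam.
  move=> rr; apply: smooth_sub sU1 => t tr.
  by have [[? _] _] := H1 t (lt_le_trans tr rr).
have J1 : [set t | `|t - t0| < r1] t0 by rewrite /= subrr normr0.
have dg0 : 'D_(1 : R) gam t0 != 0.
  have E := base_curve_velocity hX D_contact F_sub_Finsler D_oriented ac oOg sg abO If (Jab _ (lexx _)) (Jc _ (lexx _)) (Js _ (lexx _)) J1.
  have G := curve_direction_nonzero hX D_contact F_sub_Finsler ac ad (Jc _ (lexx _)) (Jd _ (lexx _)) J1.
  have [_ _ n0] := If _ t0ab'.
  by rewrite [X in X != 0]E scaler_eq0 negb_or n0.
have [r2 r20 [_ leaves]] := regular_curve_leaves (openJ r1) J1 (Js _ (lexx _)) dg0.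
pose r := Num.min delta (Num.min r1 r2).
have r0 : 0 < r by rewrite !lt_min delta0 r10.
have [rd rr1 rr2] : [/\ r <= delta, r <= r1 & r <= r2] by rewrite /r !ge_min !lexx !orbT.
pose ph t := sumsq (gam t - gam t0).
have {}leaves t t' : (t0 <= t /\ t < t' /\ t' < t0 + r) \/ (t0 - r < t' /\ t' < t /\ t <= t0) -> ph t < ph t'.
  by move=> h; apply: leaves; case: h => [[? [? ?]]|[? [? ?]]]; [left|right]; repeat split => //; lra.
have ph0 : ph t0 = 0 by rewrite /ph subrr /sumsq big1// => i _; rewrite mxE expr0n.
have php : 0 < ph (t0 + r / 4) by rewrite -ph0; apply: leaves; left; lra.
have phm : 0 < ph (t0 - r / 4) by rewrite -ph0; apply: leaves; right; lra.
have lew t t' : (t0 <= t /\ t <= t' /\ t' < t0 + r) \/ (t0 - r < t' /\ t' <= t /\ t <= t0) -> ph t <= ph t'.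
  have [->//|tt'] := eqVneq t t'; move=> h; apply/ltW/leaves; move: tt'; rewrite neq_lt.
  by case: h => [[? [? ?]]|[? [? ?]]] /orP[?|?]; [left|left|right|right]; repeat split => //; lra.
have Ug : frame_image A c (gam t0) by apply: cimg_coord => //; have [_] := hc.
have [r3 r30 ballU] := ball_sumsq (open_frame_image lf ac) Ug.
pose rho := Num.min r3 (Num.min (Num.sqrt (ph (t0 + r / 4))) (Num.sqrt (ph (t0 - r / 4)))).
have rho0 : 0 < rho by rewrite !lt_min r30 !sqrtr_gt0 php phm.
have rho3 : rho <= r3 by rewrite /rho ge_min lexx.
have rhop : rho ^+ 2 <= ph (t0 + r / 4).
  rewrite -[leRHS](sqr_sqrtr (ltW php)) lerXn2r ?nnegrE ?sqrtr_ge0 ?(ltW rho0)//.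
  by rewrite /rho !ge_min lexx !orbT.
have rhom : rho ^+ 2 <= ph (t0 - r / 4).
  rewrite -[leRHS](sqr_sqrtr (ltW phm)) lerXn2r ?nnegrE ?sqrtr_ge0 ?(ltW rho0)//.
  by rewrite /rho !ge_min lexx !orbT.
have ballU' : forall y, sumsq (y - gam t0) <= rho ^+ 2 -> frame_image A c y.
  by apply: ballU; rewrite ltW.
have rho_out t : `|t - t0| < r -> r / 4 <= `|t - t0| -> rho ^+ 2 <= ph t.
  rewrite ltr_norml ler_normr => /andP[h1 h2] /orP[h|h].
    by apply: le_trans rhop _; apply: lew; left; lra.
  by apply: le_trans rhom _; apply: lew; right; lra.
have rho_mono t x : `|t - t0| < r -> Num.min t0 t <= x <= Num.max t0 t -> ph x <= ph t.
  rewrite ltr_norml => /andP[h1 h2]; case: (leP t0 t) => ? /andP[? ?]; apply: lew; [left|right]; lra.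
have [s1 s2 s3] := smooth_frames hX lf ac.
have [P fl] := hamiltonian_flow (open_frame_image lf ac) s1 s2 s3 (frame_span hX D_contact lf ac) rho0 ballU'.
have sgnP t : `|t - t0| < r -> 0 < sgn * n1 t.
  by move=> tr; have [_ [[_ [_ ?]] _]] := H1 t (lt_le_trans tr rr1).
exact: (localized_variation hX D_contact F_sub_Finsler D_oriented lf ac ad ae pe oOg sg abO If r0
  (Jab _ rr1) (Jc _ rr1) (Jd _ rr1) (Js _ rr1) sgn2 sgnP rho0 ballU' rho_out rho_mono fl rd).
Qed.

End Localized.

(** * Critical curves and the extended system *)
Section Main.
Context {R : realType} {X : premanifold R 3}.
Variables (D : mpoint X -> set (tfam X)) (F : mpoint X -> tfam X -> R).
Variable o : mpoint X -> tfam X -> tfam X -> Prop.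
Hypothesis hX : regular_atlas X.
Hypotheses (D_contact : contact D) (F_sub_Finsler : sub_Finsler D F).
Hypothesis D_oriented : orientation D o.

Local Notation B := (B4 D F o).
Local Notation YB := (Y D F o).
Local Notation toX := (@B4_to_X R X D F o).
Local Notation can := (canonical_coframing D F o).
Local Notation toB := (Y_to_B4 D F o).
Local Notation lam := (@lambda R X D F o).

Let hB : regular_atlas B := regular_B4 hX D_contact F_sub_Finsler D_oriented.
Let hY : regular_atlas YB := regular_times_line hB.

Lemma smooth_at_Y_to_B4 (y : mpoint YB) c : chart_at y c -> smooth_at (M := YB) (N := B) toB y.
Proof.
move=> hc; have [ac cy] := hc; have [k ak Ek] := ac.
exists c, (cimg c setT); split=> //; [exact: open_cimgT|by apply: cimg_coord|].
have E : toB \o param c = param k \o lsubmx by rewrite -Ek.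
rewrite E; apply: (@smooth_into_comp _ _ _ _ _ _ (cimg k setT)).
- exact: open_cimgT.
- exact: open_cimgT.
- exact: smooth_into_param.
- exact (@smooth_lsubmx R 4 1 _).
- move=> z /(cimgP hY ac)[_ dz cz]; rewrite -cz -Ek /= row_mxKl.
  by apply: cimg_coord => //; move: dz; rewrite -Ek.
Qed.

Section LineCurve.
Variables (O : set R) (G : R -> mpoint YB) (t : R).
Hypotheses (oO : open O) (sG : smooth_into (M := YB) O G) (Ot : O t).

Lemma smooth_into_Y_to_B4 : smooth_into (M := B) O (toB \o G).
Proof.
apply: (smooth_into_map (f := toB) hY oO sG) => p Op; have [k [hk _]] := sG Op.
exact: smooth_at_Y_to_B4 hk.
Qed.

Lemma on_Y_velocity (w : form B) :
  on_Y w (G t) (velocity (M := YB) G t) = w (toB (G t)) (velocity (M := B) (toB \o G) t).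
Proof.
have [k [hk _]] := sG Ot.
by rewrite /on_Y /pullback (dmap_pushvec hY hB (1 : R) sG Ot (smooth_at_Y_to_B4 hk)).
Qed.

Lemma dlambda_velocity : is_derive t 1 (lam \o G) (dfun (M := YB) lam (G t) (velocity (M := YB) G t)).
Proof.
have [k0 [hk0 _]] := sG Ot; have hc := some_chartP hk0.
rewrite /dfun; set c := some_chart (G t) in hc *; have [ac cy] := hc; have [k ak Ek] := ac.
have dc := differentiable_coord_into hY sG Ot hc.
pose L (z : 'rV[R]_5) : R := (rsubmx (z : 'rV[R]_(4 + 1))) 0 0.
have linL : linear L by move=> a x y; rewrite /L linearP !mxE.
have cL : continuous (mk_linear linL).
  move=> z; apply: (@continuous_comp _ _ _ (fun z : 'rV[R]_(4 + 1) => rsubmx z) (fun z : 'rV[R]_1 => z 0 0)).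
    exact: continuous_rsubmx.
  exact: coord_continuous.
have E1 : lam \o param c = mk_linear linL by rewrite -Ek.
have E2 : lam \o G = mk_linear linL \o (coord c \o G).
  by apply/funext => u; rewrite /= -Ek /= /L row_mxKr mxE.
rewrite E1 E2.
have dd : differentiable (mk_linear linL \o (coord c \o G)) t.
  by apply: differentiable_comp => //; exact: linear_differentiable.
apply: DeriveDef; first exact: diff_derivable.
apply: etrans (deriveE _ dd) _; apply: etrans (diff_linear_comp _ cL dc) _.
apply: esym; apply: etrans (congr1 (fun h => h _) (diff_lin _ cL)) _.
by apply: congr1; exact: (pushvecE _ hc).
Qed.

End LineCurve.

Lemma smooth_into_line (O : set R) (g : R -> mpoint B) (l : R -> R) : open O ->
  smooth_into (M := B) O g -> smooth O l -> smooth_into (M := YB) O (fun t => (g t, l t)).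
Proof.
move=> oO sg sl t Ot; have [k [[ak kt] [U [oU Ut UO dU sU]]]] := sg _ Ot.
exists (line_chart k); split; first by split; [exists k|].
exists U; split=> //; apply: (smooth_ext oU _ (smooth_row_mx (g := fun t => const_mx (l t) : 'rV[R]_1) oU sU _)) => //.
apply: smooth_row => // i; apply: (smooth_ext oU _ (smooth_sub UO sl)) => u _.
by rewrite mxE.
Qed.

Lemma interior_limit (q h : R -> R) (a b t1 : R) : a < b -> t1 \in `[a, b] ->
  {for t1, continuous q} -> {for t1, continuous h} ->
  (\forall t \near t1, t \in `]a, b[ -> q t = h t) -> q t1 = h t1.
Proof.
move=> ab; rewrite in_itv/= => /andP[at1 t1b] cq ch N; apply/eqP; rewrite -subr_eq0; apply/negP => /negP n.
have c : {for t1, continuous (fun t => q t - h t)} by apply: cvgB.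
have M : \forall t \near t1, q t - h t != 0.
  by have := c [set y | y != 0]; apply; exact: (open_nbhs_nbhs (conj (@open_neq R 0) n)).
have MN : \forall t \near t1, q t - h t != 0 /\ (t \in `]a, b[ -> q t = h t) by exact: filterI M N.
have [e e0 H] := (near_ballP _ _).1 MN.
suff [t te tab] : exists2 t, `|t - t1| < e & t \in `]a, b[.
  by have [n' E] := H t te; rewrite E// subrr eqxx in n'.
have [t1b'|bt1] := ltP t1 b.
  exists (t1 + Num.min e (b - t1) / 2); last by rewrite in_itv/=; case: (leP e (b - t1)) => ?; lra.
  by rewrite addrAC subrr add0r; case: (leP e (b - t1)) => ?; rewrite ger0_norm; lra.
exists (t1 - Num.min e (b - a) / 2); last by rewrite in_itv/=; case: (leP e (b - a)) => ?; lra.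
by rewrite addrAC subrr add0r; case: (leP e (b - a)) => ?; rewrite normrN ger0_norm; lra.
Qed.

(** Monotone with equal end values. *)
Lemma constant_of_sign (f f' : R -> R) (a b t : R) : (forall t, t \in `[a, b] -> {for t, continuous f}) ->
  (forall t, t \in `]a, b[ -> is_derive t 1 f (f' t)) -> (forall t, t \in `]a, b[ -> 0 <= f' t) ->
  f a = f b -> t \in `]a, b[ -> f' t = 0.
Proof.
move=> cf df p fab tab.
have C u : u \in `]a, b[ -> f u = f a.
  rewrite in_itv/= => /andP[au ub].
  have L x y : a <= x -> x <= y -> y <= b -> f x <= f y.
    move=> ax xy yb.
    have C z : z \in `[x, y] -> z \in `[a, b].
      by rewrite !in_itv/= => /andP[h1 h2]; rewrite (le_trans ax h1) (le_trans h2 yb).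
    have C' z : z \in `]x, y[ -> z \in `]a, b[.
      by rewrite !in_itv/= => /andP[h1 h2]; rewrite (le_lt_trans ax h1) (lt_le_trans h2 yb).
    exact: (le_of_derive xy (fun z h => cf z (C z h)) (fun z h => df z (C' z h)) (fun z h => p z (C' z h))).
  apply/eqP; rewrite eq_le; apply/andP; split; last exact: L (lexx _) (ltW au) (ltW ub).
  by rewrite fab; exact: L (ltW au) (ltW ub) (lexx _).
have [_ <-] := df t tab; rewrite -(derive_cst (f a) (t : R) (1 : R)); apply: near_eq_D.
by apply: filterS (near_in_itvoo tab) => u /C.
Qed.

Variables I J1 J2 K A1 A2 S0 S1 S2 : mpoint B -> R.
Hypothesis hse : structure_equations (body B) can I J1 J2 K A1 A2 S0 S1 S2.
Local Notation Cl := (Clambda I J1 K A2).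

Section Necessary.
Variables (a b : R) (g : R -> mpoint B).
Hypotheses (ab : a < b) (Ig : @Ibar_curve R X D F o a b g) (cg : @critical R X D F o a b g).

Let n1 (t : R) : R := form_eta1 can (g t) (velocity (M := B) g t).
Let ph (t : R) : R := form_phi can (g t) (velocity (M := B) g t).
(** The only possible last coordinate of an integral curve of the extended
    system over [g]. *)
Definition multiplier (t : R) : R := ph t / n1 t.
Let dl (t : R) : R := 'D_(1 : R) multiplier t.

Lemma multiplier_domain : exists O, [/\ open O, `[a, b] `<=` O, smooth_into (M := B) O g & smooth O multiplier].
Proof.
have [[[Og [oOg abO sg]] _] T] := Ig.
have s1 : smooth Og n1 by exact: (smooth_along hX D_contact F_sub_Finsler D_oriented sg (smooth_eta1 hX D_contact F_sub_Finsler D_oriented)).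
have s4 : smooth Og ph by exact: (smooth_along hX D_contact F_sub_Finsler D_oriented sg (smooth_phi hX D_contact F_sub_Finsler D_oriented)).
pose O := Og `&` n1 @^-1` [set y | y != 0].
have oO : open O.
  by apply: (open_preimage_on oOg (@open_neq R 0)) => t Ot; exact: (smooth_continuous s1 Ot).
exists O; split=> //; first by move=> t tab; split; [exact: abO|exact: T].
  by apply: (smooth_into_sub oO _ sg) => t [].
have sO : O `<=` Og by move=> t [].
apply: smoothM => //; first exact: (smooth_sub sO s4).
by apply: smoothV => //; [move=> t []|exact: (smooth_sub sO s1)].
Qed.

Lemma is_derive_multiplier t : t \in `[a, b] -> is_derive t 1 multiplier (dl t) /\ {for t, continuous dl}.
Proof.
move=> tab; have [Ol [oO abO _ sl]] := multiplier_domain; have Ot := abO _ tab.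
split; last exact: (smooth_continuous (smooth_D (1 : R) sl) Ot).
by apply: derivableP; apply: diff_derivable; exact: (smooth_differentiable sl Ot).
Qed.

Lemma multiplierE t : t \in `[a, b] -> ph t = multiplier t * n1 t.
Proof. by move=> tab; have [_ T] := Ig; rewrite /multiplier mulfVK//; exact: T. Qed.

Let k (t : R) : R := n1 t * Cl (multiplier t) (g t) - dl t.

Lemma defect_continuous t1 : t1 \in `[a, b] -> exists q : R -> R, {for t1, continuous q} /\
  \forall t \near t1, t \in `[a, b] -> k t = q t.
Proof.
move=> tab; have [Ol [oO abO sg sl]] := multiplier_domain.
have [d1 c1] := is_derive_multiplier tab.
have If t : t \in `[a, b] -> form_eta2 can (g t) (velocity (M := B) g t) = 0 /\
  form_eta3 can (g t) (velocity (M := B) g t) = 0 by move=> /(curve_forms Ig)[].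
have [q [cq N]] := Clambda_continuous hX D_contact F_sub_Finsler D_oriented hse sg abO If multiplierE tab
  (is_derive_continuous d1).
exists (fun t => q t - dl t); split; first by apply: cvgB.
by apply: filterS N => t H /H; rewrite /k /n1 => ->.
Qed.

(** If [k t0] were not zero, [bump_variation] would give a variation for
    which the integrand in the derivative of the length differs from the
    derivative of the boundary term by a function of one sign that is nonzero
    at [t0], although both have integral zero. *)
Lemma defect_zero t0 : t0 \in `]a, b[ -> k t0 = 0.
Proof.
move=> t0ab; have t0ab' : t0 \in `[a, b] by move: t0ab; rewrite !in_itv/= => /andP[/ltW-> /ltW->].
apply/eqP/negP => /negP k0; have [q [cq N]] := defect_continuous t0ab'.
have q0 : k t0 = q t0 by apply: (nbhs_singleton N).
have c2 : {for t0, continuous (fun t => k t0 * q t)} by apply: cvgM; [exact: cvg_cst|exact: cq].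
have M : \forall t \near t0, 0 < k t0 * q t.
  have := c2 [set y | 0 < y]; apply; apply: (open_nbhs_nbhs (conj (@open_gt R 0) _)).
  by rewrite /= -q0 -expr2 exprn_even_gt0.
have MN : \forall t \near t0, 0 < k t0 * q t /\ (t \in `[a, b] -> k t = q t) by exact: filterI M N.
have [delta delta0 H] := (near_ballP _ _).1 MN.
have [eps [V [Ob [[eps0 oO tb sV Iv] /= [s0 s1 s2]]]]] :=
  bump_variation hX D_contact F_sub_Finsler D_oriented Ig t0ab delta0.
have [_ V0 VI Va Vb] := Iv.
have dL := is_derive_length hX D_contact F_sub_Finsler D_oriented eps0 oO tb sV.
have dL0 := cg eps0 Iv.
set n3 := pulled _ _ _ in s0 s1 s2.
pose lr := length_rate V.
have Z0 : Rintegral lebesgue_measure `[a, b] lr = 0.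
  by have [_ <-] := dL; have [_ ->] := dL0.
pose bt := boundary_term V multiplier.
have [B0 B1] : bt a = 0 /\ bt b = 0.
  exact: (boundary_term_ends hX D_contact F_sub_Finsler D_oriented ab eps0 oO tb sV V0 Va Vb).
(* [length_rate] is controlled on [`[a, b]] only; clamping its argument gives a function that is continuous on the line *)
pose cl (t : R) := Num.max a (Num.min b t).
have clab t : cl t \in `[a, b].
  by rewrite in_itv/= /cl le_max lexx/= ge_max (ltW ab) ge_min lexx.
have clE t : t \in `[a, b] -> cl t = t.
  by rewrite in_itv/= => /andP[at0 tb0]; rewrite /cl (min_idPr tb0) (max_idPr at0).
have ccl : continuous cl.
  by move=> t; apply: continuous_max; [exact: cvg_cst|apply: continuous_min; [exact: cvg_cst|exact: cvg_id]].
have clr t : t \in `[a, b] -> {for t, continuous lr}.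
  by move=> tab; exact: (continuous_length_rate hX D_contact F_sub_Finsler D_oriented eps0 tb sV tab).
have [P [_ dP]] := primitive_exists (f := lr \o cl) (fun t => continuous_comp (@ccl t) (clr _ (clab t))).
have PE : P b - P a = 0.
  have dP' t : t \in `]a, b[ -> is_derive t 1 P (lr t).
    move=> tab; have tab' : t \in `[a, b] by move: tab; rewrite !in_itv/= => /andP[/ltW-> /ltW->].
    by have := dP t; rewrite /= clE.
  by rewrite -(FTC ab clr (fun t _ => is_derive_continuous (dP t)) dP').
(* with this factor the derivative computed below is a product of two terms of constant sign *)
pose sg := k t0 * n3 (0, t0).
have F' t : t \in `]a, b[ -> is_derive t 1 (fun t => sg * (P t - bt t)) (sg * (k t * n3 (0, t))).
  move=> tab; have tab' : t \in `[a, b] by move: tab; rewrite !in_itv/= => /andP[/ltW-> /ltW->].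
  have [dm _] := is_derive_multiplier tab'.
  have vE : velocity (M := B) (V 0) t = velocity (M := B) g t.
    apply: esym; apply: (velocity_near hX D_contact F_sub_Finsler D_oriented (smooth_into_slice (s := 0) oO sV) (t := t)).
      by apply: tb => //; rewrite normr0.
    apply: filterS (near_in_itvoo tab) => u uab; apply: V0.
    by move: uab; rewrite !in_itv/= => /andP[/ltW-> /ltW->].
  have eps00 : `|0 : R| < eps by rewrite normr0.
  have NE (w : form B) : pulled (M := B) (fun p => V p.1 p.2) w (0, 1) (0, t) = w (g t) (velocity (M := B) g t).
    have := velocity_slice hX D_contact F_sub_Finsler D_oriented sV (tb _ _ eps00 tab').
    by rewrite /pulled /= vE (V0 t tab') => <-.
  have D1 := first_variation hX D_contact F_sub_Finsler D_oriented hse eps0 tb sV VI tab' dm.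
  rewrite !NE (V0 t tab') in D1; have {}D1 := D1 (multiplierE tab').
  have D2 := is_deriveZ sg (is_deriveB (dP t) D1).
  have Q (x y z : R) : x = y -> sg *: (x - (y - z)) = sg * z.
    by move=> ->; rewrite opprB addrC subrK.
  exact: is_derive_eq D2 (Q _ _ _ (congr1 lr (clE t tab'))).
have ge t : t \in `]a, b[ -> 0 <= sg * (k t * n3 (0, t)).
  move=> tab; have tab' : t \in `[a, b] by move: tab; rewrite !in_itv/= => /andP[/ltW-> /ltW->].
  have [h|h] := leP delta `|t - t0|; first by rewrite s2// !mulr0.
  have [kp kE] := H t h; rewrite -kE// in kp.
  rewrite /sg mulrACA.
  by rewrite mulr_ge0 ?(ltW kp)// s1.
have Fc t : t \in `[a, b] -> {for t, continuous (fun t => sg * (P t - bt t))}.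
  move=> tab; apply: cvgM; [exact: cvg_cst|apply: cvgB; first exact: is_derive_continuous (dP t)].
  apply: (continuous_boundary_term hX D_contact F_sub_Finsler D_oriented eps0 tb sV tab).
  by have [dm _] := is_derive_multiplier tab; exact: is_derive_continuous dm.
have E : sg * (P a - bt a) = sg * (P b - bt b).
  by rewrite B0 B1 !subr0; congr (_ * _); apply/eqP; rewrite eq_sym -subr_eq0 PE.
have := constant_of_sign Fc F' ge E t0ab.
by move/eqP; rewrite /sg -expr2 sqrf_eq0 mulf_eq0 (negbTE k0) (negbTE s0).
Qed.

(** At the ends of the interval the equation follows by continuity. *)
Lemma multiplier_equation t : t \in `[a, b] ->
  is_derive t 1 multiplier (n1 t * Cl (multiplier t) (g t)).
Proof.
move=> tab; have [d _] := is_derive_multiplier tab; apply: is_derive_eq d _.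
apply/eqP; rewrite eq_sym -subr_eq0 -/(k t); apply/eqP.
have [q [cq N]] := defect_continuous tab; rewrite (nbhs_singleton N tab).
apply: (@interior_limit q (cst 0) a b t ab tab cq); first exact: cvg_cst.
apply: filterS N => u H uab; rewrite -H; first exact: defect_zero.
by move: uab; rewrite !in_itv/= => /andP[/ltW-> /ltW->].
Qed.

Lemma critical_extremal : exists G : R -> mpoint YB,
  [/\ integral_curve (Jsys I J1 A2 K) a b G, transverse (on_Y (form_eta1 can)) a b G & toB \o G = g].
Proof.
have [Ol [oO abO sg sl]] := multiplier_domain; have sG := smooth_into_line oO sg sl.
exists (fun t => (g t, multiplier t)).
have E t (w : form B) : t \in `[a, b] -> on_Y w (g t, multiplier t) (velocity (M := YB) (fun t => (g t, multiplier t)) t) =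
    w (g t) (velocity (M := B) g t).
  by move=> tab; exact: (on_Y_velocity sG (abO _ tab)).
split=> //; last by move=> t tab; rewrite E//; have [_] := Ig; exact.
split; first by exists Ol.
move=> w t [[[->|->]|->]|->] tab; have [n2 n3 _] := curve_forms Ig tab; rewrite ?E//.
  by apply/eqP; rewrite subr_eq0; apply/eqP; exact: multiplierE tab.
have [_ D1] := dlambda_velocity sG (abO _ tab); have [_ D2] := multiplier_equation tab.
apply/eqP; rewrite subr_eq0; apply/eqP; rewrite -D1; apply: etrans D2 _.
by rewrite mulrC.
Qed.

End Necessary.

Lemma extremal_critical (a b : R) (G : R -> mpoint YB) : a < b ->
  integral_curve (Jsys I J1 A2 K) a b G -> transverse (on_Y (form_eta1 can)) a b G ->
  @Ibar_curve R X D F o a b (toB \o G) /\ @critical R X D F o a b (toB \o G).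
Proof.
move=> ab [[Ol [oO abO sG]] HJ] T; pose g := toB \o G.
have E t (w : form B) : t \in `[a, b] -> on_Y w (G t) (velocity (M := YB) G t) = w (g t) (velocity (M := B) g t).
  by move=> tab; exact: (on_Y_velocity sG (abO _ tab)).
have e2 t : t \in `[a, b] -> form_eta2 can (g t) (velocity (M := B) g t) = 0.
  by move=> tab; rewrite -E//; apply: HJ => //; left; left; left.
have e3 t : t \in `[a, b] -> form_eta3 can (g t) (velocity (M := B) g t) = 0.
  by move=> tab; rewrite -E//; apply: HJ => //; left; left; right.
have e4 t : t \in `[a, b] -> form_phi can (g t) (velocity (M := B) g t) =
    (lam \o G) t * form_eta1 can (g t) (velocity (M := B) g t).
  move=> tab; rewrite -!E//; apply/eqP; rewrite -subr_eq0; apply/eqP.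
  by apply: (HJ (fun y v => on_Y (form_phi can) y v - lambda y * on_Y (form_eta1 can) y v)) => //; left; right.
have e5 t : t \in `[a, b] -> is_derive t 1 (lam \o G)
    (form_eta1 can (g t) (velocity (M := B) g t) * Cl ((lam \o G) t) (g t)).
  move=> tab; apply: is_derive_eq (dlambda_velocity sG (abO _ tab)) _.
  have := HJ (fun y v => dfun (M := YB) lam y v - Cfun I J1 A2 K y * on_Y (form_eta1 can) y v) t.
  move=> /(_ (or_intror (erefl _)) tab) /eqP; rewrite subr_eq0 => /eqP ->.
  by rewrite E// mulrC.
split.
  split; last by move=> t tab; rewrite -(E t _ tab); exact: T.
  split; last by move=> w t [->|->] tab; [exact: e2|exact: e3].
  by exists Ol; split=> //; exact: smooth_into_Y_to_B4.
move=> eps V eps0 Iv; have [[Ob [oO' tb sV]] V0 VI Va Vb] := Iv.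
apply: is_derive_eq (is_derive_length hX D_contact F_sub_Finsler D_oriented eps0 oO' tb sV) _.
have sub t : t \in `]a, b[ -> t \in `[a, b] by rewrite !in_itv/= => /andP[/ltW-> /ltW->].
have c1 t : t \in `[a, b] -> {for t, continuous (lam \o G)}.
  by move=> tab; exact: is_derive_continuous (e5 t tab).
exact: (multiplier_stationary hX D_contact F_sub_Finsler D_oriented hse ab eps0 oO' tb sV V0 VI Va Vb c1
  (fun t h => e4 t (sub t h)) (fun t h => e5 t (sub t h))).
Qed.

End Main.

Theorem proposition5p2 (R : realType) (X : premanifold R 3)
    (D : mpoint X -> set (tfam X)) (F : mpoint X -> tfam X -> R)
    (o : mpoint X -> tfam X -> tfam X -> Prop)
    (I J1 J2 K A1 A2 S0 S1 S2 : mpoint (B4 D F o) -> R)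
    (X_manifold : is_manifold X) (D_contact : contact D)
    (D_oriented : orientation D o) (F_sub_Finsler : sub_Finsler D F)
    (invariantsP : structure_equations (body (B4 D F o)) (canonical_coframing D F o)
                     I J1 J2 K A1 A2 S0 S1 S2)
    (a b : R) (a_lt_b : a < b) (g : R -> mpoint (B4 D F o)) :
  (Ibar_curve a b g /\ critical a b g)
  <->
  exists G : R -> mpoint (Y D F o),
    [/\ integral_curve (Jsys I J1 A2 K) a b G,
        transverse (on_Y (form_eta1 (canonical_coframing D F o))) a b G
      & Y_to_B4 D F o \o G = g].
Proof.
have hX := manifold_regular X_manifold; split=> [[Ig cg]|[G [J T <-]]].
  exact: (critical_extremal hX D_contact F_sub_Finsler D_oriented invariantsP a_lt_b Ig cg).
exact: (extremal_critical hX D_contact F_sub_Finsler D_oriented invariantsP a_lt_b J T).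
Qed.
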